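(* Let $M_m$ be a von Mangoldt plane and $q\neq o$. Then (1) $\hat\kappa(r_q)>\pi/2$ if and only if $T_{\gamma_q}<\pi$; (2) $\hat\kappa(r_q)=\pi/2$ if and only if $T_{\gamma_q}=\pi$.
   Context: For a smooth function $m\colon[0,\infty)\to[0,\infty)$ with $m(0)=0$, $m'(0)=1$, $m>0$ on $(0,\infty)$ and smooth odd extension, $M_m$ is $\mathbb R^2$ with metric $dr^2+m(r)^2d\theta^2$ (polar coordinates $(r,\theta)$ about origin $o$), curvature $G_m=-m''/m$; von Mangoldt means $G_m$ non-increasing in $r$. For $q\ne o$, $r_q$ is its $r$-coordinate, $\mu_q$ is the unit speed geodesic from $q$ in direction $\partial_r$, and $\gamma_q\colon[0,\infty)\to M_m$ is the unit speed geodesic from $q$ in direction $\partial_\theta$. A ray is a unit speed geodesic on $[0,\infty)$ minimizing between any two of its points. $\hat\kappa(r_q)$ is the maximum of the angles at $q$ between $\mu_q$ and rays starting at $q$ (it depends only on $r_q$). For a geodesic $\gamma$ on $[0,\infty)$ not passing through $o$, its turn angle is $T_\gamma=\int_0^\infty|\dot\theta_{\gamma(s)}|\,ds\in[0,\infty]$ (the total change of the angular coordinate; along $\gamma_q$, $\dot\theta>0$). *)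

(* Defs.v *)
From Stdlib Require Import Reals.
From Coquelicot Require Import Coquelicot.
Open Scope R_scope.

(* Points of M_m = R^2 are represented in Cartesian coordinates (x,y);
   the pole o is (0,0); r = sqrt(x^2+y^2), theta = polar angle. *)
Definition pt := (R * R)%type.
Definition rad (p : pt) : R := sqrt (fst p ^ 2 + snd p ^ 2).

(* Standing hypotheses on m: smooth on R (the odd extension), odd,
   m(0)=0, m'(0)=1, m>0 on (0,oo). *)
Definition model_fun (m : R -> R) : Prop :=
  (forall (n : nat) (x : R), ex_derive_n m n x) /\
  (forall x, m (- x) = - m x) /\
  m 0 = 0 /\ Derive m 0 = 1 /\
  (forall x, 0 < x -> 0 < m x).

Definition curv (m : R -> R) (r : R) : R := - (Derive_n m 2 r) / m r.

Definition von_Mangoldt (m : R -> R) : Prop :=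
  model_fun m /\
  (forall r1 r2, 0 < r1 -> r1 <= r2 -> curv m r2 <= curv m r1).

(* The metric dr^2 + m(r)^2 dtheta^2 written in Cartesian coordinates:
   dr(v) = (x a + y b)/r, dtheta(v) = (x b - y a)/r^2 for v = (a,b) at p=(x,y).
   At the pole the metric is Euclidean (since m'(0)=1). *)
Definition dr (p v : pt) : R :=
  (fst p * fst v + snd p * snd v) / rad p.
Definition dtheta (p v : pt) : R :=
  (fst p * snd v - snd p * fst v) / (rad p ^ 2).
Definition gmet (m : R -> R) (p u v : pt) : R :=
  if Req_EM_T (rad p) 0 then fst u * fst v + snd u * snd v
  else dr p u * dr p v + (m (rad p)) ^ 2 * dtheta p u * dtheta p v.

Definition angle_at (m : R -> R) (p u v : pt) : R :=
  acos (gmet m p u v / (sqrt (gmet m p u u) * sqrt (gmet m p v v))).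

(* curves are maps R -> R^2 (only the relevant parameter range matters) *)
Definition curve := R -> pt.
Definition cx (c : curve) : R -> R := fun t => fst (c t).
Definition cy (c : curve) : R -> R := fun t => snd (c t).

Definition C1_curve (c : curve) : Prop :=
  (forall t, ex_derive (cx c) t /\ ex_derive (cy c) t) /\
  (forall t, continuous (Derive (cx c)) t /\ continuous (Derive (cy c)) t).

Definition velocity (c : curve) (t : R) : pt := (Derive (cx c) t, Derive (cy c) t).

Definition length01 (m : R -> R) (c : curve) : R :=
  RInt (fun t => sqrt (gmet m (c t) (velocity c t) (velocity c t))) 0 1.

Definition dist (m : R -> R) (p q : pt) : Rbar :=
  Glb_Rbar (fun l => exists c : curve,
    C1_curve c /\ c 0 = p /\ c 1 = q /\ l = length01 m c).

Definition rvel (c : curve) (t0 : R) (v : pt) : Prop :=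
  filterlim (fun h => (cx c (t0 + h) - cx c t0) / h) (at_right 0) (locally (fst v)) /\
  filterlim (fun h => (cy c (t0 + h) - cy c t0) / h) (at_right 0) (locally (snd v)).

Definition geodesic (m : R -> R) (c : curve) : Prop :=
  forall t, 0 <= t -> exists eps, 0 < eps /\
    forall s s', 0 <= s -> 0 <= s' -> Rabs (s - t) < eps -> Rabs (s' - t) < eps ->
      dist m (c s) (c s') = Finite (Rabs (s - s')).

Definition ray (m : R -> R) (c : curve) : Prop :=
  forall s t, 0 <= s -> 0 <= t -> dist m (c s) (c t) = Finite (Rabs (s - t)).

(* unit radial vector d/dr at p, and unit vector in direction d/dtheta at p *)
Definition e_r (p : pt) : pt := (fst p / rad p, snd p / rad p).
Definition e_theta (m : R -> R) (p : pt) : pt :=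
  (- snd p / m (rad p), fst p / m (rad p)).

(* hat kappa: supremum (= maximum) of the angles at q between mu_q and rays
   emanating from q *)
Definition kappa_hat (m : R -> R) (q : pt) : Rbar :=
  Lub_Rbar (fun a => exists (s : curve) (v : pt),
    ray m s /\ s 0 = q /\ rvel s 0 v /\ a = angle_at m q (e_r q) v).

(* turn angle: int_0^oo |dtheta/ds| ds (an element of [0,+oo]) *)
Definition dtheta_ds (c : curve) (s : R) : R :=
  (cx c s * Derive (cy c) s - cy c s * Derive (cx c) s) / (cx c s ^ 2 + cy c s ^ 2).
Definition turn_angle (c : curve) : Rbar :=
  Lub_Rbar (fun z => exists T, 0 <= T /\ z = RInt (fun s => Rabs (dtheta_ds c s)) 0 T).

(* Main.v *)
(* A minimizing curve that misses the pole satisfies the geodesic equations, by the first variation of the energy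
   along nearly minimizing smooth curves. Take the angle [phi] as parameter on a geodesic of angular momentum
   [c <> 0], and put [P = - r' / |c|] and [zeta = - int 1/m^2]: then [d zeta / d phi = P] and
   [d P / d phi = - m'/m]. As a function of [zeta], [m'/m] has derivative [m'^2 - m m''], which for a von Mangoldt
   plane is non-increasing in [r] and at most 1. By Sturm comparison with the sine, two geodesics from [q] whose
   initial values of [P] differ do not meet again before the opposite meridian. Reflection in a meridian shows
   that a minimizing geodesic turns by less than [PI].
   If the turn angle of [gamma_q] is below [PI], minimizing curves from [q] to points of growing radius, at a
   fixed angle between the two, start inward with a definite slope, and converge to a ray at an obtuse angle. If
   it is [PI], comparison with the minimizing curves to points of [gamma_q] shows that [gamma_q] is a ray.
   Conversely, a ray starting inward reaches every radius before turning by [PI]; so does [gamma_q] by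
   comparison, and a turn angle of exactly [PI] would force [m'^2 - m m''] to be constantly 1, in which case the
   turn angle is at most [PI / 2]. *)
Require Import Defs.
From Stdlib Require Import Reals Lra Lia Classical ClassicalEpsilon Compare_dec.
From Coquelicot Require Import Coquelicot.
From mathcomp.classical Require filter.
Open Scope R_scope.

(** * Real analysis *)

(** Geodesics and rays are given metrically, as maps realizing an infimum of lengths, so nothing is
    differentiable at the outset, and even the existence of minimizing curves has to be proved.
    Limits are taken along an ultrafilter on the integers: one ultrafilter serves all times at once,
    and the isometry property passes to the limit pointwise. Smoothness comes from test variations
    that are multiples of the defect of the integrated Euler-Lagrange equations, so that a curve
    whose length is within e^2 of the minimum satisfies these equations up to O(e). The variable
    [zeta] replaces 1/r in Binet's equation: in the flat plane it is 1/r up to a constant, lines are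
    sinusoids in the angle, and the comparison measures the departure from this oscillator. The pole
    is the other obstacle. Nonzero angular momentum keeps a geodesic away from it, but a ray may run
    straight into the pole; such a ray has no angle as parameter and is replaced by nearby
    minimizing curves. Since [kappa_hat] is a supremum, the equality case also needs that limits of
    rays are rays with the limiting initial direction. *)

Ltac ringR := match goal with |- @eq _ ?a ?b => change (@eq R a b) end; ring.
Ltac fieldR := match goal with |- @eq _ ?a ?b => change (@eq R a b) end; field.

Lemma is_derive_eq (f : R -> R) (x l l' : R) : is_derive f x l -> l = l' -> is_derive f x l'.
Proof. now intros H <-. Qed.

Lemma dplus (f g : R -> R) x a b : is_derive f x a -> is_derive g x b ->
  is_derive (fun t => f t + g t) x (a + b).
Proof. intros; now apply (is_derive_plus f g). Qed.
Lemma dminus (f g : R -> R) x a b : is_derive f x a -> is_derive g x b ->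
  is_derive (fun t => f t - g t) x (a - b).
Proof. intros; now apply (is_derive_minus f g). Qed.
Lemma dopp (f : R -> R) x a : is_derive f x a -> is_derive (fun t => - f t) x (- a).
Proof. intros; now apply (is_derive_opp f). Qed.
Lemma dconst (c x : R) : is_derive (fun _ => c) x 0.
Proof. exact (@is_derive_const R_AbsRing R_NormedModule c x). Qed.
Lemma did (x : R) : is_derive (fun t => t) x 1.
Proof. exact (@is_derive_id R_AbsRing x). Qed.
Lemma dmult (f g : R -> R) x a b : is_derive f x a -> is_derive g x b ->
  is_derive (fun t => f t * g t) x (a * g x + f x * b).
Proof.
  intros Hf Hg. apply (is_derive_mult f g x a b Hf Hg). intros; apply Rmult_comm.
Qed.
Lemma dinv (f : R -> R) x a : is_derive f x a -> f x <> 0 ->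
  is_derive (fun t => / f t) x (- a / (f x) ^ 2).
Proof. intros; now apply (is_derive_inv f). Qed.
Lemma ddiv (f g : R -> R) x a b : is_derive f x a -> is_derive g x b -> g x <> 0 ->
  is_derive (fun t => f t / g t) x ((a * g x - f x * b) / (g x) ^ 2).
Proof. intros; now apply is_derive_div. Qed.
Lemma dpow (f : R -> R) n x a : is_derive f x a ->
  is_derive (fun t => f t ^ n) x (INR n * a * f x ^ pred n).
Proof. intros; now apply (is_derive_pow f). Qed.
Lemma dcomp (g f : R -> R) x a b : is_derive g (f x) b -> is_derive f x a ->
  is_derive (fun t => g (f t)) x (a * b).
Proof. intros; now apply (is_derive_comp g f). Qed.
Lemma dsin (f : R -> R) x a : is_derive f x a -> is_derive (fun t => sin (f t)) x (a * cos (f x)).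
Proof. intros; apply dcomp; auto. apply is_derive_sin. Qed.
Lemma dcos (f : R -> R) x a : is_derive f x a -> is_derive (fun t => cos (f t)) x (a * - sin (f x)).
Proof. intros; apply dcomp; auto. apply is_derive_cos. Qed.
Lemma dsqrt (f : R -> R) x a : is_derive f x a -> 0 < f x ->
  is_derive (fun t => sqrt (f t)) x (a / (2 * sqrt (f x))).
Proof. intros; now apply is_derive_sqrt. Qed.

(** Differentiation follows the shape of the term and leaves the derivative to unification; [der]
    thus reduces a goal to the algebraic identity between the computed and the claimed derivative,
    besides side conditions. *)
Ltac der_step :=
  match goal with
  | |- is_derive (fun _ => ?c) _ _ => apply (dconst c)
  | |- is_derive (fun t => t) _ _ => apply did
  | |- is_derive (fun t => @?f t + @?g t) _ _ => apply (dplus f g)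
  | |- is_derive (fun t => @?f t - @?g t) _ _ => apply (dminus f g)
  | |- is_derive (fun t => - @?f t) _ _ => apply (dopp f)
  | |- is_derive (fun t => @?f t * @?g t) _ _ => apply (dmult f g)
  | |- is_derive (fun t => @?f t / @?g t) _ _ => apply (ddiv f g)
  | |- is_derive (fun t => / @?f t) _ _ => apply (dinv f)
  | |- is_derive (fun t => @?f t ^ ?n) _ _ => apply (dpow f n)
  | |- is_derive (fun t => sin (@?f t)) _ _ => apply (dsin f)
  | |- is_derive (fun t => cos (@?f t)) _ _ => apply (dcos f)
  | |- is_derive (fun t => sqrt (@?f t)) _ _ => apply (dsqrt f)
  | |- is_derive _ _ _ => solve [eauto]
  end.
Ltac der := eapply is_derive_eq; [repeat der_step | ].

Lemma continuous_of_derive (f : R -> R) x l : is_derive f x l -> continuous f x.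
Proof. intros H; apply (ex_derive_continuous (K := R_AbsRing) (V := R_NormedModule) f); now exists l. Qed.

Lemma cplus (f g : R -> R) x : continuous f x -> continuous g x -> continuous (fun t => f t + g t) x.
Proof. intros; now apply (continuous_plus f g). Qed.
Lemma cminus (f g : R -> R) x : continuous f x -> continuous g x -> continuous (fun t => f t - g t) x.
Proof. intros; now apply (continuous_minus f g). Qed.
Lemma copp (f : R -> R) x : continuous f x -> continuous (fun t => - f t) x.
Proof. intros; now apply (continuous_opp f). Qed.
Lemma cmult (f g : R -> R) x : continuous f x -> continuous g x -> continuous (fun t => f t * g t) x.
Proof. intros; now apply (continuous_mult f g). Qed.
Lemma ccomp (g f : R -> R) x : continuous f x -> continuous g (f x) -> continuous (fun t => g (f t)) x.
Proof. intros; now apply (continuous_comp f g). Qed.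
Lemma cinv (f : R -> R) x : continuous f x -> f x <> 0 -> continuous (fun t => / f t) x.
Proof.
  intros H H0; apply (ccomp Rinv f); auto.
  apply (continuous_of_derive _ _ (- 1 / (f x) ^ 2)). now apply (dinv (fun t => t)); [apply did|].
Qed.
Lemma cdiv (f g : R -> R) x : continuous f x -> continuous g x -> g x <> 0 ->
  continuous (fun t => f t / g t) x.
Proof. intros; apply cmult; auto; now apply cinv. Qed.
Lemma cpow (f : R -> R) n x : continuous f x -> continuous (fun t => f t ^ n) x.
Proof.
  intros H; induction n; simpl; [exact (@continuous_const R_UniformSpace R_UniformSpace 1 x) | now apply cmult].
Qed.
Lemma csqrt (f : R -> R) x : continuous f x -> continuous (fun t => sqrt (f t)) x.
Proof. intros; apply (ccomp sqrt f); auto. apply continuous_sqrt. Qed.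
Lemma cabs (f : R -> R) x : continuous f x -> continuous (fun t => Rabs (f t)) x.
Proof. intros; apply (ccomp Rabs f); auto. apply continuous_Rabs. Qed.
Lemma ccos (f : R -> R) x : continuous f x -> continuous (fun t => cos (f t)) x.
Proof. intros; apply (ccomp cos f); auto. apply continuous_cos. Qed.
Lemma csin (f : R -> R) x : continuous f x -> continuous (fun t => sin (f t)) x.
Proof. intros; apply (ccomp sin f); auto. apply continuous_sin. Qed.
Lemma cconst (c x : R) : continuous (fun _ : R => c) x.
Proof. exact (@continuous_const R_UniformSpace R_UniformSpace c x). Qed.
Lemma cid (x : R) : continuous (fun t : R => t) x.
Proof. exact (@continuous_id R_UniformSpace x). Qed.

Ltac cont_step :=
  match goal with
  | |- continuous (fun _ => ?c) _ => apply (cconst c)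
  | |- continuous (fun t => t) _ => apply cid
  | |- continuous (fun t => @?f t + @?g t) _ => apply (cplus f g)
  | |- continuous (fun t => @?f t - @?g t) _ => apply (cminus f g)
  | |- continuous (fun t => - @?f t) _ => apply (copp f)
  | |- continuous (fun t => @?f t * @?g t) _ => apply (cmult f g)
  | |- continuous (fun t => @?f t / @?g t) _ => apply (cdiv f g)
  | |- continuous (fun t => / @?f t) _ => apply (cinv f)
  | |- continuous (fun t => @?f t ^ ?n) _ => apply (cpow f n)
  | |- continuous (fun t => sqrt (@?f t)) _ => apply (csqrt f)
  | |- continuous (fun t => Rabs (@?f t)) _ => apply (cabs f)
  | |- continuous (fun t => sin (@?f t)) _ => apply (csin f)
  | |- continuous (fun t => cos (@?f t)) _ => apply (ccos f)
  | |- continuous _ _ => solve [eauto]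
  end.
Ltac cont := repeat cont_step.

Lemma continuous_eps (f : R -> R) x : continuous f x <->
  forall e, 0 < e -> exists d, 0 < d /\ forall y, Rabs (y - x) < d -> Rabs (f y - f x) < e.
Proof.
  split.
  - intros H e He.
    assert (H1 := proj1 (filterlim_locally (F := locally x) f (f x)) H (mkposreal e He)).
    destruct H1 as [d Hd]. exists d; split; [apply cond_pos|]. intros y Hy. now apply (Hd y).
  - intros H. apply (proj2 (filterlim_locally (F := locally x) f (f x))). intros e.
    destruct (H e (cond_pos e)) as [d [Hd Hd']].
    exists (mkposreal d Hd). intros y Hy. apply Hd', Hy.
Qed.

Lemma continuous_pt (f : R -> R) x : continuous f x <-> continuity_pt f x.
Proof. symmetry; apply continuity_pt_filterlim. Qed.

Lemma continuous_ext_near (f g : R -> R) x d : 0 < d ->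
  (forall y, Rabs (y - x) < d -> f y = g y) -> continuous f x -> continuous g x.
Proof.
  intros Hd H Hf. apply continuous_eps. intros e He.
  destruct (proj1 (continuous_eps f x) Hf e He) as [d1 [H1 H2]].
  exists (Rmin d d1). split; [now apply Rmin_glb_lt|]. intros y Hy.
  rewrite <- (H y), <- (H x).
  - apply H2. eapply Rlt_le_trans; [apply Hy|apply Rmin_r].
  - now rewrite Rminus_eq_0, Rabs_R0.
  - eapply Rlt_le_trans; [apply Hy|apply Rmin_l].
Qed.

Lemma is_derive_ext_near (f g : R -> R) x l d : 0 < d ->
  (forall y, Rabs (y - x) < d -> f y = g y) -> is_derive f x l -> is_derive g x l.
Proof.
  intros Hd H. apply is_derive_ext_loc. exists (mkposreal d Hd). intros y Hy. now apply H.
Qed.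

Lemma lipschitz_continuous (f : R -> R) K x :
  (forall y, Rabs (f y - f x) <= K * Rabs (y - x)) -> continuous f x.
Proof.
  intros H. apply continuous_eps. intros e He.
  assert (HK : 0 < Rmax K 0 + 1) by (generalize (Rmax_r K 0); lra).
  exists (e / (Rmax K 0 + 1)). split; [now apply Rdiv_lt_0_compat|].
  intros y Hy. apply (Rmult_lt_compat_r (Rmax K 0 + 1)) in Hy; auto.
  unfold Rdiv in Hy; rewrite Rmult_assoc, Rinv_l, Rmult_1_r in Hy by lra.
  specialize (H y). generalize (Rmax_l K 0) (Rabs_pos (y - x)); nra.
Qed.

Lemma ex_RInt_cont (f : R -> R) a b : (forall x, continuous f x) -> ex_RInt f a b.
Proof. intros; apply (ex_RInt_continuous f); auto. Qed.

Lemma ex_RInt_cont_on (f : R -> R) a b : a <= b ->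
  (forall x, a <= x <= b -> continuous f x) -> ex_RInt f a b.
Proof.
  intros Hab H; apply (ex_RInt_continuous f). intros z; rewrite Rmin_left, Rmax_right by lra. apply H.
Qed.

Lemma is_derive_RInt_cont (f : R -> R) a x : (forall x, continuous f x) ->
  is_derive (fun y => RInt f a y) x (f x).
Proof.
  intros H; apply (is_derive_RInt f _ a); [|apply H].
  exists (mkposreal 1 Rlt_0_1). intros y _. apply (RInt_correct f). now apply ex_RInt_cont.
Qed.

Lemma RInt_derive_eq (f df : R -> R) a b : a <= b ->
  (forall x, a <= x <= b -> is_derive f x (df x)) ->
  (forall x, a <= x <= b -> continuous df x) -> RInt df a b = f b - f a.
Proof.
  intros Hab H1 H2. apply is_RInt_unique.
  apply (is_RInt_derive f df); intros x; rewrite Rmin_left, Rmax_right by lra; auto.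
Qed.

Lemma RInt_ext_on (f g : R -> R) a b : a <= b ->
  (forall x, a < x < b -> f x = g x) -> RInt f a b = RInt g a b.
Proof. intros Hab H; apply RInt_ext; intros x; rewrite Rmin_left, Rmax_right by lra; auto. Qed.

Lemma RInt_const_R (c a b : R) : RInt (fun _ => c) a b = (b - a) * c.
Proof. rewrite RInt_const. reflexivity. Qed.

Lemma RInt_Chasles_R (f : R -> R) a b c : ex_RInt f a b -> ex_RInt f b c ->
  RInt f a c = RInt f a b + RInt f b c.
Proof. intros; symmetry; now apply (RInt_Chasles f). Qed.

Lemma RInt_plus_R (f g : R -> R) a b : ex_RInt f a b -> ex_RInt g a b ->
  RInt (fun x => f x + g x) a b = RInt f a b + RInt g a b.
Proof. intros; now apply (RInt_plus f g). Qed.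
Lemma RInt_minus_R (f g : R -> R) a b : ex_RInt f a b -> ex_RInt g a b ->
  RInt (fun x => f x - g x) a b = RInt f a b - RInt g a b.
Proof. intros; now apply (RInt_minus f g). Qed.
Lemma RInt_scal_R (f : R -> R) l a b : ex_RInt f a b ->
  RInt (fun x => l * f x) a b = l * RInt f a b.
Proof. intros; now apply (RInt_scal f). Qed.

Lemma RInt_nonneg (f : R -> R) a b : a <= b -> ex_RInt f a b ->
  (forall x, a < x < b -> 0 <= f x) -> 0 <= RInt f a b.
Proof.
  intros Hab He H. replace 0 with (RInt (fun _ => 0) a b) by (rewrite RInt_const_R; apply Rmult_0_r).
  apply RInt_le; auto. apply ex_RInt_const.
Qed.

Lemma RInt_abs_le (f g : R -> R) a b : a <= b -> ex_RInt f a b -> ex_RInt g a b ->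
  (forall x, a < x < b -> Rabs (f x) <= g x) -> Rabs (RInt f a b) <= RInt g a b.
Proof.
  intros Hab Hf Hg H. apply Rabs_le; split.
  - replace (- RInt g a b) with (RInt (fun x => - 1 * g x) a b) by (rewrite RInt_scal_R; auto; ringR).
    apply RInt_le; auto.
    + now apply (ex_RInt_scal g).
    + intros x Hx; specialize (H x Hx). apply Rabs_le_between in H; lra.
  - apply RInt_le; auto. intros x Hx; specialize (H x Hx). apply Rabs_le_between in H; lra.
Qed.

Lemma RInt_sqr_le (g : R -> R) a b : a <= b -> (forall x, a <= x <= b -> continuous g x) ->
  RInt g a b ^ 2 <= (b - a) * RInt (fun x => g x ^ 2) a b.
Proof.
  intros Hab Hg.
  assert (E1 : ex_RInt g a b) by now apply ex_RInt_cont_on.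
  assert (E2 : ex_RInt (fun x => g x ^ 2) a b)
    by (apply ex_RInt_cont_on; auto; intros; apply cpow; auto).
  destruct (Req_dec a b) as [<-|Hne].
  { rewrite !RInt_point. change (0 ^ 2 <= (a - a) * 0). lra. }
  set (I := RInt g a b). set (J := RInt (fun x => g x ^ 2) a b).
  set (k := I / (b - a)).
  assert (H : 0 <= RInt (fun x => g x ^ 2 - 2 * k * g x + k ^ 2) a b).
  { apply RInt_nonneg; auto.
    - apply ex_RInt_cont_on; auto; intros; cont.
    - intros x _. replace (g x ^ 2 - 2 * k * g x + k ^ 2) with ((g x - k) ^ 2) by ring. apply pow2_ge_0. }
  rewrite (RInt_plus_R (fun x => g x ^ 2 - 2 * k * g x) (fun _ => k ^ 2)),
    (RInt_minus_R (fun x => g x ^ 2) (fun x => 2 * k * g x)), (RInt_scal_R g), RInt_const_R in H; auto;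
    try (apply ex_RInt_cont_on; auto; intros; cont; fail).
  fold I J in H. assert (Hk : k * (b - a) = I) by (unfold k; field; lra).
  nra.
Qed.

Lemma derive_le (f f' : R -> R) a b : a <= b ->
  (forall x, a <= x <= b -> is_derive f x (f' x)) ->
  (forall x, a <= x <= b -> 0 <= f' x) -> f a <= f b.
Proof.
  intros Hab H H0.
  destruct (MVT_gen f a b f') as [c [Hc E]]; rewrite ?Rmin_left, ?Rmax_right in * by lra.
  - intros; apply H; lra.
  - intros; apply continuous_pt. eapply continuous_of_derive, H; lra.
  - specialize (H0 c Hc). nra.
Qed.

Lemma derive_lt (f f' : R -> R) a b : a < b ->
  (forall x, a <= x <= b -> is_derive f x (f' x)) ->
  (forall x, a <= x <= b -> 0 < f' x) -> f a < f b.
Proof.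
  intros Hab H H0.
  destruct (MVT_gen f a b f') as [c [Hc E]]; rewrite ?Rmin_left, ?Rmax_right in * by lra.
  - intros; apply H; lra.
  - intros; apply continuous_pt. eapply continuous_of_derive, H; lra.
  - specialize (H0 c Hc). nra.
Qed.

Lemma derive_zero (f : R -> R) a b : a <= b ->
  (forall x, a <= x <= b -> is_derive f x 0) -> f a = f b.
Proof.
  intros Hab H.
  destruct (MVT_gen f a b (fun _ => 0)) as [c [Hc E]]; rewrite ?Rmin_left, ?Rmax_right in * by lra.
  - intros; apply H; lra.
  - intros; apply continuous_pt. eapply continuous_of_derive, H; lra.
  - lra.
Qed.

Lemma derive_bound (f f' : R -> R) a b K : a <= b ->
  (forall x, a <= x <= b -> is_derive f x (f' x)) ->
  (forall x, a <= x <= b -> Rabs (f' x) <= K) -> Rabs (f b - f a) <= K * (b - a).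
Proof.
  intros Hab H H0.
  destruct (MVT_gen f a b f') as [c [Hc E]]; rewrite ?Rmin_left, ?Rmax_right in * by lra.
  - intros; apply H; lra.
  - intros; apply continuous_pt. eapply continuous_of_derive, H; lra.
  - rewrite E, Rabs_mult, (Rabs_pos_eq (b - a)) by lra.
    apply Rmult_le_compat_r; [lra | auto].
Qed.

Lemma derive_right_nonneg (f : R -> R) a b l : a < b -> is_derive f a l ->
  (forall x, a <= x <= b -> f a <= f x) -> 0 <= l.
Proof.
  intros Hab H H0. apply Rnot_lt_le; intros Hl.
  apply is_derive_Reals in H. destruct (H (- l / 2)) as [d Hd]; [lra|].
  set (h := Rmin (d / 2) (b - a)).
  assert (Hh : 0 < h) by (apply Rmin_glb_lt; [generalize (cond_pos d)|]; lra).
  assert (h <= d / 2) by apply Rmin_l. assert (h <= b - a) by apply Rmin_r.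
  specialize (Hd h). rewrite (Rabs_pos_eq h) in Hd by lra.
  assert (H3 := Hd ltac:(lra) ltac:(generalize (cond_pos d); lra)).
  apply Rabs_def2 in H3. specialize (H0 (a + h) ltac:(lra)).
  assert (0 <= (f (a + h) - f a) / h) by (apply Rle_div_r; lra). lra.
Qed.

Lemma derive_pos_right (f : R -> R) a l : is_derive f a l -> 0 < l ->
  exists d, 0 < d /\ forall x, a < x < a + d -> f a < f x.
Proof.
  intros H Hl. apply is_derive_Reals in H. destruct (H (l / 2)) as [d Hd]; [lra|].
  exists d; split; [apply cond_pos|]. intros x Hx.
  specialize (Hd (x - a) ltac:(lra)). rewrite (Rabs_pos_eq (x - a)) in Hd by lra.
  specialize (Hd ltac:(lra)). replace (a + (x - a)) with x in Hd by ring.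
  apply Rabs_def2 in Hd.
  assert (0 < (f x - f a) / (x - a)) by lra.
  apply Rnot_le_lt; intros Hn.
  assert ((f x - f a) / (x - a) <= 0); [|lra].
  apply Rle_div_l; lra.
Qed.

Lemma cont_max (f : R -> R) a b : a <= b -> (forall x, a <= x <= b -> continuous f x) ->
  exists x0, a <= x0 <= b /\ forall x, a <= x <= b -> f x <= f x0.
Proof.
  intros Hab H. destruct (continuity_ab_maj f a b Hab) as [x0 [H1 H2]].
  - intros; apply continuous_pt; auto.
  - now exists x0.
Qed.

Lemma cont_min (f : R -> R) a b : a <= b -> (forall x, a <= x <= b -> continuous f x) ->
  exists x0, a <= x0 <= b /\ forall x, a <= x <= b -> f x0 <= f x.
Proof.
  intros Hab H. destruct (cont_max (fun x => - f x) a b Hab) as [x0 [H1 H2]].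
  - intros; apply copp; auto.
  - exists x0; split; auto. intros x Hx; specialize (H2 x Hx); lra.
Qed.

Lemma cont_bounded (f : R -> R) a b : a <= b -> (forall x, a <= x <= b -> continuous f x) ->
  exists M, 0 < M /\ forall x, a <= x <= b -> Rabs (f x) <= M.
Proof.
  intros Hab H. destruct (cont_max (fun x => Rabs (f x)) a b Hab) as [x0 [H1 H2]].
  - intros; apply cabs; auto.
  - exists (Rabs (f x0) + 1). split; [generalize (Rabs_pos (f x0)); lra|].
    intros x Hx; specialize (H2 x Hx); lra.
Qed.

(** Composition with [clamp a b] extends a continuous function from an interval to the whole line,
    because [C1_curve] and the lemmas on primitives ask for continuity everywhere. *)
Definition clamp (a b x : R) : R := Rmax a (Rmin x b).

Lemma clamp_in a b x : a <= b -> a <= clamp a b x <= b.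
Proof.
  intros; unfold clamp; split; [apply Rmax_l|]. apply Rmax_lub; auto; apply Rmin_r.
Qed.
Lemma clamp_id a b x : a <= x <= b -> clamp a b x = x.
Proof. intros; unfold clamp. rewrite Rmin_left, Rmax_right; lra. Qed.
Lemma clamp_lip a b x y : Rabs (clamp a b x - clamp a b y) <= Rabs (x - y).
Proof.
  unfold clamp, Rmax, Rmin.
  repeat destruct Rle_dec; unfold Rabs; repeat destruct Rcase_abs; lra.
Qed.
Lemma clamp_cont a b x : continuous (clamp a b) x.
Proof.
  apply (lipschitz_continuous _ 1). intros y; rewrite Rmult_1_l; apply clamp_lip.
Qed.
Lemma cont_clamp (f : R -> R) a b : a <= b -> (forall x, a <= x <= b -> continuous f x) ->
  forall x, continuous (fun t => f (clamp a b t)) x.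
Proof.
  intros Hab H x. apply (ccomp f (clamp a b)); [apply clamp_cont|]. apply H; now apply clamp_in.
Qed.

Lemma IVT_on (f : R -> R) a b y : a <= b -> (forall x, a <= x <= b -> continuous f x) ->
  Rmin (f a) (f b) <= y <= Rmax (f a) (f b) -> exists x, a <= x <= b /\ f x = y.
Proof.
  intros Hab H Hy.
  destruct (IVT_gen (fun t => f (clamp a b t)) a b y) as [x [Hx E]].
  - intros x; apply continuous_pt. now apply cont_clamp.
  - rewrite !clamp_id by lra. auto.
  - rewrite Rmin_left, Rmax_right in Hx by lra. rewrite clamp_id in E by lra. now exists x.
Qed.

(** The zero is the supremum of the times up to which [w] stays positive. Positivity is asked just
    to the right of [a] rather than at [a], because in the comparison arguments [w a = 0]. *)
Lemma first_zero (w : R -> R) a b : a < b -> (forall x, a <= x <= b -> continuous w x) ->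
  (exists d, 0 < d /\ forall x, a < x < a + d -> 0 < w x) -> w b <= 0 ->
  exists c, a < c <= b /\ w c = 0 /\ forall x, a < x < c -> 0 < w x.
Proof.
  intros Hab Hw [d [Hd Hpos]] Hb.
  set (E := fun x => a <= x <= b /\ forall y, a < y < x -> 0 < w y).
  destruct (completeness E) as [c [Hc1 Hc2]].
  - exists b; intros x [Hx _]; lra.
  - exists a; split; [lra|]; intros; lra.
  - assert (Hcb : c <= b) by (apply Hc2; intros x [Hx _]; lra).
    assert (Hac : a < c).
    { apply Rlt_le_trans with (Rmin (a + d) b); [apply Rmin_glb_lt; lra|].
      apply Hc1; split; [split; [apply Rmin_glb; lra | apply Rmin_r]|].
      intros y Hy; apply Hpos. generalize (Rmin_l (a + d) b); lra. }
    assert (Hlt : forall y, a < y < c -> 0 < w y).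
    { intros y Hy. destruct (Rlt_le_dec 0 (w y)) as [|Hn]; auto. exfalso.
      assert (c <= y); [|lra]. apply Hc2. intros x [Hx1 Hx2].
      destruct (Rle_lt_dec x y) as [|Hxy]; auto. specialize (Hx2 y); lra. }
    exists c; split; [lra|split; auto].
    destruct (Rtotal_order (w c) 0) as [Hneg|[H0|Hp]]; auto; exfalso.
    + destruct (proj1 (continuous_eps w c) (Hw c ltac:(lra)) (- w c)) as [e [He1 He2]]; [lra|].
      set (y := Rmax ((a + c) / 2) (c - e / 2)).
      assert (y < c) by (apply Rmax_lub_lt; lra).
      assert ((a + c) / 2 <= y) by apply Rmax_l. assert (c - e / 2 <= y) by apply Rmax_r.
      specialize (He2 y). rewrite Rabs_left in He2 by lra. specialize (He2 ltac:(lra)).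
      apply Rabs_def2 in He2. specialize (Hlt y ltac:(lra)). lra.
    + assert (c < b) by (destruct (Req_dec c b); [subst; lra|lra]).
      destruct (proj1 (continuous_eps w c) (Hw c ltac:(lra)) (w c)) as [e [He1 He2]]; [lra|].
      set (y := Rmin b (c + e / 2)).
      assert (c < y) by (apply Rmin_glb_lt; lra).
      assert (y <= c); [|lra]. apply Hc1. split; [split; [lra|apply Rmin_l]|].
      intros x Hx. destruct (Rtotal_order x c) as [Hx1|[->|Hx1]]; auto.
      { apply Hlt; lra. }
      specialize (He2 x). rewrite Rabs_right in He2 by lra.
      assert (y <= c + e / 2) by apply Rmin_r. specialize (He2 ltac:(lra)).
      apply Rabs_def2 in He2. lra.
Qed.

(** The uniform lower bound [e] on the derivative makes [f] expand distances, hence onto by the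
    intermediate value theorem, with an inverse that is Lipschitz with constant 1/e. *)
Lemma inverse_C1 (f f' : R -> R) e : 0 < e ->
  (forall x, is_derive f x (f' x)) -> (forall x, e <= f' x) ->
  exists g, (forall y, f (g y) = y) /\ (forall x, g (f x) = x) /\
    (forall y, is_derive g y (/ f' (g y))).
Proof.
  intros He Hf Hf'.
  assert (Hinc : forall x y, x <= y -> e * (y - x) <= f y - f x).
  { intros x y Hxy.
    assert (H := derive_le (fun t => f t - e * t) (fun t => f' t - e) x y Hxy).
    cut (f x - e * x <= f y - e * y); [lra|]. apply H.
    - intros t _. der. ringR.
    - intros t _. specialize (Hf' t); lra. }
  assert (Hsurj : forall y, exists x, f x = y).
  { intros y. set (K := (Rabs (y - f 0) + 1) / e).
    assert (HK : e * K = Rabs (y - f 0) + 1) by (unfold K; field; lra).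
    assert (HK0 : 0 < K) by (apply Rdiv_lt_0_compat; auto; generalize (Rabs_pos (y - f 0)); lra).
    assert (H1 := Hinc (- K) 0 ltac:(lra)). assert (H2 := Hinc 0 K ltac:(lra)).
    assert (H3 := Rabs_le_between (y - f 0) (Rabs (y - f 0))).
    destruct (proj1 H3 (Rle_refl _)) as [H4 H5].
    destruct (IVT_on f (- K) K y) as [x [_ Hx]]; [lra| | |now exists x].
    - intros x _. eapply continuous_of_derive, Hf.
    - rewrite Rmin_left, Rmax_right; lra. }
  set (g := fun y => proj1_sig (constructive_indefinite_description _ (Hsurj y))).
  assert (Hfg : forall y, f (g y) = y).
  { intros y; unfold g; destruct constructive_indefinite_description; auto. }
  assert (Hlip : forall x y, e * Rabs (x - y) <= Rabs (f x - f y)).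
  { intros x y. destruct (Rle_dec x y).
    - rewrite (Rabs_minus_sym x), (Rabs_minus_sym (f x)), (Rabs_pos_eq (y - x)) by lra.
      eapply Rle_trans; [apply Hinc; auto|]. apply Rle_abs.
    - rewrite (Rabs_pos_eq (x - y)) by lra.
      eapply Rle_trans; [apply Hinc; lra|]. apply Rle_abs. }
  assert (Hgf : forall x, g (f x) = x).
  { intros x. assert (H := Hlip (g (f x)) x). rewrite Hfg, Rminus_eq_0, Rabs_R0 in H.
    assert (H1 := Rabs_pos (g (f x) - x)). assert (Rabs (g (f x) - x) = 0) by nra.
    destruct (Req_dec (g (f x) - x) 0) as [|Hn]; [lra|]. apply Rabs_no_R0 in Hn. contradiction. }
  exists g; split; auto; split; auto. intros y.
  assert (Hgc : forall y, continuous g y).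
  { intros z. apply (lipschitz_continuous _ (/ e)). intros w.
    apply (Rmult_le_reg_l e); auto. rewrite <- Rmult_assoc, Rinv_r, Rmult_1_l by lra.
    rewrite <- (Hfg w) at 2. rewrite <- (Hfg z) at 2. apply Hlip. }
  apply is_derive_Reals. intros eps Heps.
  set (p := f' (g y)). assert (Hp : e <= p) by apply Hf'.
  assert (Hd := Hf (g y)). apply is_derive_Reals in Hd. fold p in Hd.
  (* Within p / 2 of [p] the difference quotient [s] is at least p / 2, so |1/s - 1/p| = |s - p| /
     (s p) is at most (eps p^2 / 4) / (p^2 / 2) = eps / 2. *)
  destruct (Hd (Rmin (p / 2) (eps * p * p / 4))) as [d1 Hd1].
  { apply Rmin_glb_lt; [lra|]. assert (0 < eps * p * p); [|lra]. repeat apply Rmult_lt_0_compat; lra. }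
  destruct (proj1 (continuous_eps g y) (Hgc y) d1 (cond_pos d1)) as [d2 [Hd2 Hd2']].
  exists (mkposreal d2 Hd2). intros h Hh Hh2. simpl in Hh2.
  specialize (Hd2' (y + h)). replace (y + h - y) with h in Hd2' by ring. specialize (Hd2' Hh2).
  set (k := g (y + h) - g y) in *.
  assert (Hk : f (g y + k) - f (g y) = h).
  { unfold k. replace (g y + (g (y + h) - g y)) with (g (y + h)) by ring. rewrite !Hfg; ring. }
  assert (Hk0 : k <> 0).
  { intros E. rewrite E, Rplus_0_r in Hk. lra. }
  specialize (Hd1 k Hk0 Hd2'). rewrite Hk in Hd1.
  assert (Ha : Rabs (h / k - p) < p / 2) by (eapply Rlt_le_trans; [apply Hd1|apply Rmin_l]).
  assert (Hb : Rabs (h / k - p) < eps * p * p / 4) by (eapply Rlt_le_trans; [apply Hd1|apply Rmin_r]).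
  set (s := h / k) in *. assert (Hks : k / h = / s) by (unfold s; field; auto).
  fold k. rewrite Hks. apply Rabs_def2 in Ha.
  replace (/ s - / p) with (- (s - p) * / (s * p)) by (field; lra).
  rewrite Rabs_mult, Rabs_Ropp, (Rabs_pos_eq (/ (s * p)))
    by (left; apply Rinv_0_lt_compat; nra).
  assert (Hsp : p * p / 2 <= s * p) by nra.
  apply (Rmult_lt_reg_r (s * p)); [nra|]. rewrite Rmult_assoc, Rinv_l by nra. nra.
Qed.

(** The factor 6 gives integral 1 over [0, 1]. The primitive [smoothstep] is therefore 3 t^2 - 2 t^3
    there and constant outside, with a continuous derivative vanishing at both ends, which is all
    that a [C1_curve] needs to stop smoothly. *)
Definition bump (t : R) : R := 6 * Rmax 0 (t * (1 - t)).
Definition smoothstep (t : R) : R := RInt bump 0 t.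

Lemma bump_cont t : continuous bump t.
Proof.
  unfold bump. apply cmult; [apply cconst|].
  apply (continuous_ext (fun t => (t * (1 - t) + Rabs (t * (1 - t))) / 2)).
  - intros x; unfold Rmax, Rabs; destruct Rle_dec, Rcase_abs; lra.
  - cont. lra.
Qed.
Lemma bump_nonneg t : 0 <= bump t.
Proof. unfold bump. generalize (Rmax_l 0 (t * (1 - t))). lra. Qed.
Lemma bump_zero t : t <= 0 \/ 1 <= t -> bump t = 0.
Proof. intros; unfold bump. rewrite Rmax_left; [ring|nra]. Qed.
Lemma smoothstep_derive t : is_derive smoothstep t (bump t).
Proof. apply is_derive_RInt_cont, bump_cont. Qed.
Lemma smoothstep_le0 t : t <= 0 -> smoothstep t = 0.
Proof.
  intros Ht. rewrite (derive_zero smoothstep t 0); auto.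
  - unfold smoothstep; now rewrite RInt_point.
  - intros x Hx. rewrite <- (bump_zero x) by lra. apply smoothstep_derive.
Qed.
Lemma smoothstep_ge1 t : 1 <= t -> smoothstep t = 1.
Proof.
  intros Ht. rewrite <- (derive_zero smoothstep 1 t); auto.
  - unfold smoothstep. rewrite (RInt_ext_on bump (fun t => 6 * t - 6 * t ^ 2)).
    + rewrite (RInt_derive_eq (fun t => 3 * t ^ 2 - 2 * t ^ 3)); try lra.
      * intros; der. simpl; ringR.
      * intros; cont.
    + lra.
    + intros x Hx; unfold bump. rewrite Rmax_right; [ring|nra].
  - intros x Hx. rewrite <- (bump_zero x) by lra. apply smoothstep_derive.
Qed.

(** * Ultralimits *)

(** A nonprincipal ultrafilter on the integers, described by the properties in use. Every bounded
    sequence converges along it, so the limits at uncountably many times exist together. *)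
Record is_ultra (U : (nat -> Prop) -> Prop) : Prop := {
  ultra_and : forall P Q, U P -> U Q -> U (fun n => P n /\ Q n);
  ultra_imp : forall P Q : nat -> Prop, (forall n, P n -> Q n) -> U P -> U Q;
  ultra_false : ~ U (fun _ => False);
  ultra_or : forall P, U P \/ U (fun n => ~ P n);
  ultra_ge : forall N, U (fun n => (N <= n)%nat) }.

Lemma ex_ultra : exists U, is_ultra U.
Proof.
  set (F := (fun P : nat -> Prop => exists N, forall n, (N <= n)%nat -> P n) : classical_sets.set_system nat).
  assert (HF : filter.ProperFilter F).
  { constructor.
    - intros [N HN]. exact (HN N (le_n N)).
    - constructor.
      + now exists 0%nat.
      + intros P Q [N HN] [M HM]. exists (N + M)%nat. intros n Hn. split; [apply HN|apply HM]; lia.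
      + intros P Q H [N HN]. exists N. intros n Hn. apply H, HN, Hn. }
  destruct (filter.ultraFilterLemma HF) as [G [HG HFG]].
  exists G. assert (HP := @filter.ultra_proper _ _ HG).
  assert (Hf := @filter.filter_filter _ _ HP). constructor.
  - intros P Q. apply (@filter.filterI _ _ Hf).
  - intros P Q H. apply (@filter.filterS _ _ Hf); auto.
  - apply (@filter.filter_not_empty _ _ HP).
  - intros P. apply (@filter.in_ultra_setVsetC _ _ P HG).
  - intros N. apply HFG. now exists N.
Qed.

Section Ultra.
Variable U : (nat -> Prop) -> Prop.
Hypothesis HU : is_ultra U.

Definition ulim (x : nat -> R) (l : R) : Prop :=
  forall e, 0 < e -> U (fun n => Rabs (x n - l) < e).

Lemma ultra_all (P : nat -> Prop) : (forall n, P n) -> U P.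
Proof. intros H; apply (ultra_imp _ HU (fun n => (0 <= n)%nat)); auto. apply (ultra_ge _ HU). Qed.

Lemma ultra_ex (P : nat -> Prop) : U P -> exists n, P n.
Proof.
  intros H. apply NNPP. intros Hn. apply (ultra_false _ HU).
  apply (ultra_imp _ HU P); auto. intros n Hp; apply Hn; now exists n.
Qed.

(** The limit is the supremum of the [a] such that [a <= x n] for [U]-most [n]; [ultra_or] decides
    on which side of a given level [U]-most terms lie. *)
Lemma ulim_exists (x : nat -> R) K : (forall n, Rabs (x n) <= K) -> exists l, ulim x l.
Proof.
  intros HK. assert (HK' : forall n, - K <= x n <= K) by (intros n; now apply Rabs_le_between).
  destruct (completeness (fun a => U (fun n => a <= x n))) as [l [H1 H2]].
  - exists K. intros a Ha. destruct (ultra_ex _ Ha) as [n Hn]. specialize (HK' n); lra.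
  - exists (- K). apply ultra_all. intros n; specialize (HK' n); lra.
  - exists l. intros e He.
    assert (Ha : U (fun n => l - e < x n)).
    { destruct (ultra_or _ HU (fun n => l - e < x n)) as [|Hn]; auto. exfalso.
      assert (l <= l - e); [|lra]. apply H2. intros a Ha.
      destruct (ultra_ex _ (ultra_and _ HU _ _ Hn Ha)) as [n [Hn1 Hn2]]. lra. }
    assert (Hb : U (fun n => x n < l + e)).
    { destruct (ultra_or _ HU (fun n => x n < l + e)) as [|Hn]; auto. exfalso.
      assert (l + e <= l); [|lra]. apply H1. apply (ultra_imp _ HU _ _ (fun n H => Rnot_lt_le _ _ H) Hn). }
    refine (ultra_imp _ HU _ _ _ (ultra_and _ HU _ _ Ha Hb)).
    intros n [H3 H4]. apply Rabs_def1; lra.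
Qed.

Lemma ulim_unique x l1 l2 : ulim x l1 -> ulim x l2 -> l1 = l2.
Proof.
  intros H1 H2. destruct (Req_dec l1 l2) as [|Hn]; auto. exfalso.
  assert (He : 0 < Rabs (l1 - l2) / 2) by (generalize (Rabs_pos_lt (l1 - l2)); lra).
  destruct (ultra_ex _ (ultra_and _ HU _ _ (H1 _ He) (H2 _ He))) as [n [Ha Hb]].
  generalize (Rabs_triang (l1 - x n) (x n - l2)). rewrite (Rabs_minus_sym l1 (x n)).
  replace (l1 - x n + (x n - l2)) with (l1 - l2) by ring. lra.
Qed.

Lemma ulim_const l : ulim (fun _ => l) l.
Proof. intros e He; apply ultra_all; intros _. now rewrite Rminus_eq_0, Rabs_R0. Qed.

Lemma ulim_inv_n (x : nat -> R) l K :
  (forall n, Rabs (x n - l) <= K / INR (S n)) -> ulim x l.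
Proof.
  intros H e He. destruct (nfloor_ex (Rmax 0 (K / e))) as [N HN]; [apply Rmax_l|].
  apply (ultra_imp _ HU (fun n => (N <= n)%nat)); [|apply (ultra_ge _ HU)].
  intros n Hn. eapply Rle_lt_trans; [apply H|].
  assert (INR N <= INR n) by now apply le_INR.
  assert (0 < INR (S n)) by apply lt_0_INR, Nat.lt_0_succ.
  apply Rlt_div_l; auto. rewrite S_INR in *.
  assert (K / e < INR n + 1) by (generalize (Rmax_r 0 (K / e)); lra).
  apply (Rmult_lt_compat_l e) in H2; auto. replace (e * (K / e)) with K in H2 by (field; lra). lra.
Qed.

Lemma ulim_le x l a : ulim x l -> U (fun n => x n <= a) -> l <= a.
Proof.
  intros Hx Ha. apply Rnot_lt_le; intros Hn.
  destruct (ultra_ex _ (ultra_and _ HU _ _ (Hx (l - a) ltac:(lra)) Ha)) as [n [H1 H2]].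
  apply Rabs_def2 in H1. lra.
Qed.
Lemma ulim_ge x l a : ulim x l -> U (fun n => a <= x n) -> a <= l.
Proof.
  intros Hx Ha. apply Rnot_lt_le; intros Hn.
  destruct (ultra_ex _ (ultra_and _ HU _ _ (Hx (a - l) ltac:(lra)) Ha)) as [n [H1 H2]].
  apply Rabs_def2 in H1. lra.
Qed.

Lemma ulim_plus x y a b : ulim x a -> ulim y b -> ulim (fun n => x n + y n) (a + b).
Proof.
  intros Hx Hy e He.
  refine (ultra_imp _ HU _ _ _ (ultra_and _ HU _ _ (Hx (e / 2) ltac:(lra)) (Hy (e / 2) ltac:(lra)))).
  intros n [H1 H2]. replace (x n + y n - (a + b)) with ((x n - a) + (y n - b)) by ring.
  eapply Rle_lt_trans; [apply Rabs_triang|]. lra.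
Qed.
Lemma ulim_cont (f : R -> R) x a : continuous f a -> ulim x a -> ulim (fun n => f (x n)) (f a).
Proof.
  intros Hf Hx e He. destruct (proj1 (continuous_eps f a) Hf e He) as [d [Hd H]].
  apply (ultra_imp _ HU _ _ (fun n => H (x n)) (Hx d Hd)).
Qed.
Lemma ulim_bound x a : ulim x a -> U (fun n => Rabs (x n) <= Rabs a + 1).
Proof.
  intros Hx. refine (ultra_imp _ HU _ _ _ (Hx 1 Rlt_0_1)). intros n H.
  replace (x n) with (x n - a + a) by ring. generalize (Rabs_triang (x n - a) a); lra.
Qed.
Lemma ulim_mult x y a b : ulim x a -> ulim y b -> ulim (fun n => x n * y n) (a * b).
Proof.
  intros Hx Hy e He. set (K := Rabs a + Rabs b + 1).
  assert (HK : 0 < K) by (unfold K; generalize (Rabs_pos a) (Rabs_pos b); lra).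
  set (d := e / (2 * K)). assert (Hd : 0 < d) by (apply Rdiv_lt_0_compat; lra).
  refine (ultra_imp _ HU _ _ _ (ultra_and _ HU _ _ (Hx d Hd)
     (ultra_and _ HU _ _ (Hy d Hd) (ulim_bound _ _ Hx)))).
  intros n [H1 [H2 H3]].
  replace (x n * y n - a * b) with (x n * (y n - b) + b * (x n - a)) by ring.
  eapply Rle_lt_trans; [apply Rabs_triang|]. rewrite !Rabs_mult.
  assert (E : d * K * 2 = e) by (unfold d; field; lra).
  assert (Rabs (x n) * Rabs (y n - b) <= (Rabs a + 1) * Rabs (y n - b))
    by (apply Rmult_le_compat_r; auto; apply Rabs_pos).
  assert ((Rabs a + 1) * Rabs (y n - b) < (Rabs a + 1) * d)
    by (apply Rmult_lt_compat_l; auto; generalize (Rabs_pos a); lra).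
  assert (Rabs b * Rabs (x n - a) <= Rabs b * d)
    by (apply Rmult_le_compat_l; [apply Rabs_pos|lra]).
  assert (d * K = (Rabs a + 1) * d + Rabs b * d) by (unfold K; ring). lra.
Qed.
End Ultra.

(** * The Riemannian distance *)

Section Metric.
Variable m : R -> R.
Hypothesis Hm : model_fun m.

Lemma ex_m n x : ex_derive_n m n x.
Proof. apply Hm. Qed.
Lemma dm x : is_derive m x (Derive_n m 1 x).
Proof. apply Derive_correct. apply (ex_m 1). Qed.
Lemma dm1 x : is_derive (Derive_n m 1) x (Derive_n m 2 x).
Proof. apply Derive_correct. apply (ex_m 2). Qed.
Lemma dm2 x : is_derive (Derive_n m 2) x (Derive_n m 3 x).
Proof. apply Derive_correct. apply (ex_m 3). Qed.
Lemma cm x : continuous m x.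
Proof. eapply continuous_of_derive, dm. Qed.
Lemma cm1 x : continuous (Derive_n m 1) x.
Proof. eapply continuous_of_derive, dm1. Qed.
Lemma cm2 x : continuous (Derive_n m 2) x.
Proof. eapply continuous_of_derive, dm2. Qed.
Lemma m_0 : m 0 = 0.
Proof. apply Hm. Qed.
Lemma m1_0 : Derive_n m 1 0 = 1.
Proof. apply Hm. Qed.
Lemma m_pos x : 0 < x -> 0 < m x.
Proof. apply Hm. Qed.

(** The factor by which the metric stretches Euclidean lengths in the angular direction, extended to
    the pole by m'(0) = 1. *)
Definition mquot (r : R) : R := if Req_EM_T r 0 then 1 else m r / r.

Lemma mquot_cont r : continuous mquot r.
Proof.
  destruct (Req_dec r 0) as [->|Hr].
  - apply continuous_eps. intros e He. assert (H := dm 0). rewrite m1_0 in H.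
    apply is_derive_Reals in H. destruct (H e He) as [d Hd].
    exists d; split; [apply cond_pos|]. intros y Hy. rewrite Rminus_0_r in Hy.
    unfold mquot. destruct (Req_EM_T 0 0) as [_|]; [|lra].
    destruct (Req_EM_T y 0) as [_|Hy0]; [now rewrite Rminus_eq_0, Rabs_R0|].
    specialize (Hd y Hy0 Hy). now rewrite Rplus_0_l, m_0, Rminus_0_r in Hd.
  - apply (continuous_ext_near (fun r => m r / r) mquot r (Rabs r)).
    + now apply Rabs_pos_lt.
    + intros y Hy. unfold mquot. destruct (Req_EM_T y 0) as [->|]; auto.
      rewrite Rabs_minus_sym, Rminus_0_r in Hy. lra.
    + cont. apply cm. auto.
Qed.

Lemma mquot_pos r : 0 <= r -> 0 < mquot r.
Proof.
  intros Hr; unfold mquot. destruct (Req_EM_T r 0); [lra|].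
  apply Rdiv_lt_0_compat; [apply m_pos|]; lra.
Qed.

Lemma rad_nonneg p : 0 <= rad p.
Proof. apply sqrt_pos. Qed.
Lemma rad_sqr p : rad p ^ 2 = fst p ^ 2 + snd p ^ 2.
Proof.
  unfold rad. rewrite pow2_sqrt; auto. generalize (pow2_ge_0 (fst p)) (pow2_ge_0 (snd p)); lra.
Qed.
Lemma rad_0 p : rad p = 0 -> p = (0, 0).
Proof.
  intros H. assert (E := rad_sqr p). rewrite H in E. destruct p as [x y]; simpl fst in E; simpl snd in E.
  f_equal; nra.
Qed.
Lemma rad_00 : rad (0, 0) = 0.
Proof. unfold rad; simpl. transitivity (sqrt 0); [f_equal; ring|apply sqrt_0]. Qed.
Lemma rad_pos p : p <> (0, 0) -> 0 < rad p.
Proof.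
  intros H. destruct (rad_nonneg p) as [|E]; auto. now elim H; apply rad_0.
Qed.
Lemma abs_fst_le p : Rabs (fst p) <= rad p.
Proof. apply Rsqr_incr_0; [|apply Rabs_pos|apply rad_nonneg].
  rewrite <- Rsqr_abs. unfold Rsqr. assert (E := rad_sqr p). nra. Qed.
Lemma abs_snd_le p : Rabs (snd p) <= rad p.
Proof. apply Rsqr_incr_0; [|apply Rabs_pos|apply rad_nonneg].
  rewrite <- Rsqr_abs. unfold Rsqr. assert (E := rad_sqr p). nra. Qed.

Definition cross (p v : pt) : R := fst p * snd v - snd p * fst v.

Lemma gmet_polar p v : rad p <> 0 ->
  gmet m p v v = dr p v ^ 2 + (m (rad p)) ^ 2 * dtheta p v ^ 2.
Proof. intros H; unfold gmet. destruct Req_EM_T; [contradiction|]. ring. Qed.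

(** The term [cross p v ^ 2 / rad p ^ 2] is the squared Euclidean length of the angular component of
    [v]. The formula covers the pole too: there [cross] vanishes, and so does the quotient by
    zero. *)
Lemma gmet_euclid p v : gmet m p v v =
  fst v ^ 2 + snd v ^ 2 + (mquot (rad p) ^ 2 - 1) * (cross p v ^ 2 / rad p ^ 2).
Proof.
  destruct (Req_dec (rad p) 0) as [E|E].
  - unfold gmet, cross. rewrite (rad_0 p E), rad_00. simpl. destruct Req_EM_T; [|lra].
    unfold Rdiv. ring.
  - rewrite gmet_polar by auto. unfold mquot, dr, dtheta, cross. destruct Req_EM_T; [contradiction|].
    assert (H := rad_sqr p). set (r := rad p) in *.
    destruct p as [x y], v as [a b]; simpl fst in *; simpl snd in *.
    transitivity (((x * a + y * b) ^ 2 + (x * b - y * a) ^ 2) / r ^ 2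
       + ((m r / r) ^ 2 - 1) * ((x * b - y * a) ^ 2 / r ^ 2)); [field; auto|].
    f_equal. transitivity ((x ^ 2 + y ^ 2) * (a ^ 2 + b ^ 2) / r ^ 2); [field; auto|].
    rewrite <- H. field; auto.
Qed.

Lemma cross_bound p v : 0 <= cross p v ^ 2 / rad p ^ 2 <= fst v ^ 2 + snd v ^ 2.
Proof.
  destruct (Req_dec (rad p) 0) as [E|E].
  - rewrite (rad_0 p E). unfold cross; simpl fst; simpl snd.
    replace ((0 * snd v - 0 * fst v) ^ 2 / rad (0, 0) ^ 2) with 0 by (unfold Rdiv; ring).
    generalize (pow2_ge_0 (fst v)) (pow2_ge_0 (snd v)); lra.
  - assert (0 < rad p ^ 2) by (generalize (rad_nonneg p); intros; apply pow_lt; lra).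
    split; [apply Rdiv_le_0_compat; auto; apply pow2_ge_0|].
    apply Rle_div_l; auto. rewrite rad_sqr. unfold cross.
    generalize (pow2_ge_0 (fst p * fst v + snd p * snd v)). nra.
Qed.

Lemma gmet_nonneg p v : 0 <= gmet m p v v.
Proof.
  rewrite gmet_euclid. assert (H := cross_bound p v).
  generalize (pow2_ge_0 (mquot (rad p))). nra.
Qed.

Lemma gmet_lower p v l : 0 <= l <= 1 -> l <= mquot (rad p) ->
  l ^ 2 * (fst v ^ 2 + snd v ^ 2) <= gmet m p v v.
Proof.
  intros Hl1 Hl2. rewrite gmet_euclid. assert (H := cross_bound p v).
  set (q := cross p v ^ 2 / rad p ^ 2) in *. set (n := fst v ^ 2 + snd v ^ 2) in *.
  assert (l ^ 2 <= mquot (rad p) ^ 2) by (apply pow_incr; lra).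
  assert (l ^ 2 <= 1) by nra. nra.
Qed.

Lemma gmet_upper p v l : 1 <= l -> mquot (rad p) <= l ->
  gmet m p v v <= l ^ 2 * (fst v ^ 2 + snd v ^ 2).
Proof.
  intros Hl1 Hl2. rewrite gmet_euclid. assert (H := cross_bound p v).
  set (q := cross p v ^ 2 / rad p ^ 2) in *. set (n := fst v ^ 2 + snd v ^ 2) in *.
  assert (mquot (rad p) ^ 2 <= l ^ 2) by (apply pow_incr; generalize (mquot_pos (rad p) (rad_nonneg p)); lra).
  assert (1 <= l ^ 2) by nra. nra.
Qed.

Lemma gmet_radial_lower p v : (fst p * fst v + snd p * snd v) ^ 2 <= rad p ^ 2 * gmet m p v v.
Proof.
  destruct (Req_dec (rad p) 0) as [E|E].
  - rewrite (rad_0 p E), rad_00. simpl fst; simpl snd. apply Req_le. ring.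
  - rewrite gmet_polar by auto. unfold dr.
    assert (0 <= rad p ^ 2 * (m (rad p) ^ 2 * dtheta p v ^ 2)).
    { apply Rmult_le_pos; [apply pow2_ge_0|]. apply Rmult_le_pos; apply pow2_ge_0. }
    rewrite Rmult_plus_distr_l.
    replace (rad p ^ 2 * ((fst p * fst v + snd p * snd v) / rad p) ^ 2) with
      ((fst p * fst v + snd p * snd v) ^ 2) by (field; auto). lra.
Qed.

Lemma gmet_scal p v k : gmet m p (k * fst v, k * snd v) (k * fst v, k * snd v) = k ^ 2 * gmet m p v v.
Proof.
  rewrite !gmet_euclid. unfold cross; simpl fst; simpl snd. unfold Rdiv. ring.
Qed.

(** * Speed and length of C1 curves *)

Definition spd (c : curve) (t : R) : R := sqrt (gmet m (c t) (velocity c t) (velocity c t)).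

Lemma spd_nonneg c t : 0 <= spd c t.
Proof. apply sqrt_pos. Qed.
Lemma spd_sqr c t : spd c t ^ 2 = gmet m (c t) (velocity c t) (velocity c t).
Proof. unfold spd; apply pow2_sqrt, gmet_nonneg. Qed.

Lemma C1_dx c t : C1_curve c -> is_derive (cx c) t (Derive (cx c) t).
Proof. intros H. apply Derive_correct, (proj1 H t). Qed.
Lemma C1_dy c t : C1_curve c -> is_derive (cy c) t (Derive (cy c) t).
Proof. intros H. apply Derive_correct, (proj1 H t). Qed.
Lemma C1_cx c t : C1_curve c -> continuous (cx c) t.
Proof. intros H. eapply continuous_of_derive, C1_dx, H. Qed.
Lemma C1_cy c t : C1_curve c -> continuous (cy c) t.
Proof. intros H. eapply continuous_of_derive, C1_dy, H. Qed.
Lemma C1_cdx c t : C1_curve c -> continuous (Derive (cx c)) t.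
Proof. intros H. exact (proj1 (proj2 H t)). Qed.
Lemma C1_cdy c t : C1_curve c -> continuous (Derive (cy c)) t.
Proof. intros H. exact (proj2 (proj2 H t)). Qed.

Lemma C1_make (c : curve) (x1 y1 : R -> R) :
  (forall t, is_derive (cx c) t (x1 t)) -> (forall t, is_derive (cy c) t (y1 t)) ->
  (forall t, continuous x1 t) -> (forall t, continuous y1 t) ->
  C1_curve c /\ forall t, velocity c t = (x1 t, y1 t).
Proof.
  intros Hx Hy H1 H2. split.
  - split; intros t; split.
    + now exists (x1 t).
    + now exists (y1 t).
    + apply (continuous_ext x1); auto. intros; symmetry; now apply is_derive_unique.
    + apply (continuous_ext y1); auto. intros; symmetry; now apply is_derive_unique.
  - intros t; unfold velocity; f_equal; now apply is_derive_unique.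
Qed.

Lemma rad_curve_cont c t : C1_curve c -> continuous (fun t => rad (c t)) t.
Proof.
  intros H. apply (continuous_ext (fun t => sqrt (cx c t ^ 2 + cy c t ^ 2))); [reflexivity|].
  cont; [now apply C1_cx | now apply C1_cy].
Qed.

(** At the pole the angular component has no limit, but it is bounded by the Euclidean speed while
    its coefficient [mquot ^ 2 - 1] tends to 0. *)
Lemma gmet_cont c t : C1_curve c ->
  continuous (fun t => gmet m (c t) (velocity c t) (velocity c t)) t.
Proof.
  intros H.
  assert (Hx := C1_cx c t H). assert (Hy := C1_cy c t H).
  assert (Hdx := C1_cdx c t H). assert (Hdy := C1_cdy c t H).
  assert (Hq : continuous (fun t => mquot (rad (c t))) t).
  { apply (ccomp mquot (fun t => rad (c t))); [now apply rad_curve_cont|apply mquot_cont]. }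
  set (n := fun t => Derive (cx c) t ^ 2 + Derive (cy c) t ^ 2).
  assert (Hn : continuous n t) by (unfold n; cont).
  destruct (Req_dec (rad (c t)) 0) as [E|E].
  - assert (Hw : continuous (fun t => (mquot (rad (c t)) ^ 2 - 1) * n t) t) by cont.
    apply continuous_eps. intros e He.
    destruct (proj1 (continuous_eps _ _) Hn (e / 2)) as [d1 [Hd1 H1]]; [lra|].
    destruct (proj1 (continuous_eps _ _) Hw (e / 2)) as [d2 [Hd2 H2]]; [lra|].
    exists (Rmin d1 d2); split; [now apply Rmin_glb_lt|]. intros y Hyd.
    specialize (H1 y (Rlt_le_trans _ _ _ Hyd (Rmin_l _ _))).
    specialize (H2 y (Rlt_le_trans _ _ _ Hyd (Rmin_r _ _))).
    assert (E1 : mquot (rad (c t)) = 1) by (rewrite E; unfold mquot; destruct Req_EM_T; lra).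
    rewrite E1 in H2. replace ((1 ^ 2 - 1) * n t) with 0 in H2 by ring. rewrite Rminus_0_r in H2.
    rewrite !gmet_euclid, E1. change (fst (velocity c y) ^ 2 + snd (velocity c y) ^ 2) with (n y).
    change (fst (velocity c t) ^ 2 + snd (velocity c t) ^ 2) with (n t).
    assert (Hb := cross_bound (c y) (velocity c y)).
    change (fst (velocity c y) ^ 2 + snd (velocity c y) ^ 2) with (n y) in Hb.
    set (q := cross (c y) (velocity c y) ^ 2 / rad (c y) ^ 2) in *.
    set (k := mquot (rad (c y)) ^ 2 - 1) in *.
    assert (Hkq : Rabs (k * q) <= Rabs (k * n y)).
    { rewrite !Rabs_mult. apply Rmult_le_compat_l; [apply Rabs_pos|].
      rewrite !Rabs_pos_eq by lra. lra. }
    replace (n y + k * q - (n t + (1 ^ 2 - 1) * (cross (c t) (velocity c t) ^ 2 / rad (c t) ^ 2)))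
      with ((n y - n t) + k * q) by ring.
    eapply Rle_lt_trans; [apply Rabs_triang|]. lra.
  - apply (continuous_ext (fun t => n t + (mquot (rad (c t)) ^ 2 - 1) *
      ((cx c t * Derive (cy c) t - cy c t * Derive (cx c) t) ^ 2 / rad (c t) ^ 2))).
    + intros s. now rewrite gmet_euclid.
    + cont; auto. now apply rad_curve_cont. now apply pow_nonzero.
Qed.

Lemma spd_cont c t : C1_curve c -> continuous (spd c) t.
Proof. intros H. apply (csqrt (fun t => gmet m (c t) (velocity c t) (velocity c t))). now apply gmet_cont. Qed.

Lemma spd_int c a b : C1_curve c -> ex_RInt (spd c) a b.
Proof. intros H; apply ex_RInt_cont. intros; now apply spd_cont. Qed.

Lemma C1_reparam c (phi phi1 : R -> R) : C1_curve c ->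
  (forall t, is_derive phi t (phi1 t)) -> (forall t, continuous phi1 t) ->
  C1_curve (fun t => c (phi t)) /\
  forall t, spd (fun t => c (phi t)) t = Rabs (phi1 t) * spd c (phi t).
Proof.
  intros H H1 H2.
  assert (Hphi : forall t, continuous phi t) by (intros; eapply continuous_of_derive, H1).
  destruct (C1_make (fun t => c (phi t)) (fun t => phi1 t * Derive (cx c) (phi t))
    (fun t => phi1 t * Derive (cy c) (phi t))) as [H3 H4].
  - intros t. apply (dcomp (cx c) phi); auto. now apply C1_dx.
  - intros t. apply (dcomp (cy c) phi); auto. now apply C1_dy.
  - intros t. apply cmult; auto. apply (ccomp (Derive (cx c)) phi); auto. now apply C1_cdx.
  - intros t. apply cmult; auto. apply (ccomp (Derive (cy c)) phi); auto. now apply C1_cdy.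
  - split; auto. intros t. unfold spd. rewrite H4.
    rewrite <- sqrt_Rsqr_abs, <- sqrt_mult; [|apply Rle_0_sqr|apply gmet_nonneg].
    f_equal. assert (E := gmet_scal (c (phi t)) (velocity c (phi t)) (phi1 t)).
    simpl in E. unfold Rsqr. simpl. rewrite E. ring.
Qed.

Lemma length01_spd c : length01 m c = RInt (spd c) 0 1.
Proof. reflexivity. Qed.

Lemma spd_RInt_nonneg c a b : C1_curve c -> a <= b -> 0 <= RInt (spd c) a b.
Proof. intros; apply RInt_nonneg; auto. now apply spd_int. intros; apply spd_nonneg. Qed.

Lemma line_C1 (p v : pt) : C1_curve (fun t => (fst p + t * fst v, snd p + t * snd v)) /\
  forall t, velocity (fun t => (fst p + t * fst v, snd p + t * snd v)) t = v.
Proof.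
  destruct (C1_make (fun t => (fst p + t * fst v, snd p + t * snd v)) (fun _ => fst v) (fun _ => snd v)) as [H1 H2].
  - intros t. change (is_derive (fun t => fst p + t * fst v) t (fst v)). der. ringR.
  - intros t. change (is_derive (fun t => snd p + t * snd v) t (snd v)). der. ringR.
  - intros; apply cconst.
  - intros; apply cconst.
  - split; auto. intros t; rewrite H2. now destruct v.
Qed.

(** * The distance function and its comparison with the Euclidean one *)

Definition D (p q : pt) : R := real (Defs.dist m p q).

Lemma dist_glb p q : is_glb_Rbar (fun l => exists c : curve,
    C1_curve c /\ c 0 = p /\ c 1 = q /\ l = length01 m c) (Defs.dist m p q).
Proof. apply Glb_Rbar_correct. Qed.

Lemma line_connects p q : exists c, C1_curve c /\ c 0 = p /\ c 1 = q.
Proof.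
  destruct (line_C1 p (fst q - fst p, snd q - snd p)) as [H _]. eexists; split; [apply H|].
  destruct p as [x y], q as [x' y']; simpl. split; f_equal; ring.
Qed.

Lemma dist_finite p q : Defs.dist m p q = Finite (D p q).
Proof.
  unfold D. destruct (dist_glb p q) as [H1 H2].
  destruct (line_connects p q) as [c [Hc [H3 H4]]].
  destruct (Defs.dist m p q) as [d| |]; auto; exfalso.
  - apply (H1 (length01 m c)). exists c; auto.
  - apply (H2 (Finite 0)). intros l [c' [H5 [_ [_ ->]]]]. simpl. rewrite length01_spd.
    apply spd_RInt_nonneg; auto; lra.
Qed.

Lemma D_eq p q d : Defs.dist m p q = Finite d -> D p q = d.
Proof. unfold D. now intros ->. Qed.

Lemma D_le01 c : C1_curve c -> D (c 0) (c 1) <= RInt (spd c) 0 1.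
Proof.
  intros H. destruct (dist_glb (c 0) (c 1)) as [H1 _]. rewrite dist_finite in H1.
  apply (H1 (length01 m c)). exists c; auto.
Qed.

Lemma D_le c a b : C1_curve c -> a <= b -> D (c a) (c b) <= RInt (spd c) a b.
Proof.
  intros H Hab.
  destruct (C1_reparam c (fun s => (b - a) * s + a) (fun _ => b - a)) as [H1 H2]; auto.
  - intros t. der. ringR.
  - intros; apply cconst.
  - assert (H3 := D_le01 _ H1). simpl in H3.
    replace ((b - a) * 0 + a) with a in H3 by ring. replace ((b - a) * 1 + a) with b in H3 by ring.
    eapply Rle_trans; [apply H3|]. apply Req_le.
    rewrite (RInt_ext_on _ (fun s => (b - a) * spd c ((b - a) * s + a))); [|lra|].
    + assert (E := RInt_comp_lin (spd c) (b - a) a 0 1).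
      replace ((b - a) * 0 + a) with a in E by ring. replace ((b - a) * 1 + a) with b in E by ring.
      apply E. now apply spd_int.
    + intros s _. rewrite H2, Rabs_pos_eq; auto; lra.
Qed.

Lemma D_approx p q e : 0 < e ->
  exists c, C1_curve c /\ c 0 = p /\ c 1 = q /\ RInt (spd c) 0 1 < D p q + e.
Proof.
  intros He. apply NNPP. intros Hn. destruct (dist_glb p q) as [_ H]. rewrite dist_finite in H.
  specialize (H (Finite (D p q + e))). simpl in H. assert (D p q + e <= D p q); [|lra].
  apply H. intros l [c [H1 [H2 [H3 ->]]]]. simpl. apply Rnot_lt_le. intros Hl. apply Hn.
  exists c; auto.
Qed.

Lemma D_nonneg p q : 0 <= D p q.
Proof.
  apply Rnot_lt_le; intros H. destruct (D_approx p q (- D p q)) as [c [H1 [_ [_ H2]]]]; [lra|].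
  generalize (spd_RInt_nonneg c 0 1 H1); lra.
Qed.

Lemma D_refl p : D p p = 0.
Proof.
  apply Rle_antisym; [|apply D_nonneg].
  destruct (line_connects p p) as [c [H [H0 _]]].
  assert (H1 := D_le c 0 0 H (Rle_refl 0)). rewrite RInt_point, H0 in H1. exact H1.
Qed.

Lemma D_sym_le p q : D p q <= D q p.
Proof.
  apply Rnot_lt_le; intros H. destruct (D_approx q p (D p q - D q p)) as [c [H1 [H2 [H3 H4]]]]; [lra|].
  destruct (C1_reparam c (fun s => -1 * s + 1) (fun _ => -1)) as [H5 H6]; auto.
  - intros t. der. ringR.
  - intros; apply cconst.
  - assert (H7 := D_le01 _ H5). simpl in H7.
    replace (-1 * 0 + 1) with 1 in H7 by ring. replace (-1 * 1 + 1) with 0 in H7 by ring.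
    rewrite H2, H3 in H7.
    rewrite (RInt_ext_on _ (fun s => - 1 * (-1 * spd c (-1 * s + 1)))) in H7; [|lra|].
    + rewrite (RInt_scal_R (fun s => -1 * spd c (-1 * s + 1))) in H7.
      * assert (E := RInt_comp_lin (spd c) (-1) 1 0 1).
        replace (-1 * 0 + 1) with 1 in E by ring. replace (-1 * 1 + 1) with 0 in E by ring.
        specialize (E (spd_int c 1 0 H1)). change (RInt (fun s => -1 * spd c (-1 * s + 1)) 0 1 = RInt (spd c) 1 0) in E.
        rewrite E in H7. rewrite <- (opp_RInt_swap (spd c)) in H7 by now apply spd_int.
        change (opp (RInt (spd c) 0 1)) with (- RInt (spd c) 0 1) in H7. lra.
      * apply ex_RInt_cont. intros t. apply cmult; [apply cconst|].
        apply (ccomp (spd c) (fun s => -1 * s + 1)); [cont|now apply spd_cont].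
    + intros s _. rewrite H6, Rabs_left by lra. ring.
Qed.

Lemma D_sym p q : D p q = D q p.
Proof. apply Rle_antisym; apply D_sym_le. Qed.

(* A curve made to stop at its ends can be joined to the next one by mere addition. *)
Lemma smooth_stop c a : C1_curve c ->
  C1_curve (fun t => c (smoothstep (t - a))) /\
  (forall t, t <= a -> c (smoothstep (t - a)) = c 0) /\
  (forall t, a + 1 <= t -> c (smoothstep (t - a)) = c 1) /\
  (forall t, t <= a \/ a + 1 <= t -> velocity (fun t => c (smoothstep (t - a))) t = (0, 0)) /\
  RInt (spd (fun t => c (smoothstep (t - a)))) a (a + 1) = RInt (spd c) 0 1.
Proof.
  intros H.
  assert (Hd : forall t, is_derive (fun t => smoothstep (t - a)) t (bump (t - a))).
  { intros t. eapply is_derive_eq; [apply (dcomp smoothstep (fun t => t - a)); [apply smoothstep_derive|]|].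
    - repeat der_step.
    - ringR. }
  assert (Hb : forall t, continuous (fun t => bump (t - a)) t).
  { intros t. apply (ccomp bump (fun t => t - a)); [cont|apply bump_cont]. }
  destruct (C1_reparam c _ _ H Hd Hb) as [H1 H2].
  split; [auto|split; [|split; [|split]]].
  - intros t Ht. now rewrite smoothstep_le0 by lra.
  - intros t Ht. now rewrite smoothstep_ge1 by lra.
  - intros t Ht. unfold velocity.
    assert (E : bump (t - a) = 0) by (apply bump_zero; lra).
    f_equal; apply is_derive_unique.
    + replace 0 with (bump (t - a) * Derive (cx c) (smoothstep (t - a))) by (rewrite E; ring).
      apply (dcomp (cx c) (fun t => smoothstep (t - a))); auto. now apply C1_dx.
    + replace 0 with (bump (t - a) * Derive (cy c) (smoothstep (t - a))) by (rewrite E; ring).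
      apply (dcomp (cy c) (fun t => smoothstep (t - a))); auto. now apply C1_dy.
  - rewrite (RInt_ext_on _ (fun t => bump (t - a) * spd c (smoothstep (t - a)))); [|lra|].
    + assert (E := RInt_comp (spd c) (fun t => smoothstep (t - a)) (fun t => bump (t - a)) a (a + 1)).
      cbv beta in E. rewrite (smoothstep_le0 (a - a)), (smoothstep_ge1 (a + 1 - a)) in E by lra.
      apply E; auto. intros; now apply spd_cont.
    + intros t _. rewrite H2, Rabs_pos_eq; auto. apply bump_nonneg.
Qed.

Lemma C1_join c c2 a p : C1_curve c -> C1_curve c2 -> c2 0 = p ->
  (forall t, a <= t -> c t = p) ->
  exists c', C1_curve c' /\ (forall t, t <= a -> c' t = c t) /\
    (forall t, a + 1 <= t -> c' t = c2 1) /\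
    (forall t, t < a -> spd c' t = spd c t) /\
    RInt (spd c') a (a + 1) = RInt (spd c2) 0 1.
Proof.
  intros Hc Hc2 H0 Hp. destruct (smooth_stop c2 a Hc2) as [H1 [H2 [H3 [H4 H5]]]].
  set (e := fun t => c2 (smoothstep (t - a))) in *.
  assert (H2' : forall t, t <= a -> e t = c2 0) by exact H2.
  assert (H3' : forall t, a + 1 <= t -> e t = c2 1) by exact H3.
  set (c' := fun t => (cx c t + cx e t - fst p, cy c t + cy e t - snd p) : pt).
  destruct (C1_make c' (fun t => Derive (cx c) t + Derive (cx e) t) (fun t => Derive (cy c) t + Derive (cy e) t)) as [H6 H7].
  { intros t. change (is_derive (fun t => cx c t + cx e t - fst p) t (Derive (cx c) t + Derive (cx e) t)).
    eapply is_derive_eq; [apply (dminus (fun t => cx c t + cx e t) (fun _ => fst p));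
      [apply (dplus (cx c) (cx e)); now apply C1_dx|apply dconst]|ringR]. }
  { intros t. change (is_derive (fun t => cy c t + cy e t - snd p) t (Derive (cy c) t + Derive (cy e) t)).
    eapply is_derive_eq; [apply (dminus (fun t => cy c t + cy e t) (fun _ => snd p));
      [apply (dplus (cy c) (cy e)); now apply C1_dy|apply dconst]|ringR]. }
  { intros t. apply (cplus (Derive (cx c)) (Derive (cx e))); now apply C1_cdx. }
  { intros t. apply (cplus (Derive (cy c)) (Derive (cy e))); now apply C1_cdy. }
  assert (Hle : forall t, t <= a -> c' t = c t).
  { intros t Ht. unfold c', cx, cy. rewrite (H2' t Ht), H0. rewrite (surjective_pairing (c t)) at 3.
    f_equal; simpl; ring. }
  assert (Hge : forall t, a <= t -> c' t = e t).
  { intros t Ht. unfold c', cx, cy. rewrite (Hp t Ht). rewrite (surjective_pairing (e t)) at 3.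
    f_equal; simpl; ring. }
  exists c'. split; [auto|split; [auto|split; [|split]]].
  - intros t Ht. rewrite Hge by lra. now apply H3'.
  - intros t Ht. unfold spd. rewrite H7, Hle by lra.
    specialize (H4 t (or_introl (Rlt_le _ _ Ht))). unfold velocity in H4. injection H4 as E1 E2.
    rewrite E1, E2, !Rplus_0_r. reflexivity.
  - rewrite <- H5. apply RInt_ext_on; [lra|]. intros t Ht. unfold spd. rewrite H7, Hge by lra.
    assert (E1 : Derive (cx c) t = 0).
    { apply is_derive_unique. apply (is_derive_ext_near (fun _ => fst p) _ t 0 (t - a)); [lra| |apply dconst].
      intros y Hy. apply Rabs_def2 in Hy. unfold cx. rewrite Hp; auto; lra. }
    assert (E2 : Derive (cy c) t = 0).
    { apply is_derive_unique. apply (is_derive_ext_near (fun _ => snd p) _ t 0 (t - a)); [lra| |apply dconst].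
      intros y Hy. apply Rabs_def2 in Hy. unfold cy. rewrite Hp; auto; lra. }
    rewrite E1, E2, !Rplus_0_l. reflexivity.
Qed.

(** One C1 curve visits the point [p i] at time [INR i]. Two pieces give the triangle inequality,
    many pieces follow a segment closely in [seg_approx]. *)
Lemma C1_chain (p : nat -> pt) e : 0 < e -> forall N : nat,
  exists c, C1_curve c /\ (forall t, INR N <= t -> c t = p N) /\
    (forall i, (i <= N)%nat -> c (INR i) = p i) /\
    (forall i, (i < N)%nat -> RInt (spd c) (INR i) (INR (S i)) < D (p i) (p (S i)) + e).
Proof.
  intros He N. induction N as [|N [c [H1 [H2 [H3 H4]]]]].
  - destruct (line_C1 (p 0%nat) (0, 0)) as [H _]. eexists; split; [apply H|].
    assert (E : forall t, (fst (p 0%nat) + t * fst (0, 0), snd (p 0%nat) + t * snd (0, 0)) = p 0%nat).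
    { intros t. rewrite (surjective_pairing (p 0%nat)) at 3. simpl. f_equal; ring. }
    split; [intros; apply E|split; [|intros; lia]].
    intros i Hi. replace i with 0%nat by lia. apply E.
  - destruct (D_approx (p N) (p (S N)) e He) as [c2 [H5 [H6 [H7 H8]]]].
    destruct (C1_join c c2 (INR N) (p N) H1 H5 H6 H2) as [c' [K1 [K2 [K3 [K4 K5]]]]].
    exists c'. rewrite <- S_INR in K3, K5. split; [auto|split; [|split]].
    + intros t Ht. rewrite K3; auto.
    + intros i Hi. destruct (le_lt_eq_dec i (S N) Hi) as [Hlt| ->].
      * rewrite K2 by (apply le_INR; lia). apply H3; lia.
      * rewrite K3; auto; apply Rle_refl.
    + intros i Hi. destruct (le_lt_eq_dec i N ltac:(lia)) as [Hlt| ->].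
      * rewrite (RInt_ext_on _ (spd c)); auto.
        { apply le_INR; lia. }
        intros t Ht. apply K4. apply Rlt_le_trans with (INR (S i)); [lra|apply le_INR; lia].
      * now rewrite K5.
Qed.

Lemma D_tri p q s : D p s <= D p q + D q s.
Proof.
  apply Rnot_lt_le; intros H.
  destruct (C1_chain (fun i => match i with O => p | 1%nat => q | _ => s end)
    ((D p s - (D p q + D q s)) / 2) ltac:(lra) 2) as [c [H1 [_ [H3 H4]]]].
  assert (E0 := H3 0%nat ltac:(lia)). assert (E2 := H3 2%nat ltac:(lia)).
  assert (L0 := H4 0%nat ltac:(lia)). assert (L1 := H4 1%nat ltac:(lia)). cbv beta iota in *.
  assert (H5 := D_le c (INR 0) (INR 2) H1 ltac:(simpl; lra)). rewrite E0, E2 in H5.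
  rewrite (RInt_Chasles_R (spd c) (INR 0) (INR 1) (INR 2)) in H5 by now apply spd_int.
  lra.
Qed.

(** The radius is not differentiable at the pole. It is replaced by the smooth function sqrt (rad^2
    + (e / 2)^2), which differs from it by at most e / 2 and whose derivative is still bounded by
    the speed. *)
Lemma D_rad_le c a b : C1_curve c -> a <= b -> Rabs (rad (c b) - rad (c a)) <= RInt (spd c) a b.
Proof.
  intros H Hab. apply le_epsilon. intros e He.
  set (f := fun t => sqrt (cx c t ^ 2 + cy c t ^ 2 + (e / 2) ^ 2)).
  assert (He2 : 0 < (e / 2) ^ 2) by (apply pow_lt; lra).
  assert (Hpos : forall t, 0 < cx c t ^ 2 + cy c t ^ 2 + (e / 2) ^ 2).
  { intros t. generalize (pow2_ge_0 (cx c t)) (pow2_ge_0 (cy c t)); lra. }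
  set (f1 := fun t => (cx c t * Derive (cx c) t + cy c t * Derive (cy c) t) / f t).
  assert (Hf0 : forall t, 0 < f t) by (intros; now apply sqrt_lt_R0).
  assert (Hdx := C1_dx c). assert (Hdy := C1_dy c).
  assert (Hf : forall t, is_derive f t (f1 t)).
  { intros t. unfold f, f1. der; auto. fold (f t). simpl. field. apply Rgt_not_eq, Hf0. }
  assert (Hc1 : forall t, continuous f1 t).
  { intros t. assert (X := C1_cx c t H). assert (Y := C1_cy c t H).
    assert (X' := C1_cdx c t H). assert (Y' := C1_cdy c t H).
    assert (F := continuous_of_derive _ _ _ (Hf t)). unfold f1. cont. apply Rgt_not_eq, Hf0. }
  assert (Hle : forall t, Rabs (f1 t) <= spd c t).
  { intros t. apply Rsqr_le_abs_0_alt || idtac. rewrite <- (Rabs_pos_eq (spd c t)) by apply spd_nonneg.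
    apply Rsqr_le_abs_0. unfold Rsqr. replace (spd c t * spd c t) with (spd c t ^ 2) by ring.
    rewrite spd_sqr. assert (G := gmet_radial_lower (c t) (velocity c t)).
    assert (G2 := gmet_nonneg (c t) (velocity c t)). rewrite rad_sqr in G.
    set (g := gmet m (c t) (velocity c t) (velocity c t)) in *. unfold f1.
    set (n := cx c t * Derive (cx c) t + cy c t * Derive (cy c) t).
    change (n ^ 2 <= (cx c t ^ 2 + cy c t ^ 2) * g) in G.
    assert (Hff : f t * f t = cx c t ^ 2 + cy c t ^ 2 + (e / 2) ^ 2).
    { unfold f. apply sqrt_sqrt. apply Rlt_le, Hpos. }
    replace (n / f t * (n / f t)) with (n ^ 2 / (f t * f t)) by (field; apply Rgt_not_eq, Hf0).
    rewrite Hff. apply Rle_div_l; [apply Hpos|]. nra. }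
  assert (Hr : forall t, rad (c t) <= f t <= rad (c t) + e / 2).
  { intros t. unfold f. change (sqrt (cx c t ^ 2 + cy c t ^ 2)) with (rad (c t)) in *.
    assert (E := rad_sqr (c t)). change (fst (c t)) with (cx c t) in E. change (snd (c t)) with (cy c t) in E.
    assert (G := rad_nonneg (c t)). rewrite <- E. split.
    - apply Rsqr_incr_0; auto; [|apply sqrt_pos]. rewrite Rsqr_sqrt; unfold Rsqr; nra.
    - apply Rsqr_incr_0; [|apply sqrt_pos|lra]. rewrite Rsqr_sqrt; unfold Rsqr; nra. }
  assert (K : Rabs (f b - f a) <= RInt (spd c) a b).
  { rewrite <- (RInt_derive_eq f f1 a b); auto.
    apply RInt_abs_le; auto.
    - now apply ex_RInt_cont.
    - now apply spd_int. }
  assert (Ha := Hr a). assert (Hb := Hr b).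
  apply Rabs_le_between in K. apply Rabs_le; lra.
Qed.

Lemma D_rad p q : Rabs (rad p - rad q) <= D p q.
Proof.
  apply le_epsilon. intros e He. destruct (D_approx p q e He) as [c [H1 [<- [<- H4]]]].
  assert (H := D_rad_le c 0 1 H1 ltac:(lra)). rewrite Rabs_minus_sym. lra.
Qed.

(** The straight line along a meridian attains the lower bound provided by [D_rad]. *)
Lemma D_radial (u : pt) a b : rad u = 1 -> 0 <= a -> 0 <= b ->
  D (a * fst u, a * snd u) (b * fst u, b * snd u) = Rabs (b - a).
Proof.
  intros Hu Ha Hb. assert (Eu := rad_sqr u). rewrite Hu in Eu.
  assert (Hrad : forall k, 0 <= k -> rad (k * fst u, k * snd u) = k).
  { intros k Hk. unfold rad. simpl fst; simpl snd.
    replace ((k * fst u) ^ 2 + (k * snd u) ^ 2) with (k ^ 2) by (rewrite !Rpow_mult_distr; nra).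
    now apply sqrt_pow2. }
  apply Rle_antisym.
  - destruct (line_C1 (a * fst u, a * snd u) ((b - a) * fst u, (b - a) * snd u)) as [H1 H2].
    set (c := fun t => _) in H1, H2. assert (H3 := D_le01 c H1).
    replace (c 0) with (a * fst u, a * snd u) in H3 by (unfold c; simpl; f_equal; ring).
    replace (c 1) with (b * fst u, b * snd u) in H3 by (unfold c; simpl; f_equal; ring).
    eapply Rle_trans; [apply H3|]. rewrite (RInt_ext_on _ (fun _ => Rabs (b - a))); [|lra|].
    + rewrite RInt_const_R. lra.
    + intros t _. unfold spd. rewrite H2, gmet_euclid. simpl fst; simpl snd.
      assert (E : cross (c t) ((b - a) * fst u, (b - a) * snd u) = 0) by (unfold cross, c; simpl; ring).
      rewrite E. rewrite <- (sqrt_Rsqr_abs (b - a)). f_equal. unfold Rsqr, Rdiv.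
      transitivity ((b - a) ^ 2 * (fst u ^ 2 + snd u ^ 2)); [ring|rewrite <- Eu; ring].
  - assert (H := D_rad (b * fst u, b * snd u) (a * fst u, a * snd u)). rewrite !Hrad in H by auto.
    now rewrite D_sym.
Qed.

Lemma mquot_bounds K : 0 <= K -> exists l L, 0 < l <= 1 /\ 1 <= L /\
  forall r, 0 <= r <= K -> l <= mquot r <= L.
Proof.
  intros HK.
  destruct (cont_min mquot 0 K HK (fun x _ => mquot_cont x)) as [x [Hx Hmin]].
  destruct (cont_max mquot 0 K HK (fun x _ => mquot_cont x)) as [y [Hy Hmax]].
  exists (Rmin 1 (mquot x)), (Rmax 1 (mquot y)).
  assert (0 < mquot x) by (apply mquot_pos; lra).
  split; [split; [apply Rmin_glb_lt; lra|apply Rmin_l]|split; [apply Rmax_l|]].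
  intros r Hr. split; [eapply Rle_trans; [apply Rmin_r|auto]|eapply Rle_trans; [|apply Rmax_r]; auto].
Qed.

Lemma D_upper K : 0 <= K -> exists L, 1 <= L /\ forall p q, rad p <= K -> rad q <= K ->
  D p q <= L * rad (fst q - fst p, snd q - snd p).
Proof.
  (* The coordinates of the straight line from [p] to [q] are bounded by [K], so a ball of radius 3
     [K] certainly contains it. *)
  intros HK. destruct (mquot_bounds (3 * K) ltac:(lra)) as [l [L [Hl [HL Hb]]]].
  exists L; split; auto. intros p q Hp Hq.
  destruct (line_C1 p (fst q - fst p, snd q - snd p)) as [H1 H2].
  set (v := (fst q - fst p, snd q - snd p)) in *. set (c := fun t => _) in H1, H2.
  assert (H3 := D_le01 c H1).
  replace (c 0) with p in H3 by (unfold c; rewrite (surjective_pairing p) at 1; f_equal; ring).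
  replace (c 1) with q in H3 by (unfold c, v; rewrite (surjective_pairing q) at 1; simpl; f_equal; ring).
  eapply Rle_trans; [apply H3|]. replace (L * rad v) with (RInt (fun _ => L * rad v) 0 1)
    by (rewrite RInt_const_R; ringR).
  apply RInt_le; [lra|now apply spd_int|apply ex_RInt_const|].
  intros t Ht.
  assert (Hrad : rad (c t) <= 3 * K).
  { apply Rsqr_incr_0; [|apply rad_nonneg|lra]. unfold Rsqr.
    replace (rad (c t) * rad (c t)) with (rad (c t) ^ 2) by ring. rewrite rad_sqr.
    assert (A1 := abs_fst_le p). assert (A2 := abs_snd_le p). assert (A3 := abs_fst_le q). assert (A4 := abs_snd_le q).
    apply Rabs_le_between in A1. apply Rabs_le_between in A2. apply Rabs_le_between in A3. apply Rabs_le_between in A4.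
    unfold c, v; simpl fst; simpl snd.
    assert (Hh : forall a b, - K <= a <= K -> - K <= b <= K -> (a + t * (b - a)) ^ 2 <= K ^ 2).
    { intros a b Hab Hbb. assert (- K <= a + t * (b - a) <= K) by (split; nra). nra. }
    assert (B1 := Hh (fst p) (fst q) ltac:(lra) ltac:(lra)).
    assert (B2 := Hh (snd p) (snd q) ltac:(lra) ltac:(lra)). nra. }
  unfold spd. rewrite H2. specialize (Hb (rad (c t)) (conj (rad_nonneg _) Hrad)).
  assert (G := gmet_upper (c t) v L HL (proj2 Hb)). rewrite <- rad_sqr in G.
  rewrite <- (sqrt_pow2 (L * rad v)); [|apply Rmult_le_pos; [lra|apply rad_nonneg]].
  apply sqrt_le_1_alt. now rewrite Rpow_mult_distr.
Qed.

(** Distance below 1 means that almost minimizing curves stay in the ball of radius [K + 1], where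
    [mquot] is bounded below and the metric dominates a multiple of the Euclidean one. *)
Lemma D_lower K : 0 <= K -> exists l, 0 < l /\ forall p q, rad p <= K -> D p q < 1 ->
  l * Rabs (fst q - fst p) <= D p q /\ l * Rabs (snd q - snd p) <= D p q.
Proof.
  intros HK. destruct (mquot_bounds (K + 1) ltac:(lra)) as [l [L [Hl [HL Hb]]]].
  exists l; split; [lra|]. intros p q Hp Hq.
  assert (Hgoal : forall e, 0 < e -> D p q + e < 1 ->
    l * Rabs (fst q - fst p) <= D p q + e /\ l * Rabs (snd q - snd p) <= D p q + e).
  { intros e He He1. destruct (D_approx p q e He) as [c [H1 [H2 [H3 H4]]]].
    assert (Hrad : forall t, 0 <= t <= 1 -> rad (c t) <= K + 1).
    { intros t Ht. assert (G := D_rad_le c 0 t H1 ltac:(lra)). rewrite H2 in G.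
      apply Rabs_le_between in G.
      rewrite (RInt_Chasles_R (spd c) 0 t 1) in H4 by now apply spd_int.
      assert (0 <= RInt (spd c) t 1) by (apply spd_RInt_nonneg; auto; lra). lra. }
    assert (Hv : forall t, 0 <= t <= 1 -> l * Rabs (Derive (cx c) t) <= spd c t /\ l * Rabs (Derive (cy c) t) <= spd c t).
    { intros t Ht. destruct (Hb (rad (c t)) (conj (rad_nonneg _) (Hrad t Ht))) as [B1 B2].
      assert (G := gmet_lower (c t) (velocity c t) l ltac:(lra) B1). rewrite <- spd_sqr in G.
      change (fst (velocity c t)) with (Derive (cx c) t) in G. change (snd (velocity c t)) with (Derive (cy c) t) in G.
      assert (S := spd_nonneg c t).
      rewrite <- (pow2_abs (Derive (cx c) t)), <- (pow2_abs (Derive (cy c) t)) in G.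
      assert (P1 := Rabs_pos (Derive (cx c) t)). assert (P2 := Rabs_pos (Derive (cy c) t)).
      set (a := Rabs (Derive (cx c) t)) in *. set (b := Rabs (Derive (cy c) t)) in *.
      assert (Q1 := pow2_ge_0 (l * a)). assert (Q2 := pow2_ge_0 (l * b)).
      split; apply Rsqr_incr_0; auto; unfold Rsqr; nra. }
    assert (Hi : forall f f1 : R -> R, (forall t, is_derive f t (f1 t)) -> (forall t, continuous f1 t) ->
      (forall t, 0 <= t <= 1 -> l * Rabs (f1 t) <= spd c t) -> l * Rabs (f 1 - f 0) <= D p q + e).
    { intros f f1 Hf Hc Hle. rewrite <- (RInt_derive_eq f f1 0 1) by (auto; lra).
      rewrite <- (Rabs_pos_eq l) by lra. rewrite <- Rabs_mult, <- RInt_scal_R by now apply ex_RInt_cont.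
      eapply Rle_trans; [|apply Rlt_le, H4]. apply RInt_abs_le; [lra| |now apply spd_int|].
      - apply ex_RInt_cont; intros; cont.
      - intros t Ht. rewrite Rabs_mult, (Rabs_pos_eq l) by lra. apply Hle; lra. }
    assert (X := Hi (cx c) (Derive (cx c)) (fun t => C1_dx c t H1) (fun t => C1_cdx c t H1) (fun t Ht => proj1 (Hv t Ht))).
    assert (Y := Hi (cy c) (Derive (cy c)) (fun t => C1_dy c t H1) (fun t => C1_cdy c t H1) (fun t Ht => proj2 (Hv t Ht))).
    unfold cx, cy in X, Y. rewrite H2, H3 in X, Y. auto. }
  split; apply le_epsilon; intros e He.
  - assert (G := proj1 (Hgoal (Rmin e ((1 - D p q) / 2)) ltac:(apply Rmin_glb_lt; lra)
      ltac:(generalize (Rmin_r e ((1 - D p q) / 2)); lra))). generalize (Rmin_l e ((1 - D p q) / 2)); lra.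
  - assert (G := proj2 (Hgoal (Rmin e ((1 - D p q) / 2)) ltac:(apply Rmin_glb_lt; lra)
      ltac:(generalize (Rmin_r e ((1 - D p q) / 2)); lra))). generalize (Rmin_l e ((1 - D p q) / 2)); lra.
Qed.

Lemma D_zero p q : D p q = 0 -> p = q.
Proof.
  intros H. destruct (D_lower (rad p) (rad_nonneg p)) as [l [Hl Hb]].
  destruct (Hb p q (Rle_refl _) ltac:(lra)) as [H1 H2]. rewrite H in H1, H2.
  assert (Hz : forall x, l * Rabs x <= 0 -> x = 0).
  { intros x Hx. destruct (Req_dec x 0) as [|Hn]; auto. apply Rabs_pos_lt in Hn. nra. }
  apply Hz in H1. apply Hz in H2. destruct p, q; simpl in *; f_equal; lra.
Qed.

(* The reflection of the plane in the line at angle alpha / 2, where (a, b) = (cos alpha, sin alpha). *)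
Definition refl (a b : R) (p : pt) : pt := (a * fst p + b * snd p, b * fst p - a * snd p).

Lemma refl_rad a b p : a ^ 2 + b ^ 2 = 1 -> rad (refl a b p) = rad p.
Proof.
  intros H. unfold rad, refl; simpl fst; simpl snd. f_equal.
  transitivity ((a ^ 2 + b ^ 2) * (fst p ^ 2 + snd p ^ 2)); [ring|rewrite H; ring].
Qed.
Lemma refl_refl a b p : a ^ 2 + b ^ 2 = 1 -> refl a b (refl a b p) = p.
Proof.
  intros H. destruct p as [x y]. unfold refl; simpl. apply (f_equal2 pair).
  - transitivity ((a ^ 2 + b ^ 2) * x); [ring|rewrite H; ring].
  - transitivity ((a ^ 2 + b ^ 2) * y); [ring|rewrite H; ring].
Qed.
Lemma refl_gmet a b p v : a ^ 2 + b ^ 2 = 1 ->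
  gmet m (refl a b p) (refl a b v) (refl a b v) = gmet m p v v.
Proof.
  intros H. rewrite !gmet_euclid, refl_rad by auto.
  assert (E : cross (refl a b p) (refl a b v) ^ 2 = cross p v ^ 2).
  { unfold cross, refl; simpl fst; simpl snd.
    transitivity ((a ^ 2 + b ^ 2) ^ 2 * (fst p * snd v - snd p * fst v) ^ 2); [ring|rewrite H; ring]. }
  rewrite E. f_equal. unfold refl; simpl fst; simpl snd.
  transitivity ((a ^ 2 + b ^ 2) * (fst v ^ 2 + snd v ^ 2)); [ring|rewrite H; ring].
Qed.
Lemma refl_D_le a b p q : a ^ 2 + b ^ 2 = 1 -> D (refl a b p) (refl a b q) <= D p q.
Proof.
  intros H. apply le_epsilon. intros e He. destruct (D_approx p q e He) as [c [H1 [H2 [H3 H4]]]].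
  destruct (C1_make (fun t => refl a b (c t)) (fun t => a * Derive (cx c) t + b * Derive (cy c) t)
     (fun t => b * Derive (cx c) t - a * Derive (cy c) t)) as [H5 H6].
  - intros t. change (is_derive (fun t => a * cx c t + b * cy c t) t (a * Derive (cx c) t + b * Derive (cy c) t)).
    assert (A1 := C1_dx c t H1). assert (A2 := C1_dy c t H1). der. ringR.
  - intros t. change (is_derive (fun t => b * cx c t - a * cy c t) t (b * Derive (cx c) t - a * Derive (cy c) t)).
    assert (A1 := C1_dx c t H1). assert (A2 := C1_dy c t H1). der. ringR.
  - intros t. assert (A1 := C1_cdx c t H1). assert (A2 := C1_cdy c t H1). cont.
  - intros t. assert (A1 := C1_cdx c t H1). assert (A2 := C1_cdy c t H1). cont.
  - assert (H7 := D_le01 _ H5). cbv beta in H7. rewrite H2, H3 in H7.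
    rewrite (RInt_ext_on _ (spd c)) in H7; [lra|lra|].
    intros t _. unfold spd. rewrite H6. f_equal.
    change (a * Derive (cx c) t + b * Derive (cy c) t, b * Derive (cx c) t - a * Derive (cy c) t)
      with (refl a b (velocity c t)). now apply refl_gmet.
Qed.
Lemma refl_D a b p q : a ^ 2 + b ^ 2 = 1 -> D (refl a b p) (refl a b q) = D p q.
Proof.
  intros H. apply Rle_antisym; [now apply refl_D_le|].
  rewrite <- (refl_refl a b p H) at 1. rewrite <- (refl_refl a b q H) at 1. now apply refl_D_le.
Qed.

End Metric.

(** * Segments and their smooth approximation *)

(** Minimizing curves as distance-preserving maps, without any differentiability; this is the form
    that survives ultralimits. A ray is a [seg] on every interval starting at 0. *)
Definition seg (m : R -> R) (g : curve) (a b : R) : Prop :=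
  forall s t, a <= s <= b -> a <= t <= b -> D m (g s) (g t) = Rabs (s - t).

Section Approx.
Variable m : R -> R.
Hypothesis Hm : model_fun m.
Local Notation D := (D m).
Local Notation spd := (spd m).

(** The speed may vanish, so the new parameter is the integral of [spd c + e]. It has a C1 inverse,
    the new speed spd / (spd + e) is at most 1, and the price is an extra length [e] per unit of
    time. *)
Lemma arclength c e : C1_curve c -> 0 < e ->
  exists c' S : R -> _, C1_curve c' /\ (forall u, spd c' u <= 1) /\ (forall t, c' (S t) = c t) /\
    S 0 = 0 /\ forall s t, S t - S s = RInt (spd c) s t + (t - s) * e.
Proof.
  intros Hc He.
  set (S := fun t => RInt (fun t => spd c t + e) 0 t).
  assert (Hcont : forall t, continuous (fun t => spd c t + e) t).
  { intros t. apply (cplus (spd c) (fun _ => e)); [now apply (spd_cont m Hm)|apply cconst]. }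
  assert (HS : forall t, is_derive S t (spd c t + e)).
  { intros t. apply (is_derive_RInt_cont (fun t => spd c t + e)), Hcont. }
  destruct (inverse_C1 S (fun t => spd c t + e) e He HS) as [g [Hg1 [Hg2 Hg3]]].
  { intros t. generalize (spd_nonneg m c t); lra. }
  assert (Hpos : forall t, 0 < spd c t + e) by (intros t; generalize (spd_nonneg m c t); lra).
  destruct (C1_reparam m c g (fun u => / (spd c (g u) + e)) Hc Hg3) as [H1 H2].
  { intros u. assert (continuous g u) by (eapply continuous_of_derive, Hg3).
    apply (cinv (fun u => spd c (g u) + e)); [|apply Rgt_not_eq, Hpos].
    apply (ccomp (fun t => spd c t + e) g); auto. }
  exists (fun u => c (g u)), S. split; [auto|split; [|split; [|split]]].
  - intros u. rewrite H2, Rabs_pos_eq by (left; apply Rinv_0_lt_compat, Hpos).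
    rewrite Rmult_comm. apply Rle_div_l; [apply Hpos|lra].
  - intros t. now rewrite Hg2.
  - unfold S. rewrite RInt_point. reflexivity.
  - intros s t. unfold S.
    rewrite (RInt_Chasles_R (fun t => spd c t + e) 0 s t) by (apply ex_RInt_cont, Hcont).
    rewrite (RInt_plus_R (spd c) (fun _ => e) s t); [|now apply (spd_int m Hm)|apply ex_RInt_const].
    rewrite RInt_const_R. ring.
Qed.

Lemma D_speed1 c : C1_curve c -> (forall t, spd c t <= 1) ->
  forall s t, D (c s) (c t) <= Rabs (s - t).
Proof.
  intros Hc H1.
  assert (Hle : forall s t, s <= t -> D (c s) (c t) <= t - s).
  { intros s t Hst. eapply Rle_trans; [now apply (D_le m Hm)|].
    replace (t - s) with (RInt (fun _ => 1) s t) by (rewrite RInt_const_R; ringR).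
    apply RInt_le; auto. now apply (spd_int m Hm). apply ex_RInt_const. }
  intros s t. destruct (Rle_dec s t) as [H|H].
  - rewrite Rabs_minus_sym, Rabs_pos_eq by lra. auto.
  - rewrite (D_sym m Hm), Rabs_pos_eq by lra. apply Hle; lra.
Qed.

Lemma almost_minimizing p q e : 0 < e ->
  exists c L, C1_curve c /\ (forall t, spd c t <= 1) /\ D p q <= L <= D p q + e /\ c 0 = p /\ c L = q.
Proof.
  intros He. destruct (D_approx m Hm p q (e / 2) ltac:(lra)) as [c [H1 [H2 [H3 H4]]]].
  destruct (arclength c (e / 2) H1 ltac:(lra)) as [c' [S [K1 [K2 [K3 [K4 K5]]]]]].
  assert (E := K5 0 1). rewrite K4 in E.
  assert (H0 : c' 0 = p) by (rewrite <- K4, K3; auto).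
  assert (H5 : c' (S 1) = q) by (rewrite K3; auto).
  exists c', (S 1). split; [auto|split; [auto|split; [|auto]]]. split; [|lra].
  assert (0 <= S 1) by (generalize (spd_RInt_nonneg m Hm c 0 1 H1); lra).
  rewrite <- H0, <- H5. eapply Rle_trans; [now apply D_speed1|].
  rewrite Rabs_minus_sym, Rabs_pos_eq by lra. lra.
Qed.

(** Points of [g] at spacing L / n are joined by almost minimizing curves, and the result is
    parametrized by almost arc length. The i-th point is then passed at a time that differs from i L
    / n by at most 2 i e. *)
Lemma seg_approx g L d : 0 < L -> 0 < d -> seg m g 0 L ->
  exists c M, C1_curve c /\ (forall t, spd c t <= 1) /\ L <= M <= L + d /\ c 0 = g 0 /\ c M = g L /\
    forall t, 0 <= t <= L -> D (c t) (g t) <= d.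
Proof.
  intros HL Hd Hg.
  destruct (nfloor_ex (4 * L / d)) as [N0 HN0].
  { apply Rlt_le, Rdiv_lt_0_compat; lra. }
  set (N := S N0). set (n := INR N).
  assert (Hn : 0 < n) by (apply lt_0_INR; unfold N; lia).
  assert (Hn2 : 4 * L < d * n).
  { unfold n, N. rewrite S_INR. destruct HN0 as [_ HN0]. apply Rlt_div_l in HN0; lra. }
  set (p := fun i => g (INR i * (L / n))).
  (* Each of the [n] pieces costs [e] for being almost minimizing and [e] in [arclength], altogether
     2 n e = d / 4; the choice of [n] makes the spacing L / n at most d / 4 as well. *)
  set (e := d / (8 * n)). assert (He : 0 < e) by (apply Rdiv_lt_0_compat; lra).
  assert (Ene : n * e = d / 8) by (unfold e; field; lra).
  destruct (C1_chain m Hm p e He N) as [c [H1 [_ [H3 H4]]]].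
  destruct (arclength c e H1 He) as [c' [T [K1 [K2 [K3 [K4 K5]]]]]].
  assert (HLn : 0 < L / n) by (apply Rdiv_lt_0_compat; lra).
  assert (HLn2 : n * (L / n) = L) by (field; lra).
  assert (Hin : forall i, (i <= N)%nat -> 0 <= INR i * (L / n) <= L).
  { intros i Hi. apply le_INR in Hi. fold n in Hi. assert (0 <= INR i) by apply pos_INR. nra. }
  assert (HD : forall i, (i < N)%nat -> D (p i) (p (S i)) = L / n).
  { intros i Hi. unfold p. rewrite Hg; try (apply Hin; lia).
    rewrite S_INR, Rabs_minus_sym, Rabs_pos_eq; nra. }
  assert (HT : forall i, (i <= N)%nat -> INR i * (L / n) <= T (INR i) <= INR i * (L / n + 2 * e)).
  { induction i as [|i IH]; intros Hi.
    - simpl. rewrite K4. lra.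
    - specialize (IH ltac:(lia)). specialize (H4 i ltac:(lia)). rewrite HD in H4 by lia.
      assert (E := K5 (INR i) (INR (S i))).
      assert (E0 := spd_RInt_nonneg m Hm c (INR i) (INR (S i)) H1 ltac:(apply le_INR; lia)).
      assert (F := D_speed1 c' K1 K2 (T (INR i)) (T (INR (S i)))).
      rewrite !K3, !H3, HD in F by lia. rewrite Rabs_minus_sym, Rabs_pos_eq in F by (rewrite S_INR in *; nra).
      rewrite S_INR in *. lra. }
  assert (HTN := HT N (le_n N)). fold n in HTN. rewrite Rmult_plus_distr_l, HLn2 in HTN.
  exists c', (T n). split; [auto|split; [auto|split; [|split; [|split]]]].
  - lra.
  - rewrite <- K4 at 1. rewrite K3. change 0 with (INR 0) at 1. rewrite H3 by lia.
    unfold p. simpl. f_equal; ring.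
  - rewrite K3. unfold n at 1. rewrite H3 by lia. unfold p. fold n. now rewrite HLn2.
  - intros t Ht. destruct (nfloor_ex (t / (L / n))) as [i [Hi1 Hi2]].
    { apply Rmult_le_pos; [lra|]. left; now apply Rinv_0_lt_compat. }
    apply Rle_div_r in Hi1; auto. apply Rlt_div_l in Hi2; auto.
    assert (Hi : (i <= N)%nat).
    { apply INR_le. fold n. apply (Rmult_le_reg_r (L / n)); auto. lra. }
    specialize (HT i Hi). specialize (Hin i Hi).
    apply Rle_trans with (D (c' t) (c' (T (INR i))) + D (p i) (g t)).
    + rewrite (K3 (INR i)), H3 by auto. apply (D_tri m Hm).
    + assert (F := D_speed1 c' K1 K2 t (T (INR i))).
      assert (G : D (p i) (g t) <= L / n).
      { unfold p. rewrite Hg; auto. rewrite Rabs_minus_sym, Rabs_pos_eq; lra. }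
      assert (Hie : INR i * e <= d / 8).
      { rewrite <- Ene. apply Rmult_le_compat_r; [lra|]. now apply le_INR. }
      assert (HLd : L / n <= d / 4) by (apply Rle_div_l; lra).
      assert (Rabs (t - T (INR i)) <= d / 2); [|lra].
      apply Rabs_le. lra.
Qed.

End Approx.

(** * Polar coordinates *)

Definition polar (r th : R) : pt := (r * cos th, r * sin th).

Lemma cos2_sin2 x : cos x ^ 2 + sin x ^ 2 = 1.
Proof. generalize (sin2_cos2 x). unfold Rsqr. nra. Qed.

Lemma rad_polar r th : 0 <= r -> rad (polar r th) = r.
Proof.
  intros H. unfold rad, polar; simpl fst; simpl snd.
  replace ((r * cos th) ^ 2 + (r * sin th) ^ 2) with (r ^ 2).
  - now apply sqrt_pow2.
  - transitivity (r ^ 2 * (cos th ^ 2 + sin th ^ 2)); [rewrite cos2_sin2|]; ring.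
Qed.

Section Polar.
Variable m : R -> R.

Lemma polar_curve (r th r1 th1 : R -> R) :
  (forall t, is_derive r t (r1 t)) -> (forall t, is_derive th t (th1 t)) ->
  (forall t, continuous r1 t) -> (forall t, continuous th1 t) ->
  C1_curve (fun t => polar (r t) (th t)) /\
  forall t, 0 < r t -> spd m (fun t => polar (r t) (th t)) t = sqrt (r1 t ^ 2 + m (r t) ^ 2 * th1 t ^ 2).
Proof.
  intros Hr Hth Hr1 Hth1.
  assert (Cr : forall t, continuous r t) by (intros; eapply continuous_of_derive, Hr).
  assert (Cth : forall t, continuous th t) by (intros; eapply continuous_of_derive, Hth).
  destruct (C1_make (fun t => polar (r t) (th t))
    (fun t => r1 t * cos (th t) - r t * sin (th t) * th1 t)
    (fun t => r1 t * sin (th t) + r t * cos (th t) * th1 t)) as [H1 H2].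
  - intros t. change (is_derive (fun t => r t * cos (th t)) t (r1 t * cos (th t) - r t * sin (th t) * th1 t)).
    der. ringR.
  - intros t. change (is_derive (fun t => r t * sin (th t)) t (r1 t * sin (th t) + r t * cos (th t) * th1 t)).
    der. ringR.
  - intros t. cont.
  - intros t. cont.
  - split; auto. intros t Ht. unfold spd. rewrite H2.
    assert (Hrad := rad_polar (r t) (th t) (Rlt_le _ _ Ht)).
    rewrite gmet_polar by lra. rewrite Hrad. f_equal. unfold dr, dtheta. rewrite Hrad.
    unfold polar; simpl fst; simpl snd. assert (E := cos2_sin2 (th t)).
    set (C := cos (th t)) in *. set (S := sin (th t)) in *. f_equal.
    + f_equal. transitivity (r1 t * (C ^ 2 + S ^ 2)); [field; lra|rewrite E; ring].
    + f_equal. f_equal. transitivity (th1 t * (C ^ 2 + S ^ 2)); [field; lra|rewrite E; ring].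
Qed.

(** The angle is the primitive of (x y' - y x') / r^2 starting from [th0]. Both derivatives are
    clamped outside [0, M], where the curve might meet the pole, so that the lift is defined for all
    times. *)
Lemma polar_lift c M th0 : C1_curve c -> 0 <= M -> (forall t, 0 <= t <= M -> 0 < rad (c t)) ->
  c 0 = polar (rad (c 0)) th0 ->
  exists r th r1 th1 : R -> R,
    (forall t, is_derive r t (r1 t)) /\ (forall t, is_derive th t (th1 t)) /\
    (forall t, continuous r1 t) /\ (forall t, continuous th1 t) /\ th 0 = th0 /\
    forall t, 0 <= t <= M -> c t = polar (r t) (th t) /\ r t = rad (c t) /\
      spd m c t ^ 2 = r1 t ^ 2 + m (r t) ^ 2 * th1 t ^ 2.
Proof.
  intros Hc HM Hpos H0.
  set (x := cx c). set (y := cy c). set (x1 := Derive (cx c)). set (y1 := Derive (cy c)).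
  set (rr := fun t => rad (c t)).
  assert (Dx : forall t, is_derive x t (x1 t)) by (intros; now apply C1_dx).
  assert (Dy : forall t, is_derive y t (y1 t)) by (intros; now apply C1_dy).
  assert (Cx : forall t, continuous x t) by (intros; now apply C1_cx).
  assert (Cy : forall t, continuous y t) by (intros; now apply C1_cy).
  assert (Cx1 : forall t, continuous x1 t) by (intros; now apply C1_cdx).
  assert (Cy1 : forall t, continuous y1 t) by (intros; now apply C1_cdy).
  assert (Crr : forall t, continuous rr t) by (intros; now apply rad_curve_cont).
  assert (Err : forall t, rr t ^ 2 = x t ^ 2 + y t ^ 2) by (intros; apply rad_sqr).
  set (f := fun t => (x t * x1 t + y t * y1 t) / rr t).
  set (w := fun t => (x t * y1 t - y t * x1 t) / rr t ^ 2).
  assert (Hrr : forall t, 0 <= t <= M -> is_derive rr t (f t)).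
  { intros t Ht. specialize (Hpos t Ht). fold (rr t) in Hpos.
    change (is_derive (fun t => sqrt (x t ^ 2 + y t ^ 2)) t (f t)).
    der.
    - rewrite <- Err. now apply pow_lt.
    - change (sqrt (x t ^ 2 + y t ^ 2)) with (rr t). unfold f. simpl. field. lra. }
  set (r1 := fun t => f (clamp 0 M t)). set (th1 := fun t => w (clamp 0 M t)).
  assert (Cr1 : forall t, continuous r1 t).
  { apply cont_clamp; auto. intros t Ht. specialize (Hpos t Ht). fold (rr t) in Hpos. unfold f. cont. lra. }
  assert (Cth1 : forall t, continuous th1 t).
  { apply cont_clamp; auto. intros t Ht. specialize (Hpos t Ht). fold (rr t) in Hpos. unfold w. cont.
    apply pow_nonzero; lra. }
  set (r := fun t => rr 0 + RInt r1 0 t). set (th := fun t => th0 + RInt th1 0 t).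
  assert (Dr : forall t, is_derive r t (r1 t)).
  { intros t. unfold r. eapply is_derive_eq.
    - apply (dplus (fun _ => rr 0) (fun t => RInt r1 0 t)); [apply dconst|now apply is_derive_RInt_cont].
    - ringR. }
  assert (Dth : forall t, is_derive th t (th1 t)).
  { intros t. unfold th. eapply is_derive_eq.
    - apply (dplus (fun _ => th0) (fun t => RInt th1 0 t)); [apply dconst|now apply is_derive_RInt_cont].
    - ringR. }
  assert (Er : forall t, 0 <= t <= M -> r t = rr t).
  { intros t Ht. assert (E := derive_zero (fun t => r t - rr t) 0 t (proj1 Ht)). cbv beta in E.
    assert (r 0 - rr 0 = r t - rr t).
    - apply E. intros s Hs. eapply is_derive_eq.
      + apply (dminus r rr); [apply Dr|apply Hrr; lra].
      + unfold r1. rewrite clamp_id by lra. ringR.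
    - unfold r at 1 in H. rewrite RInt_point in H. change zero with 0 in H. lra. }
  assert (Eth0 : th 0 = th0) by (unfold th; rewrite RInt_point; apply Rplus_0_r).
  exists r, th, r1, th1. repeat (split; [now auto|]). intros t Ht.
  assert (Eth : forall s, 0 <= s <= M -> th1 s = w s) by (intros; unfold th1; now rewrite clamp_id by lra).
  rewrite Er by auto.
  (* [U] and [V] express that the unit vector c / |c|, rotated back by the angle [th], does not
     move; at time 0 it is (1, 0). *)
  assert (U : (x 0 * cos (th 0) + y 0 * sin (th 0)) / rr 0 = (x t * cos (th t) + y t * sin (th t)) / rr t).
  { apply (derive_zero (fun t => (x t * cos (th t) + y t * sin (th t)) / rr t)); [lra|].
    intros s Hs. assert (Hs' : 0 <= s <= M) by lra. assert (Hd := Hrr s Hs').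
    specialize (Hpos s Hs'). fold (rr s) in Hpos. der; [lra|]. rewrite Eth by auto. unfold f, w.
    assert (E := Err s).
    transitivity ((x1 s * cos (th s) + y1 s * sin (th s)) * (rr s ^ 2 - (x s ^ 2 + y s ^ 2)) / rr s ^ 3); [field; lra|].
    rewrite E. field. lra. }
  assert (V : (- x 0 * sin (th 0) + y 0 * cos (th 0)) / rr 0 = (- x t * sin (th t) + y t * cos (th t)) / rr t).
  { apply (derive_zero (fun t => (- x t * sin (th t) + y t * cos (th t)) / rr t)); [lra|].
    intros s Hs. assert (Hs' : 0 <= s <= M) by lra. assert (Hd := Hrr s Hs').
    specialize (Hpos s Hs'). fold (rr s) in Hpos. der; [lra|]. rewrite Eth by auto. unfold f, w.
    assert (E := Err s).
    transitivity ((- x1 s * sin (th s) + y1 s * cos (th s)) * (rr s ^ 2 - (x s ^ 2 + y s ^ 2)) / rr s ^ 3); [field; lra|].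
    rewrite E. field. lra. }
  assert (P0 := Hpos 0 ltac:(lra)). assert (Pt := Hpos t Ht). fold (rr 0) in P0. fold (rr t) in Pt.
  assert (X0 : x 0 = rr 0 * cos th0) by (unfold x, cx; rewrite H0; reflexivity).
  assert (Y0 : y 0 = rr 0 * sin th0) by (unfold y, cy; rewrite H0; reflexivity).
  rewrite Eth0, X0, Y0 in U, V. assert (E0 := cos2_sin2 th0). assert (Et := cos2_sin2 (th t)).
  replace ((rr 0 * cos th0 * cos th0 + rr 0 * sin th0 * sin th0) / rr 0) with 1 in U
    by (transitivity (cos th0 ^ 2 + sin th0 ^ 2); [lra|field; lra]).
  replace ((- (rr 0 * cos th0) * sin th0 + rr 0 * sin th0 * cos th0) / rr 0) with 0 in V by (field; lra).
  assert (U' : x t * cos (th t) + y t * sin (th t) = rr t).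
  { apply (f_equal (fun z => z * rr t)) in U. unfold Rdiv in U. rewrite Rmult_assoc, Rinv_l in U by lra. lra. }
  assert (V' : - x t * sin (th t) + y t * cos (th t) = 0).
  { apply (f_equal (fun z => z * rr t)) in V. unfold Rdiv in V. rewrite Rmult_assoc, Rinv_l in V by lra. lra. }
  split; [|split; [reflexivity|]].
  - unfold polar. rewrite (surjective_pairing (c t)). fold (cx c t) (cy c t). fold x y.
    set (C := cos (th t)) in *. set (S := sin (th t)) in *.
    apply (f_equal2 pair).
    + transitivity (x t * (C ^ 2 + S ^ 2)); [rewrite Et; ring|].
      replace (rr t) with (x t * C + y t * S). replace (y t * C) with (x t * S) by lra.
      transitivity (C * (x t * C) + S * (y t * C)); [replace (y t * C) with (x t * S) by lra|]; ring.
    + transitivity (y t * (C ^ 2 + S ^ 2)); [rewrite Et; ring|].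
      replace (rr t) with (x t * C + y t * S).
      transitivity (C * (y t * C) + S * (y t * S)); [ring|]. replace (y t * C) with (x t * S) by lra. ring.
  - rewrite (spd_sqr m), gmet_polar by (fold (rr t); lra).
    unfold r1, th1. rewrite clamp_id by lra. reflexivity.
Qed.

End Polar.

(** * First variation of the energy *)

(** Cauchy-Schwarz; the factor M + 1 stands for sqrt M to avoid roots. *)
Lemma RInt_abs_small (g : R -> R) M J t : 0 <= t <= M -> 0 <= J -> (forall x, continuous g x) ->
  RInt (fun x => g x ^ 2) 0 M <= J ^ 2 -> RInt (fun x => Rabs (g x)) 0 t <= (M + 1) * J.
Proof.
  intros Ht HJ Hg HI.
  assert (E : forall a b, ex_RInt (fun x => g x ^ 2) a b) by (intros; apply ex_RInt_cont; intros; cont).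
  assert (H := RInt_sqr_le (fun x => Rabs (g x)) 0 t (proj1 Ht) ltac:(intros; cont)).
  rewrite (RInt_ext_on (fun x => Rabs (g x) ^ 2) (fun x => g x ^ 2)) in H by (try lra; intros; apply pow2_abs).
  rewrite (RInt_Chasles_R _ 0 t M) in HI by apply E.
  assert (0 <= RInt (fun x => g x ^ 2) t M) by (apply RInt_nonneg; [lra|apply E|intros; apply pow2_ge_0]).
  assert (0 <= RInt (fun x => g x ^ 2) 0 t) by (apply RInt_nonneg; [lra|apply E|intros; apply pow2_ge_0]).
  apply Rsqr_incr_0; [|apply RInt_nonneg; [lra|apply ex_RInt_cont; intros; cont|intros; apply Rabs_pos]|nra].
  unfold Rsqr. set (I := RInt (fun x => Rabs (g x)) 0 t) in *. set (I2 := RInt (fun x => g x ^ 2) 0 t) in *.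
  assert (t * I2 <= M * J ^ 2) by nra. nra.
Qed.

Section Variation.
Variable m : R -> R.
Hypothesis Hm : model_fun m.
Local Notation m1 := (Derive_n m 1).

(** Two applications of the mean value theorem, to m^2 and to its derivative 2 m m', whose own
    derivative is at most 4 K^2 in absolute value. *)
Lemma taylor_sqr x y K : (forall z, Rmin x y <= z <= Rmax x y ->
    Rabs (m z) <= K /\ Rabs (m1 z) <= K /\ Rabs (Derive_n m 2 z) <= K) ->
  m y ^ 2 <= m x ^ 2 + 2 * m x * m1 x * (y - x) + 4 * K ^ 2 * (y - x) ^ 2.
Proof.
  intros HK.
  assert (D1 := dm m Hm). assert (D2 := dm1 m Hm).
  destruct (MVT_gen (fun z => m z ^ 2) x y (fun z => 2 * m z * m1 z)) as [a [Ha E1]].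
  - intros z _. der. simpl; ringR.
  - intros z _. apply continuous_pt. assert (C := cm m Hm). cont.
  - assert (Hr : forall z, Rmin x a <= z <= Rmax x a -> Rmin x y <= z <= Rmax x y).
    { intros z Hz. revert Ha Hz. unfold Rmin, Rmax. repeat destruct Rle_dec; lra. }
    destruct (MVT_gen (fun z => 2 * m z * m1 z) x a (fun z => 2 * (m1 z * m1 z + m z * Derive_n m 2 z)))
      as [b [Hb E2]].
    + intros z _. der. ringR.
    + intros z _. apply continuous_pt. assert (C := cm m Hm). assert (C1 := cm1 m Hm). cont.
    + destruct (HK b (Hr b Hb)) as [B1 [B2 B3]].
      assert (HB : Rabs (2 * (m1 b * m1 b + m b * Derive_n m 2 b)) <= 4 * K ^ 2).
      { rewrite Rabs_mult, Rabs_pos_eq by lra.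
        assert (Rabs (m1 b * m1 b + m b * Derive_n m 2 b) <= 2 * K ^ 2); [|lra].
        eapply Rle_trans; [apply Rabs_triang|]. rewrite !Rabs_mult.
        assert (P1 := Rabs_pos (m b)). assert (P2 := Rabs_pos (m1 b)). assert (P3 := Rabs_pos (Derive_n m 2 b)).
        assert (Rabs (m1 b) * Rabs (m1 b) <= K * K) by (apply Rmult_le_compat; auto).
        assert (Rabs (m b) * Rabs (Derive_n m 2 b) <= K * K) by (apply Rmult_le_compat; auto). lra. }
      set (Q := 2 * (m1 b * m1 b + m b * Derive_n m 2 b)) in *.
      assert (E3 : m y ^ 2 = m x ^ 2 + 2 * m x * m1 x * (y - x) + Q * (a - x) * (y - x)).
      { cbv beta in E1, E2. fold Q in E2.
        replace (m y ^ 2) with (m x ^ 2 + 2 * m a * m1 a * (y - x)) by lra.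
        replace (2 * m a * m1 a) with (2 * m x * m1 x + Q * (a - x)) by lra. ring. }
      rewrite E3. assert (Q * (a - x) * (y - x) <= 4 * K ^ 2 * (y - x) ^ 2); [|lra].
      assert (Hax : 0 <= (a - x) * (y - x) <= (y - x) ^ 2).
      { revert Ha. unfold Rmin, Rmax. destruct Rle_dec; nra. }
      apply Rabs_le_between in HB. rewrite Rmult_assoc. nra.
Qed.

(** The curve itself has energy at most [M], and no variation with fixed ends brings it below M - 2
    e^2. In the manner of du Bois-Reymond, the variation is a small multiple of the defect of an
    equation of motion; it lowers the energy by a multiple of the integral of the squared defect,
    which is therefore O(e^2). In the conclusion [k] approximates the angular momentum, and the
    double integral of m'/m^3 times k^2 is the contribution of the radial acceleration. *)
Lemma euler_lagrange A B Lmax : 0 < A -> A <= B -> 0 < Lmax ->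
  exists C, 0 < C /\ forall M e (r th r1 th1 : R -> R), 0 < M <= Lmax -> 0 < e <= 1 ->
    (forall t, is_derive r t (r1 t)) -> (forall t, is_derive th t (th1 t)) ->
    (forall t, continuous r1 t) -> (forall t, continuous th1 t) ->
    (forall t, 0 <= t <= M -> A <= r t <= B) ->
    (forall t, 0 <= t <= M -> r1 t ^ 2 + m (r t) ^ 2 * th1 t ^ 2 <= 1) ->
    (forall psi phi psi1 phi1 : R -> R,
      (forall t, is_derive psi t (psi1 t)) -> (forall t, is_derive phi t (phi1 t)) ->
      (forall t, continuous psi1 t) -> (forall t, continuous phi1 t) ->
      psi 0 = 0 -> psi M = 0 -> phi 0 = 0 -> phi M = 0 ->
      (forall t, 0 <= t <= M -> 0 < r t + psi t) ->
      M - 2 * e ^ 2 <= RInt (fun t => (r1 t + psi1 t) ^ 2 + m (r t + psi t) ^ 2 * (th1 t + phi1 t) ^ 2) 0 M) ->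
    exists k k2, Rabs k <= C /\ Rabs k2 <= C /\ forall t, 0 <= t <= M ->
      Rabs (th t - th 0 - k * RInt (fun s => / m (r s) ^ 2) 0 t) <= C * e /\
      Rabs (r t - r 0 - k2 * t - k ^ 2 * RInt (fun s => RInt (fun u => m1 (r u) / m (r u) ^ 3) 0 s) 0 t) <= C * e.
Proof.
  intros HA HAB HL.
  assert (Cm := cm m Hm). assert (Cm1 := cm1 m Hm). assert (Cm2 := cm2 m Hm).
  destruct (cont_min m (A / 2) (B + 1) ltac:(lra) (fun x _ => Cm x)) as [x0 [Hx0 Hmin]].
  set (mu := Rmin 1 (m x0)).
  assert (Hmu : 0 < mu) by (apply Rmin_glb_lt; [lra|apply (m_pos m Hm); lra]).
  assert (Hmu1 : mu <= 1) by apply Rmin_l.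
  assert (Hmmu : forall x, A / 2 <= x <= B + 1 -> mu <= m x).
  { intros x Hx. eapply Rle_trans; [apply Rmin_r|]. now apply Hmin. }
  destruct (cont_bounded m (A / 2) (B + 1) ltac:(lra) (fun x _ => Cm x)) as [K0 [HK0 HK0']].
  destruct (cont_bounded m1 (A / 2) (B + 1) ltac:(lra) (fun x _ => Cm1 x)) as [K1 [HK1 HK1']].
  destruct (cont_bounded (Derive_n m 2) (A / 2) (B + 1) ltac:(lra) (fun x _ => Cm2 x)) as [K2 [HK2 HK2']].
  set (K := K0 + K1 + K2 + 1).
  assert (HKpos : 1 <= K) by (unfold K; lra).
  assert (HK : forall x, A / 2 <= x <= B + 1 -> Rabs (m x) <= K /\ Rabs (m1 x) <= K /\ Rabs (Derive_n m 2 x) <= K).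
  { intros x Hx. specialize (HK0' x Hx). specialize (HK1' x Hx). specialize (HK2' x Hx). unfold K; repeat split; lra. }
  clearbody K mu. clear K0 K1 K2 HK0 HK1 HK2 HK0' HK1' HK2' Hmin Hx0.
  (* [H0] will bound the primitive [H] of the radial force and [G0] the radial defect [G]; q - 1
     measures the second-order remainder of m^2 relative to s^2 times the integral of G^2. *)
  set (H0 := Lmax * (K * K / mu ^ 2)). set (G0 := 2 * (1 + H0)).
  set (q := 1 + 4 * K ^ 2 / mu ^ 2 * Lmax ^ 2).
  assert (Hmu2 : 0 < mu ^ 2) by now apply pow_lt.
  assert (HH0 : 0 <= H0).
  { unfold H0. apply Rmult_le_pos; [lra|]. apply Rdiv_le_0_compat; auto. nra. }
  assert (HG0 : 0 < G0) by (unfold G0; lra).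
  assert (Hq : 1 <= q).
  { unfold q. assert (0 <= 4 * K ^ 2 / mu ^ 2 * Lmax ^ 2); [|lra].
    apply Rmult_le_pos; [|apply pow2_ge_0]. apply Rdiv_le_0_compat; auto. generalize (pow2_ge_0 K); lra. }
  set (eta := Rmin (A / 2) 1). assert (Heta : 0 < eta) by (apply Rmin_glb_lt; lra).
  (* The size of the radial variation: s q <= 1 lets the first-order gain 2 s outweigh the
     second-order loss s^2 q, and s Lmax G0 <= eta keeps r + psi between A / 2 and B + 1. *)
  set (s := Rmin (/ q) (eta / (Lmax * G0))).
  assert (Hs : 0 < s).
  { apply Rmin_glb_lt; [apply Rinv_0_lt_compat; lra|]. apply Rdiv_lt_0_compat; auto. now apply Rmult_lt_0_compat. }
  assert (Hsq : s * q <= 1).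
  { apply Rle_trans with (/ q * q); [apply Rmult_le_compat_r; [lra|apply Rmin_l]|]. rewrite Rinv_l; lra. }
  assert (Hseta : s * (Lmax * G0) <= eta).
  { apply Rle_trans with (eta / (Lmax * G0) * (Lmax * G0)).
    - apply Rmult_le_compat_r; [|apply Rmin_r]. apply Rmult_le_pos; lra.
    - apply Req_le. field. split; lra. }
  set (J1 := 2 * K). set (J2 := 2 / s + 2).
  assert (HJ2 : 2 / s <= J2 ^ 2 /\ 0 <= J2).
  { assert (0 < 2 / s) by (apply Rdiv_lt_0_compat; lra). unfold J2. split; nra. }
  set (N := Lmax + 1).
  set (Ca := / mu ^ 2 * (N * J1)).
  set (Cb := N * J2 + Lmax * (K / mu ^ 3 * (2 * K * (N * J1) + J1 ^ 2))).
  assert (Hmu3 : 0 < mu ^ 3) by now apply pow_lt.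
  assert (HJ1 : 0 <= J1) by (unfold J1; lra).
  assert (HKm : 0 <= K / mu ^ 3) by (apply Rdiv_le_0_compat; lra).
  assert (HCa : 0 <= Ca).
  { apply Rmult_le_pos; [left; now apply Rinv_0_lt_compat|]. apply Rmult_le_pos; unfold N; lra. }
  assert (HNJ : 0 <= N * J1) by (apply Rmult_le_pos; unfold N; lra).
  assert (HCb0 : 0 <= K / mu ^ 3 * (2 * K * (N * J1) + J1 ^ 2)).
  { apply Rmult_le_pos; auto. generalize (pow2_ge_0 J1); nra. }
  assert (HCb : 0 <= Cb).
  { unfold Cb. apply Rplus_le_le_0_compat; apply Rmult_le_pos; [unfold N; lra|exact (proj2 HJ2)|lra|exact HCb0]. }
  exists (K + (1 + H0) + Ca + Cb). split; [lra|].
  intros M e r th r1 th1 HM He Dr Dth Cr1 Cth1 HAr Hsp Hmin.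
  assert (Cr : forall t, continuous r t) by (intros; eapply continuous_of_derive, Dr).
  assert (Cmr : forall t, continuous (fun t => m (r t)) t) by (intros; apply (ccomp m r); auto).
  assert (Cm1r : forall t, continuous (fun t => m1 (r t)) t) by (intros; apply (ccomp m1 r); auto).
  assert (Hmr : forall t, 0 <= t <= M -> mu <= m (r t) <= K /\ Rabs (m1 (r t)) <= K).
  { intros t Ht. specialize (HAr t Ht). destruct (HK (r t) ltac:(lra)) as [B1 [B2 _]].
    specialize (Hmmu (r t) ltac:(lra)). rewrite Rabs_pos_eq in B1 by lra. repeat split; lra. }
  assert (Hth1b : forall t, 0 <= t <= M -> (m (r t) * th1 t) ^ 2 <= 1).
  { intros t Ht. specialize (Hsp t Ht). generalize (pow2_ge_0 (r1 t)). rewrite Rpow_mult_distr. lra. }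
  assert (Hth1c : forall t, 0 <= t <= M -> th1 t ^ 2 <= / mu ^ 2).
  { intros t Ht. specialize (Hth1b t Ht). destruct (Hmr t Ht) as [[B1 _] _]. rewrite Rpow_mult_distr in Hth1b.
    assert (mu ^ 2 <= m (r t) ^ 2) by (apply pow_incr; lra).
    apply (Rmult_le_reg_r (mu ^ 2)); auto. rewrite Rinv_l by lra. generalize (pow2_ge_0 (th1 t)); nra. }
  set (P := fun t => m (r t) ^ 2 * th1 t).
  assert (CP : forall t, continuous P t) by (intros; unfold P; cont).
  (* [P] is the angular momentum. Subtracting its mean gives the defect [g] a primitive that
     vanishes at both ends, as an admissible variation must. *)
  set (k := / M * RInt P 0 M).
  set (g := fun t => P t - k).
  assert (Cg : forall t, continuous g t) by (intros; unfold g; cont).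
  assert (Ig : RInt g 0 M = 0).
  { unfold g. rewrite (RInt_minus_R P (fun _ => k)), RInt_const_R; try (apply ex_RInt_cont; intros; cont).
    unfold k. fieldR. lra. }
  assert (Hk : Rabs k <= K).
  { unfold k. rewrite Rabs_mult, Rabs_pos_eq by (left; apply Rinv_0_lt_compat; lra).
    apply (Rmult_le_reg_l M); [lra|]. rewrite <- Rmult_assoc, Rinv_r, Rmult_1_l by lra.
    replace (M * K) with (RInt (fun _ => K) 0 M) by (rewrite RInt_const_R; ringR).
    apply RInt_abs_le; [lra|now apply ex_RInt_cont|apply ex_RInt_const|].
    intros t Ht. specialize (Hth1b t ltac:(lra)). destruct (Hmr t ltac:(lra)) as [[B1 B2] _].
    unfold P. replace (m (r t) ^ 2 * th1 t) with (m (r t) * (m (r t) * th1 t)) by ring.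
    rewrite Rabs_mult, Rabs_pos_eq by lra.
    assert (Rabs (m (r t) * th1 t) <= 1).
    { apply Rsqr_incr_0; [|apply Rabs_pos|lra]. rewrite <- Rsqr_abs. unfold Rsqr. lra. }
    generalize (Rabs_pos (m (r t) * th1 t)). nra. }
  assert (HK2 : 0 < K ^ 2) by (apply pow_lt; lra).
  (* the angular variation phi' = - g / K^2 *)
  assert (I1 : RInt (fun t => g t ^ 2) 0 M <= (J1 * e) ^ 2).
  { set (phi1 := fun t => - / K ^ 2 * g t). set (phi := (fun t => RInt phi1 0 t) : R -> R).
    assert (Cphi1 : forall t, continuous phi1 t) by (intros; unfold phi1; cont).
    assert (Hv := Hmin (fun _ => 0) phi (fun _ => 0) phi1 ltac:(intros; apply dconst)
      ltac:(intros; now apply is_derive_RInt_cont) ltac:(intros; apply cconst) Cphi1 eq_refl eq_refl).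
    assert (E0 : phi 0 = 0) by (unfold phi; now rewrite RInt_point).
    assert (EM : phi M = 0).
    { unfold phi, phi1. rewrite (RInt_scal_R g), Ig by now apply ex_RInt_cont. ringR. }
    specialize (Hv E0 EM ltac:(intros t Ht; specialize (HAr t Ht); lra)).
    assert (Hle : RInt (fun t => (r1 t + 0) ^ 2 + m (r t + 0) ^ 2 * (th1 t + phi1 t) ^ 2) 0 M <=
       RInt (fun t => 1 - / K ^ 2 * g t ^ 2 - 2 * k * / K ^ 2 * g t) 0 M).
    { apply RInt_le; [lra| | |].
      - apply ex_RInt_cont. intros t. cont. apply (ccomp m (fun t => r t + 0)); [cont|auto].
      - apply ex_RInt_cont. intros; cont.
      - intros t Ht. rewrite !Rplus_0_r. assert (Ht' : 0 <= t <= M) by lra.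
        specialize (Hsp t Ht'). destruct (Hmr t Ht') as [[B1 B2] _].
        unfold phi1. assert (Eg : m (r t) ^ 2 * th1 t = g t + k) by (unfold g, P; ring).
        assert (Hg2 : m (r t) ^ 2 * (/ K ^ 2 * g t) ^ 2 <= / K ^ 2 * g t ^ 2).
        { replace (m (r t) ^ 2 * (/ K ^ 2 * g t) ^ 2) with ((m (r t) ^ 2 * / K ^ 2) * (/ K ^ 2 * g t ^ 2)) by ring.
          assert (m (r t) ^ 2 * / K ^ 2 <= 1).
          { apply (Rmult_le_reg_r (K ^ 2)); auto. rewrite Rmult_assoc, Rinv_l, Rmult_1_l, Rmult_1_r by lra.
            apply pow_incr; lra. }
          assert (0 <= / K ^ 2 * g t ^ 2) by (apply Rmult_le_pos; [left; now apply Rinv_0_lt_compat|apply pow2_ge_0]).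
          nra. }
        replace (r1 t ^ 2 + m (r t) ^ 2 * (th1 t + - / K ^ 2 * g t) ^ 2) with
          ((r1 t ^ 2 + m (r t) ^ 2 * th1 t ^ 2) - 2 * / K ^ 2 * g t * (m (r t) ^ 2 * th1 t)
            + m (r t) ^ 2 * (/ K ^ 2 * g t) ^ 2) by ring.
        rewrite Eg. lra. }
    rewrite (RInt_minus_R (fun t => 1 - / K ^ 2 * g t ^ 2) (fun t => 2 * k * / K ^ 2 * g t)),
      (RInt_minus_R (fun _ => 1) (fun t => / K ^ 2 * g t ^ 2)), RInt_const_R, (RInt_scal_R g), Ig,
      (RInt_scal_R (fun t => g t ^ 2)) in Hle by (apply ex_RInt_cont; intros; cont).
    assert (Hf : / K ^ 2 * RInt (fun t => g t ^ 2) 0 M <= 2 * e ^ 2) by lra.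
    apply (Rmult_le_compat_l (K ^ 2)) in Hf; [|lra].
    rewrite <- Rmult_assoc, Rinv_r, Rmult_1_l in Hf by lra. unfold J1. nra. }
  (* [h] is the radial acceleration prescribed by the geodesic equation; for a solution r' minus its
     primitive [H] would be constant, and [G] is the deviation from the mean. *)
  set (h := fun t => m (r t) * m1 (r t) * th1 t ^ 2).
  assert (Ch : forall t, continuous h t) by (intros; unfold h; cont).
  set (H := (fun t => RInt h 0 t) : R -> R).
  assert (DH : forall t, is_derive H t (h t)) by (intros; now apply is_derive_RInt_cont).
  assert (CH : forall t, continuous H t) by (intros; eapply continuous_of_derive, DH).
  assert (HhB : forall t, 0 <= t <= M -> Rabs (h t) <= K * K / mu ^ 2).
  { intros t Ht. specialize (Hth1c t Ht). destruct (Hmr t Ht) as [[B1 B2] B3].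
    unfold h. rewrite !Rabs_mult, (Rabs_pos_eq (m (r t))), (Rabs_pos_eq (th1 t ^ 2)) by (lra || apply pow2_ge_0).
    unfold Rdiv. apply Rmult_le_compat; auto; [|apply pow2_ge_0|].
    - apply Rmult_le_pos; [lra|apply Rabs_pos].
    - apply Rmult_le_compat; try lra. apply Rabs_pos. }
  assert (HHB : forall t, 0 <= t <= M -> Rabs (H t) <= H0).
  { intros t Ht. assert (E := derive_bound H h 0 t (K * K / mu ^ 2) (proj1 Ht) (fun x _ => DH x)
      ltac:(intros x Hx; apply HhB; lra)).
    assert (E0 : H 0 = 0) by (unfold H; now rewrite RInt_point). rewrite E0, Rminus_0_r in E.
    eapply Rle_trans; [apply E|]. unfold H0. rewrite Rmult_comm. apply Rmult_le_compat_r; [|lra].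
    apply Rdiv_le_0_compat; nra. }
  set (Q := fun t => r1 t - H t).
  assert (CQ : forall t, continuous Q t) by (intros; unfold Q; cont).
  assert (HQB : forall t, 0 <= t <= M -> Rabs (Q t) <= 1 + H0).
  { intros t Ht. specialize (HHB t Ht). specialize (Hsp t Ht). unfold Q.
    assert (Rabs (r1 t) <= 1).
    { apply Rsqr_incr_0; [|apply Rabs_pos|lra]. rewrite <- Rsqr_abs. unfold Rsqr.
      assert (0 <= m (r t) ^ 2 * th1 t ^ 2) by (apply Rmult_le_pos; apply pow2_ge_0). lra. }
    generalize (Rabs_triang (r1 t) (- H t)). rewrite Rabs_Ropp. unfold Rminus. lra. }
  set (k2 := / M * RInt Q 0 M). set (G := fun t => Q t - k2).
  assert (CG : forall t, continuous G t) by (intros; unfold G; cont).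
  assert (IG : RInt G 0 M = 0).
  { unfold G. rewrite (RInt_minus_R Q (fun _ => k2)), RInt_const_R; try (apply ex_RInt_cont; intros; cont).
    unfold k2. fieldR. lra. }
  assert (Hk2 : Rabs k2 <= 1 + H0).
  { unfold k2. rewrite Rabs_mult, Rabs_pos_eq by (left; apply Rinv_0_lt_compat; lra).
    apply (Rmult_le_reg_l M); [lra|]. rewrite <- Rmult_assoc, Rinv_r, Rmult_1_l by lra.
    replace (M * (1 + H0)) with (RInt (fun _ => 1 + H0) 0 M) by (rewrite RInt_const_R; ringR).
    apply RInt_abs_le; [lra|now apply ex_RInt_cont|apply ex_RInt_const|].
    intros t Ht. apply HQB; lra. }
  assert (HGB : forall t, 0 <= t <= M -> Rabs (G t) <= G0).
  { intros t Ht. specialize (HQB t Ht). unfold G, G0. generalize (Rabs_triang (Q t) (- k2)).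
    rewrite Rabs_Ropp. unfold Rminus. lra. }
  set (I := RInt (fun t => G t ^ 2) 0 M).
  assert (HI0 : 0 <= I) by (apply RInt_nonneg; [lra|apply ex_RInt_cont; intros; cont|intros; apply pow2_ge_0]).
  (* the radial variation psi' = - s G *)
  assert (I2 : I <= (J2 * e) ^ 2).
  { set (psi1 := fun t => - s * G t). set (psi := (fun t => RInt psi1 0 t) : R -> R).
    assert (Cpsi1 : forall t, continuous psi1 t) by (intros; unfold psi1; cont).
    assert (Dpsi : forall t, is_derive psi t (psi1 t)) by (intros; now apply is_derive_RInt_cont).
    assert (Cpsi : forall t, continuous psi t) by (intros; eapply continuous_of_derive, Dpsi).
    assert (E0 : psi 0 = 0) by (unfold psi; now rewrite RInt_point).
    assert (EM : psi M = 0).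
    { unfold psi, psi1. rewrite (RInt_scal_R G), IG by now apply ex_RInt_cont. ringR. }
    assert (Hpsi : forall t, 0 <= t <= M -> Rabs (psi t) <= eta).
    { intros t Ht. assert (E := derive_bound psi psi1 0 t (s * G0) (proj1 Ht) (fun x _ => Dpsi x)).
      rewrite E0, Rminus_0_r in E. eapply Rle_trans; [apply E|].
      - intros x Hx. unfold psi1. rewrite Rabs_mult, Rabs_Ropp, (Rabs_pos_eq s) by lra.
        apply Rmult_le_compat_l; [lra|]. apply HGB; lra.
      - rewrite Rminus_0_r. eapply Rle_trans; [|apply Hseta]. rewrite Rmult_assoc.
        apply Rmult_le_compat_l; [lra|]. rewrite Rmult_comm. apply Rmult_le_compat_r; lra. }
    assert (Hpsi2 : forall t, 0 <= t <= M -> psi t ^ 2 <= Lmax * s ^ 2 * I).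
    { intros t Ht. assert (E := RInt_sqr_le psi1 0 t (proj1 Ht) (fun x _ => Cpsi1 x)).
      fold (psi t) in E. eapply Rle_trans; [apply E|].
      rewrite (RInt_ext_on _ (fun x => s ^ 2 * G x ^ 2)) by (try lra; intros; unfold psi1; ring).
      rewrite RInt_scal_R by (apply ex_RInt_cont; intros; cont).
      assert (EI : I = RInt (fun x => G x ^ 2) 0 t + RInt (fun x => G x ^ 2) t M)
        by (apply RInt_Chasles_R; apply ex_RInt_cont; intros; cont).
      assert (0 <= RInt (fun x => G x ^ 2) t M) by (apply RInt_nonneg; [lra|apply ex_RInt_cont; intros; cont|intros; apply pow2_ge_0]).
      assert (0 <= RInt (fun x => G x ^ 2) 0 t) by (apply RInt_nonneg; [lra|apply ex_RInt_cont; intros; cont|intros; apply pow2_ge_0]).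
      rewrite Rminus_0_r. rewrite (Rmult_assoc Lmax). apply Rmult_le_compat; try lra.
      - apply Rmult_le_pos; [apply pow2_ge_0|auto].
      - apply Rmult_le_compat_l; [apply pow2_ge_0|lra]. }
    assert (Heta1 : eta <= A / 2) by apply Rmin_l. assert (Heta2 : eta <= 1) by apply Rmin_r.
    assert (Hv := Hmin psi (fun _ => 0) psi1 (fun _ => 0) Dpsi ltac:(intros; apply dconst) Cpsi1
      ltac:(intros; apply cconst) E0 EM eq_refl eq_refl).
    specialize (Hv ltac:(intros t Ht; specialize (HAr t Ht); specialize (Hpsi t Ht); apply Rabs_le_between in Hpsi; lra)).
    set (X := 4 * K ^ 2 / mu ^ 2 * (Lmax * s ^ 2 * I)).
    assert (HX : M * X <= s ^ 2 * I * (q - 1)).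
    { unfold X, q. replace (s ^ 2 * I * (1 + 4 * K ^ 2 / mu ^ 2 * Lmax ^ 2 - 1)) with
        (Lmax * (4 * K ^ 2 / mu ^ 2 * (Lmax * s ^ 2 * I))) by (field; lra).
      apply Rmult_le_compat_r; [|lra]. apply Rmult_le_pos.
      - apply Rdiv_le_0_compat; auto. lra.
      - repeat apply Rmult_le_pos; auto; lra. }
    assert (Hle : RInt (fun t => (r1 t + psi1 t) ^ 2 + m (r t + psi t) ^ 2 * (th1 t + 0) ^ 2) 0 M <=
       RInt (fun t => (1 + X) + 2 * (h t * psi t + H t * psi1 t) - (2 * s - s ^ 2) * G t ^ 2 - 2 * s * k2 * G t) 0 M).
    { apply RInt_le; [lra| | |].
      - apply ex_RInt_cont. intros t. cont. apply (ccomp m (fun t => r t + psi t)); [cont|auto].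
      - apply ex_RInt_cont. intros; cont.
      - intros t Ht. rewrite !Rplus_0_r. assert (Ht' : 0 <= t <= M) by lra.
        specialize (Hsp t Ht'). specialize (Hpsi t Ht'). specialize (Hpsi2 t Ht').
        specialize (HAr t Ht'). specialize (Hth1c t Ht'). apply Rabs_le_between in Hpsi.
        assert (T := taylor_sqr (r t) (r t + psi t) K).
        replace (r t + psi t - r t) with (psi t) in T by ring.
        assert (T' := T ltac:(intros z Hz; apply HK; revert Hz; unfold Rmin, Rmax; repeat destruct Rle_dec; lra)).
        assert (Hsq1 : 0 <= th1 t ^ 2) by apply pow2_ge_0.
        assert (HXt : 4 * K ^ 2 * psi t ^ 2 * th1 t ^ 2 <= X).
        { unfold X. replace (4 * K ^ 2 / mu ^ 2 * (Lmax * s ^ 2 * I)) with (4 * K ^ 2 * (Lmax * s ^ 2 * I) * / mu ^ 2)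
            by (unfold Rdiv; ring).
          apply Rmult_le_compat; auto.
          - apply Rmult_le_pos; [lra|apply pow2_ge_0].
          - apply Rmult_le_compat_l; [lra|auto]. }
        assert (Er1 : r1 t = G t + H t + k2) by (unfold G, Q; ring).
        unfold psi1, h.
        replace ((r1 t + - s * G t) ^ 2) with (r1 t ^ 2 - 2 * s * r1 t * G t + s ^ 2 * G t ^ 2) by ring.
        assert (Hm2 : m (r t + psi t) ^ 2 * th1 t ^ 2 <=
          (m (r t) ^ 2 + 2 * m (r t) * m1 (r t) * psi t + 4 * K ^ 2 * psi t ^ 2) * th1 t ^ 2)
          by (apply Rmult_le_compat_r; auto).
        assert (Er2 : 2 * s * r1 t * G t = 2 * s * (G t + H t + k2) * G t) by now rewrite Er1.
        rewrite Er2. lra. }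
    (* The integrand is the derivative of H psi, which vanishes at both ends. Without it the
       first-order change of the energy is just - 2 s times the integral of G^2. *)
    assert (Ip : RInt (fun t => h t * psi t + H t * psi1 t) 0 M = 0).
    { rewrite (RInt_derive_eq (fun t => H t * psi t)); [rewrite E0, EM; ringR|lra| |].
      - intros t _. der. ringR.
      - intros t _. cont. }
    rewrite (RInt_minus_R (fun t => (1 + X) + 2 * (h t * psi t + H t * psi1 t) - (2 * s - s ^ 2) * G t ^ 2) (fun t => 2 * s * k2 * G t)),
      (RInt_minus_R (fun t => (1 + X) + 2 * (h t * psi t + H t * psi1 t)) (fun t => (2 * s - s ^ 2) * G t ^ 2)),
      (RInt_plus_R (fun _ => 1 + X) (fun t => 2 * (h t * psi t + H t * psi1 t))), RInt_const_R,
      (RInt_scal_R G), IG, (RInt_scal_R (fun t => G t ^ 2)),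
      (RInt_scal_R (fun t => h t * psi t + H t * psi1 t)), Ip in Hle by (apply ex_RInt_cont; intros; cont).
    fold I in Hle.
    assert (Hf : s * I <= 2 * e ^ 2).
    { assert (s * (s * q) * I <= s * I); [|nra].
      apply Rmult_le_compat_r; auto. rewrite <- (Rmult_1_r s) at 3. apply Rmult_le_compat_l; lra. }
    assert (HI' : I <= 2 / s * e ^ 2).
    { apply (Rmult_le_reg_l s); auto. replace (s * (2 / s * e ^ 2)) with (2 * e ^ 2) by (field; lra). lra. }
    rewrite Rpow_mult_distr. eapply Rle_trans; [apply HI'|]. apply Rmult_le_compat_r; [apply pow2_ge_0|apply HJ2]. }
  exists k, k2. split; [lra|split; [lra|]]. intros t Ht.
  assert (A1 := RInt_abs_small g M (J1 * e) t Ht ltac:(apply Rmult_le_pos; lra) Cg I1).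
  assert (A2 := RInt_abs_small G M (J2 * e) t Ht ltac:(apply Rmult_le_pos; lra) CG I2).
  assert (Hpos : forall u, 0 <= u <= M -> m (r u) <> 0) by (intros u Hu; destruct (Hmr u Hu); lra).
  assert (HN1 : forall x, 0 <= x -> (M + 1) * (x * e) <= N * x * e).
  { intros x Hx. rewrite <- Rmult_assoc. apply Rmult_le_compat_r; [lra|]. apply Rmult_le_compat_r; [lra|unfold N; lra]. }
  assert (HN1J := HN1 J1 HJ1). assert (HN2J := HN1 J2 (proj2 HJ2)).
  split.
  - replace (th t - th 0) with (RInt th1 0 t) by (apply RInt_derive_eq; auto; lra).
    assert (E1 : ex_RInt (fun s => / m (r s) ^ 2) 0 t).
    { apply ex_RInt_cont_on; [lra|]. intros u Hu. cont. apply pow_nonzero, Hpos; lra. }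
    rewrite <- RInt_scal_R by auto.
    rewrite <- (RInt_minus_R th1) by (auto using ex_RInt_cont; apply (ex_RInt_scal (fun s => / m (r s) ^ 2)); auto).
    apply Rle_trans with (RInt (fun u => / mu ^ 2 * Rabs (g u)) 0 t).
    + apply RInt_abs_le; [lra| | |].
      * apply ex_RInt_cont_on; [lra|]. intros u Hu. cont. apply pow_nonzero, Hpos; lra.
      * apply ex_RInt_cont; intros; cont.
      * intros u Hu. assert (Hu' : 0 <= u <= M) by lra. destruct (Hmr u Hu') as [[B1 B2] _].
        replace (th1 u - k * / m (r u) ^ 2) with (/ m (r u) ^ 2 * g u).
        -- rewrite Rabs_mult. apply Rmult_le_compat_r; [apply Rabs_pos|].
           rewrite Rabs_pos_eq by (left; apply Rinv_0_lt_compat, pow_lt; lra).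
           apply Rinv_le_contravar; auto. apply pow_incr; lra.
        -- unfold g, P. field. lra.
    + rewrite RInt_scal_R by (apply ex_RInt_cont; intros; cont).
      apply Rle_trans with (Ca * e); [|apply Rmult_le_compat_r; lra].
      unfold Ca. rewrite (Rmult_assoc (/ mu ^ 2)). apply Rmult_le_compat_l; [left; now apply Rinv_0_lt_compat|].
      lra.
  - replace (r t - r 0) with (RInt r1 0 t) by (apply RInt_derive_eq; auto; lra).
    set (f := fun u => m1 (r u) / m (r u) ^ 3).
    assert (Cf : forall u, 0 <= u <= M -> continuous f u).
    { intros u Hu. unfold f. cont. apply pow_nonzero, Hpos; lra. }
    set (F := (fun s => RInt f 0 s) : R -> R).
    set (fh := fun u => f (clamp 0 M u)). assert (Cfh := cont_clamp f 0 M ltac:(lra) Cf). fold fh in Cfh.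
    set (Fh := (fun s => RInt fh 0 s) : R -> R).
    assert (EF : forall u, 0 <= u <= M -> F u = Fh u).
    { intros u Hu. apply RInt_ext_on; [lra|]. intros z Hz. unfold fh. now rewrite clamp_id by lra. }
    assert (DFh : forall u, is_derive Fh u (fh u)) by (intros; now apply is_derive_RInt_cont).
    assert (CFh : forall u, continuous Fh u) by (intros; eapply continuous_of_derive, DFh).
    change (RInt (fun s0 => RInt (fun u => m1 (r u) / m (r u) ^ 3) 0 s0) 0 t) with (RInt F 0 t).
    rewrite (RInt_ext_on F Fh) by (try lra; intros; apply EF; lra).
    assert (HHF : forall u, 0 <= u <= M -> Rabs (H u - k ^ 2 * Fh u) <= K / mu ^ 3 * (2 * K * (N * J1) + J1 ^ 2) * e).
    { intros u Hu. unfold H, Fh.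
      rewrite <- (RInt_scal_R fh) by now apply ex_RInt_cont.
      rewrite <- (RInt_minus_R h) by (apply ex_RInt_cont; intros; cont).
      apply Rle_trans with (RInt (fun z => K / mu ^ 3 * (2 * K * Rabs (g z) + g z ^ 2)) 0 u).
      - apply RInt_abs_le; [lra|apply ex_RInt_cont; intros; cont|apply ex_RInt_cont; intros; cont|].
        intros z Hz. assert (Hz' : 0 <= z <= M) by lra. destruct (Hmr z Hz') as [[B1 B2] B3].
        unfold fh. rewrite clamp_id by lra. unfold f.
        (* Here h = (m'/m^3) (m^2 th')^2 is expanded with m^2 th' = k + g. *)
        replace (h z - k ^ 2 * (m1 (r z) / m (r z) ^ 3)) with (m1 (r z) / m (r z) ^ 3 * (2 * k * g z + g z ^ 2)).
        + rewrite Rabs_mult. apply Rmult_le_compat; try apply Rabs_pos.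
          * unfold Rdiv. rewrite Rabs_mult. apply Rmult_le_compat; auto; try apply Rabs_pos.
            rewrite Rabs_pos_eq by (left; apply Rinv_0_lt_compat, pow_lt; lra).
            apply Rinv_le_contravar; auto. apply pow_incr; lra.
          * eapply Rle_trans; [apply Rabs_triang|]. rewrite !Rabs_mult, (Rabs_pos_eq 2), (Rabs_pos_eq (g z ^ 2)) by (lra || apply pow2_ge_0).
            apply Rplus_le_compat_r. apply Rmult_le_compat_r; [apply Rabs_pos|lra].
        + unfold h, g, P. field. lra.
      - rewrite RInt_scal_R by (apply ex_RInt_cont; intros; cont).
        rewrite (Rmult_assoc (K / mu ^ 3)). apply Rmult_le_compat_l; auto.
        rewrite (RInt_plus_R (fun z => 2 * K * Rabs (g z)) (fun z => g z ^ 2)) by (apply ex_RInt_cont; intros; cont).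
        rewrite (RInt_scal_R (fun z => Rabs (g z))) by (apply ex_RInt_cont; intros; cont).
        assert (A1' := RInt_abs_small g M (J1 * e) u Hu ltac:(apply Rmult_le_pos; lra) Cg I1).
        assert (EI : RInt (fun z => g z ^ 2) 0 M = RInt (fun x => g x ^ 2) 0 u + RInt (fun x => g x ^ 2) u M)
          by (apply RInt_Chasles_R; apply ex_RInt_cont; intros; cont).
        assert (0 <= RInt (fun x => g x ^ 2) u M) by (apply RInt_nonneg; [lra|apply ex_RInt_cont; intros; cont|intros; apply pow2_ge_0]).
        assert (Ee : (J1 * e) ^ 2 <= J1 ^ 2 * e).
        { rewrite Rpow_mult_distr. apply Rmult_le_compat_l; [apply pow2_ge_0|nra]. }
        assert (2 * K * RInt (fun z => Rabs (g z)) 0 u <= 2 * K * (N * J1 * e)) by (apply Rmult_le_compat_l; lra).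
        lra. }
    assert (Ek2 : k2 * t = RInt (fun _ => k2) 0 t) by (rewrite RInt_const_R; ringR). rewrite Ek2.
    rewrite <- (RInt_scal_R Fh) by now apply ex_RInt_cont.
    rewrite <- (RInt_minus_R r1) by (apply ex_RInt_cont; intros; cont).
    rewrite <- (RInt_minus_R (fun x => r1 x - k2)) by (apply ex_RInt_cont; intros; cont).
    rewrite (RInt_ext_on _ (fun u => G u + (H u - k ^ 2 * Fh u))) by (try lra; intros; unfold G, Q; ring).
    rewrite (RInt_plus_R G (fun u => H u - k ^ 2 * Fh u)) by (apply ex_RInt_cont; intros; cont).
    eapply Rle_trans; [apply Rabs_triang|].
    assert (X1 : Rabs (RInt G 0 t) <= N * J2 * e).
    { eapply Rle_trans; [|apply HN2J]. eapply Rle_trans; [|apply A2].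
      apply RInt_abs_le; [lra|apply ex_RInt_cont; intros; cont|apply ex_RInt_cont; intros; cont|intros; lra]. }
    assert (X2 : Rabs (RInt (fun u => H u - k ^ 2 * Fh u) 0 t) <=
      Lmax * (K / mu ^ 3 * (2 * K * (N * J1) + J1 ^ 2)) * e).
    { apply Rle_trans with (RInt (fun _ => K / mu ^ 3 * (2 * K * (N * J1) + J1 ^ 2) * e) 0 t).
      - apply RInt_abs_le; [lra|apply ex_RInt_cont; intros; cont|apply ex_RInt_const|].
        intros u Hu. apply HHF; lra.
      - rewrite RInt_const_R, Rminus_0_r. rewrite (Rmult_assoc Lmax). apply Rmult_le_compat_r; [|lra].
        apply Rmult_le_pos; lra. }
    apply Rle_trans with (Cb * e); [unfold Cb; lra|]. apply Rmult_le_compat_r; lra.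
Qed.

End Variation.

(** * Segments away from the pole are solutions of the geodesic equations *)

(** The geodesic equations in polar coordinates: [c] is Clairaut's constant and the last clause says
    unit speed. Derivatives at the two end times are two-sided, so the functions are understood to
    be continued beyond them. *)
Definition geo (m : R -> R) (c : R) (r rho th : R -> R) (L : R) : Prop :=
  forall t, 0 <= t <= L ->
    0 < r t /\ is_derive r t (rho t) /\
    is_derive rho t (c ^ 2 * (Derive_n m 1 (r t) / m (r t) ^ 3)) /\
    is_derive th t (c * / m (r t) ^ 2) /\
    rho t ^ 2 + c ^ 2 * / m (r t) ^ 2 = 1.

Lemma cos_lip x y : Rabs (cos x - cos y) <= Rabs (x - y).
Proof.
  assert (H : forall a b, a <= b -> Rabs (cos b - cos a) <= b - a).
  { intros a b Hab. rewrite <- (Rmult_1_l (b - a)). apply (derive_bound cos (fun x => - sin x)); auto.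
    - intros; apply is_derive_cos.
    - intros. rewrite Rabs_Ropp. apply Rabs_le. generalize (SIN_bound x0); lra. }
  destruct (Rle_dec x y).
  - rewrite Rabs_minus_sym, (Rabs_minus_sym x), (Rabs_pos_eq (y - x)) by lra. auto.
  - rewrite (Rabs_pos_eq (x - y)) by lra. apply H; lra.
Qed.
Lemma sin_lip x y : Rabs (sin x - sin y) <= Rabs (x - y).
Proof.
  rewrite <- (cos_shift x), <- (cos_shift y). eapply Rle_trans; [apply cos_lip|].
  replace (PI / 2 - x - (PI / 2 - y)) with (- (x - y)) by ring. rewrite Rabs_Ropp. lra.
Qed.

Lemma C1_lipschitz_on (f f' : R -> R) a b : a <= b ->
  (forall x, a <= x <= b -> is_derive f x (f' x)) -> (forall x, a <= x <= b -> continuous f' x) ->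
  exists K, 0 < K /\ forall x y, a <= x <= b -> a <= y <= b -> Rabs (f x - f y) <= K * Rabs (x - y).
Proof.
  intros Hab Hf Hc. destruct (cont_bounded f' a b Hab Hc) as [K [HK HK']].
  exists K; split; auto.
  assert (H : forall x y, a <= x -> x <= y -> y <= b -> Rabs (f y - f x) <= K * (y - x)).
  { intros x y H1 H2 H3. apply (derive_bound f f'); auto; intros; [apply Hf|apply HK']; lra. }
  intros x y Hx Hy. destruct (Rle_dec x y).
  - rewrite Rabs_minus_sym, (Rabs_minus_sym x), (Rabs_pos_eq (y - x)) by lra. apply H; lra.
  - rewrite (Rabs_pos_eq (x - y)) by lra. apply H; lra.
Qed.

Lemma choice2 (Q : nat -> R -> R -> Prop) : (forall n, exists a b, Q n a b) ->
  exists f g, forall n, Q n (f n) (g n).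
Proof.
  intros H.
  assert (H' : forall n, exists p, Q n (fst p) (snd p)).
  { intros n. destruct (H n) as [a [b Hab]]. now exists (a, b). }
  exists (fun n => fst (proj1_sig (constructive_indefinite_description _ (H' n)))),
    (fun n => snd (proj1_sig (constructive_indefinite_description _ (H' n)))).
  intros n. exact (proj2_sig (constructive_indefinite_description _ (H' n))).
Qed.

Section Regularity.
Variable m : R -> R.
Hypothesis Hm : model_fun m.
Local Notation spd := (spd m).
Local Notation m1 := (Derive_n m 1).
Local Notation seg := (seg m).

Lemma seg_rad g L : 0 <= L -> seg g 0 L -> forall s t,
  Rabs (rad (g (clamp 0 L s)) - rad (g (clamp 0 L t))) <= 1 * Rabs (s - t).
Proof.
  intros HL Hg s t. eapply Rle_trans; [apply (D_rad m Hm)|].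
  rewrite Hg by now apply clamp_in. rewrite Rmult_1_l. apply clamp_lip.
Qed.

(** Integrates (al - r')^2 + (be / m - m th')^2 >= 0. A bound on velocities is lost in a pointwise
    limit, whereas this dual form of it involves only positions and persists. *)
Lemma energy_ineq (r th r1 th1 : R -> R) al be t : 0 <= t ->
  (forall t, is_derive r t (r1 t)) -> (forall t, is_derive th t (th1 t)) ->
  (forall t, continuous r1 t) -> (forall t, continuous th1 t) ->
  (forall s, 0 <= s <= t -> 0 < r s /\ r1 s ^ 2 + m (r s) ^ 2 * th1 s ^ 2 <= 1) ->
  al * (r t - r 0) + be * (th t - th 0) <=
    / 2 * al ^ 2 * t + / 2 * be ^ 2 * RInt (fun s => / m (r s) ^ 2) 0 t + / 2 * t.
Proof.
  intros Ht Dr Dth C1 C2 H.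
  assert (Cr : forall t, continuous r t) by (intros; eapply continuous_of_derive, Dr).
  assert (Cm := cm m Hm). assert (Cmr : forall t, continuous (fun t => m (r t)) t) by (intros; now apply (ccomp m r)).
  assert (Hp : forall s, 0 <= s <= t -> m (r s) ^ 2 <> 0).
  { intros s Hs. apply pow_nonzero, Rgt_not_eq, (m_pos m Hm). now apply H. }
  assert (Ci : forall s, 0 <= s <= t -> continuous (fun s => / m (r s) ^ 2) s) by (intros; cont; auto).
  rewrite <- (RInt_derive_eq r r1 0 t), <- (RInt_derive_eq th th1 0 t) by auto.
  replace (/ 2 * al ^ 2 * t) with (RInt (fun _ => / 2 * al ^ 2) 0 t) by (rewrite RInt_const_R; ringR).
  replace (/ 2 * t) with (RInt (fun _ => / 2) 0 t) by (rewrite RInt_const_R; ringR).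
  rewrite <- (RInt_scal_R r1), <- (RInt_scal_R th1), <- (RInt_scal_R (fun s => / m (r s) ^ 2))
    by (try (apply ex_RInt_cont_on; auto); now apply ex_RInt_cont).
  rewrite <- (RInt_plus_R (fun x => al * r1 x)) by (apply ex_RInt_cont; intros; cont).
  rewrite <- (RInt_plus_R (fun _ => / 2 * al ^ 2)), <- (RInt_plus_R (fun x => _ + _))
    by (apply ex_RInt_cont_on; auto; intros; cont; auto).
  apply RInt_le; auto.
  - apply ex_RInt_cont; intros; cont.
  - apply ex_RInt_cont_on; auto; intros; cont; auto.
  - intros s Hs. destruct (H s ltac:(lra)) as [H1 H2]. specialize (Hp s ltac:(lra)).
    assert (Hms : 0 < m (r s)) by now apply (m_pos m Hm).
    assert (X := pow2_ge_0 (al - r1 s)). assert (Y := pow2_ge_0 (be * / m (r s) - m (r s) * th1 s)).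
    replace ((be * / m (r s) - m (r s) * th1 s) ^ 2) with
      (be ^ 2 * / m (r s) ^ 2 - 2 * be * th1 s + m (r s) ^ 2 * th1 s ^ 2) in Y by (field; lra).
    lra.
Qed.

(** The curves of [seg_approx] solve the integrated equations up to O(e), with constants [k], [k2]
    that stay bounded. In an ultralimit as e tends to 0 the radius of [g] satisfies the integrated
    equations exactly, which makes it twice differentiable. Unit speed is proved separately at the
    end, from both sides. *)
Theorem seg_regular g L th0 : 0 < L -> seg g 0 L -> (forall t, 0 <= t <= L -> 0 < rad (g t)) ->
  g 0 = polar (rad (g 0)) th0 ->
  exists c r rho th, geo m c r rho th L /\ th 0 = th0 /\
    forall t, 0 <= t <= L -> g t = polar (r t) (th t).
Proof.
  intros HL Hg Hpos H0.
  set (rg := fun t => rad (g (clamp 0 L t))).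
  assert (Crg : forall t, continuous rg t).
  { intros t. apply (lipschitz_continuous _ 1). intros y. apply (seg_rad g L); auto; lra. }
  assert (Erg : forall t, 0 <= t <= L -> rg t = rad (g t)) by (intros; unfold rg; now rewrite clamp_id).
  destruct (cont_min rg 0 L ltac:(lra) (fun t _ => Crg t)) as [ta [Hta Hmin]].
  destruct (cont_max rg 0 L ltac:(lra) (fun t _ => Crg t)) as [tb [Htb Hmax]].
  set (a := rg ta) in *. set (b := rg tb) in *.
  assert (Ha : 0 < a) by (unfold a; rewrite Erg; auto).
  assert (Hab : a <= b) by (apply Hmin; auto).
  assert (Hrgab : forall t, a <= rg t <= b).
  { intros t. assert (Ht := clamp_in 0 L t ltac:(lra)).
    assert (E : rg t = rg (clamp 0 L t)) by (unfold rg; now rewrite (clamp_id 0 L (clamp 0 L t))).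
    rewrite E; auto. }
  clearbody a b. clear ta tb Hta Htb Hmin Hmax.
  (* Room for the approximating curves, whose radius differs from that of [g] by at most e <= min
     (1/2, a / 4). *)
  set (A := a / 2). set (B := b + 1).
  assert (HA : 0 < A) by (unfold A; lra). assert (HAB : A <= B) by (unfold A, B; lra).
  assert (Hmp : forall x, A <= x <= B -> 0 < m x) by (intros; apply (m_pos m Hm); lra).
  assert (Dm := dm m Hm). assert (Dm1 := dm1 m Hm). assert (Cm := cm m Hm).
  assert (Cm1 := cm1 m Hm). assert (Cm2 := cm2 m Hm).
  destruct (C1_lipschitz_on (fun x => / m x ^ 2) (fun x => - (2 * m1 x * m x) / (m x ^ 2) ^ 2) A B HAB)
    as [K1 [HK1 HK1']].
  { intros x Hx. specialize (Hmp x Hx). der; [apply pow_nonzero; lra|]. simpl; fieldR; lra. }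
  { intros x Hx. specialize (Hmp x Hx). cont. apply pow_nonzero, pow_nonzero; lra. }
  destruct (C1_lipschitz_on (fun x => m1 x / m x ^ 3)
    (fun x => (Derive_n m 2 x * m x ^ 3 - m1 x * (3 * m1 x * m x ^ 2)) / (m x ^ 3) ^ 2) A B HAB)
    as [K2 [HK2 HK2']].
  { intros x Hx. specialize (Hmp x Hx). der; [apply pow_nonzero; lra|]. simpl; fieldR; lra. }
  { intros x Hx. specialize (Hmp x Hx). cont. apply pow_nonzero, pow_nonzero; lra. }
  set (F1 := fun x => / m (clamp A B x) ^ 2).
  set (F2 := fun x => m1 (clamp A B x) / m (clamp A B x) ^ 3).
  assert (EF1 : forall x, A <= x <= B -> F1 x = / m x ^ 2) by (intros; unfold F1; now rewrite clamp_id).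
  assert (EF2 : forall x, A <= x <= B -> F2 x = m1 x / m x ^ 3) by (intros; unfold F2; now rewrite clamp_id).
  assert (CF1 : forall x, continuous F1 x).
  { apply (cont_clamp (fun x => / m x ^ 2) A B HAB). intros x Hx; specialize (Hmp x Hx). cont.
    apply pow_nonzero; lra. }
  assert (CF2 : forall x, continuous F2 x).
  { apply (cont_clamp (fun x => m1 x / m x ^ 3) A B HAB). intros x Hx; specialize (Hmp x Hx). cont.
    apply pow_nonzero; lra. }
  assert (LF1 : forall x y, Rabs (F1 x - F1 y) <= K1 * Rabs (x - y)).
  { intros x y. eapply Rle_trans; [apply HK1'; now apply clamp_in|].
    apply Rmult_le_compat_l; [lra|apply clamp_lip]. }
  assert (LF2 : forall x y, Rabs (F2 x - F2 y) <= K2 * Rabs (x - y)).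
  { intros x y. eapply Rle_trans; [apply HK2'; now apply clamp_in|].
    apply Rmult_le_compat_l; [lra|apply clamp_lip]. }
  set (I := (fun t => RInt (fun s => F1 (rg s)) 0 t) : R -> R).
  set (J := (fun t => RInt (fun s => F2 (rg s)) 0 t) : R -> R).
  set (JJ := (fun t => RInt J 0 t) : R -> R).
  assert (CF1r : forall r : R -> R, (forall t, continuous r t) -> forall t, continuous (fun s => F1 (r s)) t)
    by (intros r Hr t; now apply (ccomp F1 r)).
  assert (CF2r : forall r : R -> R, (forall t, continuous r t) -> forall t, continuous (fun s => F2 (r s)) t)
    by (intros r Hr t; now apply (ccomp F2 r)).
  assert (DI : forall t, is_derive I t (F1 (rg t))) by (intros; apply (is_derive_RInt_cont (fun s => F1 (rg s))); auto).
  assert (DJ : forall t, is_derive J t (F2 (rg t))) by (intros; apply (is_derive_RInt_cont (fun s => F2 (rg s))); auto).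
  assert (CJ : forall t, continuous J t) by (intros; eapply continuous_of_derive, DJ).
  assert (DJJ : forall t, is_derive JJ t (J t)) by (intros; apply (is_derive_RInt_cont J); auto).
  destruct (euler_lagrange m Hm A B (L + 1) HA HAB ltac:(lra)) as [C [HC HEL]].
  destruct (D_lower m Hm B ltac:(lra)) as [l [Hl HDl]].
  set (e0 := Rmin (/ 2) (a / 4)). assert (He0 : 0 < e0) by (apply Rmin_glb_lt; lra).
  assert (He0a : e0 <= / 2) by apply Rmin_l. assert (He0b : e0 <= a / 4) by apply Rmin_r.
  set (W := C * L * K1 * 2 + C). set (W1 := L * K1 * 2).
  set (W2 := C + 4 + C ^ 2 * L * L * K2 * 2). set (W3 := / l + 2 + B * W).
  assert (HW : 0 <= W) by (unfold W; apply Rplus_le_le_0_compat; [repeat apply Rmult_le_pos|]; lra).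
  assert (HB : 0 < B) by (unfold B; lra).
  (* All that is kept of an approximating curve: estimates in terms of [g], the two constants and
     [e], so that the limit requires only the convergence of [k] and [k2]. *)
  set (Q := fun e k k2 => Rabs k <= C /\ Rabs k2 <= C /\
    forall t, 0 <= t <= L ->
      Rabs (rg t - rg 0 - k2 * t - k ^ 2 * JJ t) <= W2 * e /\
      Rabs (fst (g t) - rg t * cos (th0 + k * I t)) <= W3 * e /\
      Rabs (snd (g t) - rg t * sin (th0 + k * I t)) <= W3 * e /\
      forall al be, al * (rg t - rg 0) + be * (k * I t) <=
        / 2 * al ^ 2 * t + / 2 * be ^ 2 * I t + / 2 * t + (Rabs al * 4 + Rabs be * W + / 2 * be ^ 2 * W1) * e).
  assert (key : forall e, 0 < e <= e0 -> exists k k2, Q e k k2).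
  { intros e He. assert (Hee : e ^ 2 <= e / 2) by nra. assert (Hee0 : 0 < e ^ 2) by (apply pow_lt; lra).
    destruct (seg_approx m Hm g L (e ^ 2) HL Hee0 Hg) as [c [M [Hc [Hsp [HM [Hc0 [HcM HcD]]]]]]].
    assert (Hcr : forall t, 0 <= t <= M -> Rabs (rad (c t) - rg t) <= e).
    { intros t Ht. destruct (Rle_dec t L) as [HtL|HtL].
      - rewrite Erg by lra. eapply Rle_trans; [apply (D_rad m Hm)|]. eapply Rle_trans; [apply HcD; lra|]. lra.
      - assert (E : rg t = rad (g L)).
        { unfold rg, clamp. rewrite Rmin_right, Rmax_right by lra. reflexivity. }
        rewrite E, <- HcM. eapply Rle_trans; [apply (D_rad m Hm)|].
        eapply Rle_trans; [apply (D_speed1 m Hm c Hc Hsp)|]. apply Rabs_le. lra. }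
    assert (HcAB : forall t, 0 <= t <= M -> A <= rad (c t) <= B).
    { intros t Ht. specialize (Hcr t Ht). apply Rabs_le_between in Hcr. specialize (Hrgab t). unfold A, B. lra. }
    destruct (polar_lift m c M th0 Hc ltac:(lra)) as [r [th [r1 [th1 [Dr [Dth [Cr1 [Cth1 [Eth0 Hlift]]]]]]]]].
    { intros t Ht. specialize (HcAB t Ht). lra. }
    { now rewrite Hc0. }
    assert (Cr : forall t, continuous r t) by (intros; eapply continuous_of_derive, Dr).
    assert (HrAB : forall t, 0 <= t <= M -> A <= r t <= B).
    { intros t Ht. destruct (Hlift t Ht) as [_ [E _]]. rewrite E. auto. }
    assert (Hrr : forall t, 0 <= t <= M -> Rabs (r t - rg t) <= e).
    { intros t Ht. destruct (Hlift t Ht) as [_ [E _]]. rewrite E. auto. }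
    assert (Hspr : forall t, 0 <= t <= M -> r1 t ^ 2 + m (r t) ^ 2 * th1 t ^ 2 <= 1).
    { intros t Ht. destruct (Hlift t Ht) as [_ [_ E]]. rewrite <- E. specialize (Hsp t).
      generalize (spd_nonneg m c t). nra. }
    destruct (HEL M e r th r1 th1) as [k [k2 [Hk [Hk2 HEL']]]]; auto; try lra.
    (* The varied curve still joins [g 0] to [g L], so its length is at least [L] and its energy at
       least L^2 / M by Cauchy-Schwarz; L >= M - e^2 makes this at least M - 2 e^2. *)
    { intros psi phi psi1 phi1 Dpsi Dphi Cpsi1 Cphi1 Epsi0 EpsiM Ephi0 EphiM Hp.
      assert (Cpsi : forall t, continuous psi t) by (intros; eapply continuous_of_derive, Dpsi).
      destruct (polar_curve m (fun t => r t + psi t) (fun t => th t + phi t) (fun t => r1 t + psi1 t)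
        (fun t => th1 t + phi1 t)) as [G1 G2]; try (intros; der; reflexivity); try (intros; cont).
      set (c' := fun t => _) in G1, G2.
      assert (E0 : c' 0 = g 0).
      { unfold c'. rewrite Epsi0, Ephi0, !Rplus_0_r, <- Hc0. symmetry. apply Hlift; lra. }
      assert (EM : c' M = g L).
      { unfold c'. rewrite EpsiM, EphiM, !Rplus_0_r, <- HcM. symmetry. apply Hlift; lra. }
      assert (X := D_le m Hm c' 0 M G1 ltac:(lra)). rewrite E0, EM, Hg in X by lra.
      rewrite Rabs_minus_sym, Rminus_0_r, Rabs_pos_eq in X by lra.
      assert (Y := RInt_sqr_le (spd c') 0 M ltac:(lra) (fun t _ => spd_cont m Hm c' t G1)).
      rewrite (RInt_ext_on (fun x => spd c' x ^ 2)
        (fun t => (r1 t + psi1 t) ^ 2 + m (r t + psi t) ^ 2 * (th1 t + phi1 t) ^ 2)) in Y.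
      - set (EE := RInt (fun t => _ + _) 0 M) in *. assert (L ^ 2 <= M * EE) by nra. nra.
      - lra.
      - intros t Ht. rewrite G2 by (apply Hp; lra). apply pow2_sqrt.
        apply Rplus_le_le_0_compat; [apply pow2_ge_0|apply Rmult_le_pos; apply pow2_ge_0]. }
    exists k, k2. split; [auto|split; [auto|]]. intros t Ht. assert (HtM : 0 <= t <= M) by lra.
    destruct (HEL' t HtM) as [X1 X2]. clear HEL HEL'.
    assert (Hsmall : forall (F : R -> R) K, (forall x, continuous F x) -> 0 < K ->
       (forall x y, Rabs (F x - F y) <= K * Rabs (x - y)) -> forall s, 0 <= s <= L ->
       Rabs (RInt (fun u => F (r u)) 0 s - RInt (fun u => F (rg u)) 0 s) <= L * K * e).
    { intros F K CF HK LF s Hs.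
      assert (CFr : forall f : R -> R, (forall t, continuous f t) -> forall t, continuous (fun s => F (f s)) t)
        by (intros f Hf u; now apply (ccomp F f)).
      rewrite <- (RInt_minus_R (fun u => F (r u))) by (apply ex_RInt_cont; intros; auto).
      apply Rle_trans with (RInt (fun _ => K * e) 0 s).
      - apply RInt_abs_le; [lra| |apply ex_RInt_const|].
        + assert (Y1 := CFr r Cr). assert (Y2 := CFr rg Crg). apply ex_RInt_cont; intros; cont.
        + intros u Hu. eapply Rle_trans; [apply LF|]. apply Rmult_le_compat_l; [lra|]. apply Hrr; lra.
      - rewrite RInt_const_R, Rminus_0_r, Rmult_assoc. apply Rmult_le_compat_r; [|lra]. apply Rmult_le_pos; lra. }
    assert (S1 := Hsmall F1 K1 CF1 HK1 LF1 t Ht). fold (I t) in S1.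
    assert (S2 := fun s Hs => Hsmall F2 K2 CF2 HK2 LF2 s Hs).
    rewrite (RInt_ext_on (fun s => / m (r s) ^ 2) (fun s => F1 (r s))) in X1
      by (try lra; intros; rewrite EF1; auto; apply HrAB; lra).
    set (In := RInt (fun s => F1 (r s)) 0 t) in *.
    assert (Hth : Rabs (th t - th0 - k * I t) <= W * e).
    { replace (th t - th0 - k * I t) with ((th t - th 0 - k * In) + k * (In - I t)) by (rewrite Eth0; ring).
      eapply Rle_trans; [apply Rabs_triang|]. rewrite Rabs_mult.
      assert (Rabs k * Rabs (In - I t) <= C * (L * K1 * e)) by (apply Rmult_le_compat; auto; apply Rabs_pos).
      assert (0 <= C * (L * K1 * e)) by (repeat apply Rmult_le_pos; lra).
      unfold W. lra. }
    assert (Hr0 := Hrr 0 ltac:(lra)). assert (Hrt := Hrr t HtM).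
    split; [|split; [|split]].
    - set (Jn := (fun s => RInt (fun u => F2 (r u)) 0 s) : R -> R).
      assert (DJn : forall t, is_derive Jn t (F2 (r t))) by (intros; apply (is_derive_RInt_cont (fun s => F2 (r s))); auto).
      assert (CJn : forall t, continuous Jn t) by (intros; eapply continuous_of_derive, DJn).
      rewrite (RInt_ext_on (fun s => RInt (fun u => m1 (r u) / m (r u) ^ 3) 0 s) Jn) in X2; [|lra|].
      2:{ intros s Hs. apply RInt_ext_on; [lra|]. intros u Hu. rewrite EF2; auto. apply HrAB; lra. }
      assert (S3 : Rabs (RInt Jn 0 t - JJ t) <= L * (L * K2 * e)).
      { unfold JJ. rewrite <- (RInt_minus_R Jn) by now apply ex_RInt_cont.
        apply Rle_trans with (RInt (fun _ => L * K2 * e) 0 t).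
        - apply RInt_abs_le; [lra|apply ex_RInt_cont; intros; cont|apply ex_RInt_const|].
          intros s Hs. apply S2; lra.
        - rewrite RInt_const_R, Rminus_0_r. apply Rmult_le_compat_r; [|lra]. repeat apply Rmult_le_pos; lra. }
      replace (rg t - rg 0 - k2 * t - k ^ 2 * JJ t) with ((r t - r 0 - k2 * t - k ^ 2 * RInt Jn 0 t)
        + (k ^ 2 * (RInt Jn 0 t - JJ t) + ((r 0 - rg 0) - (r t - rg t)))) by ring.
      eapply Rle_trans; [apply Rabs_triang|].
      assert (Y1 : Rabs (k ^ 2 * (RInt Jn 0 t - JJ t)) <= C ^ 2 * (L * (L * K2 * e))).
      { rewrite Rabs_mult. apply Rmult_le_compat; auto; try apply Rabs_pos.
        rewrite <- RPow_abs. apply pow_incr. split; [apply Rabs_pos|auto]. }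
      assert (Y2 : Rabs ((r 0 - rg 0) - (r t - rg t)) <= 2 * e).
      { apply Rabs_le_between in Hr0. apply Rabs_le_between in Hrt. apply Rabs_le. lra. }
      generalize (Rabs_triang (k ^ 2 * (RInt Jn 0 t - JJ t)) ((r 0 - rg 0) - (r t - rg t))).
      assert (0 <= C ^ 2 * (L * (L * K2 * e))) by (repeat apply Rmult_le_pos; lra || apply pow2_ge_0).
      unfold W2. lra.
    - destruct (Hlift t HtM) as [Ec [_ _]]. specialize (HcD t Ht).
      destruct (HDl (c t) (g t) ltac:(apply HcAB; lra) ltac:(lra)) as [Y1 _].
      assert (Hx : Rabs (fst (g t) - fst (c t)) <= / l * e).
      { apply (Rmult_le_reg_l l); auto. rewrite <- Rmult_assoc, Rinv_r, Rmult_1_l by lra. lra. }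
      rewrite Ec in Hx. unfold polar in Hx; simpl fst in Hx.
      replace (fst (g t) - rg t * cos (th0 + k * I t)) with ((fst (g t) - r t * cos (th t)) +
        ((r t - rg t) * cos (th t) + rg t * (cos (th t) - cos (th0 + k * I t)))) by ring.
      eapply Rle_trans; [apply Rabs_triang|].
      assert (Z1 : Rabs ((r t - rg t) * cos (th t)) <= e * 1).
      { rewrite Rabs_mult. apply Rmult_le_compat; auto; try apply Rabs_pos. apply Rabs_le. apply COS_bound. }
      assert (Z2 : Rabs (rg t * (cos (th t) - cos (th0 + k * I t))) <= B * (W * e)).
      { rewrite Rabs_mult. specialize (Hrgab t). apply Rmult_le_compat; try apply Rabs_pos.
        - rewrite Rabs_pos_eq; unfold B; lra.
        - eapply Rle_trans; [apply cos_lip|]. replace (th t - (th0 + k * I t)) with (th t - th0 - k * I t) by ring. auto. }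
      generalize (Rabs_triang ((r t - rg t) * cos (th t)) (rg t * (cos (th t) - cos (th0 + k * I t)))).
      unfold W3. lra.
    - destruct (Hlift t HtM) as [Ec [_ _]]. specialize (HcD t Ht).
      destruct (HDl (c t) (g t) ltac:(apply HcAB; lra) ltac:(lra)) as [_ Y1].
      assert (Hx : Rabs (snd (g t) - snd (c t)) <= / l * e).
      { apply (Rmult_le_reg_l l); auto. rewrite <- Rmult_assoc, Rinv_r, Rmult_1_l by lra. lra. }
      rewrite Ec in Hx. unfold polar in Hx; simpl snd in Hx.
      replace (snd (g t) - rg t * sin (th0 + k * I t)) with ((snd (g t) - r t * sin (th t)) +
        ((r t - rg t) * sin (th t) + rg t * (sin (th t) - sin (th0 + k * I t)))) by ring.
      eapply Rle_trans; [apply Rabs_triang|].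
      assert (Z1 : Rabs ((r t - rg t) * sin (th t)) <= e * 1).
      { rewrite Rabs_mult. apply Rmult_le_compat; auto; try apply Rabs_pos. apply Rabs_le. apply SIN_bound. }
      assert (Z2 : Rabs (rg t * (sin (th t) - sin (th0 + k * I t))) <= B * (W * e)).
      { rewrite Rabs_mult. specialize (Hrgab t). apply Rmult_le_compat; try apply Rabs_pos.
        - rewrite Rabs_pos_eq; unfold B; lra.
        - eapply Rle_trans; [apply sin_lip|]. replace (th t - (th0 + k * I t)) with (th t - th0 - k * I t) by ring. auto. }
      generalize (Rabs_triang ((r t - rg t) * sin (th t)) (rg t * (sin (th t) - sin (th0 + k * I t)))).
      unfold W3. lra.
    - intros al be.
      assert (EI := energy_ineq r th r1 th1 al be t (proj1 Ht) Dr Dth Cr1 Cth1).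
      rewrite (RInt_ext_on (fun s => / m (r s) ^ 2) (fun s => F1 (r s))) in EI
        by (try lra; intros; rewrite EF1; auto; apply HrAB; lra). fold In in EI.
      specialize (EI ltac:(intros s Hs; split; [specialize (HrAB s ltac:(lra)); lra|apply Hspr; lra])).
      rewrite Eth0 in EI.
      assert (Z1 : al * (rg t - rg 0) <= al * (r t - r 0) + Rabs al * (2 * e)).
      { replace (al * (rg t - rg 0)) with (al * (r t - r 0) + al * ((r 0 - rg 0) - (r t - rg t))) by ring.
        apply Rplus_le_compat_l. eapply Rle_trans; [apply Rle_abs|]. rewrite Rabs_mult.
        apply Rmult_le_compat_l; [apply Rabs_pos|].
        apply Rabs_le_between in Hr0. apply Rabs_le_between in Hrt. apply Rabs_le. lra. }
      assert (Z2 : be * (k * I t) <= be * (th t - th0) + Rabs be * (W * e)).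
      { replace (be * (k * I t)) with (be * (th t - th0) + - be * (th t - th0 - k * I t)) by ring.
        apply Rplus_le_compat_l. eapply Rle_trans; [apply Rle_abs|]. rewrite Rabs_mult, Rabs_Ropp.
        apply Rmult_le_compat_l; [apply Rabs_pos|auto]. }
      assert (Z3 : / 2 * be ^ 2 * In <= / 2 * be ^ 2 * I t + / 2 * be ^ 2 * (L * K1 * e)).
      { assert (In <= I t + L * K1 * e) by (apply Rabs_le_between in S1; lra).
        rewrite <- Rmult_plus_distr_l. apply Rmult_le_compat_l; auto.
        generalize (pow2_ge_0 be); lra. }
      assert (0 <= / 2 * be ^ 2 * (L * K1 * e)).
      { apply Rmult_le_pos; [generalize (pow2_ge_0 be); lra|]. repeat apply Rmult_le_pos; lra. }
      assert (0 <= Rabs al * e) by (apply Rmult_le_pos; [apply Rabs_pos|lra]).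
      unfold W1. lra. }
  clear HEL.
  destruct ex_ultra as [U HU].
  assert (Hen : forall n, 0 < e0 / INR (S n) <= e0).
  { intros n. assert (1 <= INR (S n)) by (rewrite S_INR; generalize (pos_INR n); lra).
    split; [apply Rdiv_lt_0_compat; lra|]. apply Rle_div_l; nra. }
  destruct (choice2 (fun n => Q (e0 / INR (S n))) (fun n => key _ (Hen n))) as [kk [kk2 Hkk2]].
  clear key. unfold Q in Hkk2. clear Q.
  destruct (ulim_exists U HU kk C ltac:(intros n; apply Hkk2)) as [k Hk].
  destruct (ulim_exists U HU kk2 C ltac:(intros n; apply Hkk2)) as [k2 Hk2].
  assert (Hgen := fun n => proj2 (proj2 (Hkk2 n))). clear Hkk2.
  assert (Hzero : forall (x : nat -> R) lx K, ulim U x lx ->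
    (forall n, Rabs (x n) <= K * (e0 / INR (S n))) -> lx = 0).
  { intros x lx K Hx HxK. apply (ulim_unique U HU x); auto.
    apply (ulim_inv_n U HU x 0 (K * e0)). intros n. rewrite Rminus_0_r.
    eapply Rle_trans; [apply HxK|]. right. unfold Rdiv; ring. }
  assert (Lc := ulim_const U HU).
  assert (Hrad : forall t, 0 <= t <= L -> rg t - rg 0 - k2 * t - k ^ 2 * JJ t = 0).
  { intros t Ht.
    apply (Hzero (fun n => rg t - rg 0 - kk2 n * t - kk n ^ 2 * JJ t) _ W2).
    - apply (ulim_cont U HU (fun k => rg t - rg 0 - k2 * t - k ^ 2 * JJ t)) in Hk; [|cont].
      assert (Hk2' := ulim_plus U HU _ _ _ _ Hk
        (ulim_mult U HU _ _ _ _ (ulim_plus U HU _ _ _ _ (Lc k2) (ulim_mult U HU _ _ _ _ (Lc (-1)) Hk2)) (Lc t))).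
      intros e He. refine (ultra_imp _ HU _ _ _ (Hk2' e He)). intros n Hn. cbv beta in Hn.
      eapply Rle_lt_trans; [|apply Hn]. right. f_equal. ring.
    - intros n. apply Hgen; auto. }
  assert (Hx : forall t, 0 <= t <= L -> fst (g t) - rg t * cos (th0 + k * I t) = 0).
  { intros t Ht. apply (Hzero (fun n => fst (g t) - rg t * cos (th0 + kk n * I t)) _ W3).
    - apply (ulim_cont U HU (fun k => fst (g t) - rg t * cos (th0 + k * I t))); auto. cont.
    - intros n. apply Hgen; auto. }
  assert (Hy : forall t, 0 <= t <= L -> snd (g t) - rg t * sin (th0 + k * I t) = 0).
  { intros t Ht. apply (Hzero (fun n => snd (g t) - rg t * sin (th0 + kk n * I t)) _ W3).
    - apply (ulim_cont U HU (fun k => snd (g t) - rg t * sin (th0 + k * I t))); auto. cont.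
    - intros n. apply Hgen; auto. }
  assert (Hen2 : forall t al be, 0 <= t <= L ->
     al * (rg t - rg 0) + be * (k * I t) <= / 2 * al ^ 2 * t + / 2 * be ^ 2 * I t + / 2 * t).
  { intros t al be Ht. apply le_epsilon. intros e He.
    set (V := Rabs al * 4 + Rabs be * W + / 2 * be ^ 2 * W1).
    assert (HV : ulim U (fun n => V * e0 / INR (S n)) 0).
    { apply (ulim_inv_n U HU _ 0 (Rabs (V * e0))). intros n. rewrite Rminus_0_r. unfold Rdiv. rewrite Rabs_mult.
      right. f_equal. apply Rabs_pos_eq. left; apply Rinv_0_lt_compat, lt_0_INR; lia. }
    assert (H1 : ulim U (fun n => al * (rg t - rg 0) + be * (kk n * I t)) (al * (rg t - rg 0) + be * (k * I t))).
    { apply (ulim_cont U HU (fun k => al * (rg t - rg 0) + be * (k * I t))); auto. cont. }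
    apply (ulim_le U HU _ _ _ H1). refine (ultra_imp _ HU _ _ _ (HV e He)). intros n Hn.
    rewrite Rminus_0_r in Hn. eapply Rle_trans; [apply Hgen; auto|]. apply Rplus_le_compat_l.
    fold V. replace (V * (e0 / INR (S n))) with (V * e0 / INR (S n)) by (unfold Rdiv; ring).
    eapply Rle_trans; [apply Rle_abs|lra]. }
  set (rho := fun t => k2 + k ^ 2 * J t). set (r := fun t => rg 0 + k2 * t + k ^ 2 * JJ t).
  set (th := fun t => th0 + k * I t).
  assert (Er : forall t, 0 <= t <= L -> r t = rg t) by (intros t Ht; specialize (Hrad t Ht); unfold r; lra).
  assert (HrgAB : forall t, A <= rg t <= B) by (intros t; specialize (Hrgab t); unfold A, B; lra).
  assert (Dr : forall t, is_derive r t (rho t)) by (intros t; unfold r, rho; der; ringR).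
  assert (Drho : forall t, 0 <= t <= L -> is_derive rho t (k ^ 2 * (m1 (r t) / m (r t) ^ 3))).
  { intros t Ht. rewrite Er by auto. rewrite <- EF2 by auto. unfold rho. der. ringR. }
  assert (Dth' : forall t, is_derive th t (k * F1 (rg t))) by (intros t; unfold th; der; ringR).
  assert (Dth : forall t, 0 <= t <= L -> is_derive th t (k * / m (r t) ^ 2)).
  { intros t Ht. rewrite Er by auto. rewrite <- EF1 by auto. apply Dth'. }
  assert (Hm0 : forall t, 0 <= t <= L -> 0 < m (r t)) by (intros t Ht; rewrite Er by auto; auto).
  set (E := fun t => rho t ^ 2 + k ^ 2 * / m (r t) ^ 2).
  assert (HE : forall t, 0 <= t <= L -> E t = E 0).
  { intros t Ht. symmetry. apply derive_zero; [lra|]. intros s Hs. assert (Hs' : 0 <= s <= L) by lra.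
    assert (X := Drho s Hs'). assert (Y := Dr s). specialize (Hm0 s Hs'). unfold E.
    assert (Z := dcomp m r s _ _ (Dm (r s)) Y).
    der; [apply pow_nonzero; lra|]. simpl. fieldR. lra. }
  (* For [al = rho 0] and [be = k] both sides of [Hen2] vanish at time 0, and comparing their
     derivatives there gives the bound. *)
  assert (E1 : E 0 <= 1).
  { set (Phi := fun t => / 2 * rho 0 ^ 2 * t + / 2 * k ^ 2 * I t + / 2 * t - (rho 0 * (r t - rg 0) + k * (k * I t))).
    assert (HP : 0 <= / 2 * rho 0 ^ 2 + / 2 * k ^ 2 * F1 (rg 0) + / 2 - (rho 0 * rho 0 + k * (k * F1 (rg 0)))).
    { apply (derive_right_nonneg Phi 0 L _ HL).
      - unfold Phi. assert (X := Dr 0). assert (Y := DI 0). der. ringR.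
      - intros t Ht. unfold Phi. specialize (Hen2 t (rho 0) k Ht). rewrite !Er by lra.
        unfold I at 1 2. rewrite RInt_point. change zero with 0. lra. }
    unfold E. rewrite Er, <- EF1 by (auto; lra). lra. }
  (* The curve now has constant speed sqrt (E 0) and joins two points at distance [L] in time
     [L]. *)
  assert (E2 : 1 <= E 0).
  { destruct (polar_curve m r th rho (fun t => k * F1 (rg t)) Dr Dth') as [G1 G2].
    - intros t. unfold rho. cont.
    - intros t. apply cmult; [apply cconst|auto].
    - assert (X := D_le m Hm _ 0 L G1 ltac:(lra)). cbv beta in X.
      assert (Eg : forall t, 0 <= t <= L -> polar (r t) (th t) = g t).
      { intros t Ht. specialize (Hx t Ht). specialize (Hy t Ht). unfold polar. rewrite Er by auto.
        rewrite (surjective_pairing (g t)). unfold th. f_equal; lra. }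
      rewrite !Eg, Hg in X by lra. rewrite Rabs_minus_sym, Rminus_0_r, Rabs_pos_eq in X by lra.
      rewrite (RInt_ext_on _ (fun _ => sqrt (E 0))) in X; [|lra|].
      + rewrite RInt_const_R, Rminus_0_r in X.
        assert (HE0 : 0 <= E 0).
        { apply Rplus_le_le_0_compat; [apply pow2_ge_0|]. apply Rmult_le_pos; [apply pow2_ge_0|].
          left. apply Rinv_0_lt_compat, pow_lt, Hm0; lra. }
        assert (S := sqrt_sqrt _ HE0). assert (S' := sqrt_pos (E 0)).
        assert (1 <= sqrt (E 0)) by (apply (Rmult_le_reg_l L); lra). nra.
      + intros t Ht. assert (Ht' : 0 <= t <= L) by lra. specialize (Hm0 t Ht').
        rewrite G2 by (rewrite Er by auto; specialize (HrgAB t); lra).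
        f_equal. rewrite <- (HE t Ht'). unfold E. rewrite EF1, <- Er by auto. field. lra. }
  exists k, r, rho, th. split; [|split].
  - intros t Ht. split; [rewrite Er by auto; specialize (HrgAB t); lra|].
    split; [auto|split; [auto|split; [auto|]]]. change (E t = 1). rewrite HE by auto. lra.
  - unfold th, I. rewrite RInt_point. change zero with 0. ring.
  - intros t Ht. specialize (Hx t Ht). specialize (Hy t Ht). unfold polar. rewrite Er by auto.
    rewrite (surjective_pairing (g t)). unfold th. f_equal; lra.
Qed.

End Regularity.

(** * Minimizing curves *)

Lemma polar_exists p : exists th, p = polar (rad p) th.
Proof.
  destruct (Req_dec (rad p) 0) as [E|E].
  - exists 0. rewrite (rad_0 p E), rad_00. unfold polar. f_equal; ring.
  - assert (Hr : 0 < rad p) by (generalize (rad_nonneg p); lra).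
    assert (Hx := abs_fst_le p). apply Rabs_le_between in Hx.
    assert (Hx' : -1 <= fst p / rad p <= 1) by (split; [apply Rle_div_r|apply Rle_div_l]; lra).
    assert (E2 := rad_sqr p).
    assert (Hs : sqrt (1 - Rsqr (fst p / rad p)) = Rabs (snd p) / rad p).
    { replace (1 - Rsqr (fst p / rad p)) with ((Rabs (snd p) / rad p) ^ 2).
      - apply sqrt_pow2. apply Rdiv_le_0_compat; auto. apply Rabs_pos.
      - unfold Rdiv. rewrite Rpow_mult_distr, pow2_abs. replace (snd p ^ 2) with (rad p ^ 2 - fst p ^ 2) by lra.
        unfold Rsqr. field. auto. }
    destruct (Rle_dec 0 (snd p)) as [Hy|Hy].
    + exists (acos (fst p / rad p)). unfold polar. rewrite cos_acos, sin_acos, Hs, Rabs_pos_eq by lra.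
      rewrite (surjective_pairing p) at 1. f_equal; field; auto.
    + exists (- acos (fst p / rad p)). unfold polar.
      rewrite cos_neg, sin_neg, cos_acos, sin_acos, Hs, Rabs_left by lra.
      rewrite (surjective_pairing p) at 1. f_equal; field; auto.
Qed.

Lemma polar_inj r th r' th' : 0 < r -> 0 < r' -> polar r th = polar r' th' ->
  r = r' /\ cos th = cos th' /\ sin th = sin th'.
Proof.
  intros H H' E. assert (Er : r = r') by (rewrite <- (rad_polar r th), <- (rad_polar r' th'), E; lra).
  subst r'. unfold polar in E. injection E as E1 E2.
  split; auto. split; apply (Rmult_eq_reg_l r); lra.
Qed.

Lemma polar_add_PI r th : polar r (th + PI) = (- (r * cos th), - (r * sin th)).
Proof. unfold polar. rewrite neg_cos, neg_sin. f_equal; ring. Qed.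

Section Minimizers.
Variable m : R -> R.
Hypothesis Hm : model_fun m.
Local Notation D := (D m).
Local Notation seg := (seg m).
Local Notation geo := (geo m).

Lemma geo_restrict c r rho th L L' : L' <= L -> geo c r rho th L -> geo c r rho th L'.
Proof. intros H G t Ht. apply G; lra. Qed.

Lemma seg_restrict g L L' : L' <= L -> seg g 0 L -> seg g 0 L'.
Proof. intros H G s t Hs Ht. apply G; lra. Qed.

Lemma D_pole p : D (0, 0) p = rad p.
Proof.
  destruct (polar_exists p) as [th E].
  assert (Hu : rad (cos th, sin th) = 1).
  { rewrite <- (rad_polar 1 th) by lra. f_equal. unfold polar. f_equal; ring. }
  assert (H := D_radial m Hm (cos th, sin th) 0 (rad p) Hu (Rle_refl 0) (rad_nonneg p)).
  simpl in H. rewrite !Rmult_0_l, Rminus_0_r, Rabs_pos_eq in H by apply rad_nonneg.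
  rewrite E at 1. exact H.
Qed.

Lemma geo_velocity c r rho th L (g : curve) t : geo c r rho th L -> 0 < t < L ->
  (forall t, 0 <= t <= L -> g t = polar (r t) (th t)) ->
  is_derive (cx g) t (rho t * cos (th t) - r t * sin (th t) * (c * / m (r t) ^ 2)) /\
  is_derive (cy g) t (rho t * sin (th t) + r t * cos (th t) * (c * / m (r t) ^ 2)).
Proof.
  intros G Ht Hg. destruct (G t ltac:(lra)) as [_ [Dr [_ [Dth _]]]].
  assert (Hd : 0 < Rmin t (L - t)) by (apply Rmin_glb_lt; lra).
  assert (Hnear : forall y, Rabs (y - t) < Rmin t (L - t) -> polar (r y) (th y) = g y).
  { intros y Hy. symmetry. apply Hg. assert (A1 := Rmin_l t (L - t)). assert (A2 := Rmin_r t (L - t)).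
    apply Rabs_def2 in Hy. lra. }
  split.
  - apply (is_derive_ext_near (fun t => r t * cos (th t)) _ _ _ _ Hd).
    + intros y Hy. unfold cx. now rewrite <- (Hnear y Hy).
    + der. ringR.
  - apply (is_derive_ext_near (fun t => r t * sin (th t)) _ _ _ _ Hd).
    + intros y Hy. unfold cy. now rewrite <- (Hnear y Hy).
    + der. ringR.
Qed.

Lemma geo_dtheta c r rho th L (g : curve) t : geo c r rho th L -> 0 < t < L ->
  (forall t, 0 <= t <= L -> g t = polar (r t) (th t)) -> dtheta_ds g t = c * / m (r t) ^ 2.
Proof.
  intros G Ht Hg. destruct (geo_velocity c r rho th L g t G Ht Hg) as [H1 H2].
  destruct (G t ltac:(lra)) as [Hr _]. assert (Hmr := m_pos m Hm (r t) Hr).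
  unfold dtheta_ds. rewrite (is_derive_unique _ _ _ H1), (is_derive_unique _ _ _ H2).
  unfold cx, cy. rewrite Hg by lra. unfold polar; simpl fst; simpl snd.
  assert (E := cos2_sin2 (th t)). set (C := cos (th t)) in *. set (S := sin (th t)) in *.
  transitivity ((r t ^ 2 * (C ^ 2 + S ^ 2)) * (c * / m (r t) ^ 2) / (r t ^ 2 * (C ^ 2 + S ^ 2))).
  - f_equal; ring.
  - rewrite E. field. split; lra.
Qed.

(** Reads the angular momentum off the curve itself, so that any two polar descriptions of one curve
    share it. *)
Lemma geo_constant c r rho th L (g : curve) t : geo c r rho th L -> 0 < t < L ->
  (forall t, 0 <= t <= L -> g t = polar (r t) (th t)) -> c = m (rad (g t)) ^ 2 * dtheta_ds g t.
Proof.
  intros G Ht Hg. rewrite (geo_dtheta c r rho th L g t G Ht Hg), Hg by lra.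
  destruct (G t ltac:(lra)) as [Hr _]. assert (Hmr := m_pos m Hm (r t) Hr).
  rewrite rad_polar by lra. field. lra.
Qed.

Lemma dtheta_ds_ext (g h : curve) t d : 0 < d -> (forall y, Rabs (y - t) < d -> g y = h y) ->
  dtheta_ds g t = dtheta_ds h t.
Proof.
  intros Hd H. unfold dtheta_ds.
  assert (E : g t = h t) by (apply H; now rewrite Rminus_eq_0, Rabs_R0).
  rewrite (Derive_ext_loc (cx g) (cx h)), (Derive_ext_loc (cy g) (cy h)).
  - unfold cx, cy. now rewrite E.
  - exists (mkposreal d Hd). intros y Hy. unfold cy. now rewrite H.
  - exists (mkposreal d Hd). intros y Hy. unfold cx. now rewrite H.
Qed.

Lemma geo_theta_mono c r rho th L s t : geo c r rho th L -> 0 < c -> 0 <= s < t -> t <= L -> th s < th t.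
Proof.
  intros G Hc Hst HtL. apply (derive_lt th (fun t => c * / m (r t) ^ 2)); [lra| |].
  - intros x Hx. apply G; lra.
  - intros x Hx. destruct (G x ltac:(lra)) as [Hr _]. apply Rmult_lt_0_compat; auto.
    now apply Rinv_0_lt_compat, pow_lt, (m_pos m Hm).
Qed.

Lemma geo_opp c r rho th L : geo c r rho th L -> geo (- c) r rho (fun t => - th t) L.
Proof.
  intros G t Ht. destruct (G t Ht) as [H1 [H2 [H3 [H4 H5]]]].
  split; [auto|split; [auto|split; [|split]]].
  - replace ((- c) ^ 2) with (c ^ 2) by ring. auto.
  - der. ringR.
  - replace ((- c) ^ 2) with (c ^ 2) by ring. auto.
Qed.

Lemma refl_polar al r th : refl (cos al) (sin al) (polar r th) = polar r (al - th).
Proof. unfold refl, polar; simpl. rewrite cos_minus, sin_minus. f_equal; ring. Qed.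

Lemma refl_dtheta a b (g : curve) t : a ^ 2 + b ^ 2 = 1 -> ex_derive (cx g) t -> ex_derive (cy g) t ->
  dtheta_ds (fun t => refl a b (g t)) t = - dtheta_ds g t.
Proof.
  intros H Hx Hy. apply Derive_correct in Hx. apply Derive_correct in Hy. unfold dtheta_ds.
  rewrite (is_derive_unique (cx (fun t => refl a b (g t))) t (a * Derive (cx g) t + b * Derive (cy g) t)).
  2:{ change (is_derive (fun t => a * cx g t + b * cy g t) t (a * Derive (cx g) t + b * Derive (cy g) t)). der. ringR. }
  rewrite (is_derive_unique (cy (fun t => refl a b (g t))) t (b * Derive (cx g) t - a * Derive (cy g) t)).
  2:{ change (is_derive (fun t => b * cx g t - a * cy g t) t (b * Derive (cx g) t - a * Derive (cy g) t)). der. ringR. }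
  unfold cx, cy, refl; simpl fst; simpl snd. set (x := fst (g t)). set (y := snd (g t)).
  set (x' := Derive _ t). set (y' := Derive _ t).
  replace ((a * x + b * y) ^ 2 + (b * x - a * y) ^ 2) with ((a ^ 2 + b ^ 2) * (x ^ 2 + y ^ 2)) by ring.
  rewrite H, Rmult_1_l. unfold Rdiv.
  transitivity (- ((a ^ 2 + b ^ 2) * (x * y' - y * x')) * / (x ^ 2 + y ^ 2)); [ring|rewrite H; ring].
Qed.

(* Otherwise reflecting the part of the curve before it meets the opposite meridian would
   give another minimizing curve, whose angular momentum changes sign along the way. *)
Lemma turn_lt_PI g c r rho th L : seg g 0 L -> geo c r rho th L -> c <> 0 ->
  (forall t, 0 <= t <= L -> g t = polar (r t) (th t)) ->
  forall t, 0 <= t < L -> Rabs (th t - th 0) < PI.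
Proof.
  intros Hg G Hc Hgp t Ht. apply Rnot_le_lt. intros Hturn.
  assert (Cth : forall s, 0 <= s <= L -> continuous th s).
  { intros s Hs. eapply continuous_of_derive. apply G; lra. }
  destruct (IVT_on (fun s => Rabs (th s - th 0)) 0 t PI) as [t1 [Ht1 E1]]; [lra| | |].
  { intros s Hs. apply (cabs (fun s => th s - th 0)). apply (cminus th (fun _ => th 0)); [apply Cth; lra|apply cconst]. }
  { rewrite Rminus_eq_0, Rabs_R0, Rmin_left, Rmax_right by (generalize PI_RGT_0; lra).
    generalize PI_RGT_0; lra. }
  assert (Ht0 : 0 < t1).
  { destruct (Req_dec t1 0) as [->|]; [|lra]. rewrite Rminus_eq_0, Rabs_R0 in E1. generalize PI_RGT_0; lra. }
  set (al := 2 * th 0). set (F := refl (cos al) (sin al)).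
  assert (Hal : cos al ^ 2 + sin al ^ 2 = 1) by apply cos2_sin2.
  assert (F0 : F (g 0) = g 0).
  { rewrite Hgp by lra. unfold F. rewrite refl_polar. f_equal. unfold al. ring. }
  assert (F1 : F (g t1) = g t1).
  { rewrite Hgp by lra. unfold F. rewrite refl_polar. unfold polar.
    assert (E : th t1 = th 0 + PI \/ th t1 = th 0 - PI) by (unfold Rabs in E1; destruct Rcase_abs in E1; lra).
    destruct E as [E|E].
    - replace (al - th t1) with (th t1 - 2 * PI) by (rewrite E; unfold al; ring).
      rewrite cos_minus, sin_minus, cos_2PI, sin_2PI. f_equal; ring.
    - replace (al - th t1) with (th t1 + 2 * PI) by (rewrite E; unfold al; ring).
      rewrite cos_plus, sin_plus, cos_2PI, sin_2PI. f_equal; ring. }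
  set (g' := fun s => if Rle_dec s t1 then F (g s) else g s).
  assert (G1 : forall s, s <= t1 -> g' s = F (g s)) by (intros s Hs; unfold g'; destruct Rle_dec; [reflexivity|lra]).
  assert (G2 : forall s, t1 <= s -> g' s = g s).
  { intros s Hs; unfold g'; destruct Rle_dec; auto. replace s with t1 by lra. auto. }
  assert (FD : forall p p', D (F p) (F p') = D p p') by (intros; now apply refl_D).
  assert (Hle : forall s u, 0 <= s -> s <= u -> u <= L -> D (g' s) (g' u) = u - s).
  { intros s u Hs Hsu Hu. destruct (Rle_dec u t1) as [Hu1|Hu1].
    - rewrite !G1, FD, Hg, Rabs_minus_sym, Rabs_pos_eq; lra.
    - destruct (Rle_dec t1 s) as [Hs1|Hs1].
      + rewrite !G2, Hg, Rabs_minus_sym, Rabs_pos_eq; lra.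
      + rewrite G1, G2 by lra. apply Rle_antisym.
        * eapply Rle_trans; [apply (D_tri m Hm _ (g t1))|]. rewrite <- F1 at 1.
          rewrite FD, !Hg, !(Rabs_minus_sym _ t1), (Rabs_minus_sym t1 u), !Rabs_pos_eq; lra.
        * assert (T := D_tri m Hm (g 0) (F (g s)) (g u)). rewrite <- F0 in T at 2.
          rewrite FD, !Hg in T by lra.
          rewrite !(Rabs_minus_sym 0), !Rabs_pos_eq in T by lra. lra. }
  assert (Hg' : seg g' 0 L).
  { intros s u Hs Hu. destruct (Rle_dec s u).
    - rewrite Rabs_minus_sym, Rabs_pos_eq, Hle; lra.
    - rewrite (D_sym m Hm), Rabs_pos_eq, Hle; lra. }
  destruct (seg_regular m Hm g' L (th 0)) as [c' [r' [rho' [th' [G' [Eth' Hgp']]]]]]; auto.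
  { lra. }
  { intros s Hs. destruct (Rle_dec s t1).
    - rewrite G1 by auto. unfold F. rewrite refl_rad, Hgp by auto. rewrite rad_polar; [|left]; apply G; lra.
    - rewrite G2, Hgp by lra. rewrite rad_polar; [|left]; apply G; lra. }
  { rewrite G1 by lra. rewrite F0, Hgp by lra. rewrite rad_polar; auto. left; apply G; lra. }
  (* The momentum of [g'] is - c at time t1 / 2, where the curve is reflected, and c at time (t1 +
     L) / 2, where it is not. Being constant, it forces c = 0. *)
  assert (Ha : 0 < t1 / 2 < L) by lra. assert (Hb : 0 < (t1 + L) / 2 < L) by lra.
  assert (Ca := geo_constant _ _ _ _ _ g (t1 / 2) G Ha Hgp).
  assert (Cb := geo_constant _ _ _ _ _ g ((t1 + L) / 2) G Hb Hgp).
  assert (Ca' := geo_constant _ _ _ _ _ g' (t1 / 2) G' Ha Hgp').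
  assert (Cb' := geo_constant _ _ _ _ _ g' ((t1 + L) / 2) G' Hb Hgp').
  rewrite (dtheta_ds_ext g' (fun s => F (g s)) (t1 / 2) (t1 / 2)) in Ca'
    by (try lra; intros y Hy; apply Rabs_def2 in Hy; apply G1; lra).
  destruct (geo_velocity _ _ _ _ _ g (t1 / 2) G Ha Hgp) as [V1 V2].
  unfold F in Ca'. rewrite refl_dtheta in Ca' by (auto; eexists; eauto).
  rewrite G1 in Ca' by lra. unfold F in Ca'. rewrite refl_rad in Ca' by auto.
  rewrite (dtheta_ds_ext g' g ((t1 + L) / 2) ((L - t1) / 2)) in Cb'
    by (try lra; intros y Hy; apply Rabs_def2 in Hy; apply G2; lra).
  rewrite G2 in Cb' by lra. apply Hc. lra.
Qed.

(* If two almost antipodal points of a small circle about the pole are not antipodal, then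
   the chord is shorter than the way through the pole. *)
Lemma antipodal_of_D_eq p y : 0 < rad p -> 0 < rad y -> D p y = rad p + rad y ->
  y = (- (rad y / rad p) * fst p, - (rad y / rad p) * snd p).
Proof.
  intros Hp Hy HD. destruct (polar_exists p) as [a Ea]. destruct (polar_exists y) as [b Eb].
  set (R0 := rad p) in *. set (R1 := rad y) in *.
  set (dx := cos b - cos a). set (dy := sin b - sin a).
  assert (Hunit : forall x, rad (cos x, sin x) = 1).
  { intros x. rewrite <- (rad_polar 1 x) by lra. f_equal. unfold polar. f_equal; ring. }
  assert (Hsmall : forall eps, 0 < eps -> exists e, 0 < e /\ e < R0 /\ e < R1 /\
     D (polar e a) (polar e b) <= (1 + eps) * (e * rad (dx, dy))).
  { intros eps Heps.
    destruct (proj1 (continuous_eps (mquot m) 0) (mquot_cont m Hm 0) eps Heps) as [d [Hd Hd']].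
    assert (Eq0 : mquot m 0 = 1) by (unfold mquot; destruct Req_EM_T; lra).
    set (e := Rmin (d / 2) (Rmin (R0 / 2) (R1 / 2))).
    assert (He : 0 < e) by (repeat apply Rmin_glb_lt; lra).
    assert (E1 : e <= d / 2) by apply Rmin_l.
    assert (E2 : e <= R0 / 2) by (eapply Rle_trans; [apply Rmin_r|apply Rmin_l]).
    assert (E3 : e <= R1 / 2) by (eapply Rle_trans; [apply Rmin_r|apply Rmin_r]).
    exists e. split; [auto|split; [lra|split; [lra|]]].
    destruct (line_C1 (polar e a) (e * dx, e * dy)) as [L1 L2]. set (c := fun t => _) in L1, L2.
    assert (H := D_le01 m Hm c L1).
    replace (c 0) with (polar e a) in H by (unfold c, polar; simpl; f_equal; ring).
    replace (c 1) with (polar e b) in H by (unfold c, polar, dx, dy; simpl; f_equal; ring).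
    eapply Rle_trans; [apply H|].
    replace ((1 + eps) * (e * rad (dx, dy))) with (RInt (fun _ => (1 + eps) * (e * rad (dx, dy))) 0 1)
      by (rewrite RInt_const_R; ringR).
    apply RInt_le; [lra|now apply (spd_int m Hm)|apply ex_RInt_const|].
    intros t Ht. unfold spd. rewrite L2.
    assert (Hrad : rad (c t) <= e).
    { apply Rsqr_incr_0; [|apply rad_nonneg|lra]. unfold Rsqr.
      replace (rad (c t) * rad (c t)) with (rad (c t) ^ 2) by ring. rewrite rad_sqr.
      unfold c, polar; simpl fst; simpl snd.
      assert (Ca := cos2_sin2 a). assert (Cb := cos2_sin2 b).
      replace ((e * cos a + t * (e * dx)) ^ 2 + (e * sin a + t * (e * dy)) ^ 2) with
        (e ^ 2 * ((1 - t) * (cos a ^ 2 + sin a ^ 2) + t * (cos b ^ 2 + sin b ^ 2)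
           - t * (1 - t) * (dx ^ 2 + dy ^ 2))) by (unfold dx, dy; ring).
      rewrite Ca, Cb. assert (0 <= t * (1 - t) * (dx ^ 2 + dy ^ 2)).
      { apply Rmult_le_pos; [nra|]. generalize (pow2_ge_0 dx) (pow2_ge_0 dy); lra. }
      assert (0 <= e ^ 2) by apply pow2_ge_0. nra. }
    assert (Hq : mquot m (rad (c t)) <= 1 + eps).
    { specialize (Hd' (rad (c t))). rewrite Rminus_0_r, Eq0 in Hd'.
      rewrite Rabs_pos_eq in Hd' by apply rad_nonneg. specialize (Hd' ltac:(lra)). apply Rabs_def2 in Hd'. lra. }
    assert (X := gmet_upper m Hm (c t) (e * dx, e * dy) (1 + eps) ltac:(lra) Hq). simpl fst in X; simpl snd in X.
    assert (Y := rad_sqr (dx, dy)). simpl fst in Y; simpl snd in Y.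
    replace ((e * dx) ^ 2 + (e * dy) ^ 2) with ((e * rad (dx, dy)) ^ 2) in X by (rewrite Rpow_mult_distr, Y; ring).
    rewrite <- (sqrt_pow2 ((1 + eps) * (e * rad (dx, dy)))).
    - apply sqrt_le_1_alt. rewrite Rpow_mult_distr. exact X.
    - apply Rmult_le_pos; [lra|]. apply Rmult_le_pos; [lra|apply rad_nonneg]. }
  (* Going along one radius down to radius e, across the chord and out along the other radius is no
     shorter than R0 + R1. So 2 e is at most (1 + eps) e times the corresponding chord of the unit
     circle, which must be a diameter. Dividing eps by [rad (dx, dy) + 1] keeps the error below
     eps. *)
  assert (H2 : 2 <= rad (dx, dy)).
  { apply le_epsilon. intros eps Heps.
    assert (Hn := rad_nonneg (dx, dy)).
    destruct (Hsmall (eps / (rad (dx, dy) + 1))) as [e [He [He1 [He2 He3]]]].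
    { apply Rdiv_lt_0_compat; lra. }
    assert (X1 : D p (polar e a) = R0 - e).
    { rewrite Ea. assert (X := D_radial m Hm (cos a, sin a) R0 e (Hunit a) ltac:(lra) ltac:(lra)).
      simpl in X. unfold polar. rewrite X, Rabs_minus_sym, Rabs_pos_eq; lra. }
    assert (X2 : D (polar e b) y = R1 - e).
    { rewrite Eb. assert (X := D_radial m Hm (cos b, sin b) e R1 (Hunit b) ltac:(lra) ltac:(lra)).
      simpl in X. unfold polar. rewrite X, Rabs_pos_eq; lra. }
    assert (T1 := D_tri m Hm p (polar e a) y). assert (T2 := D_tri m Hm (polar e a) (polar e b) y).
    assert (X3 : 2 * e <= (1 + eps / (rad (dx, dy) + 1)) * (e * rad (dx, dy))) by lra.
    assert (X4 : 2 <= (1 + eps / (rad (dx, dy) + 1)) * rad (dx, dy)) by (apply (Rmult_le_reg_l e); auto; lra).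
    assert (X5 : eps / (rad (dx, dy) + 1) * rad (dx, dy) <= eps).
    { unfold Rdiv. rewrite Rmult_assoc. rewrite <- (Rmult_1_r eps) at 2. apply Rmult_le_compat_l; [lra|].
      rewrite Rmult_comm. apply Rle_div_l; lra. }
    lra. }
  assert (H4 : 4 <= dx ^ 2 + dy ^ 2).
  { assert (Y := rad_sqr (dx, dy)). simpl fst in Y; simpl snd in Y. rewrite <- Y. nra. }
  assert (Ca := cos2_sin2 a). assert (Cb := cos2_sin2 b).
  assert (H0 : (cos a + cos b) ^ 2 + (sin a + sin b) ^ 2 <= 0) by (unfold dx, dy in H4; nra).
  assert (Ex : cos b = - cos a) by (generalize (pow2_ge_0 (sin a + sin b)); nra).
  assert (Ey : sin b = - sin a) by (generalize (pow2_ge_0 (cos a + cos b)); nra).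
  assert (F1 : fst p = R0 * cos a) by exact (f_equal fst Ea).
  assert (F2 : snd p = R0 * sin a) by exact (f_equal snd Ea).
  rewrite F1, F2. transitivity (polar R1 b); [exact Eb|]. unfold polar. rewrite Ex, Ey.
  clearbody R0 R1. f_equal; field; lra.
Qed.

End Minimizers.

(** * Existence and limits of minimizing curves *)

Lemma rad_le_abs p : rad p <= Rabs (fst p) + Rabs (snd p).
Proof.
  assert (P1 := Rabs_pos (fst p)). assert (P2 := Rabs_pos (snd p)).
  apply Rsqr_incr_0; [|apply rad_nonneg|lra]. unfold Rsqr. assert (E := rad_sqr p).
  rewrite <- (pow2_abs (fst p)), <- (pow2_abs (snd p)) in E. nra.
Qed.

Lemma ulim_exists_near U (HU : is_ultra U) (x : nat -> R) K : U (fun n => Rabs (x n) <= K) ->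
  exists l, ulim U x l.
Proof.
  intros H. destruct (ultra_ex U HU _ H) as [n0 Hn0]. assert (HK := Rabs_pos (x n0)).
  destruct (ulim_exists U HU (fun n => clamp (- K) K (x n)) K) as [l Hl].
  { intros n. apply Rabs_le. apply clamp_in. lra. }
  exists l. intros e He. refine (ultra_imp _ HU _ _ _ (ultra_and _ HU _ _ H (Hl e He))).
  intros n [H1 H2]. apply Rabs_le_between in H1. now rewrite clamp_id in H2.
Qed.

Lemma is_derive_right_quotient (f g : R -> R) l h : is_derive f 0 l -> 0 < h ->
  (forall t, 0 <= t <= h -> g t = f t) ->
  filterlim (fun h => (g (0 + h) - g 0) / h) (at_right 0) (locally l).
Proof.
  intros Hf Hh Hg. apply filterlim_locally. intros eps.
  apply is_derive_Reals in Hf. destruct (Hf eps (cond_pos eps)) as [d Hd].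
  assert (Hdh : 0 < Rmin d h) by (apply Rmin_glb_lt; [apply cond_pos|auto]).
  exists (mkposreal _ Hdh). intros y Hy Hy0. simpl in Hy.
  change (Rabs (y - 0) < Rmin d h) in Hy. rewrite Rminus_0_r, Rabs_pos_eq in Hy by lra.
  assert (A1 := Rmin_l d h). assert (A2 := Rmin_r d h).
  change (Rabs ((g (0 + y) - g 0) / y - l) < eps). rewrite !Hg by lra.
  apply Hd; [lra|]. rewrite Rabs_pos_eq; lra.
Qed.

Lemma le_of_small_quadratic a C h : 0 < h -> (forall t, 0 < t <= h -> a * t <= C * t ^ 2) -> a <= 0.
Proof.
  intros Hh H. apply Rnot_lt_le. intros Ha.
  set (t := Rmin h (a / (2 * (Rabs C + 1)))).
  assert (HC := Rabs_pos C). assert (HC2 := Rle_abs C).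
  assert (Ht : 0 < t) by (apply Rmin_glb_lt; auto; apply Rdiv_lt_0_compat; lra).
  assert (T1 : t <= h) by apply Rmin_l. assert (T2 : t <= a / (2 * (Rabs C + 1))) by apply Rmin_r.
  specialize (H t (conj Ht T1)). apply Rle_div_r in T2; [|lra]. nra.
Qed.

Section Limits.
Variable m : R -> R.
Hypothesis Hm : model_fun m.
Local Notation D := (D m).
Local Notation m1 := (Derive_n m 1).
Local Notation seg := (seg m).
Local Notation geo := (geo m).

Section Ultralimit.
Variable U : (nat -> Prop) -> Prop.
Hypothesis HU : is_ultra U.

(** Each time gets its own limit point, coordinate by coordinate, and [D_upper] turns Euclidean
    convergence into convergence in distance. What the limit curve inherits then follows from
    [ulim_D]. *)
Lemma ulim_curve (c : nat -> curve) (S : R -> Prop) (K : R -> R) :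
  (forall t, S t -> U (fun n => rad (c n t) <= K t)) ->
  exists g : curve, forall t, S t -> ulim U (fun n => D (c n t) (g t)) 0.
Proof.
  intros H.
  assert (Hp : forall t, exists p, S t -> ulim U (fun n => D (c n t) p) 0).
  { intros t. destruct (classic (S t)) as [HS|HS]; [|exists (0, 0); contradiction].
    specialize (H t HS).
    destruct (ulim_exists_near U HU (fun n => fst (c n t)) (K t)) as [x Hx].
    { refine (ultra_imp _ HU _ _ _ H). intros n Hn. eapply Rle_trans; [apply abs_fst_le|auto]. }
    destruct (ulim_exists_near U HU (fun n => snd (c n t)) (K t)) as [y Hy].
    { refine (ultra_imp _ HU _ _ _ H). intros n Hn. eapply Rle_trans; [apply abs_snd_le|auto]. }
    exists (x, y). intros _.
    destruct (D_upper m Hm (Rmax (K t) (rad (x, y)))) as [L [HL HD]].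
    { eapply Rle_trans; [apply rad_nonneg|apply Rmax_r]. }
    intros e He. assert (He' : 0 < e / (4 * L)) by (apply Rdiv_lt_0_compat; lra).
    refine (ultra_imp _ HU _ _ _ (ultra_and _ HU _ _ H (ultra_and _ HU _ _ (Hx _ He') (Hy _ He')))).
    intros n [H1 [H2 H3]]. rewrite Rminus_0_r, Rabs_pos_eq by apply (D_nonneg m Hm).
    eapply Rle_lt_trans; [apply HD|].
    - eapply Rle_trans; [apply H1|apply Rmax_l].
    - apply Rmax_r.
    - assert (X := rad_le_abs (fst (x, y) - fst (c n t), snd (x, y) - snd (c n t))). simpl in X. simpl.
      rewrite (Rabs_minus_sym x), (Rabs_minus_sym y) in X.
      apply Rle_lt_trans with (L * (e / (4 * L) + e / (4 * L))).
      + apply Rmult_le_compat_l; lra.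
      + replace (L * (e / (4 * L) + e / (4 * L))) with (e / 2) by (field; lra). lra. }
  exists (fun t => proj1_sig (constructive_indefinite_description _ (Hp t))).
  intros t HS. exact (proj2_sig (constructive_indefinite_description _ (Hp t)) HS).
Qed.

Lemma ulim_D (a b : nat -> pt) p q d : ulim U (fun n => D (a n) p) 0 -> ulim U (fun n => D (b n) q) 0 ->
  ulim U (fun n => D (a n) (b n)) d -> D p q = d.
Proof.
  intros Ha Hb Hd. apply (ulim_unique U HU (fun n => D (a n) (b n))); auto.
  intros e He.
  refine (ultra_imp _ HU _ _ _ (ultra_and _ HU _ _ (Ha (e / 2) ltac:(lra)) (Hb (e / 2) ltac:(lra)))).
  intros n [H1 H2]. rewrite Rminus_0_r, Rabs_pos_eq in H1, H2 by apply (D_nonneg m Hm).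
  assert (T1 := D_tri m Hm (a n) p (b n)). assert (T2 := D_tri m Hm p q (b n)).
  assert (T3 := D_tri m Hm p (a n) q). assert (T4 := D_tri m Hm (a n) (b n) q).
  rewrite (D_sym m Hm p (a n)) in T3. rewrite (D_sym m Hm q (b n)) in T2. apply Rabs_def1; lra.
Qed.

Lemma ulim_point (a : nat -> pt) p q : ulim U (fun n => D (a n) p) 0 -> ulim U (fun n => D (a n) q) 0 -> p = q.
Proof.
  intros Hp Hq. apply (D_zero m Hm). apply (ulim_D a a); auto.
  intros e He. apply (ultra_all U HU). intros n. rewrite (D_refl m Hm), Rminus_0_r, Rabs_R0. auto.
Qed.

Lemma ulim_rad (a : nat -> pt) p : ulim U (fun n => D (a n) p) 0 -> ulim U (fun n => rad (a n)) (rad p).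
Proof.
  intros H e He. refine (ultra_imp _ HU _ _ _ (H e He)). intros n Hn.
  rewrite Rminus_0_r, Rabs_pos_eq in Hn by apply (D_nonneg m Hm).
  eapply Rle_lt_trans; [apply (D_rad m Hm)|auto].
Qed.

End Ultralimit.

(** The ultralimit of curves of speed at most 1 whose lengths exceed the distance by at most 1 / (n
    + 1). By the triangle inequality such curves preserve distances up to that error. *)
Lemma minimizer_exists p q : exists g, seg g 0 (D p q) /\ g 0 = p /\ g (D p q) = q.
Proof.
  destruct ex_ultra as [U HU]. set (d := D p q).
  assert (Hd : 0 <= d) by apply (D_nonneg m Hm).
  assert (H : forall n : nat, exists c, exists L, C1_curve c /\ (forall t, spd m c t <= 1) /\
    d <= L <= d + / INR (S n) /\ c 0 = p /\ c L = q).
  { intros n. apply (almost_minimizing m Hm). apply Rinv_0_lt_compat, lt_0_INR; lia. }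
  set (c := fun n => proj1_sig (constructive_indefinite_description _ (H n))).
  assert (Hc : forall n, exists L, C1_curve (c n) /\ (forall t, spd m (c n) t <= 1) /\
    d <= L <= d + / INR (S n) /\ c n 0 = p /\ c n L = q).
  { intros n. exact (proj2_sig (constructive_indefinite_description _ (H n))). }
  clearbody c. clear H.
  assert (Hiso : forall n s t, 0 <= s <= d -> 0 <= t <= d -> Rabs (D (c n s) (c n t) - Rabs (s - t)) <= 1 / INR (S n)).
  { intros n s t Hs Ht. destruct (Hc n) as [L [C1 [C2 [C3 [C4 C5]]]]].
    assert (Hsp := D_speed1 m Hm (c n) C1 C2).
    assert (X : forall s t, 0 <= s -> s <= t -> t <= d -> t - s - / INR (S n) <= D (c n s) (c n t)).
    { intros s' t' H1 H2 H3. assert (T1 := D_tri m Hm p (c n s') q). assert (T2 := D_tri m Hm (c n s') (c n t') q).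
      assert (S1 := Hsp 0 s'). assert (S2 := Hsp t' L). rewrite C4 in S1. rewrite C5 in S2.
      rewrite Rabs_minus_sym, Rabs_pos_eq in S1 by lra. rewrite Rabs_minus_sym, Rabs_pos_eq in S2 by lra.
      fold d in T1. lra. }
    assert (Hi : 0 < / INR (S n)) by (apply Rinv_0_lt_compat, lt_0_INR; lia).
    specialize (Hsp s t). unfold Rdiv. rewrite Rmult_1_l. apply Rabs_le. split; [|lra].
    destruct (Rle_dec s t).
    - rewrite Rabs_minus_sym, Rabs_pos_eq by lra. specialize (X s t). lra.
    - rewrite Rabs_pos_eq by lra. specialize (X t s). rewrite (D_sym m Hm). lra. }
  destruct (ulim_curve U HU c (fun t => 0 <= t <= d) (fun t => rad p + t)) as [g Hg].
  { intros t Ht. apply (ultra_all U HU). intros n. destruct (Hc n) as [L [C1 [C2 [C3 [C4 C5]]]]].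
    assert (S1 := D_speed1 m Hm (c n) C1 C2 0 t). rewrite C4, Rabs_minus_sym, Rminus_0_r, Rabs_pos_eq in S1 by lra.
    assert (S2 := D_rad m Hm p (c n t)). apply Rabs_le_between in S2. lra. }
  assert (Hseg : seg g 0 d).
  { intros s t Hs Ht. apply (ulim_D U HU (fun n => c n s) (fun n => c n t)); auto.
    apply (ulim_inv_n U HU _ _ 1). intros n. apply Hiso; auto. }
  exists g. split; [auto|split].
  - apply (ulim_point U HU (fun n => c n 0)); [apply Hg; lra|].
    intros e He. apply (ultra_all U HU). intros n. destruct (Hc n) as [L [_ [_ [_ [C4 _]]]]].
    now rewrite C4, (D_refl m Hm), Rminus_0_r, Rabs_R0.
  - apply (ulim_point U HU (fun n => c n d)); [apply Hg; lra|].
    apply (ulim_inv_n U HU _ _ 1). intros n. destruct (Hc n) as [L [C1 [C2 [C3 [C4 C5]]]]].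
    rewrite Rminus_0_r, Rabs_pos_eq by apply (D_nonneg m Hm). rewrite <- C5.
    eapply Rle_trans; [apply (D_speed1 m Hm (c n) C1 C2)|]. rewrite Rabs_minus_sym, Rabs_pos_eq by lra.
    unfold Rdiv. lra.
Qed.

(** Initial data of a curve that starts as a geodesic: [c] is its angular momentum and [x] the
    radial component of its unit velocity, which is the cosine of the angle with the radial
    direction by [init_angle]. *)
Definition init (g : curve) (x c : R) : Prop := exists h r rho th, 0 < h /\ geo c r rho th h /\
  rho 0 = x /\ forall t, 0 <= t <= h -> g t = polar (r t) (th t).

Lemma init_unique g x c x' c' : init g x c -> init g x' c' -> x = x' /\ c = c'.
Proof.
  intros [h [r [rho [th [Hh [G [Ex Hg]]]]]]] [h' [r' [rho' [th' [Hh' [G' [Ex' Hg']]]]]]].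
  set (k := Rmin h h'). assert (Hk : 0 < k) by now apply Rmin_glb_lt.
  assert (Hkh : k <= h) by apply Rmin_l. assert (Hkh' : k <= h') by apply Rmin_r.
  assert (Err : forall t, 0 <= t <= k -> r t = r' t).
  { intros t Ht. rewrite <- (rad_polar (r t) (th t)), <- (rad_polar (r' t) (th' t)).
    - rewrite <- Hg, <- Hg' by lra. reflexivity.
    - left; apply G'; lra.
    - left; apply G; lra. }
  split.
  - destruct (G 0 ltac:(lra)) as [_ [Dr _]]. destruct (G' 0 ltac:(lra)) as [_ [Dr' _]].
    rewrite Ex in Dr. rewrite Ex' in Dr'.
    apply Rle_antisym; apply Rminus_le_0.
    + apply (derive_right_nonneg (fun t => r' t - r t) 0 k); auto.
      * now apply dminus.
      * intros t Ht. rewrite !Err by lra. lra.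
    + apply (derive_right_nonneg (fun t => r t - r' t) 0 k); auto.
      * now apply dminus.
      * intros t Ht. rewrite !Err by lra. lra.
  - rewrite (geo_constant m Hm c r rho th k g (k / 2)), (geo_constant m Hm c' r' rho' th' k g (k / 2));
      auto; try lra.
    + apply (geo_restrict m _ _ _ _ h'); auto.
    + intros t Ht; apply Hg'; lra.
    + apply (geo_restrict m _ _ _ _ h); auto.
    + intros t Ht; apply Hg; lra.
Qed.

Lemma seg_cont_rad g L t : seg g 0 L -> 0 <= t <= L -> Rabs (rad (g t) - rad (g 0)) <= t.
Proof.
  intros Hg Ht. eapply Rle_trans; [apply (D_rad m Hm)|]. rewrite Hg by lra. rewrite Rminus_0_r, Rabs_pos_eq; lra.
Qed.

Lemma seg_geo g L th0 : 0 < L -> seg g 0 L -> (forall t, 0 <= t <= L -> 0 < rad (g t)) ->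
  g 0 = polar (rad (g 0)) th0 -> forall x c, init g x c ->
  exists r rho th, geo c r rho th L /\ th 0 = th0 /\ rho 0 = x /\
    forall t, 0 <= t <= L -> g t = polar (r t) (th t).
Proof.
  intros HL Hg Hpos H0 x c Hi.
  destruct (seg_regular m Hm g L th0 HL Hg Hpos H0) as [c' [r [rho [th [G [Eth Hgp]]]]]].
  assert (Hi' : init g (rho 0) c') by (exists L, r, rho, th; auto).
  destruct (init_unique _ _ _ _ _ Hi Hi') as [-> ->].
  exists r, rho, th. auto.
Qed.

Lemma seg_init g L : 0 < L -> seg g 0 L -> 0 < rad (g 0) -> exists x c, init g x c.
Proof.
  intros HL Hg Hr. destruct (polar_exists (g 0)) as [th0 E].
  set (h := Rmin L (rad (g 0) / 2)). assert (Hh : 0 < h) by (apply Rmin_glb_lt; lra).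
  assert (h <= L) by apply Rmin_l. assert (h <= rad (g 0) / 2) by apply Rmin_r.
  destruct (seg_regular m Hm g h th0) as [c [r [rho [th [G [Eth Hgp]]]]]]; auto.
  - apply (seg_restrict m g L); auto.
  - intros t Ht. assert (X := seg_cont_rad g L t Hg ltac:(lra)). apply Rabs_le_between in X. lra.
  - exists (rho 0), c, h, r, rho, th. auto.
Qed.

Lemma init_energy g x c : init g x c -> x ^ 2 + c ^ 2 * / m (rad (g 0)) ^ 2 = 1.
Proof.
  intros [h [r [rho [th [Hh [G [<- Hg]]]]]]]. rewrite Hg by lra.
  destruct (G 0 ltac:(lra)) as [H1 [_ [_ [_ H2]]]]. rewrite rad_polar by lra. auto.
Qed.

Lemma init_abs g x c : 0 < rad (g 0) -> init g x c -> -1 <= x <= 1.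
Proof.
  intros Hr Hi. assert (E := init_energy g x c Hi).
  assert (0 <= c ^ 2 * / m (rad (g 0)) ^ 2).
  { apply Rmult_le_pos; [apply pow2_ge_0|]. left. apply Rinv_0_lt_compat, pow_lt, (m_pos m Hm); auto. }
  split; nra.
Qed.

(** Clairaut: c^2 / m^2 <= 1 keeps m (r) above |c|, whereas m tends to 0 at the pole. The
    contradiction is drawn shortly before the first passage through the pole. *)
Lemma seg_nonpole g L x c : 0 < L -> seg g 0 L -> 0 < rad (g 0) -> init g x c -> c <> 0 ->
  forall t, 0 <= t <= L -> 0 < rad (g t).
Proof.
  intros HL Hg Hr Hi Hc t1 Ht1. apply Rnot_le_lt. intros Hn.
  destruct (polar_exists (g 0)) as [th0 E0].
  set (w := fun t => rad (g (clamp 0 L t))).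
  assert (Cw : forall t, continuous w t).
  { intros t. apply (lipschitz_continuous _ 1). intros y. apply (seg_rad m Hm g L); auto; lra. }
  assert (Ew : forall t, 0 <= t <= L -> w t = rad (g t)) by (intros; unfold w; now rewrite clamp_id).
  destruct (Req_dec t1 0) as [->|Ht0]; [lra|].
  destruct (first_zero w 0 t1) as [z [Hz [Ez Hlt]]]; [lra|intros; apply Cw| | |].
  { exists (Rmin L (rad (g 0))). split; [now apply Rmin_glb_lt|]. intros y Hy. rewrite Rplus_0_l in Hy.
    assert (A1 := Rmin_l L (rad (g 0))). assert (A2 := Rmin_r L (rad (g 0))). rewrite Ew by lra.
    assert (X := seg_cont_rad g L y Hg ltac:(lra)). apply Rabs_le_between in X. lra. }
  { rewrite Ew; auto. }
  assert (Cm := cm m Hm).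
  assert (Cmw : continuous (fun t => m (w t) ^ 2) z) by (apply cpow, (ccomp m w); auto).
  assert (Hc2 : 0 < c ^ 2) by (rewrite <- Rsqr_pow2; now apply Rsqr_pos_lt).
  destruct (proj1 (continuous_eps _ _) Cmw (c ^ 2) Hc2) as [d [Hd H]].
  set (t := Rmax (z / 2) (z - d / 2)).
  assert (Htz : t < z) by (apply Rmax_lub_lt; lra). assert (Ht2 : z / 2 <= t) by apply Rmax_l.
  assert (Ht3 : z - d / 2 <= t) by apply Rmax_r.
  specialize (H t). rewrite Rabs_left in H by lra. specialize (H ltac:(lra)).
  rewrite Ez, (m_0 m Hm) in H. replace (m (w t) ^ 2 - 0 ^ 2) with (m (w t) ^ 2) in H by ring.
  rewrite Rabs_pos_eq in H by apply pow2_ge_0.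
  destruct (seg_geo g t th0 ltac:(lra)) with (x := x) (c := c) as [r [rho [th [G [_ [_ Hgp]]]]]]; auto.
  { apply (seg_restrict m g L); auto; lra. }
  { intros s Hs. destruct (Req_dec s 0) as [->|]; auto. rewrite <- Ew by lra. apply Hlt; lra. }
  destruct (G t ltac:(lra)) as [G1 [_ [_ [_ G2]]]].
  rewrite Ew, Hgp, rad_polar in H by lra. assert (Hmr := m_pos m Hm _ G1).
  assert (c ^ 2 * / m (r t) ^ 2 <= 1) by (generalize (pow2_ge_0 (rho t)); lra).
  apply Rle_div_l in H0; [lra|]. apply pow_lt; lra.
Qed.

(** Since c^2 / m^2 <= 1, the radial acceleration is at most |m'/m|. The constant therefore depends
    on [R0] alone, and initial velocities can be recovered uniformly from radii. *)
Lemma init_rate R0 : 0 < R0 -> exists C, 0 < C /\ forall g L x c, seg g 0 L -> rad (g 0) = R0 -> init g x c ->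
  forall t, 0 <= t <= L -> t <= R0 / 2 -> Rabs (rad (g t) - R0 - x * t) <= C * t ^ 2.
Proof.
  intros HR.
  assert (Hp : forall x, R0 / 2 <= x <= 3 * R0 / 2 -> 0 < m x) by (intros; apply (m_pos m Hm); lra).
  destruct (cont_bounded (fun x => m1 x / m x) (R0 / 2) (3 * R0 / 2)) as [C [HC HC']]; [lra| |].
  { intros x Hx. assert (X := cm m Hm x). assert (Y := cm1 m Hm x). specialize (Hp x Hx). cont. lra. }
  exists C. split; auto. intros g L x c Hg Eg Hi t Ht Ht2.
  destruct (Req_dec t 0) as [->|Ht0].
  { rewrite Eg. replace (R0 - R0 - x * 0) with 0 by ring. rewrite Rabs_R0. simpl. lra. }
  destruct (polar_exists (g 0)) as [th0 E0].
  assert (Hrad : forall s, 0 <= s <= t -> R0 / 2 <= rad (g s) <= 3 * R0 / 2).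
  { intros s Hs. assert (X := seg_cont_rad g L s Hg ltac:(lra)). rewrite Eg in X. apply Rabs_le_between in X. lra. }
  destruct (seg_geo g t th0 ltac:(lra)) with (x := x) (c := c) as [r [rho [th [G [_ [Ex Hgp]]]]]]; auto.
  { apply (seg_restrict m g L); auto; lra. }
  { intros s Hs. specialize (Hrad s Hs). lra. }
  assert (Er : forall s, 0 <= s <= t -> r s = rad (g s)).
  { intros s Hs. rewrite Hgp by auto. rewrite rad_polar; auto. left; apply G; auto. }
  assert (Hrho : forall s, 0 <= s <= t -> Rabs (rho s - x) <= C * t).
  { intros s Hs. rewrite <- Ex. apply Rle_trans with (C * (s - 0)); [|apply Rmult_le_compat_l; lra].
    apply (derive_bound rho (fun s => c ^ 2 * (m1 (r s) / m (r s) ^ 3))); [lra| |].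
    - intros u Hu. apply G; lra.
    - intros u Hu. destruct (G u ltac:(lra)) as [G1 [_ [_ [_ G2]]]]. assert (Hmu := m_pos m Hm _ G1).
      replace (c ^ 2 * (m1 (r u) / m (r u) ^ 3)) with ((c ^ 2 * / m (r u) ^ 2) * (m1 (r u) / m (r u))) by (field; lra).
      assert (Hcm : 0 <= c ^ 2 * / m (r u) ^ 2).
      { apply Rmult_le_pos; [apply pow2_ge_0|]. left. now apply Rinv_0_lt_compat, pow_lt. }
      rewrite Rabs_mult, (Rabs_pos_eq _ Hcm).
      assert (X := HC' (r u) ltac:(rewrite Er by lra; apply Hrad; lra)).
      assert (c ^ 2 * / m (r u) ^ 2 <= 1) by (generalize (pow2_ge_0 (rho u)); lra).
      generalize (Rabs_pos (m1 (r u) / m (r u))). nra. }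
  assert (X := derive_bound (fun s => r s - x * s) (fun s => rho s - x) 0 t (C * t) ltac:(lra)).
  cbv beta in X. rewrite !Er, Eg in X by lra.
  replace (rad (g t) - x * t - (R0 - x * 0)) with (rad (g t) - R0 - x * t) in X by ring.
  replace (C * t ^ 2) with (C * t * (t - 0)) by ring. apply X; auto.
  intros s Hs. destruct (G s Hs) as [_ [Dr _]]. der. ringR.
Qed.

(** Distances pass to the pointwise limit at once. The uniform second-order estimate of [init_rate]
    identifies the radial speed of the limit with the limit of the radial speeds. *)
Lemma limit_ray U (HU : is_ultra U) (s : nat -> curve) (L x c : nat -> R) q x0 : 0 < rad q ->
  (forall n, seg (s n) 0 (L n)) -> (forall n, s n 0 = q) -> (forall n, init (s n) (x n) (c n)) ->
  (forall T, U (fun n => T <= L n)) -> ulim U x x0 ->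
  exists g, (forall T, seg g 0 T) /\ g 0 = q /\ exists c0, init g x0 c0.
Proof.
  intros Hq Hs H0 Hi HT Hx.
  destruct (ulim_curve U HU s (fun t => 0 <= t) (fun t => rad q + t)) as [g Hg].
  { intros t Ht. refine (ultra_imp _ HU _ _ _ (HT t)). intros n Hn.
    assert (X := seg_cont_rad (s n) (L n) t (Hs n) ltac:(lra)). rewrite H0 in X. apply Rabs_le_between in X. lra. }
  assert (Hseg : forall T, seg g 0 T).
  { intros T u t Hu Ht. apply (ulim_D U HU (fun n => s n u) (fun n => s n t)); try (apply Hg; lra).
    intros e He. refine (ultra_imp _ HU _ _ _ (HT T)). intros n Hn. rewrite (Hs n) by lra.
    now rewrite Rminus_eq_0, Rabs_R0. }
  assert (Hg0 : g 0 = q).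
  { apply (ulim_point U HU (fun n => s n 0)); [apply Hg; lra|].
    intros e He. apply (ultra_all U HU). intros n. now rewrite H0, (D_refl m Hm), Rminus_0_r, Rabs_R0. }
  exists g. split; [auto|split; [auto|]].
  destruct (seg_init g 1 Rlt_0_1 (Hseg 1)) as [x' [c' Hi']]; [now rewrite Hg0|].
  exists c'. replace x0 with x'; auto.
  destruct (init_rate (rad q) Hq) as [C [HC HC']].
  assert (X1 : forall t, 0 <= t <= rad q / 2 -> Rabs (rad (g t) - rad q - x' * t) <= C * t ^ 2).
  { intros t Ht. apply (HC' g t x' c'); auto; try lra. now rewrite Hg0. }
  assert (X2 : forall t, 0 <= t <= rad q / 2 -> Rabs (rad (g t) - rad q - x0 * t) <= C * t ^ 2).
  { intros t Ht.
    assert (Hl : ulim U (fun n => Rabs (rad (s n t) + (- rad q + - x n * t))) (Rabs (rad (g t) + (- rad q + - x0 * t)))).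
    { apply (ulim_cont U HU Rabs); [apply continuous_Rabs|].
      apply (ulim_plus U HU); [apply (ulim_rad U HU), Hg; lra|].
      apply (ulim_cont U HU (fun x => - rad q + - x * t)); auto. cont. }
    replace (rad (g t) - rad q - x0 * t) with (rad (g t) + (- rad q + - x0 * t)) by ring.
    apply (ulim_le U HU _ _ _ Hl). refine (ultra_imp _ HU _ _ _ (HT t)). intros n Hn.
    replace (rad (s n t) + (- rad q + - x n * t)) with (rad (s n t) - rad q - x n * t) by ring.
    apply (HC' (s n) (L n) (x n) (c n)); auto; try lra. now rewrite H0. }
  assert (X3 : forall t, 0 < t <= rad q / 2 -> Rabs (x' - x0) * t <= (2 * C) * t ^ 2).
  { intros t Ht. specialize (X1 t ltac:(lra)). specialize (X2 t ltac:(lra)).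
    rewrite <- (Rabs_pos_eq t) at 1 by lra. rewrite <- Rabs_mult.
    apply Rabs_le_between in X1. apply Rabs_le_between in X2. apply Rabs_le. lra. }
  apply le_of_small_quadratic in X3; [|lra].
  destruct (Req_dec x' x0) as [|Hn]; auto.
  assert (Y := Rabs_pos_lt (x' - x0) ltac:(lra)). lra.
Qed.

Lemma init_rvel g x c th0 : 0 < rad (g 0) -> g 0 = polar (rad (g 0)) th0 -> init g x c -> forall v,
  rvel g 0 v <-> v = (x * cos th0 - sin th0 * (c * / m (rad (g 0))) * (rad (g 0) / m (rad (g 0))),
                      x * sin th0 + cos th0 * (c * / m (rad (g 0))) * (rad (g 0) / m (rad (g 0)))).
Proof.
  intros Hr H0 [h [r [rho [th [Hh [G [Ex Hg]]]]]]] v.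
  destruct (G 0 ltac:(lra)) as [Hr0 [Dr [_ [Dth _]]]].
  assert (E0 : polar (r 0) (th 0) = polar (rad (g 0)) th0) by (rewrite <- H0, Hg by lra; reflexivity).
  destruct (polar_inj _ _ _ _ Hr0 Hr E0) as [E1 [E2 E3]]. set (R0 := rad (g 0)) in *.
  assert (Hm0 := m_pos m Hm R0 Hr). clearbody R0. subst R0.
  assert (Vx : filterlim (fun h => (cx g (0 + h) - cx g 0) / h) (at_right 0)
    (locally (x * cos th0 - sin th0 * (c * / m (r 0)) * (r 0 / m (r 0))))).
  { apply (is_derive_right_quotient (fun t => r t * cos (th t)) (cx g) _ h); auto.
    - der. rewrite E2, E3, Ex. fieldR. lra.
    - intros t Ht. unfold cx. rewrite Hg by auto. reflexivity. }
  assert (Vy : filterlim (fun h => (cy g (0 + h) - cy g 0) / h) (at_right 0)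
    (locally (x * sin th0 + cos th0 * (c * / m (r 0)) * (r 0 / m (r 0))))).
  { apply (is_derive_right_quotient (fun t => r t * sin (th t)) (cy g) _ h); auto.
    - der. rewrite E2, E3, Ex. fieldR. lra.
    - intros t Ht. unfold cy. rewrite Hg by auto. reflexivity. }
  split.
  - intros [V1 V2]. rewrite (surjective_pairing v). f_equal.
    + eapply (filterlim_locally_unique (F := at_right 0)); eauto.
    + eapply (filterlim_locally_unique (F := at_right 0)); eauto.
  - intros ->. split; auto.
Qed.

Lemma init_angle g x c v : 0 < rad (g 0) -> init g x c -> rvel g 0 v ->
  angle_at m (g 0) (e_r (g 0)) v = acos x.
Proof.
  intros Hr Hi Hv. destruct (polar_exists (g 0)) as [th0 E0].
  apply (init_rvel g x c th0 Hr E0 Hi) in Hv. assert (En := init_energy g x c Hi).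
  set (R0 := rad (g 0)) in *. assert (Hm0 := m_pos m Hm R0 Hr).
  assert (Hrad : rad (polar R0 th0) = R0) by (apply rad_polar; lra).
  assert (E := cos2_sin2 th0). rewrite E0. clearbody R0.
  set (w := c * / m R0) in *.
  assert (Ew : x ^ 2 + w ^ 2 = 1) by (unfold w; rewrite <- En; field; lra).
  set (A := cos th0) in *. set (B := sin th0) in *.
  assert (Ee : e_r (polar R0 th0) = (A, B)).
  { unfold e_r. rewrite Hrad. unfold polar. fold A B. simpl. f_equal; field; lra. }
  assert (F1 : dr (polar R0 th0) (A, B) = 1).
  { unfold dr. rewrite Hrad. unfold polar. fold A B. simpl. transitivity (A ^ 2 + B ^ 2); [field; lra|lra]. }
  assert (F2 : dtheta (polar R0 th0) (A, B) = 0).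
  { unfold dtheta. rewrite Hrad. unfold polar. fold A B. simpl. field; lra. }
  assert (F3 : dr (polar R0 th0) v = x).
  { unfold dr. rewrite Hrad, Hv. unfold polar. fold A B. simpl. transitivity ((A ^ 2 + B ^ 2) * x); [field; lra|rewrite E; ring]. }
  assert (F4 : dtheta (polar R0 th0) v = w * / m R0).
  { unfold dtheta. rewrite Hrad, Hv. unfold polar. fold A B. simpl. transitivity ((A ^ 2 + B ^ 2) * (w * / m R0)); [field; lra|rewrite E; ring]. }
  unfold angle_at, gmet. rewrite Hrad. destruct Req_EM_T; [lra|].
  rewrite Ee, F1, F2, F3, F4. f_equal.
  replace (1 * 1 + m R0 ^ 2 * 0 * 0) with 1 by ring.
  replace (x * x + m R0 ^ 2 * (w * / m R0) * (w * / m R0)) with (x ^ 2 + w ^ 2) by (field; lra).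
  rewrite Ew, sqrt_1. field. lra.
Qed.

(** A minimizing curve through the pole would end on the opposite meridian by [antipodal_of_D_eq],
    and zero momentum would keep it on the meridian of [q]; both are excluded by 0 < al < PI. The
    total turn is at most PI by [turn_lt_PI] and continuity, and it has the same cosine as [al]. *)
Lemma minimizer_off_meridian q th0 n al : q = polar (rad q) th0 -> 0 < rad q -> 0 < n -> 0 < al < PI ->
  exists g L c r rho th, 0 < L /\ L = D q (polar n (th0 + al)) /\ seg g 0 L /\ g 0 = q /\
    g L = polar n (th0 + al) /\
    geo c r rho th L /\ th 0 = th0 /\ (forall t, 0 <= t <= L -> g t = polar (r t) (th t)) /\
    c <> 0 /\ Rabs (th L - th0) = al /\ r 0 = rad q /\ r L = n /\ init g (rho 0) c.
Proof.
  intros Hq Hr Hn Hal. set (y := polar n (th0 + al)).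
  destruct (minimizer_exists q y) as [g [Hg [H0 H1]]]. set (L := D q y) in *.
  assert (Hcs : ~ (cos al = 1 /\ sin al = 0)).
  { intros [_ E]. generalize (sin_gt_0 al ltac:(lra) ltac:(lra)). lra. }
  assert (Hrady : rad y = n) by (apply rad_polar; lra).
  assert (HL : 0 < L).
  { destruct (D_nonneg m Hm q y) as [|E]; auto. exfalso. symmetry in E. apply (D_zero m Hm) in E.
    rewrite Hq in E. unfold y in E. destruct (polar_inj _ _ _ _ Hr Hn E) as [_ [E1 E2]].
    apply Hcs. replace al with (th0 + al - th0) by ring. rewrite cos_minus, sin_minus, <- E1, <- E2.
    assert (X := cos2_sin2 th0). split; [|ring]. rewrite <- X. ring. }
  assert (Hpole : forall t, 0 <= t <= L -> 0 < rad (g t)).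
  { intros t Ht. destruct (rad_nonneg (g t)) as [|E]; auto. exfalso. symmetry in E. apply rad_0 in E.
    assert (X1 := Hg 0 t ltac:(lra) Ht). assert (X2 := Hg t L Ht ltac:(lra)). rewrite H0, E in X1. rewrite H1, E in X2.
    rewrite (D_sym m Hm), (D_pole m Hm) in X1. rewrite (D_pole m Hm) in X2.
    rewrite Rabs_minus_sym, Rminus_0_r, Rabs_pos_eq in X1 by lra. rewrite Rabs_minus_sym, Rabs_pos_eq in X2 by lra.
    assert (C := antipodal_of_D_eq m Hm q y Hr ltac:(lra) ltac:(fold L; lra)). rewrite Hrady in C.
    assert (Q1 : fst q = rad q * cos th0) by exact (f_equal fst Hq).
    assert (Q2 : snd q = rad q * sin th0) by exact (f_equal snd Hq).
    assert (C1 : n * cos (th0 + al) = - (n / rad q) * fst q) by exact (f_equal fst C).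
    assert (C2 : n * sin (th0 + al) = - (n / rad q) * snd q) by exact (f_equal snd C).
    rewrite Q1 in C1. rewrite Q2 in C2.
    assert (K1 : cos (th0 + al) = - cos th0).
    { apply (Rmult_eq_reg_l n); [|lra]. rewrite C1. field. lra. }
    assert (K2 : sin (th0 + al) = - sin th0).
    { apply (Rmult_eq_reg_l n); [|lra]. rewrite C2. field. lra. }
    assert (S : sin al = 0).
    { replace al with (th0 + al - th0) by ring. rewrite sin_minus, K1, K2. ring. }
    generalize (sin_gt_0 al ltac:(lra) ltac:(lra)). lra. }
  assert (Hg0 : g 0 = polar (rad (g 0)) th0) by now rewrite H0.
  destruct (seg_regular m Hm g L th0 HL Hg Hpole Hg0) as [c [r [rho [th [G [Eth Hgp]]]]]].
  assert (Er0 : r 0 = rad q) by (rewrite <- H0, Hgp, rad_polar by (try lra; left; apply G; lra); auto).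
  assert (ErL : r L = n).
  { rewrite <- Hrady, <- H1, Hgp, rad_polar by (try lra; left; apply G; lra); auto. }
  assert (EL : polar (r L) (th L) = polar n (th0 + al)) by (rewrite <- Hgp by lra; exact H1).
  assert (HrL : 0 < r L) by lra.
  destruct (polar_inj _ _ _ _ HrL Hn EL) as [_ [K1 K2]].
  assert (Hc : c <> 0).
  { intros ->. assert (E : th 0 = th L).
    { apply derive_zero; [lra|]. intros t Ht. destruct (G t Ht) as [_ [_ [_ [X _]]]]. now rewrite Rmult_0_l in X. }
    rewrite <- E, Eth in K1, K2. apply Hcs. replace al with (th0 + al - th0) by ring.
    rewrite cos_minus, sin_minus, <- K1, <- K2. assert (X := cos2_sin2 th0). split; [|ring]. rewrite <- X. ring. }
  exists g, L, c, r, rho, th. repeat (split; [now auto|]). split; [|split; [auto|split; [auto|]]].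
  - assert (Hturn : Rabs (th L - th0) <= PI).
    { apply Rnot_lt_le. intros Hn2.
      assert (Cth : continuous (fun t => Rabs (th t - th0)) L).
      { assert (continuous th L) by (eapply continuous_of_derive; apply G; lra). cont. }
      destruct (proj1 (continuous_eps _ _) Cth (Rabs (th L - th0) - PI) ltac:(lra)) as [d [Hd Hd']].
      set (t := Rmax (L / 2) (L - d / 2)).
      assert (T1 : t < L) by (apply Rmax_lub_lt; lra). assert (T2 : L / 2 <= t) by apply Rmax_l.
      assert (T3 : L - d / 2 <= t) by apply Rmax_r.
      specialize (Hd' t). rewrite Rabs_left in Hd' by lra. specialize (Hd' ltac:(lra)). apply Rabs_def2 in Hd'.
      assert (X := turn_lt_PI m Hm g c r rho th L Hg G Hc Hgp t ltac:(lra)). rewrite Eth in X. lra. }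
    assert (Ecos : cos (Rabs (th L - th0)) = cos al).
    { assert (X : cos (th L - th0) = cos al).
      { rewrite cos_minus, K1, K2. replace al with (th0 + al - th0) at 3 by ring. now rewrite cos_minus. }
      unfold Rabs. destruct Rcase_abs; [rewrite cos_neg|]; auto. }
    rewrite <- (acos_cos (Rabs (th L - th0))), Ecos by (split; [apply Rabs_pos|auto]). apply acos_cos; lra.
  - exists L, r, rho, th. auto.
Qed.

End Limits.

(** * Comparison of geodesics in a von Mangoldt plane *)

Section Unique.
Variable m : R -> R.
Hypothesis Hm : model_fun m.
Local Notation m1 := (Derive_n m 1).
Local Notation m2 := (Derive_n m 2).
Local Notation geo := (geo m).

Lemma geo_cont c r rho th L t : geo c r rho th L -> 0 <= t <= L -> continuous r t.
Proof. intros G Ht. destruct (G t Ht) as [_ [X _]]. exact (continuous_of_derive _ _ _ X). Qed.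

(** Gronwall's inequality for the squared difference of (r, rho). The unit speed condition
    determines only c^2, so the two curves may turn in opposite directions and the angles are
    compared in absolute value. *)
Lemma geo_unique c r rho th c' r' rho' th' L : geo c r rho th L -> geo c' r' rho' th' L ->
  r 0 = r' 0 -> rho 0 = rho' 0 ->
  forall t, 0 <= t <= L -> r t = r' t /\ rho t = rho' t /\ Rabs (th t - th 0) = Rabs (th' t - th' 0).
Proof.
  intros G G' E0 E1.
  assert (Hall : forall t, 0 <= t <= L -> c ^ 2 = c' ^ 2 /\ r t = r' t /\ rho t = rho' t).
  { intros T HT. destruct (G 0 ltac:(lra)) as [P0 [_ [_ [_ En]]]]. destruct (G' 0 ltac:(lra)) as [P0' [_ [_ [_ En']]]].
    assert (Hm0 := m_pos m Hm _ P0).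
    assert (Ec : c ^ 2 = c' ^ 2).
    { rewrite <- E0, <- E1 in En'. apply (Rmult_eq_reg_r (/ m (r 0) ^ 2)); [lra|].
      apply Rinv_neq_0_compat, pow_nonzero; lra. }
    split; auto.
    assert (Cr : forall t, 0 <= t <= T -> continuous r t) by (intros; apply (geo_cont _ _ _ _ _ t G); lra).
    assert (Cr' : forall t, 0 <= t <= T -> continuous r' t) by (intros; apply (geo_cont _ _ _ _ _ t G'); lra).
    destruct (cont_min r 0 T ltac:(lra) Cr) as [a [Ha Hamin]]. destruct (cont_max r 0 T ltac:(lra) Cr) as [b [Hb Hbmax]].
    destruct (cont_min r' 0 T ltac:(lra) Cr') as [a' [Ha' Hamin']]. destruct (cont_max r' 0 T ltac:(lra) Cr') as [b' [Hb' Hbmax']].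
    set (A := Rmin (r a) (r' a')). set (B := Rmax (r b) (r' b')).
    assert (HA : 0 < A) by (apply Rmin_glb_lt; [apply G|apply G']; lra).
    assert (HrAB : forall t, 0 <= t <= T -> A <= r t <= B).
    { intros t Ht. split; [eapply Rle_trans; [apply Rmin_l|auto]|eapply Rle_trans; [|apply Rmax_l]; auto]. }
    assert (HrAB' : forall t, 0 <= t <= T -> A <= r' t <= B).
    { intros t Ht. split; [eapply Rle_trans; [apply Rmin_r|auto]|eapply Rle_trans; [|apply Rmax_r]; auto]. }
    assert (HAB : A <= B) by (specialize (HrAB 0 ltac:(lra)); lra).
    assert (Dm := dm m Hm). assert (Dm1 := dm1 m Hm). assert (Cm := cm m Hm). assert (Cm1 := cm1 m Hm). assert (Cm2 := cm2 m Hm).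
    assert (Hmp : forall x, A <= x <= B -> 0 < m x) by (intros; apply (m_pos m Hm); lra).
    destruct (C1_lipschitz_on (fun x => m1 x / m x ^ 3)
      (fun x => (m2 x * m x ^ 3 - m1 x * (3 * m1 x * m x ^ 2)) / (m x ^ 3) ^ 2) A B HAB) as [K [HK HK']].
    { intros x Hx. specialize (Hmp x Hx). der; [apply pow_nonzero; lra|]. simpl; fieldR; lra. }
    { intros x Hx. specialize (Hmp x Hx). cont. apply pow_nonzero, pow_nonzero; lra. }
    (* In the derivative of [N] the summand 1 pays for 2 u v and c^2 K for the Lipschitz force term,
       so N' <= k N. *)
    set (k := 1 + c ^ 2 * K). assert (Hc2 := pow2_ge_0 c).
    set (N := fun t => (r t - r' t) ^ 2 + (rho t - rho' t) ^ 2).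
    assert (HN : - (N 0 * exp (- k * 0)) <= - (N T * exp (- k * T))).
    { apply (derive_le (fun t => - (N t * exp (- k * t)))
        (fun t => - ((2 * (r t - r' t) * (rho t - rho' t) + 2 * (rho t - rho' t) *
          (c ^ 2 * (m1 (r t) / m (r t) ^ 3) - c' ^ 2 * (m1 (r' t) / m (r' t) ^ 3))) * exp (- k * t)
          + N t * (- k * exp (- k * t))))); [lra| |].
      - intros t Ht. destruct (G t ltac:(lra)) as [_ [D1 [D2 _]]]. destruct (G' t ltac:(lra)) as [_ [D1' [D2' _]]].
        assert (De : is_derive (fun t => exp (- k * t)) t (- k * exp (- k * t))).
        { apply (dcomp exp (fun t => - k * t)); [apply is_derive_exp|]. der. ringR. }
        unfold N. der. simpl. ringR.
      - intros t Ht. rewrite <- Ec. assert (He := exp_pos (- k * t)).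
        assert (Hl := HK' (r t) (r' t) (HrAB t Ht) (HrAB' t Ht)).
        set (u := r t - r' t) in *. set (v := rho t - rho' t).
        replace (c ^ 2 * (m1 (r t) / m (r t) ^ 3) - c ^ 2 * (m1 (r' t) / m (r' t) ^ 3)) with
          (c ^ 2 * (m1 (r t) / m (r t) ^ 3 - m1 (r' t) / m (r' t) ^ 3)) by ring.
        set (w := m1 (r t) / m (r t) ^ 3 - m1 (r' t) / m (r' t) ^ 3) in *.
        assert (Hvw : v * w <= K * (u ^ 2 + v ^ 2) / 2).
        { eapply Rle_trans; [apply Rle_abs|]. rewrite Rabs_mult.
          apply Rle_trans with (Rabs v * (K * Rabs u)); [apply Rmult_le_compat_l; auto; apply Rabs_pos|].
          rewrite <- (pow2_abs u), <- (pow2_abs v). generalize (pow2_ge_0 (Rabs u - Rabs v)). nra. }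
        assert (EN : N t = u ^ 2 + v ^ 2) by reflexivity. rewrite EN.
        assert (Hin : 2 * u * v + 2 * v * (c ^ 2 * w) <= k * (u ^ 2 + v ^ 2)).
        { unfold k. generalize (pow2_ge_0 (u - v)). nra. }
        nra. }
    assert (N0 : N 0 = 0) by (unfold N; rewrite E0, E1; ring).
    rewrite N0, Rmult_0_l in HN. assert (He := exp_pos (- k * T)).
    assert (HNT : N T <= 0) by nra. unfold N in HNT.
    assert (S1 := pow2_ge_0 (r T - r' T)). assert (S2 := pow2_ge_0 (rho T - rho' T)).
    assert (Hsq : forall x, x ^ 2 = 0 -> x = 0) by (intros x Hx; nra).
    split; apply Rminus_diag_uniq, Hsq; lra. }
  intros t Ht. destruct (Hall t Ht) as [Ec [Er Erho]]. split; [auto|split; auto].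
  assert (Hc : c' = c \/ c' = - c) by (assert ((c' - c) * (c' + c) = 0) by nra;
    apply Rmult_integral in H; destruct H; [left|right]; lra).
  destruct Hc as [-> | ->].
  - assert (E : th 0 - th' 0 = th t - th' t).
    { apply (derive_zero (fun t => th t - th' t)); [lra|]. intros s Hs.
      destruct (G s ltac:(lra)) as [_ [_ [_ [X _]]]]. destruct (G' s ltac:(lra)) as [_ [_ [_ [Y _]]]].
      destruct (Hall s ltac:(lra)) as [_ [Es _]]. rewrite <- Es in Y. der. ringR. }
    f_equal. lra.
  - assert (E : th 0 + th' 0 = th t + th' t).
    { apply (derive_zero (fun t => th t + th' t)); [lra|]. intros s Hs.
      destruct (G s ltac:(lra)) as [_ [_ [_ [X _]]]]. destruct (G' s ltac:(lra)) as [_ [_ [_ [Y _]]]].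
      destruct (Hall s ltac:(lra)) as [_ [Es _]]. rewrite <- Es in Y. der. ringR. }
    replace (th t - th 0) with (- (th' t - th' 0)) by lra. apply Rabs_Ropp.
Qed.

(* With the angle as parameter and [P = - rho / |c|] in place of [rho]. *)
Definition graph (c : R) (rr P : R -> R) (A : R) : Prop :=
  forall t, 0 <= t <= A -> 0 < rr t /\ is_derive rr t (- (m (rr t) ^ 2 * P t)) /\
    is_derive P t (- (m1 (rr t) / m (rr t))) /\ P t ^ 2 + / m (rr t) ^ 2 = / c ^ 2.

Lemma graph_restrict c rr P A A' : A' <= A -> graph c rr P A -> graph c rr P A'.
Proof. intros H G t Ht. apply G; lra. Qed.

Lemma graph_shift c rr P A a : 0 <= a -> graph c rr P A ->
  graph c (fun t => rr (a + t)) (fun t => P (a + t)) (A - a).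
Proof.
  intros Ha G t Ht. destruct (G (a + t) ltac:(lra)) as [H1 [H2 [H3 H4]]].
  assert (Hs : is_derive (fun t => a + t) t 1) by (der; ringR).
  split; [auto|split; [|split; auto]].
  - eapply is_derive_eq; [apply (dcomp rr (fun t => a + t)); eauto|]. ringR.
  - eapply is_derive_eq; [apply (dcomp P (fun t => a + t)); eauto|]. ringR.
Qed.

(** With c <> 0 the angle moves monotonically at a rate bounded below on [0, L]; [inverse_C1]
    inverts |th - th 0|. Absolute values make geodesics turning either way comparable. *)
Lemma geo_graph c r rho th L : geo c r rho th L -> c <> 0 -> 0 < L ->
  exists rr P, graph c rr P (Rabs (th L - th 0)) /\
    forall t, 0 <= t <= L -> 0 <= Rabs (th t - th 0) <= Rabs (th L - th 0) /\
      rr (Rabs (th t - th 0)) = r t /\ P (Rabs (th t - th 0)) = - rho t / Rabs c.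
Proof.
  intros G Hc HL. assert (Hc' := Rabs_pos_lt c Hc).
  assert (Cm := cm m Hm).
  assert (Hmr : forall t, 0 <= t <= L -> 0 < m (r t)) by (intros; apply (m_pos m Hm), G; auto).
  assert (Cr : forall t, 0 <= t <= L -> continuous r t) by (intros; now apply (geo_cont _ _ _ _ _ t G)).
  assert (Cmr : forall t, 0 <= t <= L -> continuous (fun t => m (r t)) t) by (intros; apply (ccomp m r); auto).
  set (f0 := fun t => Rabs c * / m (r t) ^ 2). set (f1 := fun t => f0 (clamp 0 L t)).
  assert (Cf0 : forall t, 0 <= t <= L -> continuous f0 t).
  { intros t Ht. unfold f0. specialize (Hmr t Ht). cont. apply pow_nonzero; lra. }
  assert (Cf1 : forall t, continuous f1 t) by (apply cont_clamp; auto; lra).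
  destruct (cont_min f0 0 L ltac:(lra) Cf0) as [t0 [Ht0 Hmin]].
  assert (He : 0 < f0 t0).
  { unfold f0. apply Rmult_lt_0_compat; auto. apply Rinv_0_lt_compat, pow_lt; auto. }
  set (f := (fun t => RInt f1 0 t) : R -> R).
  assert (Df : forall t, is_derive f t (f1 t)) by (intros; now apply is_derive_RInt_cont).
  destruct (inverse_C1 f f1 (f0 t0) He Df) as [g [Hfg [Hgf Dg]]].
  { intros t. apply Hmin, clamp_in; lra. }
  assert (Ef0 : f 0 = 0) by (unfold f; now rewrite RInt_point).
  assert (Hmono : forall s t, s <= t -> f s <= f t).
  { intros s t Hst. apply (derive_le f f1); auto. intros x Hx.
    apply Rle_trans with (f0 t0); [lra|]. apply Hmin, clamp_in; lra. }
  assert (Ef : forall t, 0 <= t <= L -> f t = Rabs (th t - th 0)).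
  { intros t Ht. assert (Hft := Hmono 0 t (proj1 Ht)). rewrite Ef0 in Hft.
    assert (Hd : forall s, 0 <= s <= t -> is_derive th s (c * / m (r s) ^ 2)) by (intros; apply G; lra).
    assert (Ef1 : forall s, 0 <= s <= t -> f1 s = Rabs c * / m (r s) ^ 2).
    { intros s Hs. unfold f1, f0. now rewrite clamp_id by lra. }
    destruct (Rle_dec 0 c).
    - assert (E : th 0 - f 0 = th t - f t).
      { apply (derive_zero (fun t => th t - f t)); [lra|]. intros s Hs. assert (X := Hd s Hs). assert (Y := Df s).
        rewrite Ef1, Rabs_pos_eq in Y by auto. der. ringR. }
      rewrite Ef0 in E. rewrite Rabs_pos_eq; lra.
    - assert (E : th 0 + f 0 = th t + f t).
      { apply (derive_zero (fun t => th t + f t)); [lra|]. intros s Hs. assert (X := Hd s Hs). assert (Y := Df s).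
        rewrite Ef1, Rabs_left in Y by lra. der. ringR. }
      rewrite Ef0 in E. rewrite Rabs_left1; lra. }
  assert (Hg : forall u, 0 <= u <= Rabs (th L - th 0) -> 0 <= g u <= L).
  { intros u Hu. rewrite <- Ef in Hu by lra. split; apply Rnot_lt_le; intros Hn.
    - assert (X := derive_lt f f1 (g u) 0 Hn ltac:(auto)).
      rewrite Hfg, Ef0 in X. apply (Rlt_not_le 0 u); [apply X|lra].
      intros x Hx. apply Rlt_le_trans with (f0 t0); auto. apply Hmin, clamp_in; lra.
    - assert (X := derive_lt f f1 L (g u) Hn ltac:(auto)).
      rewrite Hfg in X. apply (Rlt_not_le u (f L)); [apply X|lra].
      intros x Hx. apply Rlt_le_trans with (f0 t0); auto. apply Hmin, clamp_in; lra. }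
  exists (fun u => r (g u)), (fun u => - rho (g u) / Rabs c). split.
  - intros u Hu. specialize (Hg u Hu). destruct (G (g u) Hg) as [H1 [H2 [H3 [H4 H5]]]].
    specialize (Hmr (g u) Hg). assert (Dgu := Dg u). unfold f1, f0 in Dgu. rewrite clamp_id in Dgu by auto.
    split; [auto|split; [|split]].
    + eapply is_derive_eq; [apply (dcomp r g); eauto|]. fieldR. split; lra.
    + eapply is_derive_eq.
      * apply (ddiv (fun u => - rho (g u)) (fun _ => Rabs c)); [|apply dconst|lra].
        apply (dopp (fun u => rho (g u))). apply (dcomp rho g); eauto.
      * rewrite <- (pow2_abs c). fieldR. split; lra.
    + rewrite <- (pow2_abs c). rewrite <- (pow2_abs c) in H5.
      replace ((- rho (g u) / Rabs c) ^ 2 + / m (r (g u)) ^ 2) with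
        ((rho (g u) ^ 2 + Rabs c ^ 2 * / m (r (g u)) ^ 2) / Rabs c ^ 2) by (field; split; lra).
      rewrite H5. field. lra.
  - intros t Ht. rewrite <- !Ef by lra. rewrite !Hgf. split; [|auto]. split.
    + rewrite <- Ef0. now apply Hmono.
    + now apply Hmono.
Qed.

End Unique.

(** * Sturm comparison with the flat plane *)

Section VonMangoldt.
Variable m : R -> R.
Hypothesis Hv : von_Mangoldt m.
Local Notation m1 := (Derive_n m 1).
Local Notation m2 := (Derive_n m 2).
Local Notation m3 := (Derive_n m 3).
Local Notation graph := (graph m).

Lemma von_Mangoldt_model : model_fun m.
Proof. apply Hv. Qed.

Let Hm : model_fun m := von_Mangoldt_model.

(* The derivative of [m'/m] with respect to [zeta], the primitive of [- 1/m^2] below. *)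
Definition slope (r : R) : R := m1 r ^ 2 - m r * m2 r.

Lemma slope_derive r : is_derive slope r (m1 r * m2 r - m r * m3 r).
Proof.
  assert (D0 := dm m Hm r). assert (D1 := dm1 m Hm r). assert (D2 := dm2 m Hm r).
  unfold slope. der. simpl; ringR.
Qed.

(** The derivative m' m'' - m m''' equals m^2 times the derivative of the curvature - m''/m. *)
Lemma slope_decr r1 r2 : 0 < r1 -> r1 <= r2 -> slope r2 <= slope r1.
Proof.
  intros H1 H2. apply Ropp_le_cancel.
  apply (derive_le (fun r => - slope r) (fun r => - (m1 r * m2 r - m r * m3 r))); auto.
  - intros r _. assert (X := slope_derive r). der. ringR.
  - intros r Hr. assert (Hmr := m_pos m Hm r ltac:(lra)).
    assert (D0 := dm m Hm r). assert (D1 := dm1 m Hm r). assert (D2 := dm2 m Hm r).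
    assert (H : 0 <= (m3 r * m r - m2 r * m1 r) / m r ^ 2).
    { apply (derive_right_nonneg (fun r => m2 r / m r) r (r + 1)); [lra| |].
      - der; [lra|]. ringR.
      - intros x Hx. assert (X := proj2 Hv r x ltac:(lra) (proj1 Hx)). unfold curv in X.
        unfold Rdiv in *. lra. }
    apply Rle_div_r in H; [|apply pow_lt; lra]. lra.
Qed.

(** At the pole the slope is m'(0)^2 = 1, and it does not increase from there. *)
Lemma slope_le1 r : 0 < r -> slope r <= 1.
Proof.
  intros Hr. apply le_epsilon. intros e He.
  assert (C := continuous_of_derive _ _ _ (slope_derive 0)).
  destruct (proj1 (continuous_eps _ _) C e He) as [d [Hd H]].
  set (s := Rmin r (d / 2)). assert (Hs : 0 < s) by (apply Rmin_glb_lt; lra).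
  assert (S1 : s <= r) by apply Rmin_l. assert (S2 : s <= d / 2) by apply Rmin_r.
  specialize (H s). rewrite Rminus_0_r, Rabs_pos_eq in H by lra. specialize (H ltac:(lra)).
  assert (E : slope 0 = 1) by (unfold slope; rewrite (m1_0 m Hm), (m_0 m Hm); ring).
  rewrite E in H. apply Rabs_def2 in H. assert (X := slope_decr s r Hs S1). lra.
Qed.

Section Base.
Variable R0 : R.
Hypothesis HR0 : 0 < R0.

(** In the flat plane this is 1/r - 1/R0, in terms of which straight lines are sinusoids in the
    angle. *)
Definition zeta (r : R) : R := - RInt (fun x => / m x ^ 2) R0 r.

Lemma zeta_derive r : 0 < r -> is_derive zeta r (- / m r ^ 2).
Proof.
  intros Hr. unfold zeta. apply (dopp (fun r => RInt (fun x => / m x ^ 2) R0 r)).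
  assert (C : forall x, 0 < x -> continuous (fun x => / m x ^ 2) x).
  { intros x Hx. assert (Cm := cm m Hm x). assert (Hmx := m_pos m Hm x Hx). cont. apply pow_nonzero; lra. }
  apply (is_derive_RInt (fun x => / m x ^ 2) _ R0); [|now apply C].
  exists (mkposreal r Hr). intros y Hy. change (Rabs (y - r) < r) in Hy. apply Rabs_def2 in Hy.
  apply (RInt_correct (fun x => / m x ^ 2)). apply (ex_RInt_continuous (fun x => / m x ^ 2)).
  intros z Hz. apply C. apply Rlt_le_trans with (Rmin R0 y); [apply Rmin_glb_lt; lra|apply Hz].
Qed.

Lemma zeta_R0 : zeta R0 = 0.
Proof. unfold zeta. rewrite RInt_point. apply Ropp_0. Qed.

Lemma zeta_decr r1 r2 : 0 < r1 -> r1 < r2 -> zeta r2 < zeta r1.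
Proof.
  intros H1 H2. apply Ropp_lt_cancel.
  apply (derive_lt (fun r => - zeta r) (fun r => / m r ^ 2)); auto.
  - intros x Hx. assert (X := zeta_derive x ltac:(lra)). der. ringR.
  - intros x Hx. apply Rinv_0_lt_compat, pow_lt, (m_pos m Hm). lra.
Qed.

Lemma zeta_le r1 r2 : 0 < r1 -> 0 < r2 -> zeta r2 <= zeta r1 -> r1 <= r2.
Proof.
  intros H1 H2 H. apply Rnot_lt_le. intros Hn. assert (X := zeta_decr r2 r1 H2 Hn). lra.
Qed.

(** Along a geodesic P' = - m'/m = - (zeta + excess), an oscillator perturbed by [excess]. The
    perturbation is constant in the flat plane, and in general its derivative with respect to - zeta
    is 1 - slope >= 0. *)
Definition excess (r : R) : R := m1 r / m r - zeta r.

Lemma excess_derive r : 0 < r -> is_derive excess r ((1 - slope r) / m r ^ 2).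
Proof.
  intros Hr. assert (Hmr := m_pos m Hm r Hr).
  assert (D0 := dm m Hm r). assert (D1 := dm1 m Hm r). assert (D2 := zeta_derive r Hr).
  unfold excess. der; [lra|]. unfold slope. fieldR. lra.
Qed.

Lemma excess_growth r1 r2 a : 0 < r1 -> r1 <= r2 -> (forall r, r1 <= r <= r2 -> a <= 1 - slope r) ->
  a * (zeta r1 - zeta r2) <= excess r2 - excess r1.
Proof.
  intros H1 H2 Ha.
  cut (excess r1 + a * zeta r1 <= excess r2 + a * zeta r2); [lra|].
  apply (derive_le (fun r => excess r + a * zeta r) (fun r => (1 - slope r - a) / m r ^ 2)); auto.
  - intros r Hr. assert (Hmr := m_pos m Hm r ltac:(lra)).
    assert (X := excess_derive r ltac:(lra)). assert (Y := zeta_derive r ltac:(lra)). der. fieldR. lra.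
  - intros r Hr. specialize (Ha r Hr). apply Rdiv_le_0_compat; [lra|]. apply pow_lt, (m_pos m Hm). lra.
Qed.

Lemma excess_incr r1 r2 : 0 < r1 -> r1 <= r2 -> excess r1 <= excess r2.
Proof.
  intros H1 H2. assert (X := excess_growth r1 r2 0 H1 H2).
  cut (0 * (zeta r1 - zeta r2) <= excess r2 - excess r1); [lra|]. apply X.
  intros r Hr. assert (Y := slope_le1 r ltac:(lra)). lra.
Qed.

Lemma graph_zeta c rr P A t : graph c rr P A -> 0 <= t <= A -> is_derive (fun t => zeta (rr t)) t (P t).
Proof.
  intros G Ht. destruct (G t Ht) as [H1 [H2 _]].
  eapply is_derive_eq; [apply (dcomp zeta rr); [now apply zeta_derive|exact H2]|].
  assert (Hmr := m_pos m Hm _ H1). fieldR. lra.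
Qed.

Section Compare.
Variables (c0 c1 : R) (rr0 P0 rr1 P1 : R -> R) (A : R).
Hypotheses (G0 : graph c0 rr0 P0 A) (G1 : graph c1 rr1 P1 A) (HA : A < PI)
  (E0 : rr0 0 = R0) (E1 : rr1 0 = R0) (HP : P1 0 < P0 0).

Local Notation w := (fun t => zeta (rr0 t) - zeta (rr1 t)).

Lemma compare_w t : 0 <= t <= A -> is_derive w t (P0 t - P1 t).
Proof. intros Ht. apply dminus; eapply graph_zeta; eauto. Qed.

(** The difference [w] of the two zetas solves w'' = - w + f with the forcing f = excess (rr1) -
    excess (rr0), which is nonnegative wherever w is, because [zeta] decreases and [excess]
    increases. *)
Lemma compare_dP t : 0 <= t <= A -> is_derive (fun t => P0 t - P1 t) t
  (excess (rr1 t) - excess (rr0 t) - w t).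
Proof.
  intros Ht. destruct (G0 t Ht) as [_ [_ [X _]]]. destruct (G1 t Ht) as [_ [_ [Y _]]].
  der. unfold excess. ringR.
Qed.

Lemma compare_excess t : 0 <= t <= A -> 0 <= w t -> excess (rr0 t) <= excess (rr1 t).
Proof.
  intros Ht Hw. destruct (G0 t Ht) as [X _]. destruct (G1 t Ht) as [Y _].
  apply excess_incr; auto. apply zeta_le; auto; lra.
Qed.

(** Variation of constants: w' sin (B - s) + w cos (B - s) has derivative f sin (B - s), nonnegative
    because B < PI, and it runs from (P0 0 - P1 0) sin B to w B. *)
Lemma compare_lower B : 0 <= B <= A -> (forall t, 0 <= t <= B -> 0 <= w t) -> (P0 0 - P1 0) * sin B <= w B.
Proof.
  intros HB Hw.
  assert (X := derive_le (fun s => (P0 s - P1 s) * sin (B - s) + w s * cos (B - s))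
    (fun s => (excess (rr1 s) - excess (rr0 s)) * sin (B - s)) 0 B (proj1 HB)).
  cbv beta in X. rewrite !Rminus_0_r, Rminus_eq_0, sin_0, cos_0, E0, E1 in X.
  cut ((P0 0 - P1 0) * sin B + (zeta R0 - zeta R0) * cos B <= (P0 B - P1 B) * 0 + w B * 1); [lra|].
  apply X.
  - intros s Hs. assert (Y := compare_w s ltac:(lra)). assert (Z := compare_dP s ltac:(lra)).
    assert (S : is_derive (fun s => B - s) s (-1)) by (der; ringR).
    eapply is_derive_eq.
    + apply (dplus (fun s => (P0 s - P1 s) * sin (B - s)) (fun s => w s * cos (B - s))).
      * apply (dmult (fun s => P0 s - P1 s) (fun s => sin (B - s))); [exact Z|]. apply (dsin (fun s => B - s)); exact S.
      * apply (dmult w (fun s => cos (B - s))); [exact Y|]. apply (dcos (fun s => B - s)); exact S.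
    + cbv beta. ringR.
  - intros s Hs. apply Rmult_le_pos.
    + assert (Y := compare_excess s ltac:(lra) (Hw s Hs)). lra.
    + apply sin_ge_0; lra.
Qed.

(* Because the slope of [m'/m] is at most 1, two geodesics issuing from one point separate at
   least as fast as in the flat plane, so they do not meet again before the opposite meridian. *)
Lemma compare t : 0 <= t <= A -> (P0 0 - P1 0) * sin t <= w t.
Proof.
  intros Ht. apply compare_lower; auto. intros s Hs.
  destruct (Req_dec s 0) as [->|Hs0]; [rewrite E0, E1; lra|].
  apply Rnot_lt_le. intros Hn.
  destruct (first_zero w 0 s) as [z [Hz [Ez Hlt]]].
  - lra.
  - intros x Hx. eapply continuous_of_derive. apply compare_w; lra.
  - destruct (derive_pos_right w 0 _ (compare_w 0 ltac:(lra))) as [d [Hd Hd']]; [lra|].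
    exists d. split; auto. intros x Hx. specialize (Hd' x Hx). rewrite E0, E1 in Hd'. lra.
  - lra.
  (* Up to its first zero [z] the difference is nonnegative, so [compare_lower] applies on [0, z]
     and gives a positive lower bound for its value at [z]. *)
  - assert (X := compare_lower z ltac:(lra)). cbv beta in Ez, X. rewrite Ez in X.
    assert (Y : (P0 0 - P1 0) * sin z <= 0).
    { apply X. intros u Hu. destruct (Req_dec u 0) as [->|]; [rewrite E0, E1; lra|].
      destruct (Req_dec u z) as [->|]; [lra|]. specialize (Hlt u ltac:(lra)). lra. }
    assert (0 < sin z) by (apply sin_gt_0; lra). nra.
Qed.

Lemma compare_pos t : 0 < t <= A -> rr0 t < rr1 t.
Proof.
  intros Ht. assert (X := compare t ltac:(lra)). assert (0 < sin t) by (apply sin_gt_0; lra).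
  destruct (G0 t ltac:(lra)) as [Y _]. destruct (G1 t ltac:(lra)) as [Z _].
  apply Rnot_le_lt. intros Hn. destruct (Rle_lt_or_eq_dec _ _ Hn) as [Hl|He].
  - assert (W := zeta_decr _ _ Z Hl). cbv beta in X. nra.
  - cbv beta in X. rewrite He in X. nra.
Qed.

(** The Wronskian of [w] with the solution sin of the unforced oscillator; its derivative is the
    forcing times sin. *)
Definition wronskian (t : R) : R := (P0 t - P1 t) * sin t - w t * cos t.

Lemma wronskian_growth s t a : 0 <= s -> s <= t -> t <= A ->
  (forall u, s <= u <= t -> a <= (excess (rr1 u) - excess (rr0 u)) * sin u) ->
  a * (t - s) <= wronskian t - wronskian s.
Proof.
  intros Hs Hst Ht Ha.
  cut (wronskian s - a * s <= wronskian t - a * t); [lra|].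
  apply (derive_le (fun u => wronskian u - a * u) (fun u => (excess (rr1 u) - excess (rr0 u)) * sin u - a)); auto.
  - intros u Hu. assert (Y := compare_w u ltac:(lra)). assert (Z := compare_dP u ltac:(lra)).
    unfold wronskian. eapply is_derive_eq.
    + apply (dminus (fun u => (P0 u - P1 u) * sin u - w u * cos u) (fun u => a * u)).
      * apply (dminus (fun u => (P0 u - P1 u) * sin u) (fun u => w u * cos u)).
        -- apply (dmult (fun s => P0 s - P1 s) (fun s => sin s)); [exact Z|]. apply (dsin (fun s => s)); apply did.
        -- apply (dmult w (fun s => cos s)); [exact Y|]. apply (dcos (fun s => s)); apply did.
      * apply (dmult (fun _ => a) (fun u => u)); [apply dconst|apply did].
    + cbv beta. ringR.
  - intros u Hu. specialize (Ha u Hu). lra.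
Qed.

Lemma compare_excess_sin t : 0 <= t <= A -> 0 <= (excess (rr1 t) - excess (rr0 t)) * sin t.
Proof.
  intros Ht. assert (0 <= sin t) by (apply sin_ge_0; lra). apply Rmult_le_pos; auto.
  assert (X := compare t Ht). assert (0 <= w t) by (cbv beta in *; nra).
  assert (Y := compare_excess t Ht H0). lra.
Qed.

End Compare.
End Base.
End VonMangoldt.

(** * The geodesic in the direction of the parallel *)

Section Parallel.
Variable m : R -> R.
Hypothesis Hm : model_fun m.
Local Notation m1 := (Derive_n m 1).
Local Notation geo := (geo m).

Lemma geo_shift c r rho th L a : 0 <= a -> geo c r rho th L ->
  geo c (fun t => r (a + t)) (fun t => rho (a + t)) (fun t => th (a + t)) (L - a).
Proof.
  intros Ha G t Ht. destruct (G (a + t) ltac:(lra)) as [H1 [H2 [H3 [H4 H5]]]].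
  assert (Hs : is_derive (fun t => a + t) t 1) by (der; ringR).
  split; [auto|split; [|split; [|split; auto]]].
  - eapply is_derive_eq; [apply (dcomp r (fun t => a + t)); eauto|]. ringR.
  - eapply is_derive_eq; [apply (dcomp rho (fun t => a + t)); eauto|]. ringR.
  - eapply is_derive_eq; [apply (dcomp th (fun t => a + t)); eauto|]. ringR.
Qed.

(** On the overlap [a, b] the two descriptions coincide by [geo_unique]. Because the overlap has
    positive length, each derivative of the glued functions can be taken from a single one of
    them. *)
Lemma geo_extend (g : curve) c r rho th b a l : 0 <= a < b -> b < a + l -> geo c r rho th b ->
  (forall t, 0 <= t <= b -> g t = polar (r t) (th t)) ->
  seg m g a (a + l) -> (forall t, a <= t <= a + l -> 0 < rad (g t)) ->
  exists r' rho' th', geo c r' rho' th' (a + l) /\ th' 0 = th 0 /\ rho' 0 = rho 0 /\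
    forall t, 0 <= t <= a + l -> g t = polar (r' t) (th' t).
Proof.
  intros Ha Hb G Hg Hs Hpos.
  set (ga := fun t => g (a + t)).
  assert (Hsa : seg m ga 0 l).
  { intros s t H1 H2. unfold ga. rewrite Hs by lra. f_equal. ring. }
  assert (Gs := geo_shift c r rho th b a (proj1 Ha) G).
  assert (Hgs : forall t, 0 <= t <= b - a -> ga t = polar (r (a + t)) (th (a + t))) by (intros; apply Hg; lra).
  assert (Hia : init m ga (rho a) c).
  { exists (b - a), (fun t => r (a + t)), (fun t => rho (a + t)), (fun t => th (a + t)).
    split; [lra|split; [auto|split; [f_equal; ring|auto]]]. }
  assert (Era : rad (ga 0) = r a).
  { rewrite Hgs, Rplus_0_r by lra. apply rad_polar. left; apply G; lra. }
  destruct (seg_geo m Hm ga l (th a)) with (x := rho a) (c := c) as [r2 [rho2 [th2 [G2 [Eth [Erho Hg2]]]]]]; auto.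
  { lra. }
  { intros t Ht. apply Hpos. lra. }
  { rewrite Era. rewrite Hgs by lra. now rewrite Rplus_0_r. }
  assert (Er2 : r2 0 = r a).
  { rewrite <- Era, Hg2, rad_polar by (try lra; left; apply G2; lra). auto. }
  assert (Hu : forall t, 0 <= t <= b - a -> r (a + t) = r2 t /\ rho (a + t) = rho2 t /\ th (a + t) = th2 t).
  { intros t Ht.
    assert (G2' : geo c r2 rho2 th2 (b - a)) by (apply (geo_restrict m _ _ _ _ l); auto; lra).
    assert (U := geo_unique m Hm _ _ _ _ _ _ _ _ _ Gs G2'). cbv beta in U. rewrite Rplus_0_r in U.
    assert (U' := U (eq_sym Er2) (eq_sym Erho)).
    destruct (U' t Ht) as [U1 [U2 _]]. split; [auto|split; auto].
    assert (E : th (a + 0) - th2 0 = th (a + t) - th2 t).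
    { apply (derive_zero (fun t => th (a + t) - th2 t)); [lra|]. intros s Hs'.
      destruct (Gs s ltac:(lra)) as [_ [_ [_ [X _]]]]. destruct (G2' s ltac:(lra)) as [_ [_ [_ [Y _]]]].
      destruct (U' s ltac:(lra)) as [Es _]. rewrite <- Es in Y. eapply is_derive_eq; [apply dminus; eauto|]. ringR. }
    rewrite Rplus_0_r, Eth in E. lra. }
  set (glue := fun (f f2 : R -> R) t => if Rle_dec t a then f t else f2 (t - a)).
  assert (Gl : forall f f2 : R -> R, (forall t, 0 <= t <= b - a -> f (a + t) = f2 t) -> forall t, t <= b -> glue f f2 t = f t).
  { intros f f2 H t Ht. unfold glue. destruct Rle_dec; auto. rewrite <- H by lra. f_equal. ring. }
  assert (Gr : forall f f2 : R -> R, (forall t, 0 <= t <= b - a -> f (a + t) = f2 t) -> forall t, a <= t -> glue f f2 t = f2 (t - a)).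
  { intros f f2 H t Ht. unfold glue. destruct Rle_dec; auto. replace t with (a + (t - a)) at 1 by ring. apply H; lra. }
  assert (Gd : forall (f f2 : R -> R) t l0, (forall t, 0 <= t <= b - a -> f (a + t) = f2 t) ->
     (t < b -> is_derive f t l0) -> (a < t -> is_derive f2 (t - a) l0) -> is_derive (glue f f2) t l0).
  { intros f f2 t l0 H H1 H2. destruct (Rlt_dec t b).
    - apply (is_derive_ext_near f _ _ _ (b - t)); [lra| |auto].
      intros y Hy. apply Rabs_def2 in Hy. symmetry. apply Gl; auto; lra.
    - apply (is_derive_ext_near (fun y => f2 (y - a)) _ _ _ (t - a)); [lra| |].
      + intros y Hy. apply Rabs_def2 in Hy. symmetry. apply Gr; auto; lra.
      + eapply is_derive_eq; [apply (dcomp f2 (fun y => y - a)); [apply H2; lra|]|].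
        * repeat der_step.
        * ringR. }
  assert (Ur : forall t, 0 <= t <= b - a -> r (a + t) = r2 t) by (intros; apply Hu; auto).
  assert (Urho : forall t, 0 <= t <= b - a -> rho (a + t) = rho2 t) by (intros; apply Hu; auto).
  assert (Uth : forall t, 0 <= t <= b - a -> th (a + t) = th2 t) by (intros; apply Hu; auto).
  exists (glue r r2), (glue rho rho2), (glue th th2). split; [|split; [|split]].
  - intros t Ht.
    assert (Hcase : glue r r2 t = r t /\ glue rho rho2 t = rho t /\ t <= b \/
      glue r r2 t = r2 (t - a) /\ glue rho rho2 t = rho2 (t - a) /\ a <= t).
    { destruct (Rle_dec t b); [left|right]; (split; [|split]); try (apply Gl; auto; lra); try (apply Gr; auto; lra); lra. }
    assert (V1 : t <= b -> glue r r2 t = r t) by (intros; apply Gl; auto).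
    assert (V2 : a <= t -> glue r r2 t = r2 (t - a)) by (intros; apply Gr; auto).
    assert (W1 : t <= b -> glue rho rho2 t = rho t) by (intros; apply Gl; auto).
    assert (W2 : a <= t -> glue rho rho2 t = rho2 (t - a)) by (intros; apply Gr; auto).
    split; [|split; [|split; [|split]]].
    + destruct Hcase as [[-> [_ H]]|[-> [_ H]]]; [apply G|apply G2]; lra.
    + apply Gd; auto; intros H; [rewrite W1 by lra; apply G|rewrite W2 by lra; apply G2]; lra.
    + apply Gd; auto; intros H; [rewrite V1 by lra; apply G|rewrite V2 by lra; apply G2]; lra.
    + apply Gd; auto; intros H; [rewrite V1 by lra; apply G|rewrite V2 by lra; apply G2]; lra.
    + destruct Hcase as [[-> [-> H]]|[-> [-> H]]]; [apply G|apply G2]; lra.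
  - apply Gl; auto; lra.
  - apply Gl; auto; lra.
  - intros t Ht. destruct (Rle_dec t b).
    + rewrite !Gl by auto. apply Hg; lra.
    + rewrite !Gr by (auto; lra). rewrite <- Hg2 by lra. unfold ga. f_equal. ring.
Qed.

Variables (g : curve) (q : pt) (th0 : R).
Hypotheses (Hg : geodesic m g) (Hg0 : g 0 = q) (Hq : 0 < rad q) (Eq : q = polar (rad q) th0)
  (Hvel : rvel g 0 (e_theta m q)).
Local Notation c := (m (rad q)).

Definition good (b : R) : Prop := exists r rho th, geo c r rho th b /\ th 0 = th0 /\ rho 0 = 0 /\
  forall t, 0 <= t <= b -> g t = polar (r t) (th t).

Lemma geodesic_seg t : 0 <= t -> exists e, 0 < e /\ forall a b, 0 <= a -> t - e < a -> b < t + e -> seg m g a b.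
Proof.
  intros Ht. destruct (Hg t Ht) as [e [He H]]. exists e. split; auto. intros a b H0 Ha Hb s s' Hs Hs'.
  specialize (H s s' ltac:(lra) ltac:(lra) ltac:(apply Rabs_def1; lra) ltac:(apply Rabs_def1; lra)).
  apply (D_eq m), H.
Qed.

Lemma good_start : exists b, 0 < b /\ good b.
Proof.
  destruct (geodesic_seg 0 (Rle_refl 0)) as [e [He H]].
  set (h := Rmin (e / 2) (rad q / 2)). assert (Hh : 0 < h) by (apply Rmin_glb_lt; lra).
  assert (h <= e / 2) by apply Rmin_l. assert (h <= rad q / 2) by apply Rmin_r.
  assert (Hs : seg m g 0 h) by (apply H; lra).
  assert (Hm0 := m_pos m Hm (rad q) Hq).
  destruct (seg_init m Hm g h Hh Hs) as [x [c' Hi]]; [now rewrite Hg0|].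
  assert (E0 : g 0 = polar (rad (g 0)) th0) by now rewrite Hg0.
  destruct (seg_geo m Hm g h th0 Hh Hs) with (x := x) (c := c') as [r [rho [th [G [Eth [Ex Hgp]]]]]]; auto.
  { intros t Ht. assert (X := seg_cont_rad m Hm g h t Hs Ht). rewrite Hg0 in X. apply Rabs_le_between in X. lra. }
  assert (V := proj1 (init_rvel m Hm g x c' th0 ltac:(now rewrite Hg0) E0 Hi _) Hvel).
  rewrite Hg0 in V. unfold e_theta in V.
  assert (Q1 : fst q = rad q * cos th0) by exact (f_equal fst Eq).
  assert (Q2 : snd q = rad q * sin th0) by exact (f_equal snd Eq).
  rewrite Q1, Q2 in V. injection V as V1 V2. set (R0 := rad q) in *.
  assert (X := cos2_sin2 th0). set (A := cos th0) in *. set (B := sin th0) in *.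
  set (k := c' * / m R0 * (R0 / m R0)) in *.
  assert (V1' : - (R0 * B) / m R0 = x * A - k * B) by (rewrite V1; unfold k; ring).
  assert (V2' : R0 * A / m R0 = x * B + k * A) by (rewrite V2; unfold k; ring).
  (* Rotation by - th0 separates the radial component of the prescribed velocity, which is 0, from
     the angular one, which determines the momentum. *)
  assert (Ex0 : x = 0).
  { transitivity (x * (A ^ 2 + B ^ 2)); [rewrite X; ring|].
    transitivity (A * (x * A - k * B) + B * (x * B + k * A)); [ring|]. rewrite <- V1', <- V2'. field. lra. }
  assert (Ek : k = R0 / m R0).
  { transitivity (k * (A ^ 2 + B ^ 2)); [rewrite X; ring|].
    transitivity (- B * (x * A - k * B) + A * (x * B + k * A)); [ring|]. rewrite <- V1', <- V2'.
    transitivity ((A ^ 2 + B ^ 2) * (R0 / m R0)); [field; lra|rewrite X; ring]. }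
  assert (Ec : c' = m R0).
  { assert (Ek' : c' * (R0 / (m R0 * m R0)) = m R0 * (R0 / (m R0 * m R0))).
    { transitivity k; [unfold k; field; lra|rewrite Ek; field; lra]. }
    apply Rmult_eq_reg_r in Ek'; auto. apply Rgt_not_eq, Rdiv_lt_0_compat; nra. }
  exists h. split; auto. exists r, rho, th.
  change (m R0) with (m (rad q)) in Ec. rewrite <- Ec. split; [auto|split; [auto|split; [lra|auto]]].
Qed.

Lemma good_restrict b b' : b' <= b -> good b -> good b'.
Proof.
  intros H [r [rho [th [G [E1 [E2 Hgp]]]]]]. exists r, rho, th.
  split; [apply (geo_restrict m _ _ _ _ b); auto|split; [auto|split; [auto|]]]. intros t Ht; apply Hgp; lra.
Qed.

(** Clairaut's relation keeps m (r) above the momentum, and m is small near the pole. The bound does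
    not depend on [b], which allows continuation past a supremum of good times. *)
Lemma clairaut_rmin : exists rmin, 0 < rmin /\ forall b, good b -> forall t, 0 <= t <= b -> rmin <= rad (g t).
Proof.
  assert (Hc : 0 < c) by now apply (m_pos m Hm).
  destruct (proj1 (continuous_eps m 0) (cm m Hm 0) c Hc) as [d [Hd H]].
  exists d. split; auto. intros b [r [rho [th [G [_ [_ Hgp]]]]]] t Ht. apply Rnot_lt_le. intros Hn.
  destruct (G t Ht) as [H1 [_ [_ [_ H5]]]]. rewrite Hgp, rad_polar in Hn by lra.
  specialize (H (r t)). rewrite Rminus_0_r, (m_0 m Hm), Rminus_0_r, Rabs_pos_eq in H by lra.
  specialize (H Hn). assert (Hmr := m_pos m Hm _ H1). rewrite Rabs_pos_eq in H by lra.
  assert (c ^ 2 * / m (r t) ^ 2 <= 1) by (generalize (pow2_ge_0 (rho t)); lra).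
  apply Rle_div_l in H0; [|apply pow_lt; lra]. nra.
Qed.

Lemma good_all b : good b.
Proof.
  apply NNPP. intros Hb. destruct good_start as [b0 [Hb0 Hgb0]]. destruct clairaut_rmin as [rm [Hrm Hmin]].
  assert (Hlt : forall x, good x -> x < b) by (intros x Hx; apply Rnot_le_lt; intros Hn; apply Hb, (good_restrict x); auto).
  destruct (completeness good) as [s [Hs1 Hs2]].
  { exists b. intros x Hx. left; auto. }
  { now exists b0. }
  assert (Hs0 : b0 <= s) by now apply Hs1.
  assert (Hbelow : forall x, x < s -> good x).
  { intros x Hx. apply NNPP. intros Hn. assert (s <= x); [|lra]. apply Hs2. intros y Hy.
    apply Rnot_lt_le. intros Hxy. apply Hn, (good_restrict y); auto; lra. }
  destruct (geodesic_seg s ltac:(lra)) as [e [He H]].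
  (* The window of length [l] centred at [s] is short enough for [g] to minimize on it, for the pole
     to be out of reach, and for it to begin after time 0. *)
  set (l := Rmin (e / 2) (Rmin (rm / 2) (b0 / 2))).
  assert (Hl : 0 < l) by (repeat apply Rmin_glb_lt; lra).
  assert (L1 : l <= e / 2) by apply Rmin_l.
  assert (L2 : l <= rm / 2) by (eapply Rle_trans; [apply Rmin_r|apply Rmin_l]).
  assert (L3 : l <= b0 / 2) by (eapply Rle_trans; [apply Rmin_r|apply Rmin_r]).
  assert (Hseg : seg m g (s - l / 2) (s - l / 2 + l)) by (apply H; lra).
  destruct (Hbelow (s - l / 4) ltac:(lra)) as [r [rho [th [G [E1 [E2 Hgp]]]]]].
  destruct (geo_extend g c r rho th (s - l / 4) (s - l / 2) l) as [r' [rho' [th' [G' [F1 [F2 Hgp']]]]]]; auto; try lra.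
  - intros t Ht. assert (X := Hmin (s - l / 4) (Hbelow (s - l / 4) ltac:(lra)) (s - l / 2) ltac:(lra)).
    assert (Y := D_rad m Hm (g t) (g (s - l / 2))). rewrite Hseg in Y by lra.
    rewrite (Rabs_pos_eq (t - _)) in Y by lra. apply Rabs_le_between in Y. lra.
  - assert (good (s - l / 2 + l)) by (exists r', rho', th'; split; [auto|split; [lra|split; [lra|auto]]]).
    apply Hs1 in H0. lra.
Qed.

(** [good_all] yields functions that depend on the end time. Global ones are obtained by integrating
    the equations along the radius of [g], which is known for all times, and are then identified
    with the local ones. *)
Theorem parallel_geodesic : exists r rho th, (forall L, geo c r rho th L) /\ r 0 = rad q /\ rho 0 = 0 /\ th 0 = th0 /\
  forall t, 0 <= t -> g t = polar (r t) (th t).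
Proof.
  set (rg := fun t => rad (g (Rmax 0 t))).
  assert (Hc : 0 < c) by now apply (m_pos m Hm).
  destruct clairaut_rmin as [rm [Hrm Hmin]].
  assert (Hrg : forall t, 0 < rg t).
  { intros t. assert (X := Hmin (Rmax 0 t) (good_all _) (Rmax 0 t) ltac:(split; [apply Rmax_l|lra])).
    unfold rg. lra. }
  assert (Crg : forall t, continuous rg t).
  { intros t0. apply (continuous_ext_near (fun t => rad (g (clamp 0 (Rabs t0 + 1) t))) _ _ 1 Rlt_0_1).
    - intros y Hy. unfold rg, clamp. rewrite Rmin_left; auto. apply Rabs_def2 in Hy. generalize (Rle_abs t0); lra.
    - assert (Hb : 0 <= Rabs t0 + 1) by (generalize (Rabs_pos t0); lra).
      destruct (good_all (Rabs t0 + 1)) as [r [rho [th [G [_ [_ Hgp]]]]]].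
      apply (continuous_ext (fun t => r (clamp 0 (Rabs t0 + 1) t))).
      + intros t. assert (Ht := clamp_in 0 (Rabs t0 + 1) t Hb). rewrite Hgp by auto.
        rewrite rad_polar; auto. left; apply G; auto.
      + apply cont_clamp; auto. intros x Hx. apply (geo_cont m _ _ _ _ _ x G Hx). }
  assert (Cm := cm m Hm). assert (Cm1 := cm1 m Hm).
  assert (Hmr : forall t, 0 < m (rg t)) by (intros; now apply (m_pos m Hm)).
  assert (Cmr : forall t, continuous (fun t => m (rg t)) t) by (intros; now apply (ccomp m rg)).
  assert (Cm1r : forall t, continuous (fun t => m1 (rg t)) t) by (intros; now apply (ccomp m1 rg)).
  set (f2 := fun t => c ^ 2 * (m1 (rg t) / m (rg t) ^ 3)). set (f1 := fun t => c * / m (rg t) ^ 2).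
  assert (Cf2 : forall t, continuous f2 t) by (intros t; specialize (Hmr t); unfold f2; cont; apply pow_nonzero; lra).
  assert (Cf1 : forall t, continuous f1 t) by (intros t; specialize (Hmr t); unfold f1; cont; apply pow_nonzero; lra).
  set (rho := (fun t => RInt f2 0 t) : R -> R).
  assert (Drho : forall t, is_derive rho t (f2 t)) by (intros; now apply is_derive_RInt_cont).
  assert (Crho : forall t, continuous rho t) by (intros; eapply continuous_of_derive, Drho).
  set (r := (fun t => rad q + RInt rho 0 t) : R -> R). set (th := (fun t => th0 + RInt f1 0 t) : R -> R).
  assert (Dr : forall t, is_derive r t (rho t)).
  { intros t. eapply is_derive_eq; [apply (dplus (fun _ => rad q) (fun t => RInt rho 0 t)); [apply dconst|now apply is_derive_RInt_cont]|ringR]. }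
  assert (Dth : forall t, is_derive th t (f1 t)).
  { intros t. eapply is_derive_eq; [apply (dplus (fun _ => th0) (fun t => RInt f1 0 t)); [apply dconst|now apply is_derive_RInt_cont]|ringR]. }
  assert (Z : forall f : R -> R, RInt f 0 0 = 0) by (intros f; now rewrite RInt_point).
  assert (Ez : rho 0 = 0 /\ r 0 = rad q /\ th 0 = th0) by (unfold rho, r, th; rewrite !Z; lra).
  assert (Hall : forall t, 0 <= t -> r t = rg t /\ rho t ^ 2 + c ^ 2 * / m (r t) ^ 2 = 1 /\ g t = polar (r t) (th t)).
  { intros t Ht. destruct (good_all t) as [r' [rho' [th' [G [E1 [E2 Hgp]]]]]].
    assert (Er' : forall s, 0 <= s <= t -> r' s = rg s).
    { intros s Hs. unfold rg. rewrite Rmax_right by lra. rewrite Hgp, rad_polar; auto. left; apply G; auto. }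
    assert (Erho : forall s, 0 <= s <= t -> rho s = rho' s).
    { intros s Hs. assert (E : rho 0 - rho' 0 = rho s - rho' s).
      { apply (derive_zero (fun s => rho s - rho' s)); [lra|]. intros u Hu.
        destruct (G u ltac:(lra)) as [_ [_ [X _]]]. rewrite Er' in X by lra.
        eapply is_derive_eq; [apply dminus; [apply Drho|exact X]|]. unfold f2. ringR. }
      lra. }
    assert (Err : r t = r' t).
    { assert (E : r 0 - r' 0 = r t - r' t).
      { apply (derive_zero (fun s => r s - r' s)); [lra|]. intros u Hu.
        destruct (G u ltac:(lra)) as [_ [X _]]. eapply is_derive_eq; [apply dminus; [apply Dr|exact X]|].
        rewrite Erho by lra. ringR. }
      assert (r' 0 = rad q) by (rewrite Er' by lra; unfold rg; rewrite Rmax_left, Hg0; lra). lra. }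
    assert (Eth : th t = th' t).
    { assert (E : th 0 - th' 0 = th t - th' t).
      { apply (derive_zero (fun s => th s - th' s)); [lra|]. intros u Hu.
        destruct (G u ltac:(lra)) as [_ [_ [_ [X _]]]]. rewrite Er' in X by lra.
        eapply is_derive_eq; [apply dminus; [apply Dth|exact X]|]. unfold f1. ringR. }
      lra. }
    split; [rewrite Err; apply Er'; lra|]. rewrite Err, Eth, Erho by lra. split; [apply G; lra|apply Hgp; lra]. }
  exists r, rho, th. split; [|split; [apply Ez|split; [apply Ez|split; [apply Ez|intros t Ht; apply Hall; auto]]]].
  intros L t Ht. destruct (Hall t (proj1 Ht)) as [E1 [E2 _]].
  split; [rewrite E1; auto|split; [auto|split; [|split; auto]]].
  - rewrite E1. apply Drho.
  - rewrite E1. apply Dth.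
Qed.

End Parallel.

(** * The turn angle of the parallel geodesic *)

Lemma sin_pos_min a b : 0 < a -> a <= b -> b < PI -> exists s, 0 < s /\ forall t, a <= t <= b -> s <= sin t.
Proof.
  intros Ha Hab Hb. destruct (cont_min sin a b Hab) as [x [Hx Hmin]].
  - intros x _. apply continuous_sin.
  - exists (sin x). split; auto. apply sin_gt_0; lra.
Qed.

Section Turn.
Variable m : R -> R.
Hypothesis Hv : von_Mangoldt m.
Local Notation m1 := (Derive_n m 1).
Local Notation graph := (graph m).
Local Notation geo := (geo m).
Variables (R0 th0 : R) (r rho th : R -> R).
Hypothesis HR0 : 0 < R0.
Local Notation c := (m R0).
Hypotheses (G : forall L, geo c r rho th L) (Er0 : r 0 = R0) (Erho0 : rho 0 = 0) (Eth0 : th 0 = th0).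
Local Notation zeta := (zeta m R0).
Local Notation excess := (excess m R0).
Local Notation slope := (slope m).

Let Hm : model_fun m := von_Mangoldt_model m Hv.

Lemma par_c : 0 < c.
Proof. now apply (m_pos m Hm). Qed.

Lemma par_geo t : 0 <= t -> 0 < r t /\ is_derive r t (rho t) /\
    is_derive rho t (c ^ 2 * (m1 (r t) / m (r t) ^ 3)) /\
    is_derive th t (c * / m (r t) ^ 2) /\ rho t ^ 2 + c ^ 2 * / m (r t) ^ 2 = 1.
Proof. intros Ht. apply (G t). lra. Qed.

Lemma par_cont t : 0 <= t -> continuous r t.
Proof. intros Ht. apply (geo_cont m _ _ _ _ t t (G t)). lra. Qed.

Lemma par_th_cont t : 0 <= t -> continuous th t.
Proof. intros Ht. destruct (par_geo t Ht) as [_ [_ [_ [X _]]]]. exact (continuous_of_derive _ _ _ X). Qed.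

Lemma par_mono s t : 0 <= s < t -> th s < th t.
Proof. intros H. apply (geo_theta_mono m Hm c r rho th t s t (G t)); [apply par_c|auto|lra]. Qed.

Lemma par_clairaut t : 0 <= t -> c <= m (r t).
Proof.
  intros Ht. destruct (par_geo t Ht) as [H1 [_ [_ [_ H5]]]]. assert (Hmr := m_pos m Hm _ H1).
  assert (Hc := par_c). assert (H : c ^ 2 * / m (r t) ^ 2 <= 1) by (generalize (pow2_ge_0 (rho t)); lra).
  apply Rle_div_l in H; [|apply pow_lt; lra]. apply Rnot_lt_le. intros Hn. nra.
Qed.

Lemma par_angle s t phi : 0 <= s <= t -> th s - th0 <= phi <= th t - th0 -> exists u, s <= u <= t /\ th u - th0 = phi.
Proof.
  intros Hs Hphi. destruct (IVT_on th s t (phi + th0)) as [u [Hu Eu]]; [lra| | |].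
  - intros x Hx. apply par_th_cont; lra.
  - rewrite Rmin_left, Rmax_right; lra.
  - exists u. split; auto. lra.
Qed.

Lemma par_graph b : 0 < b -> exists rr P, graph c rr P (th b - th0) /\ rr 0 = R0 /\ P 0 = 0 /\
  forall t, 0 <= t <= b -> rr (th t - th0) = r t.
Proof.
  intros Hb. assert (Hc := par_c).
  destruct (geo_graph m Hm c r rho th b (G b) ltac:(lra) Hb) as [rr [P [Hgr H]]].
  assert (Ea : forall t, 0 <= t <= b -> Rabs (th t - th 0) = th t - th0).
  { intros t Ht. rewrite Eth0. apply Rabs_pos_eq. destruct (Req_dec t 0) as [->|]; [lra|].
    assert (X := par_mono 0 t ltac:(lra)). lra. }
  rewrite Ea in Hgr by lra. exists rr, P. split; [auto|].
  destruct (H 0 ltac:(lra)) as [_ [H1 H2]]. rewrite Rminus_eq_0, Rabs_R0 in H1, H2.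
  split; [lra|split].
  - rewrite H2, Erho0. unfold Rdiv. ring.
  - intros t Ht. destruct (H t Ht) as [_ [H3 _]]. now rewrite Ea in H3.
Qed.

Section Bounded.
Variable al0 : R.
Hypothesis Hb : forall t, 0 <= t -> th t - th0 <= al0.

(** On a bounded range of radii the angular speed c / m^2 is bounded below, and the turn would
    exceed any bound. *)
Lemma par_unbounded K : exists t, 0 < t /\ K < r t.
Proof.
  apply NNPP. intros Hn.
  assert (HK : forall t, 0 < t -> r t <= K) by (intros t Ht; apply Rnot_lt_le; intros H; apply Hn; now exists t).
  set (K' := Rmax K R0). assert (HK'0 : R0 <= K') by apply Rmax_r. assert (HK'1 : K <= K') by apply Rmax_l.
  destruct (cont_bounded m 0 K' ltac:(lra) (fun x _ => cm m Hm x)) as [M [HM HM']].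
  assert (Hr : forall t, 0 <= t -> r t <= K').
  { intros t Ht. destruct (Req_dec t 0) as [->|]; [lra|]. specialize (HK t ltac:(lra)). lra. }
  assert (Hc := par_c). set (k := c * / M ^ 2).
  assert (Hk : 0 < k) by (apply Rmult_lt_0_compat; auto; apply Rinv_0_lt_compat, pow_lt; auto).
  set (t := (Rabs al0 + 1) / k). assert (Ht : 0 < t) by (apply Rdiv_lt_0_compat; auto; generalize (Rabs_pos al0); lra).
  assert (X : th 0 - k * 0 <= th t - k * t).
  { apply (derive_le (fun t => th t - k * t) (fun t => c * / m (r t) ^ 2 - k)); [lra| |].
    - intros s Hs. destruct (par_geo s ltac:(lra)) as [_ [_ [_ [Y _]]]]. der. ringR.
    - intros s Hs. destruct (par_geo s ltac:(lra)) as [H1 _]. assert (Hms := m_pos m Hm _ H1).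
      specialize (HM' (r s) ltac:(specialize (Hr s); lra)). rewrite Rabs_pos_eq in HM' by lra.
      unfold k. rewrite <- Rmult_minus_distr_l. apply Rmult_le_pos; [lra|].
      cut (/ M ^ 2 <= / m (r s) ^ 2); [lra|]. apply Rinv_le_contravar; [apply pow_lt; lra|apply pow_incr; lra]. }
  assert (Ek : k * t = Rabs al0 + 1) by (unfold t; field; lra).
  specialize (Hb t ltac:(lra)). generalize (Rle_abs al0). lra.
Qed.

(** By Clairaut m (r) >= m (R0) along the geodesic, and the unbounded radius passes every value
    above R0, so m' (R0) cannot be negative. If it were 0, the circle of radius R0 would be the
    geodesic itself. *)
Lemma par_slope_pos : 0 < m1 R0.
Proof.
  assert (Hc := par_c). destruct (Rtotal_order (m1 R0) 0) as [H|[H|H]]; auto; exfalso.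
  - destruct (derive_pos_right (fun x => - m x) R0 (- m1 R0)) as [d [Hd Hd']]; [|lra|].
    { apply dopp, (dm m Hm). }
    destruct (par_unbounded R0) as [t [Ht Hrt]].
    set (v := Rmin (r t) (R0 + d / 2)). assert (V1 : v <= r t) by apply Rmin_l.
    assert (V2 : v <= R0 + d / 2) by apply Rmin_r. assert (V3 : R0 < v) by (apply Rmin_glb_lt; lra).
    destruct (IVT_on r 0 t v) as [s [Hs Es]]; [lra| | |].
    { intros x Hx. apply par_cont; lra. }
    { rewrite Er0, Rmin_left, Rmax_right; lra. }
    assert (X := par_clairaut s ltac:(lra)). rewrite Es in X. specialize (Hd' v ltac:(lra)). lra.
  - destruct (par_unbounded R0) as [t [Ht Hrt]].
    assert (Gc : geo c (fun _ => R0) (fun _ => 0) (fun s => s * (c * / c ^ 2)) t).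
    { intros s Hs. split; [auto|split; [apply dconst|split; [|split]]].
      - eapply is_derive_eq; [apply dconst|]. rewrite H. fieldR. lra.
      - der. ringR.
      - field. lra. }
    assert (U := geo_unique m Hm _ _ _ _ _ _ _ _ _ (G t) Gc Er0 Erho0 t ltac:(lra)). lra.
Qed.

(** P^2 <= 1 / c^2, so [zeta] falls at rate at most 1 / c in the angle, and every radius is passed
    within the angle [al0]. Thus 1/m^2 is integrable at infinity. *)
Lemma zeta_lower x : 0 < x -> - (al0 / c) <= zeta x.
Proof.
  intros Hx. assert (Hc := par_c). destruct (par_unbounded x) as [t [Ht Hrt]].
  destruct (par_graph t Ht) as [rr [P [Hgr [E0 [_ Hrr]]]]].
  assert (Z := zeta_decr m Hv R0 HR0 x (r t) Hx Hrt).
  set (A := th t - th0). assert (HA : 0 < A) by (assert (X := par_mono 0 t ltac:(lra)); unfold A; lra).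
  assert (X : zeta (rr 0) + / c * 0 <= zeta (rr A) + / c * A).
  { apply (derive_le (fun s => zeta (rr s) + / c * s) (fun s => P s + / c)); [lra| |].
    - intros s Hs. assert (Y := graph_zeta m Hv R0 HR0 c rr P A s Hgr Hs).
      eapply is_derive_eq; [apply (dplus (fun s => zeta (rr s)) (fun s => / c * s)); [exact Y|]|].
      + repeat der_step.
      + ringR.
    - intros s Hs. destruct (Hgr s Hs) as [H1 [_ [_ H4]]]. assert (Hms := m_pos m Hm _ H1).
      assert (0 < / m (rr s) ^ 2) by (apply Rinv_0_lt_compat, pow_lt; auto).
      assert (0 < / c) by now apply Rinv_0_lt_compat.
      assert (H5 : P s ^ 2 <= (/ c) ^ 2) by (rewrite pow_inv; lra). nra. }
  rewrite E0, (zeta_R0 m) in X. unfold A in X at 1. rewrite Hrr in X by lra.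
  specialize (Hb t ltac:(lra)). assert (/ c * A <= al0 / c).
  { unfold Rdiv. rewrite Rmult_comm. apply Rmult_le_compat_r; [left; now apply Rinv_0_lt_compat|]. auto. }
  lra.
Qed.

(* In constant curvature the angle would be at most [PI / 2]. *)
Lemma slope_not_constant : (exists t, 0 <= t /\ PI / 2 < th t - th0 < PI) -> exists x, 0 < x /\ slope x < 1.
Proof.
  intros [t [Ht Hphi]]. apply NNPP. intros Hn. assert (Hc := par_c).
  assert (Hs : forall x, 0 < x -> slope x = 1).
  { intros x Hx. apply Rle_antisym; [now apply slope_le1|]. apply Rnot_lt_le. intros H. apply Hn. now exists x. }
  set (F0 := m1 R0 / c). assert (HF0 : 0 < F0) by (apply Rdiv_lt_0_compat; auto; apply par_slope_pos).
  (* If the slope is 1 everywhere, [excess] is constant and the motion is the unforced oscillator P'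
     = - (F0 + zeta). *)
  assert (He : forall x, 0 < x -> m1 x / m x = F0 + zeta x).
  { assert (X : forall a b, 0 < a -> a <= b -> excess a = excess b).
    { intros a b Ha Hab. apply derive_zero; auto. intros x Hx. eapply is_derive_eq.
      - apply (excess_derive m Hv R0 HR0). lra.
      - rewrite Hs by lra. unfold Rdiv. ringR. }
    assert (Y : forall x, 0 < x -> excess x = excess R0).
    { intros x Hx. destruct (Rle_dec x R0); [apply X; lra|symmetry; apply X; lra]. }
    intros x Hx. specialize (Y x Hx). change (m1 x / m x - zeta x = m1 R0 / c - zeta R0) in Y. rewrite (zeta_R0 m) in Y. unfold F0. lra. }
  (* A negative value at [x] makes m decrease from there on; 1/m^2 stays above 1/m(x)^2, and at the
     far point [y] zeta has fallen below the bound of [zeta_lower]. *)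
  assert (Hpos : forall x, 0 < x -> 0 <= F0 + zeta x).
  { intros x Hx. apply Rnot_lt_le. intros Hneg.
    assert (Hmx := m_pos m Hm x Hx).
    assert (Hdec : forall y, x <= y -> m y <= m x).
    { intros y Hy. apply Ropp_le_cancel. apply (derive_le (fun y => - m y) (fun y => - m1 y)); auto.
      - intros z _. apply dopp, (dm m Hm).
      - intros z Hz. assert (Hmz := m_pos m Hm z ltac:(lra)). specialize (He z ltac:(lra)).
        assert (Zz : zeta z <= zeta x).
        { destruct (Req_dec z x) as [->|]; [lra|]. left. apply (zeta_decr m Hv R0 HR0); lra. }
        assert (E : m1 z = (F0 + zeta z) * m z) by (rewrite <- He; field; lra). nra. }
    assert (Hk : 0 < / m x ^ 2) by (apply Rinv_0_lt_compat, pow_lt; auto).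
    set (y := x + (Rabs (al0 / c) + Rabs (zeta x) + 1) * m x ^ 2).
    assert (Hal := Rabs_pos (al0 / c)). assert (Hz := Rabs_pos (zeta x)).
    assert (Hxy : x <= y).
    { unfold y. assert (0 <= (Rabs (al0 / c) + Rabs (zeta x) + 1) * m x ^ 2); [|lra].
      apply Rmult_le_pos; [lra|apply pow2_ge_0]. }
    assert (X : - zeta x - / m x ^ 2 * x <= - zeta y - / m x ^ 2 * y).
    { apply (derive_le (fun y => - zeta y - / m x ^ 2 * y) (fun y => / m y ^ 2 - / m x ^ 2)); auto.
      - intros z Hz'. assert (Y := zeta_derive m Hv R0 HR0 z ltac:(lra)). der. ringR.
      - intros z Hz'. assert (Hmz := m_pos m Hm z ltac:(lra)). specialize (Hdec z ltac:(lra)).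
        cut (/ m x ^ 2 <= / m z ^ 2); [lra|]. apply Rinv_le_contravar; [apply pow_lt; lra|apply pow_incr; lra]. }
    assert (E : / m x ^ 2 * y = / m x ^ 2 * x + (Rabs (al0 / c) + Rabs (zeta x) + 1)) by (unfold y; field; lra).
    assert (Y := zeta_lower y ltac:(lra)). generalize (Rle_abs (al0 / c)) (Rle_abs (zeta x)). lra. }
  assert (Ht0 : 0 < t).
  { destruct (Req_dec t 0) as [E|]; [|lra]. rewrite E in Hphi. generalize PI_RGT_0. lra. }
  destruct (par_graph t Ht0) as [rr [P [Hgr [E0 [EP _]]]]]. set (A := th t - th0) in *.
  assert (HA : 0 < A) by (generalize PI_RGT_0; lra).
  assert (DZ : forall s, 0 <= s <= A -> is_derive (fun s => F0 + zeta (rr s)) s (P s)).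
  { intros s Hs'. eapply is_derive_eq; [apply (dplus (fun _ => F0) (fun s => zeta (rr s)));
      [apply dconst|apply (graph_zeta m Hv R0 HR0 c rr P A s Hgr Hs')]|]. ringR. }
  assert (DP : forall s, 0 <= s <= A -> is_derive P s (- (F0 + zeta (rr s)))).
  { intros s Hs'. destruct (Hgr s Hs') as [H1 [_ [H3 _]]]. now rewrite He in H3. }
  (* With Z = F0 + zeta, Z' = P and P' = - Z, the quantity Z sin + P cos is conserved, and it is 0
     at the start. For A between PI / 2 and PI one has Z sin A >= 0 and, as P is negative there, P
     cos A > 0. *)
  assert (W : (F0 + zeta (rr 0)) * sin 0 + P 0 * cos 0 = (F0 + zeta (rr A)) * sin A + P A * cos A).
  { apply (derive_zero (fun s => (F0 + zeta (rr s)) * sin s + P s * cos s)); [lra|]. intros s Hs'.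
    assert (X := DZ s Hs'). assert (Y := DP s Hs').
    eapply is_derive_eq.
    - apply (dplus (fun s => (F0 + zeta (rr s)) * sin s) (fun s => P s * cos s)).
      + apply (dmult (fun s => F0 + zeta (rr s)) (fun s => sin s)); [exact X|apply (dsin (fun s => s)), did].
      + apply (dmult P (fun s => cos s)); [exact Y|apply (dcos (fun s => s)), did].
    - ringR. }
  rewrite sin_0, EP in W.
  assert (HPA : P A < 0).
  { destruct (derive_pos_right (fun s => - P s) 0 (F0 + zeta (rr 0))) as [d [Hd Hd']].
    - eapply is_derive_eq; [apply dopp, DP; lra|]. ringR.
    - rewrite E0, (zeta_R0 m). lra.
    - set (s := Rmin A (d / 2)). assert (S1 : s <= A) by apply Rmin_l. assert (S2 : s <= d / 2) by apply Rmin_r.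
      assert (S3 : 0 < s) by (apply Rmin_glb_lt; lra). specialize (Hd' s ltac:(lra)).
      assert (X : - P s <= - P A).
      { apply (derive_le (fun s => - P s) (fun s => F0 + zeta (rr s))); [lra| |].
        - intros u Hu. eapply is_derive_eq; [apply dopp, DP; lra|]. ringR.
        - intros u Hu. apply Hpos. apply Hgr. lra. }
      lra. }
  assert (HsA : 0 < sin A) by (apply sin_gt_0; lra).
  assert (HcA : cos A < 0) by (apply cos_lt_0; lra).
  assert (Z := Hpos (rr A) ltac:(apply Hgr; lra)). nra.
Qed.

End Bounded.

(* Otherwise the turn angle is [PI]. The Wronskian with the sine of the difference of the two geodesics then
   gains a fixed amount on an angular interval where the slope is below 1, yet it becomes arbitrarily small at
   angle [A] as [n] grows. *)
Lemma inward_escape b0 : 0 < b0 ->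
  (forall n, R0 < n -> exists c' rr P A, 0 < A < PI /\ graph c' rr P A /\ rr 0 = R0 /\ b0 <= P 0 /\ rr A = n /\ P A <= 0) ->
  exists al0, al0 < PI /\ forall t, 0 <= t -> th t - th0 <= al0.
Proof.
  intros Hb0 H. assert (Hc := par_c).
  (* A geodesic starting more inward has the smaller radius at equal angles by [compare_pos]. It can
     therefore exceed the largest radius of [r] on [0, t] only after turning by more than th t -
     th0. *)
  assert (Hlater : forall t, 0 < t -> exists K, R0 <= K /\ forall c' rr P A, 0 < A < PI -> graph c' rr P A -> rr 0 = R0 ->
    b0 <= P 0 -> K < rr A -> th t - th0 < A).
  { intros t Ht. destruct (cont_max r 0 t ltac:(lra)) as [s [Hs Hmax]]; [intros; apply par_cont; lra|].
    exists (r s). split; [rewrite <- Er0; apply Hmax; lra|]. intros c' rr P A HA Hgr E0 HP HK.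
    apply Rnot_le_lt. intros Hn.
    destruct (par_graph t Ht) as [rr1 [P1 [Hgr1 [E1 [EP1 Hrr1]]]]].
    assert (Hgr1' := graph_restrict m _ _ _ _ A Hn Hgr1).
    assert (X := compare_pos m Hv R0 HR0 c' c rr P rr1 P1 A Hgr Hgr1' ltac:(lra) E0 E1 ltac:(lra) A ltac:(lra)).
    destruct (par_angle 0 t A ltac:(lra)) as [u [Hu Eu]]; [lra|].
    rewrite <- Eu in X at 2. rewrite Hrr1 in X by auto. specialize (Hmax u Hu). lra. }
  assert (HltPI : forall t, 0 <= t -> th t - th0 < PI).
  { intros t Ht. destruct (Req_dec t 0) as [->|]; [generalize PI_RGT_0; lra|].
    destruct (Hlater t ltac:(lra)) as [K [HK HK']].
    destruct (H (K + 1) ltac:(lra)) as [c' [rr [P [A [HA [Hgr [E0 [HP [EA _]]]]]]]]].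
    specialize (HK' c' rr P A HA Hgr E0 HP ltac:(lra)). lra. }
  apply NNPP. intros Hn.
  assert (Hsup : forall a, a < PI -> exists t, 0 <= t /\ a < th t - th0).
  { intros a Ha. apply NNPP. intros Hna. apply Hn. exists a. split; auto. intros t Ht.
    apply Rnot_lt_le. intros Hlt. apply Hna. now exists t. }
  assert (HbPI : forall t, 0 <= t -> th t - th0 <= PI) by (intros t Ht; left; auto).
  destruct (slope_not_constant PI HbPI) as [x1 [Hx1 Hslope]].
  { destruct (Hsup (PI / 2)) as [t [Ht Ht']]; [generalize PI_RGT_0; lra|]. exists t. split; auto. }
  set (a := 1 - slope x1). assert (Ha : 0 < a) by (unfold a; lra).
  destruct (par_unbounded PI HbPI (x1 + 1)) as [ts [Hts Hrts]].
  destruct (proj1 (continuous_eps r ts) (par_cont ts ltac:(lra)) (r ts - (x1 + 1)) ltac:(lra)) as [d [Hd Hd']].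
  set (te := ts + d / 2).
  assert (Hfar : forall u, ts <= u <= te -> x1 + 1 < r u).
  { intros u Hu. specialize (Hd' u). rewrite Rabs_pos_eq in Hd' by (unfold te in Hu; lra).
    specialize (Hd' ltac:(unfold te in Hu; lra)). apply Rabs_def2 in Hd'. lra. }
  set (pa := th ts - th0). set (pb := th te - th0).
  assert (Hpa : 0 < pa) by (assert (X := par_mono 0 ts ltac:(lra)); unfold pa; lra).
  assert (Hpab : pa < pb) by (assert (X := par_mono ts te ltac:(unfold te; lra)); unfold pa, pb; lra).
  assert (HpbPI : pb < PI) by (apply HltPI; unfold te; lra).
  destruct (sin_pos_min pa pb Hpa ltac:(lra) HpbPI) as [s0 [Hs0 Hsin]].
  (* A lower bound, between the angles [pa] and [pb], for the part of the gap zeta (rr u) - zeta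
     (rr1 u) that stems from radii beyond [x1]. If rr u >= x1 this is the whole gap, at least b0 s0
     by [compare]; otherwise it contains the stretch from x1 to x1 + 1, which [rr1] has passed. *)
  set (mu := Rmin (b0 * s0) (zeta x1 - zeta (x1 + 1))).
  assert (Hmu : 0 < mu).
  { apply Rmin_glb_lt; [now apply Rmult_lt_0_compat|]. assert (X := zeta_decr m Hv R0 HR0 x1 (x1 + 1) Hx1 ltac:(lra)). lra. }
  assert (Hmu1 : mu <= b0 * s0) by apply Rmin_l. assert (Hmu2 : mu <= zeta x1 - zeta (x1 + 1)) by apply Rmin_r.
  set (S := a * mu * s0). assert (HS : 0 < S * (pb - pa)) by (unfold S; repeat apply Rmult_lt_0_compat; lra).
  (* [M0] is minus the infimum of [zeta]. Beyond the radius [xe] the function varies by less than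
     [eps], and this bounds the gap [w] when the inward geodesic reaches radius [n]. *)
  destruct (completeness (fun z => exists x, 0 < x /\ z = - zeta x)) as [M0 [HM1 HM2]].
  { exists (PI / c). intros z [x [Hx ->]]. assert (X := zeta_lower PI HbPI x Hx). lra. }
  { exists (- zeta R0). now exists R0. }
  (* The final Wronskian is at most sin A / c + w, where w <= eps and sin A <= eps / b0, hence at
     most k eps; [eps] makes this half of the guaranteed gain S (pb - pa). *)
  set (k := / (b0 * c) + 1). assert (Hk : 0 < k).
  { unfold k. assert (0 < / (b0 * c)) by (apply Rinv_0_lt_compat, Rmult_lt_0_compat; auto). lra. }
  set (eps := S * (pb - pa) / (2 * k)). assert (Heps : 0 < eps) by (apply Rdiv_lt_0_compat; lra).
  assert (Hinf : exists x, 0 < x /\ M0 - eps < - zeta x).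
  { apply NNPP. intros Hne. assert (M0 <= M0 - eps); [|lra]. apply HM2. intros z [x [Hx ->]].
    apply Rnot_lt_le. intros Hlt. apply Hne. now exists x. }
  destruct Hinf as [xe [Hxe Hxe']].
  destruct (Hlater te ltac:(unfold te; lra)) as [K [HK HK']].
  set (n := Rmax K xe + 1). assert (Hn1 : K < n) by (unfold n; generalize (Rmax_l K xe); lra).
  assert (Hn2 : xe < n) by (unfold n; generalize (Rmax_r K xe); lra).
  destruct (H n ltac:(lra)) as [c' [rr [P [A [HA [Hgr [E0 [HP [EA HPA]]]]]]]]].
  assert (HpbA : pb < A) by (apply (HK' c' rr P A); auto; lra).
  destruct (Hsup A ltac:(lra)) as [t [Ht HtA]].
  assert (Ht0 : 0 < t) by (destruct (Req_dec t 0) as [E|]; [rewrite E in HtA; lra|lra]).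
  destruct (par_graph t Ht0) as [rr1 [P1 [Hgr1 [E1 [EP1 Hrr1]]]]].
  assert (Hgr1' := graph_restrict m _ _ _ _ A (Rlt_le _ _ HtA) Hgr1).
  assert (HP01 : P1 0 < P 0) by lra.
  assert (Hcmp := compare m Hv R0 HR0 c' c rr P rr1 P1 A Hgr Hgr1' (proj2 HA) E0 E1 HP01).
  assert (Hgrow := wronskian_growth m Hv R0 HR0 c' c rr P rr1 P1 A Hgr Hgr1').
  assert (Hex := compare_excess_sin m Hv R0 HR0 c' c rr P rr1 P1 A Hgr Hgr1' (proj2 HA) E0 E1 HP01).
  assert (W1 := Hgrow 0 pa 0 ltac:(lra) ltac:(lra) ltac:(lra) ltac:(intros u Hu; apply Hex; lra)).
  assert (W3 := Hgrow pb A 0 ltac:(lra) ltac:(lra) ltac:(lra) ltac:(intros u Hu; apply Hex; lra)).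
  assert (W2 : S * (pb - pa) <= wronskian m R0 rr P rr1 P1 pb - wronskian m R0 rr P rr1 P1 pa).
  { apply Hgrow; try lra. intros u Hu. specialize (Hsin u Hu). unfold S.
    destruct (par_angle ts te u ltac:(unfold te; lra) Hu) as [v [Hv' Ev]].
    destruct (par_angle 0 t u ltac:(lra)) as [v' [Hv'' Ev']]; [lra|].
    assert (Evv : v = v').
    { destruct (Rtotal_order v v') as [X|[X|X]]; auto; exfalso.
      - assert (Y := par_mono v v' ltac:(lra)). lra.
      - assert (Y := par_mono v' v ltac:(lra)). lra. }
    subst v'. assert (Err1 : rr1 u = r v) by (rewrite <- Ev; apply Hrr1; auto).
    assert (Hrv := Hfar v Hv'). assert (Hru : 0 < rr u) by (apply Hgr; lra).
    assert (Hlt : rr u < rr1 u) by (apply (compare_pos m Hv R0 HR0 c' c rr P rr1 P1 A); auto; lra).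
    assert (Ha' : forall x, x1 <= x -> a <= 1 - slope x).
    { intros x Hx. unfold a. assert (X := slope_decr m Hv x1 x Hx1 Hx). lra. }
    assert (Hexc : a * mu <= excess (rr1 u) - excess (rr u)).
    { destruct (Rle_dec x1 (rr u)) as [Hle|Hle].
      - eapply Rle_trans; [|apply (excess_growth m Hv R0 HR0 (rr u) (rr1 u) a); auto; try lra; intros; apply Ha'; lra].
        apply Rmult_le_compat_l; [lra|]. specialize (Hcmp u ltac:(lra)). rewrite EP1 in Hcmp.
        assert (b0 * s0 <= (P 0 - 0) * sin u) by (apply Rmult_le_compat; lra). lra.
      - assert (X1 := excess_incr m Hv R0 HR0 (rr u) x1 Hru ltac:(lra)).
        assert (X2 := excess_growth m Hv R0 HR0 x1 (rr1 u) a Hx1 ltac:(lra) ltac:(intros; apply Ha'; lra)).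
        assert (X3 := zeta_decr m Hv R0 HR0 (x1 + 1) (rr1 u) ltac:(lra) ltac:(lra)).
        assert (a * mu <= a * (zeta x1 - zeta (rr1 u))) by (apply Rmult_le_compat_l; lra). lra. }
    apply Rmult_le_compat; auto; try lra. apply Rmult_le_pos; lra. }
  assert (W0 : wronskian m R0 rr P rr1 P1 0 = 0).
  { unfold wronskian. rewrite E0, E1, sin_0. ring. }
  set (w := zeta (rr A) - zeta (rr1 A)).
  assert (Hw : w <= eps).
  { assert (X := HM1 (- zeta (rr1 A)) ltac:(exists (rr1 A); split; auto; apply Hgr1'; lra)).
    assert (Y := zeta_decr m Hv R0 HR0 xe n Hxe Hn2). unfold w. rewrite EA. lra. }
  assert (HsA : 0 < sin A) by (apply sin_gt_0; lra).
  specialize (Hcmp A ltac:(lra)). cbv beta in Hcmp. fold w in Hcmp. rewrite EP1, Rminus_0_r in Hcmp.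
  assert (Hbs0 : b0 * sin A <= P 0 * sin A) by (apply Rmult_le_compat_r; lra).
  assert (Hbs : b0 * sin A <= eps) by lra.
  assert (HP1A : - P1 A <= / c).
  { destruct (Hgr1' A ltac:(lra)) as [H1 [_ [_ H4]]]. assert (Hms := m_pos m Hm _ H1).
    assert (0 < / m (rr1 A) ^ 2) by (apply Rinv_0_lt_compat, pow_lt; auto).
    assert (0 < / c) by now apply Rinv_0_lt_compat.
    assert (H5 : P1 A ^ 2 <= (/ c) ^ 2) by (rewrite pow_inv; lra). nra. }
  (* P A <= 0 as the inward geodesic is no longer approaching the pole, - P1 A <= 1 / c by the
     energy relation, and cos A >= - 1. *)
  assert (WA : wronskian m R0 rr P rr1 P1 A <= / c * sin A + w).
  { unfold wronskian. fold w. assert (0 <= w) by (assert (0 <= b0 * sin A) by (apply Rmult_le_pos; lra); lra). assert (X := COS_bound A).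
    assert ((P A - P1 A) * sin A <= / c * sin A) by (apply Rmult_le_compat_r; lra). nra. }
  assert (Hfin : / c * sin A + w <= k * eps).
  { unfold k. replace ((/ (b0 * c) + 1) * eps) with (/ c * (eps / b0) + eps) by (field; lra).
    apply Rplus_le_compat; auto. apply Rmult_le_compat_l; [left; now apply Rinv_0_lt_compat|].
    apply Rle_div_r; lra. }
  assert (E : k * eps = S * (pb - pa) / 2) by (unfold eps; field; lra).
  lra.
Qed.

End Turn.

(** * Rays and the turn angle *)

Section Rays.
Variable m : R -> R.
Hypothesis Hv : von_Mangoldt m.
Local Notation D := (D m).
Local Notation m1 := (Derive_n m 1).
Local Notation seg := (seg m).
Local Notation geo := (geo m).
Local Notation graph := (graph m).
Local Notation init := (init m).

Let Hm : model_fun m := von_Mangoldt_model m Hv.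

Lemma graph_first_hit c rr P A n : 0 <= A -> graph c rr P A -> rr 0 < n -> n <= rr A ->
  exists B, 0 < B <= A /\ rr B = n /\ P B <= 0.
Proof.
  intros HA G H0 Hn.
  destruct (Req_dec A 0) as [->|HA0]; [lra|].
  assert (Crr : forall x, 0 <= x <= A -> continuous rr x).
  { intros x Hx. destruct (G x Hx) as [_ [X _]]. exact (continuous_of_derive _ _ _ X). }
  destruct (first_zero (fun t => n - rr t) 0 A) as [B [HB [EB Hlt]]]; [lra| | |lra|].
  - intros x Hx. assert (X := Crr x Hx). cont.
  - destruct (proj1 (continuous_eps rr 0) (Crr 0 ltac:(lra)) (n - rr 0) ltac:(lra)) as [d [Hd H]].
    exists d. split; auto. intros x Hx. specialize (H x). rewrite Rminus_0_r, Rabs_pos_eq in H by lra.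
    specialize (H ltac:(lra)). apply Rabs_def2 in H. lra.
  - exists B. split; [auto|split; [lra|]]. apply Rnot_lt_le. intros HP.
    destruct (G B ltac:(lra)) as [H1 [H2 _]]. assert (Hmr := m_pos m Hm _ H1).
    assert (Hder : is_derive (fun s => rr (B - s)) 0 (m (rr B) ^ 2 * P B)).
    { eapply is_derive_eq; [apply (dcomp rr (fun s => B - s)); [rewrite Rminus_0_r; exact H2|repeat der_step]|]. ringR. }
    destruct (derive_pos_right _ _ _ Hder) as [d [Hd H]].
    { apply Rmult_lt_0_compat; auto. now apply pow_lt. }
    set (s := Rmin (d / 2) (B / 2)). assert (S1 : s <= d / 2) by apply Rmin_l. assert (S2 : s <= B / 2) by apply Rmin_r.
    assert (S3 : 0 < s) by (apply Rmin_glb_lt; lra). specialize (H s ltac:(lra)). rewrite Rminus_0_r in H.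
    specialize (Hlt (B - s) ltac:(lra)). lra.
Qed.

Variables (q : pt) (th0 : R).
Hypotheses (Hq : 0 < rad q) (Eq : q = polar (rad q) th0).

Lemma init_momentum s x c : s 0 = q -> init s x c -> Rabs c <= m (rad q).
Proof.
  intros E Hi. assert (En := init_energy m s x c Hi). rewrite E in En.
  assert (Hmq := m_pos m Hm _ Hq). assert (H : c ^ 2 * / m (rad q) ^ 2 <= 1) by (generalize (pow2_ge_0 x); lra).
  apply Rle_div_l in H; [|apply pow_lt; lra]. apply Rsqr_incr_0; [|apply Rabs_pos|lra].
  rewrite <- Rsqr_abs. unfold Rsqr. lra.
Qed.

Lemma ray_geo s x c L : 0 < L -> (forall T, seg s 0 T) -> s 0 = q -> init s x c -> c <> 0 ->
  exists r rho th, geo c r rho th L /\ th 0 = th0 /\ rho 0 = x /\ r 0 = rad q /\ L - rad q <= r L /\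
    (forall t, 0 <= t <= L -> Rabs (th t - th0) < PI).
Proof.
  intros HL Hs E Hi Hc.
  (* One unit of time beyond [L], because [turn_lt_PI] is strict only before the end of a
     segment. *)
  assert (Hpos := seg_nonpole m Hm s (L + 1) x c ltac:(lra) (Hs (L + 1)) ltac:(now rewrite E) Hi Hc).
  destruct (seg_geo m Hm s (L + 1) th0 ltac:(lra) (Hs (L + 1)) Hpos) with (x := x) (c := c)
    as [r [rho [th [G [Eth [Erho Hsp]]]]]]; auto; [now rewrite E|].
  assert (Er : forall t, 0 <= t <= L + 1 -> r t = rad (s t)).
  { intros t Ht. rewrite Hsp, rad_polar; auto. left; apply G; auto. }
  exists r, rho, th. split; [apply (geo_restrict m _ _ _ _ (L + 1)); auto; lra|].
  split; [auto|split; [auto|split; [rewrite Er, E; lra|split]]].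
  - rewrite Er by lra.
    assert (Y := D_tri m Hm q (0, 0) (s L)). rewrite (D_sym m Hm q (0, 0)), !(D_pole m Hm) in Y.
    assert (Z := Hs L 0 L ltac:(lra) ltac:(lra)). rewrite E in Z.
    rewrite Rabs_minus_sym, Rminus_0_r, Rabs_pos_eq in Z by lra. lra.
  - intros t Ht. rewrite <- Eth. apply (turn_lt_PI m Hm s c r rho th (L + 1)); auto. lra.
Qed.

(** With zero momentum the ray runs down its meridian at unit speed and is at the pole at time
    [rad q]. Since it goes on minimizing, [antipodal_of_D_eq] places its continuation on the
    opposite meridian. *)
Lemma pole_ray s : (forall T, seg s 0 T) -> s 0 = q -> init s (-1) 0 ->
  forall n, 0 < n -> D q (polar n (th0 + PI)) = rad q + n.
Proof.
  intros Hs E Hi n Hn. set (R0 := rad q) in *.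
  assert (H1 : forall t, 0 < t < R0 -> rad (s t) = R0 - t).
  { intros t Ht.
    destruct (seg_geo m Hm s t th0 ltac:(lra) (Hs t)) with (x := -1) (c := 0) as [r [rho [th [G [Eth [Erho Hsp]]]]]]; auto.
    - intros u Hu. assert (X := seg_cont_rad m Hm s t u (Hs t) Hu). rewrite E in X. fold R0 in X.
      apply Rabs_le_between in X. lra.
    - now rewrite E.
    - assert (Hrho : forall u, 0 <= u <= t -> rho u = -1).
      { intros u Hu. rewrite <- Erho. symmetry. apply derive_zero; [lra|]. intros v Hv'.
        destruct (G v ltac:(lra)) as [_ [_ [X _]]]. eapply is_derive_eq; [exact X|]. ringR. }
      assert (X : r 0 + 0 = r t + t).
      { apply (derive_zero (fun t => r t + t)); [lra|]. intros v Hv'. destruct (G v ltac:(lra)) as [_ [Y _]].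
        rewrite Hrho in Y by lra. der. ringR. }
      assert (Er : forall u, 0 <= u <= t -> r u = rad (s u)).
      { intros u Hu. rewrite Hsp, rad_polar; auto. left; apply G; auto. }
      rewrite !Er, E in X by lra. fold R0 in X. lra. }
  assert (H2 : s R0 = (0, 0)).
  { apply rad_0. apply Rle_antisym; [|apply rad_nonneg]. apply le_epsilon. intros e He.
    set (t := Rmax (R0 / 2) (R0 - e / 2)). assert (T1 : R0 / 2 <= t) by apply Rmax_l.
    assert (T2 : R0 - e / 2 <= t) by apply Rmax_r. assert (T3 : t < R0) by (apply Rmax_lub_lt; lra).
    assert (X := D_rad m Hm (s R0) (s t)). rewrite (Hs R0), (H1 t), (Rabs_pos_eq (R0 - t)) in X by lra.
    apply Rabs_le_between in X. lra. }
  assert (H3 : rad (s (R0 + n)) = n).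
  { rewrite <- (D_pole m Hm), <- H2, (Hs (R0 + n)) by lra. rewrite Rabs_minus_sym, Rabs_pos_eq; lra. }
  assert (H4 : D q (s (R0 + n)) = R0 + n).
  { rewrite <- E, (Hs (R0 + n)) by lra. rewrite Rabs_minus_sym, Rminus_0_r, Rabs_pos_eq; lra. }
  assert (C := antipodal_of_D_eq m Hm q (s (R0 + n)) Hq ltac:(lra) ltac:(rewrite H3; exact H4)). rewrite H3 in C. fold R0 in C.
  replace (polar n (th0 + PI)) with (s (R0 + n)); auto. rewrite C, polar_add_PI.
  assert (Q1 : fst q = R0 * cos th0) by exact (f_equal fst Eq).
  assert (Q2 : snd q = R0 * sin th0) by exact (f_equal snd Eq).
  rewrite Q1, Q2. f_equal; field; lra.
Qed.

(* Were the minimizing curves to points approaching the opposite meridian to leave [q] at angles bounded away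
   from [PI], their limit, continued by the meridian, would be a minimizing curve with a corner. *)
Lemma pole_ray_inward n : 0 < n -> (forall n, 0 < n -> D q (polar n (th0 + PI)) = rad q + n) ->
  exists L c r rho th, 0 < L /\ geo c r rho th L /\ th 0 = th0 /\ c <> 0 /\ r 0 = rad q /\ r L = n /\
    Rabs (th L - th0) < PI /\ rho 0 <= - / 2 /\ Rabs c <= m (rad q).
Proof.
  intros Hn Hpole. set (R0 := rad q) in *. apply NNPP. intros Hno.
  set (al := fun j : nat => PI - / INR (S j)).
  assert (Hj : forall j, 0 < / INR (S j) <= 1).
  { intros j. assert (1 <= INR (S j)) by (rewrite S_INR; generalize (pos_INR j); lra). split.
    - apply Rinv_0_lt_compat; lra.
    - rewrite <- Rinv_1. apply Rinv_le_contravar; lra. }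
  assert (Hal : forall j, 0 < al j < PI).
  { intros j. specialize (Hj j). assert (X := PI2_1). unfold al. lra. }
  set (y := polar n (th0 + PI)). set (yj := fun j => polar n (th0 + al j)).
  assert (H : forall j, exists s, seg s 0 (D q (yj j)) /\ 0 < D q (yj j) /\ s 0 = q /\
    s (D q (yj j)) = yj j /\ exists x c, init s x c /\ - / 2 <= x).
  { intros j. destruct (minimizer_off_meridian m Hm q th0 n (al j) Eq Hq Hn (Hal j))
      as [s [L [c [r [rho [th [HL [EL [Hs [E0 [E1 [G [Eth [Hsp [Hc [Hth [Er0 [ErL Hi]]]]]]]]]]]]]]]]]].
    exists s. fold (yj j) in EL, E1. rewrite <- EL. repeat (split; [now auto|]).
    exists (rho 0), c. split; auto. left. apply Rnot_le_lt. intros Hx. apply Hno.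
    exists L, c, r, rho, th. repeat (split; [now auto|]).
    split; [rewrite Hth; apply Hal|split; [auto|]]. now apply (init_momentum s (rho 0)). }
  set (s := fun j => proj1_sig (constructive_indefinite_description _ (H j))).
  assert (Hs : forall j, seg (s j) 0 (D q (yj j)) /\ 0 < D q (yj j) /\ s j 0 = q /\
    s j (D q (yj j)) = yj j /\ exists x c, init (s j) x c /\ - / 2 <= x).
  { intros j. exact (proj2_sig (constructive_indefinite_description _ (H j))). }
  clearbody s. clear H Hno.
  destruct ex_ultra as [U HU].
  assert (Hy : ulim U (fun j => D (yj j) y) 0).
  { destruct (D_upper m Hm n ltac:(lra)) as [K [HK HKD]].
    apply (ulim_inv_n U HU _ _ (K * (2 * n))). intros j.
    rewrite Rminus_0_r, Rabs_pos_eq by apply (D_nonneg m Hm).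
    eapply Rle_trans; [apply HKD; unfold y, yj; rewrite rad_polar; lra|].
    unfold Rdiv. rewrite Rmult_assoc. apply Rmult_le_compat_l; [lra|].
    eapply Rle_trans; [apply rad_le_abs|]. unfold y, yj, polar; simpl fst; simpl snd.
    rewrite <- !Rmult_minus_distr_l, !Rabs_mult, (Rabs_pos_eq n) by lra.
    assert (X1 := cos_lip (th0 + PI) (th0 + al j)). assert (X2 := sin_lip (th0 + PI) (th0 + al j)).
    replace (th0 + PI - (th0 + al j)) with (/ INR (S j)) in X1, X2 by (unfold al; ring).
    specialize (Hj j). rewrite (Rabs_pos_eq (/ INR (S j))) in X1, X2 by lra. nra. }
  assert (Hd : forall j, Rabs (D q (yj j) - (R0 + n)) <= D (yj j) y).
  { intros j. rewrite <- (Hpole n Hn). fold y. assert (X1 := D_tri m Hm q y (yj j)).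
    assert (X2 := D_tri m Hm q (yj j) y). rewrite (D_sym m Hm y) in X1. apply Rabs_le. lra. }
  assert (Hlen : ulim U (fun j => D q (yj j)) (R0 + n)).
  { intros e He. refine (ultra_imp _ HU _ _ _ (Hy e He)). intros j X.
    rewrite Rminus_0_r, Rabs_pos_eq in X by apply (D_nonneg m Hm). specialize (Hd j). lra. }
  assert (Hev : forall t, t < R0 + n -> U (fun j => t <= D q (yj j))).
  { intros t Ht. refine (ultra_imp _ HU _ _ _ (Hlen (R0 + n - t) ltac:(lra))). intros j X. apply Rabs_def2 in X. lra. }
  (* The lengths of the curves merely converge to R0 + n, so each earlier time is eventually
     available but the end time is not; there the limit is supplied by [y]. *)
  destruct (ulim_curve m Hm U HU s (fun t => 0 <= t < R0 + n) (fun t => R0 + t)) as [g Hg].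
  { intros t Ht. refine (ultra_imp _ HU _ _ _ (Hev t (proj2 Ht))). intros j Hjt.
    destruct (Hs j) as [H1 [H2 [H3 _]]]. assert (X := seg_cont_rad m Hm (s j) _ t H1 ltac:(lra)).
    rewrite H3 in X. fold R0 in X. apply Rabs_le_between in X. lra. }
  assert (Hiso : forall u t, 0 <= u < R0 + n -> 0 <= t < R0 + n -> D (g u) (g t) = Rabs (u - t)).
  { intros u t Hu Ht. apply (ulim_D m Hm U HU (fun j => s j u) (fun j => s j t)); auto.
    intros e He. refine (ultra_imp _ HU _ _ _ (ultra_and _ HU _ _ (Hev u (proj2 Hu)) (Hev t (proj2 Ht)))).
    intros j [J1 J2]. destruct (Hs j) as [H1 _]. rewrite H1 by lra. now rewrite Rminus_eq_0, Rabs_R0. }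
  assert (Hisoy : forall u, 0 <= u < R0 + n -> D (g u) y = R0 + n - u).
  { intros u Hu. apply (ulim_D m Hm U HU (fun j => s j u) yj); auto.
    intros e He. refine (ultra_imp _ HU _ _ _ (ultra_and _ HU _ _ (Hev u (proj2 Hu)) (Hlen e He))).
    intros j [J1 J2]. destruct (Hs j) as [H1 [H2 [_ [H4 _]]]]. rewrite <- H4, H1 by lra.
    rewrite (Rabs_minus_sym u), (Rabs_pos_eq (_ - u)) by lra.
    replace (D q (yj j) - u - (R0 + n - u)) with (D q (yj j) - (R0 + n)) by ring. auto. }
  assert (Hg0 : g 0 = q).
  { apply (ulim_point m Hm U HU (fun j => s j 0)); [apply Hg; lra|].
    intros e He. apply (ultra_all U HU). intros j. destruct (Hs j) as [_ [_ [-> _]]].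
    now rewrite (D_refl m Hm), Rminus_0_r, Rabs_R0. }
  destruct (init_rate m Hm R0 Hq) as [C [HC HC']].
  assert (Hrate : forall u, 0 <= u -> u < R0 + n -> u <= R0 / 2 -> R0 - u / 2 - C * u ^ 2 <= rad (g u)).
  { intros u Hu0 Hu1 Hu2. apply (ulim_ge U HU (fun j => rad (s j u))).
    - apply (ulim_rad m Hm U HU), Hg. lra.
    - refine (ultra_imp _ HU _ _ _ (Hev u Hu1)). intros j Hju. destruct (Hs j) as [H1 [H2 [H3 [_ [x [c [Hi Hx]]]]]]].
      assert (X := HC' (s j) _ x c H1 ltac:(now rewrite H3) Hi u ltac:(lra) Hu2).
      apply Rabs_le_between in X. assert (- / 2 * u <= x * u) by (apply Rmult_le_compat_r; lra). lra. }
  (* A passage through the pole would have to occur at time R0 and give radius R0 - u at time u. The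
     initial radial speed is at least - 1/2, so for small u the radius is too large for that. *)
  assert (Hnp : forall t, 0 <= t < R0 + n -> 0 < rad (g t)).
  { intros t Ht. destruct (rad_nonneg (g t)) as [|E]; auto. exfalso. symmetry in E. apply rad_0 in E.
    assert (Hrad : forall u, 0 <= u < R0 + n -> rad (g u) = Rabs (t - u)).
    { intros u Hu. rewrite <- (D_pole m Hm), <- E. apply Hiso; auto. }
    assert (E0 := Hrad 0 ltac:(lra)). rewrite Hg0, Rminus_0_r, Rabs_pos_eq in E0 by lra. fold R0 in E0.
    set (h := Rmin (R0 / 2) (n / 2)).
    assert (h <= R0 / 2) by apply Rmin_l. assert (0 < h) by (apply Rmin_glb_lt; lra).
    assert (/ 2 <= 0); [|lra]. apply (le_of_small_quadratic (/ 2) C h); auto. intros u Hu.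
    assert (X := Hrate u ltac:(lra) ltac:(lra) ltac:(lra)). rewrite Hrad, Rabs_pos_eq in X by lra. lra. }
  set (yt := fun t => polar (t - R0) (th0 + PI)).
  assert (Hyt : forall u t, R0 + n <= u -> R0 + n <= t -> D (yt u) (yt t) = Rabs (u - t)).
  { intros u t Hu Ht. unfold yt, polar.
    assert (X := D_radial m Hm (cos (th0 + PI), sin (th0 + PI)) (u - R0) (t - R0)). simpl in X. rewrite X; try lra.
    - rewrite Rabs_minus_sym. f_equal. ring.
    - rewrite <- (rad_polar 1 (th0 + PI)) by lra. f_equal. unfold polar. f_equal; ring. }
  assert (Ey : y = yt (R0 + n)) by (unfold y, yt; f_equal; ring).
  assert (Hmix : forall u t, 0 <= u < R0 + n -> R0 + n <= t -> D (g u) (yt t) = t - u).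
  { intros u t Hu Ht. apply Rle_antisym.
    - eapply Rle_trans; [apply (D_tri m Hm _ y)|]. rewrite Hisoy, Ey, Hyt by lra.
      rewrite Rabs_minus_sym, Rabs_pos_eq; lra.
    - assert (X := D_tri m Hm q (g u) (yt t)). unfold yt at 1 in X. rewrite (Hpole (t - R0)) in X by lra.
      rewrite <- Hg0 in X at 1. rewrite Hiso in X by lra. fold R0 in X.
      rewrite Rabs_minus_sym, Rminus_0_r, Rabs_pos_eq in X by lra.
      assert (rad q = R0) by reflexivity. lra. }
  set (g' := fun t => if Rlt_dec t (R0 + n) then g t else yt t).
  assert (G1 : forall t, t < R0 + n -> g' t = g t) by (intros t Ht; unfold g'; destruct Rlt_dec; [reflexivity|lra]).
  assert (G2 : forall t, R0 + n <= t -> g' t = yt t) by (intros t Ht; unfold g'; destruct Rlt_dec; [lra|reflexivity]).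
  assert (Hseg : seg g' 0 (R0 + n + 1)).
  { intros u t Hu Ht. destruct (Rlt_dec u (R0 + n)), (Rlt_dec t (R0 + n)).
    - rewrite !G1 by auto. apply Hiso; lra.
    - rewrite G1, G2 by lra. rewrite Hmix, Rabs_minus_sym, Rabs_pos_eq; lra.
    - rewrite G2, G1 by lra. rewrite (D_sym m Hm), Hmix, Rabs_pos_eq; lra.
    - rewrite !G2 by lra. apply Hyt; lra. }
  destruct (seg_regular m Hm g' (R0 + n + 1) th0) as [c [r [rho [th [G [Eth Hgp]]]]]]; auto.
  { lra. }
  { intros t Ht. destruct (Rlt_dec t (R0 + n)).
    - rewrite G1 by auto. apply Hnp; lra.
    - rewrite G2 by lra. unfold yt. rewrite rad_polar; lra. }
  { rewrite G1, Hg0 by lra. exact Eq. }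
  set (t1 := R0 + n + / 2).
  (* On the meridian the angle is constant, so the momentum of the whole curve is 0. Then the angle
     is constant from [q] on, although [y] lies on the opposite meridian. *)
  assert (Ec : c = 0).
  { assert (HR : 0 < R0) by exact Hq. assert (Ht1 : 0 < t1 < R0 + n + 1) by (unfold t1; lra).
    rewrite (geo_constant m Hm _ _ _ _ _ g' t1 G Ht1 Hgp).
    rewrite (dtheta_ds_ext g' yt t1 (/ 2)); [|lra|intros u Hu; apply Rabs_def2 in Hu; apply G2; unfold t1 in Hu; lra].
    assert (E : dtheta_ds yt t1 = 0); [|rewrite E; ring]. unfold dtheta_ds.
    rewrite (is_derive_unique (cx yt) t1 (cos (th0 + PI))).
    2:{ change (is_derive (fun t => (t - R0) * cos (th0 + PI)) t1 (cos (th0 + PI))). der. ringR. }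
    rewrite (is_derive_unique (cy yt) t1 (sin (th0 + PI))).
    2:{ change (is_derive (fun t => (t - R0) * sin (th0 + PI)) t1 (sin (th0 + PI))). der. ringR. }
    unfold cx, cy, yt, polar; simpl fst; simpl snd. unfold Rdiv. ring. }
  assert (HR : 0 < R0) by exact Hq.
  assert (E : th 0 = th (R0 + n)).
  { apply derive_zero; [lra|]. intros t Ht. destruct (G t ltac:(lra)) as [_ [_ [_ [X _]]]].
    now rewrite Ec, Rmult_0_l in X. }
  assert (X := Hgp (R0 + n) ltac:(lra)). rewrite G2, <- E, Eth in X by lra. rewrite <- Ey in X.
  assert (Hr := proj1 (G (R0 + n) ltac:(lra))).
  destruct (polar_inj _ _ _ _ Hn Hr X) as [_ [X1 X2]]. rewrite neg_cos in X1. rewrite neg_sin in X2.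
  assert (Y := cos2_sin2 th0). nra.
Qed.

Lemma geo_hit c r rho th L n : 0 < L -> geo c r rho th L -> c <> 0 -> th 0 = th0 -> r 0 = rad q -> rad q < n -> n <= r L ->
  Rabs (th L - th0) < PI ->
  exists rr P A, 0 < A < PI /\ graph c rr P A /\ rr 0 = rad q /\ P 0 = - rho 0 / Rabs c /\ rr A = n /\ P A <= 0.
Proof.
  intros HL G Hc Eth Er0 Hn HrL Hth.
  destruct (geo_graph m Hm c r rho th L G Hc HL) as [rr [P [Hgr H]]].
  destruct (H 0 ltac:(lra)) as [_ [H1 H2]]. destruct (H L ltac:(lra)) as [H3 [H4 _]].
  rewrite Rminus_eq_0, Rabs_R0 in H1, H2. rewrite Eth in *.
  destruct (graph_first_hit c rr P (Rabs (th L - th0)) n) as [B [HB [EB HPB]]]; auto; try lra.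
  exists rr, P, B. split; [lra|split; [apply (graph_restrict m _ _ _ (Rabs (th L - th0))); auto; lra|]].
  split; [lra|auto].
Qed.

Variables (r rho th : R -> R).
Local Notation R0 := (rad q).
Hypotheses (G : forall L, geo (m R0) r rho th L) (Er0 : r 0 = R0) (Erho0 : rho 0 = 0) (Eth0 : th 0 = th0).

Let Hc : 0 < m R0 := m_pos m Hm R0 Hq.

(** A ray with momentum c <> 0 itself reaches every radius and feeds [inward_escape] with b0 = - x /
    |c|. A ray of zero momentum runs into the pole and is replaced through [pole_ray_inward], where
    rho 0 <= - 1/2 and |c| <= m (rad q) give b0. *)
Lemma obtuse_ray s x c : (forall T, seg s 0 T) -> s 0 = q -> init s x c -> x < 0 ->
  exists al0, al0 < PI /\ forall t, 0 <= t -> th t - th0 <= al0.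
Proof.
  intros Hs E Hi Hx. assert (Hinv : 0 < / m R0) by now apply Rinv_0_lt_compat.
  destruct (Req_dec c 0) as [Ec|Ec].
  - assert (Ex : x = -1).
    { assert (En := init_energy m s x c Hi). rewrite Ec in En. nra. }
    subst x c. assert (Hpole := pole_ray s Hs E Hi).
    apply (inward_escape m Hv R0 th0 r rho th Hq G Er0 Erho0 Eth0 (/ 2 * / m R0)); [nra|].
    intros n Hn. destruct (pole_ray_inward n ltac:(lra) Hpole) as [L [c [r' [rho' [th' [HL [G' [Eth [Hc' [Er' [ErL [Hth [Hrho Habs]]]]]]]]]]]]].
    destruct (geo_hit c r' rho' th' L n) as [rr [P [A [HA [Hgr [F0 [F1 [F2 F3]]]]]]]]; auto; try lra.
    exists c, rr, P, A. split; [auto|split; [auto|split; [auto|split; [|auto]]]].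
    rewrite F1. apply Rabs_pos_lt in Hc'. unfold Rdiv. apply Rmult_le_compat; try lra.
    now apply Rinv_le_contravar.
  - apply (inward_escape m Hv R0 th0 r rho th Hq G Er0 Erho0 Eth0 (- x / Rabs c)).
    { apply Rabs_pos_lt in Ec. apply Rdiv_lt_0_compat; lra. }
    intros n Hn. destruct (ray_geo s x c (n + R0) ltac:(lra) Hs E Hi Ec) as [r' [rho' [th' [G' [Eth [Erho [Er' [ErL Hth]]]]]]]].
    destruct (geo_hit c r' rho' th' (n + R0) n) as [rr [P [A [HA [Hgr [F0 [F1 [F2 F3]]]]]]]]; auto; try lra.
    { apply Hth; lra. }
    exists c, rr, P, A. split; [auto|split; [auto|split; [auto|split; [|auto]]]]. rewrite F1, Erho. lra.
Qed.

(** Equal initial radius and radial speed make the ray the given geodesic up to orientation, by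
    [geo_unique], and a ray turns by less than PI. *)
Lemma right_angle_ray s c : (forall T, seg s 0 T) -> s 0 = q -> init s 0 c -> forall t, 0 <= t -> th t - th0 < PI.
Proof.
  intros Hs E Hi t Ht.
  assert (Ec : c <> 0).
  { intros ->. assert (En := init_energy m s 0 0 Hi). rewrite !pow_i, Rmult_0_l in En by lia. lra. }
  destruct (ray_geo s 0 c (t + 1) ltac:(lra) Hs E Hi Ec) as [r' [rho' [th' [G' [Eth [Erho [Er' [_ Hth]]]]]]]].
  destruct (geo_unique m Hm _ _ _ _ _ _ _ _ _ G' (G (t + 1)) ltac:(lra) ltac:(lra) t ltac:(lra)) as [_ [_ X]].
  rewrite Eth, Eth0 in X. specialize (Hth t ltac:(lra)). rewrite X in Hth. generalize (Rle_abs (th t - th0)). lra.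
Qed.

(** A minimizing curve from [q] to [g T] exists because the angle is below PI. Comparison forces its
    initial radial speed to be 0, and uniqueness makes it [g] or the mirror image of [g]. *)
Lemma tight_seg (g : curve) : (forall t, 0 <= t -> g t = polar (r t) (th t)) -> (forall t, 0 <= t -> th t - th0 < PI) ->
  forall T, seg g 0 T.
Proof.
  intros Hg HPI T. destruct (Rle_dec T 0) as [HT|HT].
  { intros u t Hu Ht. replace u with 0 by lra. replace t with 0 by lra.
    now rewrite (D_refl m Hm), Rminus_eq_0, Rabs_R0. }
  assert (HT0 : 0 < T) by lra. set (al := th T - th0).
  assert (Hal : 0 < al) by (assert (X := par_mono m Hv R0 r rho th Hq G 0 T ltac:(lra)); unfold al; lra).
  assert (HalPI : al < PI) by (apply HPI; lra).
  destruct (par_geo m R0 r rho th G T ltac:(lra)) as [HrT _].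
  destruct (minimizer_off_meridian m Hm q th0 (r T) al Eq Hq HrT (conj Hal HalPI))
      as [s [L [c [r' [rho' [th' [HL [EL [Hs [E0 [E1 [G' [Eth [Hsp [Hc' [Hth [Er0' [ErL Hi]]]]]]]]]]]]]]]]]].
  destruct (geo_graph m Hm c r' rho' th' L G' Hc' HL) as [rr [P [Hgr H]]].
  destruct (H 0 ltac:(lra)) as [_ [H1 H2]]. destruct (H L ltac:(lra)) as [_ [H4 _]].
  rewrite Rminus_eq_0, Rabs_R0 in H1, H2. rewrite Eth, Hth in H4, Hgr. rewrite ErL in H4. rewrite Er0' in H1.
  destruct (par_graph m Hv R0 th0 r rho th Hq G Er0 Erho0 Eth0 T HT0) as [rr1 [P1 [Hgr1 [F0 [F1 F2]]]]].
  fold al in Hgr1. assert (F3 := F2 T ltac:(lra)). fold al in F3.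
  (* Both geodesics have radius [r T] at the angle [al]; different slopes at [q] would make one
     radius strictly larger there. *)
  assert (Hrho : rho' 0 = 0).
  { destruct (Rtotal_order (P 0) 0) as [X|[X|X]].
    - assert (Y := compare_pos m Hv R0 Hq _ _ rr1 P1 rr P al Hgr1 Hgr HalPI F0 H1 ltac:(lra) al ltac:(lra)). lra.
    - rewrite X in H2. apply Rabs_pos_lt in Hc'.
      apply (Rmult_eq_compat_r (Rabs c)) in H2. unfold Rdiv in H2. rewrite Rmult_assoc, Rinv_l in H2 by lra. lra.
    - assert (Y := compare_pos m Hv R0 Hq _ _ rr P rr1 P1 al Hgr Hgr1 HalPI H1 F0 ltac:(lra) al ltac:(lra)). lra. }
  assert (U := geo_unique m Hm _ _ _ _ _ _ _ _ _ G' (G L) ltac:(lra) ltac:(lra)).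
  rewrite Eth, Eth0 in U.
  assert (Hpos : forall t, 0 <= t -> 0 <= th t - th0).
  { intros t Ht. destruct (Req_dec t 0) as [->|]; [lra|].
    assert (X := par_mono m Hv R0 r rho th Hq G 0 t ltac:(lra)). lra. }
  assert (ELT : L = T).
  { destruct (U L ltac:(lra)) as [_ [_ X]]. rewrite Hth, Rabs_pos_eq in X by (apply Hpos; lra).
    unfold al in X. destruct (Rtotal_order L T) as [Y|[Y|Y]]; auto; exfalso.
    - assert (Z := par_mono m Hv R0 r rho th Hq G L T ltac:(lra)). lra.
    - assert (Z := par_mono m Hv R0 r rho th Hq G T L ltac:(lra)). lra. }
  clear EL. subst L.
  (* The sign of [c] decides between [g] and its reflection in the meridian of [q]; in the second
     case distances are transferred by [refl_D]. *)
  assert (Hor : (forall t, 0 <= t <= T -> th' t = th t) \/ (forall t, 0 <= t <= T -> th' t = 2 * th0 - th t)).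
  { assert (Hmono : forall c r rho th, geo c r rho th T -> 0 < c -> forall t, 0 <= t <= T -> 0 <= th t - th 0).
    { intros c2 r2 rho2 th2 G2 Hc2 t Ht. destruct (Req_dec t 0) as [->|]; [lra|].
      assert (X := geo_theta_mono m Hm c2 r2 rho2 th2 T 0 t G2 Hc2 ltac:(lra) (proj2 Ht)). lra. }
    destruct (Rlt_dec 0 c) as [Hlt|Hlt]; [left|right]; intros t Ht; destruct (U t Ht) as [_ [_ X]];
      rewrite (Rabs_pos_eq (th t - th0)) in X by (apply Hpos; lra).
    - assert (Y := Hmono _ _ _ _ G' Hlt t Ht). rewrite Rabs_pos_eq in X; lra.
    - assert (Y := Hmono _ _ _ _ (geo_opp m _ _ _ _ _ G') ltac:(lra) t Ht). cbv beta in Y.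
      rewrite Rabs_left1 in X; lra. }
  destruct Hor as [Hor|Hor].
  - intros u t Hu Ht. rewrite <- Hs by auto. rewrite !Hg, !Hsp, !Hor by lra.
    destruct (U u Hu) as [-> _]. destruct (U t Ht) as [-> _]. reflexivity.
  - intros u t Hu Ht. rewrite <- Hs by auto.
    assert (Hcs : cos (2 * th0) ^ 2 + sin (2 * th0) ^ 2 = 1) by apply cos2_sin2.
    rewrite <- (refl_D m Hm _ _ (s u) (s t) Hcs). rewrite !Hsp, !Hor, !refl_polar, !Hg by lra.
    destruct (U u Hu) as [-> _]. destruct (U t Ht) as [-> _].
    replace (2 * th0 - (2 * th0 - th u)) with (th u) by ring.
    replace (2 * th0 - (2 * th0 - th t)) with (th t) by ring. reflexivity.
Qed.

Section Escape.
Variable al0 : R.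
Hypothesis Hb : forall t, 0 <= t -> th t - th0 <= al0.

(** A geodesic starting outward has the larger radius at equal angles, and the parallel geodesic
    reaches arbitrarily large radii before the angle [al0]. But [rr] is bounded on [0, A]. *)
Lemma outward_bounded c rr P A : graph c rr P A -> rr 0 = R0 -> P 0 < 0 -> al0 < A -> A < PI -> False.
Proof.
  intros Hgr E0 HP HA HAPI.
  assert (Hal0 : 0 <= al0) by (specialize (Hb 0 (Rle_refl 0)); lra).
  destruct (cont_max rr 0 A ltac:(lra)) as [x [Hx Hmax]].
  { intros x Hx. destruct (Hgr x Hx) as [_ [X _]]. exact (continuous_of_derive _ _ _ X). }
  destruct (par_unbounded m Hv R0 th0 r rho th Hq G Er0 Eth0 al0 Hb (rr x)) as [t [Ht Hrt]].
  destruct (par_graph m Hv R0 th0 r rho th Hq G Er0 Erho0 Eth0 t Ht) as [rr1 [P1 [Hgr1 [F0 [F1 F2]]]]].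
  assert (Hphi := Hb t ltac:(lra)). assert (X := par_mono m Hv R0 r rho th Hq G 0 t ltac:(lra)).
  set (phi := th t - th0) in *.
  assert (Hgr' := graph_restrict m _ _ _ A phi ltac:(lra) Hgr).
  assert (Y := compare_pos m Hv R0 Hq _ _ rr1 P1 rr P phi Hgr1 Hgr' ltac:(lra) F0 E0 ltac:(lra) phi ltac:(unfold phi; lra)).
  specialize (Hmax phi ltac:(unfold phi in *; lra)). unfold phi in Y at 1. rewrite F2 in Y by lra. lra.
Qed.

(* A geodesic starting inward with small slope soon comes back to radius [R0], and then
   escapes at least as fast as the parallel geodesic. *)
Lemma inward_slope_lower al : al0 < al < PI -> exists b1, 0 < b1 /\
  forall c r' rho' th' L, 0 < L -> geo c r' rho' th' L -> c <> 0 -> r' 0 = R0 -> Rabs (th' L - th' 0) = al ->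
    b1 <= - rho' 0 / Rabs c.
Proof.
  intros Hal. assert (Hal0 : 0 <= al0) by (specialize (Hb 0 (Rle_refl 0)); lra).
  assert (Hs := par_slope_pos m Hv R0 th0 r rho th Hq G Er0 Erho0 Eth0 al0 Hb).
  set (k0 := m1 R0 / m R0 / 2). assert (Hk0 : 0 < k0) by (apply Rdiv_lt_0_compat; [now apply Rdiv_lt_0_compat|lra]).
  assert (Cf : continuous (fun x => m1 x / m x) R0).
  { assert (X := cm m Hm R0). assert (Y := cm1 m Hm R0). cont. lra. }
  destruct (proj1 (continuous_eps _ _) Cf k0 Hk0) as [d0 [Hd0 Hd0']].
  set (de := d0 / 2). assert (Hde : 0 < de) by (unfold de; lra).
  assert (Hf : forall x, R0 - de <= x <= R0 -> k0 <= m1 x / m x).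
  { intros x Hx. specialize (Hd0' x ltac:(unfold de in Hx; apply Rabs_def1; lra)). apply Rabs_def2 in Hd0'.
    unfold k0 in *. lra. }
  destruct (cont_bounded m 0 R0 ltac:(lra) (fun x _ => cm m Hm x)) as [M [HM HM']].
  assert (Hinv : 0 < / m R0) by now apply Rinv_0_lt_compat.
  set (V0 := 1 + / m R0). set (V := M ^ 2 * V0).
  assert (HV : 0 < V) by (apply Rmult_lt_0_compat; [now apply pow_lt|unfold V0; lra]).
  (* For p0 < b1 the bound 1 gives P <= V0, the second makes the angle pe = 3 p0 / k0 less than (al
     - al0) / 2, and the third keeps the radius within [de] of R0 up to that angle. *)
  set (b1 := Rmin 1 (Rmin (k0 * (al - al0) / 6) (k0 * (de / V) / 3))).
  assert (HdV : 0 < de / V) by now apply Rdiv_lt_0_compat.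
  assert (Hb1 : 0 < b1).
  { repeat apply Rmin_glb_lt; try lra; apply Rdiv_lt_0_compat; try lra; apply Rmult_lt_0_compat; lra. }
  assert (B1 : b1 <= 1) by apply Rmin_l.
  assert (B2 : b1 <= k0 * (al - al0) / 6) by (eapply Rle_trans; [apply Rmin_r|apply Rmin_l]).
  assert (B3 : b1 <= k0 * (de / V) / 3) by (eapply Rle_trans; [apply Rmin_r|apply Rmin_r]).
  exists b1. split; auto. intros c r' rho' th' L HL G' Hc' Er' Hth. apply Rnot_lt_le. intros Hlt.
  destruct (geo_graph m Hm c r' rho' th' L G' Hc' HL) as [rr [P [Hgr H]]].
  destruct (H 0 ltac:(lra)) as [_ [H1 H2]]. rewrite Rminus_eq_0, Rabs_R0 in H1, H2. rewrite Er' in H1.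
  rewrite Hth in Hgr. set (p0 := - rho' 0 / Rabs c) in *.
  assert (Hcabs := Rabs_pos_lt c Hc').
  destruct (Rtotal_order p0 0) as [X|[X|X]].
  - apply (outward_bounded c rr P al); auto; lra.
  - assert (Erho : rho' 0 = 0).
    { unfold p0 in X. apply (Rmult_eq_compat_r (Rabs c)) in X. unfold Rdiv in X. rewrite Rmult_assoc, Rinv_l in X by lra. lra. }
    destruct (geo_unique m Hm _ _ _ _ _ _ _ _ _ G' (G L) ltac:(lra) ltac:(lra) L ltac:(lra)) as [_ [_ Y]].
    assert (Z := par_mono m Hv R0 r rho th Hq G 0 L ltac:(lra)).
    rewrite Hth, Eth0, Rabs_pos_eq in Y by lra. specialize (Hb L ltac:(lra)). lra.
  (* Near R0 one has P' <= - k0, so zeta (rr t) <= p0 t - k0 t^2 / 2 as long as the radius has not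
     exceeded R0. At [pe] the right side is - p0 pe / 2 < 0, which means a radius above R0; hence R0
     is reached again by then. *)
  - set (pe := 3 * p0 / k0). assert (Hpe : 0 < pe) by (apply Rdiv_lt_0_compat; lra).
    assert (Epe : k0 * pe = 3 * p0) by (unfold pe; field; lra).
    assert (Hpe1 : pe < (al - al0) / 2) by (apply (Rmult_lt_reg_l k0); auto; lra).
    assert (Hpe2 : pe <= de / V) by (apply (Rmult_le_reg_l k0); auto; lra).
    destruct (classic (exists u, 0 < u <= pe /\ R0 <= rr u)) as [[u [Hu Hru]]|Hno].
    + destruct (first_zero (fun t => R0 - rr t) 0 u) as [B [HB [EB Hbefore]]]; [lra| | |lra|].
      * intros x Hx. destruct (Hgr x ltac:(lra)) as [_ [Y _]]. assert (Z := continuous_of_derive _ _ _ Y). cont.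
      * destruct (Hgr 0 ltac:(lra)) as [Y0 [Y _]]. assert (Hm0 := m_pos m Hm _ Y0).
        destruct (derive_pos_right (fun t => - rr t) 0 (m (rr 0) ^ 2 * P 0)) as [d [Hd Hd']].
        { eapply is_derive_eq; [apply dopp; exact Y|]. ringR. }
        { apply Rmult_lt_0_compat; [now apply pow_lt|lra]. }
        exists d. split; auto. intros x Hx. specialize (Hd' x Hx). lra.
      * assert (ErB : rr B = R0) by lra.
        (* At equal radius the energy relation gives P B = p0 or P B = - p0. The first would put the
           radius above R0 just before [B], against the choice of [B] as first return. *)
        assert (HPB : P B < 0).
        { destruct (Hgr 0 ltac:(lra)) as [_ [_ [_ Y0]]]. destruct (Hgr B ltac:(lra)) as [Y1 [Y2 [_ Y3]]].
          rewrite H1 in Y0. rewrite ErB in Y3, Y1, Y2. assert (Esq : P B ^ 2 = p0 ^ 2) by (rewrite <- H2; lra).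
          apply Rnot_le_lt. intros Hn. assert (EPB : P B = p0) by nra.
          assert (Hder : is_derive (fun s => rr (B - s)) 0 (m R0 ^ 2 * P B)).
          { eapply is_derive_eq; [apply (dcomp rr (fun s => B - s)); [rewrite Rminus_0_r; exact Y2|repeat der_step]|]. ringR. }
          destruct (derive_pos_right _ _ _ Hder) as [d [Hd Hd']].
          { apply Rmult_lt_0_compat; [now apply pow_lt|lra]. }
          set (s := Rmin (d / 2) (B / 2)). assert (S1 : s <= d / 2) by apply Rmin_l. assert (S2 : s <= B / 2) by apply Rmin_r.
          assert (S3 : 0 < s) by (apply Rmin_glb_lt; lra). specialize (Hd' s ltac:(lra)). rewrite Rminus_0_r in Hd'.
          specialize (Hbefore (B - s) ltac:(lra)). lra. }
        apply (outward_bounded c (fun t => rr (B + t)) (fun t => P (B + t)) (al - B)).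
        -- apply graph_shift; auto. lra.
        -- now rewrite Rplus_0_r.
        -- now rewrite Rplus_0_r.
        -- lra.
        -- lra.
    + assert (Hin : forall t, 0 <= t <= pe -> 0 < rr t <= R0).
      { intros t Ht. split; [apply Hgr; lra|]. destruct (Req_dec t 0) as [->|]; [lra|].
        apply Rnot_lt_le. intros Hn. apply Hno. exists t. lra. }
      assert (HPV : forall t, 0 <= t <= pe -> P t <= V0).
      { intros t Ht. destruct (Hgr 0 ltac:(lra)) as [_ [_ [_ Y0]]]. destruct (Hgr t ltac:(lra)) as [Y1 [_ [_ Y3]]].
        rewrite H1, H2 in Y0. assert (Hmt := m_pos m Hm _ Y1).
        assert (0 < / m (rr t) ^ 2) by (apply Rinv_0_lt_compat, pow_lt; auto).
        rewrite <- pow_inv in Y0. assert (P t ^ 2 <= V0 ^ 2) by (unfold V0; nra).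
        assert (0 < V0) by (unfold V0; lra). nra. }
      assert (Hrr : forall t, 0 <= t <= pe -> R0 - de <= rr t).
      { intros t Ht. assert (Y : rr 0 + V * 0 <= rr t + V * t).
        { apply (derive_le (fun t => rr t + V * t) (fun t => - (m (rr t) ^ 2 * P t) + V)); [lra| |].
          - intros s Hs'. destruct (Hgr s ltac:(lra)) as [_ [Z _]]. der. ringR.
          - intros s Hs'. specialize (Hin s ltac:(lra)). specialize (HPV s ltac:(lra)).
            specialize (HM' (rr s) ltac:(lra)). assert (Hms := m_pos m Hm (rr s) ltac:(lra)).
            rewrite Rabs_pos_eq in HM' by lra. assert (Hm2 : m (rr s) ^ 2 <= M ^ 2) by (apply pow_incr; lra).
            assert (0 < m (rr s) ^ 2) by (apply pow_lt; lra). assert (0 < V0) by (unfold V0; lra).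
            assert (m (rr s) ^ 2 * P s <= m (rr s) ^ 2 * V0) by (apply Rmult_le_compat_l; lra).
            assert (m (rr s) ^ 2 * V0 <= V) by (apply Rmult_le_compat_r; lra). lra. }
        assert (V * t <= de).
        { apply Rle_trans with (V * (de / V)); [apply Rmult_le_compat_l; lra|]. right. field. lra. }
        lra. }
      assert (HP : forall t, 0 <= t <= pe -> P t <= p0 - k0 * t).
      { intros t Ht. assert (Y : - P 0 - k0 * 0 <= - P t - k0 * t); [|lra].
        apply (derive_le (fun t => - P t - k0 * t) (fun t => m1 (rr t) / m (rr t) - k0)); [lra| |].
        - intros s Hs'. destruct (Hgr s ltac:(lra)) as [_ [_ [Z _]]]. der. ringR.
        - intros s Hs'. specialize (Hf (rr s) ltac:(split; [apply Hrr|apply Hin]; lra)). lra. }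
      assert (HZ : p0 * 0 - k0 * 0 ^ 2 / 2 - zeta m R0 (rr 0) <= p0 * pe - k0 * pe ^ 2 / 2 - zeta m R0 (rr pe)).
      { apply (derive_le (fun t => p0 * t - k0 * t ^ 2 / 2 - zeta m R0 (rr t)) (fun t => p0 - k0 * t - P t)); [lra| |].
        - intros s Hs'. assert (Z := graph_zeta m Hv R0 Hq c rr P al s Hgr ltac:(lra)).
          eapply is_derive_eq; [apply (dminus (fun t => p0 * t - k0 * t ^ 2 / 2) (fun t => zeta m R0 (rr t))); [|exact Z]|].
          + repeat der_step. lra.
          + simpl. fieldR.
        - intros s Hs'. specialize (HP s Hs'). lra. }
      rewrite H1, (zeta_R0 m) in HZ.
      assert (Eneg : p0 * pe - k0 * pe ^ 2 / 2 = - (p0 * pe / 2)).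
      { replace (k0 * pe ^ 2) with (k0 * pe * pe) by ring. rewrite Epe. field. }
      assert (Hppe : 0 < p0 * pe) by now apply Rmult_lt_0_compat.
      assert (Zneg : zeta m R0 (rr pe) < zeta m R0 R0) by (rewrite (zeta_R0 m); lra).
      destruct (Hin pe ltac:(lra)) as [Y1 Y2]. destruct (Rle_lt_or_eq_dec _ _ Y2) as [Y3|Y3].
      * assert (W := zeta_decr m Hv R0 Hq _ _ Y1 Y3). lra.
      * rewrite Y3 in Zneg. lra.
Qed.

(** Minimizing curves to points at a fixed angle strictly between [al0] and PI and at radii tending
    to infinity start inward with a slope bounded by [inward_slope_lower]; their limit is given by
    [limit_ray]. *)
Lemma escape_ray : al0 < PI -> exists s x c, (forall T, seg s 0 T) /\ s 0 = q /\ init s x c /\ x < 0.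
Proof.
  intros Hlt. assert (Hal0 : 0 <= al0) by (specialize (Hb 0 (Rle_refl 0)); lra).
  set (al := (al0 + PI) / 2). assert (Hal : al0 < al < PI) by (unfold al; lra).
  destruct (inward_slope_lower al Hal) as [b1 [Hb1 Hbound]].
  (* Either the initial radial speed is at most - 1/2, or |c| >= m (rad q) / 2 by the energy
     relation, and the bound b1 on - rho / |c| becomes b1 m (rad q) / 2. *)
  set (x1 := Rmin (/ 2) (b1 * m R0 / 2)). assert (Hx1 : 0 < x1).
  { apply Rmin_glb_lt; [lra|]. assert (0 < b1 * m R0) by now apply Rmult_lt_0_compat. lra. }
  assert (X1 : x1 <= / 2) by apply Rmin_l. assert (X2 : x1 <= b1 * m R0 / 2) by apply Rmin_r.
  assert (H : forall j : nat, exists s, exists L x c, seg s 0 L /\ INR j - R0 <= L /\ s 0 = q /\ init s x c /\ x <= - x1).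
  { intros j. assert (Hn : 0 < INR j + 1) by (generalize (pos_INR j); lra).
    destruct (minimizer_off_meridian m Hm q th0 (INR j + 1) al Eq Hq Hn ltac:(lra))
      as [s [L [c [r' [rho' [th' [HL [EL [Hs [E0 [E1 [G' [Eth [Hsp [Hc' [Hth [Er0' [ErL Hi]]]]]]]]]]]]]]]]]].
    exists s, L, (rho' 0), c. split; [auto|split; [|split; [auto|split; [auto|]]]].
    - assert (X := seg_cont_rad m Hm s L L Hs ltac:(lra)). rewrite E0, E1, rad_polar in X by lra.
      apply Rabs_le_between in X. lra.
    - assert (Y := Hbound c r' rho' th' L HL G' Hc' Er0' ltac:(now rewrite Eth)).
      assert (Hcabs := Rabs_pos_lt c Hc'). apply Rle_div_r in Y; auto.
      assert (En := init_energy m s _ c Hi). rewrite E0 in En.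
      apply Rnot_lt_le. intros Hn'.
      assert (Hxpos : rho' 0 <= 0) by (assert (0 <= b1 * Rabs c) by (apply Rmult_le_pos; lra); lra).
      assert (Hx2 : rho' 0 ^ 2 <= / 4) by nra.
      assert (Hc2 : / 4 * m R0 ^ 2 <= Rabs c ^ 2).
      { rewrite pow2_abs. assert (E : c ^ 2 = (1 - rho' 0 ^ 2) * m R0 ^ 2).
        { rewrite <- En. field. lra. }
        rewrite E. apply Rmult_le_compat_r; [apply pow2_ge_0|lra]. }
      assert (Hc3 : m R0 / 2 <= Rabs c) by nra.
      assert (b1 * (m R0 / 2) <= b1 * Rabs c) by (apply Rmult_le_compat_l; lra). lra. }
  set (s := fun j => proj1_sig (constructive_indefinite_description _ (H j))).
  assert (Hs : forall j, exists L x, exists c, seg (s j) 0 L /\ INR j - R0 <= L /\ s j 0 = q /\ init (s j) x c /\ x <= - x1).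
  { intros j. exact (proj2_sig (constructive_indefinite_description _ (H j))). }
  clearbody s. clear H.
  destruct (choice2 _ Hs) as [L [x Hx]].
  set (c := fun j => proj1_sig (constructive_indefinite_description _ (Hx j))).
  assert (Hcx : forall j, seg (s j) 0 (L j) /\ INR j - R0 <= L j /\ s j 0 = q /\ init (s j) (x j) (c j) /\ x j <= - x1).
  { intros j. exact (proj2_sig (constructive_indefinite_description _ (Hx j))). }
  clearbody c. clear Hx Hs.
  destruct ex_ultra as [U HU].
  destruct (ulim_exists U HU x 1) as [x0 Hx0].
  { intros j. destruct (Hcx j) as [_ [_ [E [Hi _]]]]. apply Rabs_le. apply (init_abs m Hm (s j) (x j) (c j)); auto.
    now rewrite E. }
  assert (Hx0' : x0 <= - x1).
  { apply (ulim_le U HU x); auto. apply (ultra_all U HU). intros j. apply Hcx. }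
  destruct (limit_ray m Hm U HU s L x c q x0 Hq) as [g [H1 [H2 [c0 H3]]]]; auto; try (intros j; apply Hcx).
  { intros T. destruct (nfloor_ex (Rmax 0 (T + R0))) as [N HN]; [apply Rmax_l|].
    refine (ultra_imp _ HU _ _ _ (ultra_ge _ HU (S N))). intros j Hj. destruct (Hcx j) as [_ [X _]].
    apply le_INR in Hj. rewrite S_INR in Hj. generalize (Rmax_r 0 (T + R0)). lra. }
  exists g, x0, c0. split; [auto|split; [auto|split; [auto|lra]]].
Qed.

End Escape.
End Rays.

(** * Angles of rays, the turn angle as a supremum, and the conclusion *)

Lemma acos_gt_PI2 x : -1 <= x <= 1 -> (PI / 2 < acos x <-> x < 0).
Proof.
  intros Hx. assert (B := acos_bound x). assert (E := cos_acos x Hx). split; intros H.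
  - rewrite <- E. apply cos_lt_0; lra.
  - apply Rnot_le_lt. intros Hn. assert (X := cos_ge_0 (acos x) ltac:(lra) Hn). lra.
Qed.

Lemma ray_seg m s : model_fun m -> ray m s <-> forall T, seg m s 0 T.
Proof.
  intros Hm. split; intros H.
  - intros T u t Hu Ht. apply D_eq, H; lra.
  - intros u t Hu Ht. rewrite dist_finite by auto. f_equal.
    apply (H (Rmax u t)); split; auto using Rmax_l, Rmax_r.
Qed.

(** By regularity every ray from [q] has initial data, so the supremum in [kappa_hat] runs over acos
    x, and an obtuse angle means x < 0. *)
Lemma ray_angles m q : model_fun m -> 0 < rad q -> forall a,
  (exists s v, ray m s /\ s 0 = q /\ rvel s 0 v /\ a = angle_at m q (e_r q) v) <->
  (exists s x c, (forall T, seg m s 0 T) /\ s 0 = q /\ init m s x c /\ a = acos x).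
Proof.
  intros Hm Hq a. split.
  - intros [s [v [Hs [E [Hv ->]]]]]. rewrite ray_seg in Hs by auto. subst q.
    destruct (seg_init m Hm s 1 ltac:(lra) (Hs 1) Hq) as [x [c Hi]].
    exists s, x, c. now rewrite (init_angle m Hm s x c v).
  - intros [s [x [c [Hs [E [Hi ->]]]]]]. subst q. destruct (polar_exists (s 0)) as [th0 E].
    eexists s, _. rewrite ray_seg by auto. split; [auto|split; [auto|]].
    assert (Hv := proj2 (init_rvel m Hm s x c th0 Hq E Hi _) eq_refl).
    split; [exact Hv|]. symmetry. now apply (init_angle m Hm s x c).
Qed.

Section TurnAngle.
Variables (m : R -> R) (g : curve) (c : R) (r rho th : R -> R).
Hypothesis Hm : model_fun m.
Hypothesis Hc : 0 < c.
Hypothesis G : forall L, geo m c r rho th L.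
Hypothesis Hg : forall t, 0 <= t -> g t = polar (r t) (th t).

Lemma turn_integral T : 0 <= T -> RInt (fun s => Rabs (dtheta_ds g s)) 0 T = th T - th 0.
Proof.
  intros HT. rewrite (RInt_ext_on _ (fun t => c * / m (r t) ^ 2)); auto.
  - apply RInt_derive_eq; auto.
    + intros t Ht. apply (G T); auto.
    + intros t Ht. assert (X := geo_cont m _ _ _ _ T t (G T) Ht).
      assert (Y := m_pos m Hm _ (proj1 (G T t Ht))). assert (Z := ccomp m r t X (cm m Hm (r t))). cont.
      apply pow_nonzero. lra.
  - intros t Ht. rewrite (geo_dtheta m Hm c r rho th T g t (G T) Ht); [|intros; apply Hg; lra].
    apply Rabs_pos_eq. assert (Y := m_pos m Hm _ (proj1 (G T t ltac:(lra)))).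
    apply Rmult_le_pos; [lra|]. left. now apply Rinv_0_lt_compat, pow_lt.
Qed.

Lemma turn_ge t : 0 <= t -> Rbar_le (th t - th 0) (turn_angle g).
Proof. intros Ht. apply Lub_Rbar_correct. exists t. now rewrite turn_integral. Qed.

Lemma turn_le a : (forall t, 0 <= t -> th t - th 0 <= a) -> Rbar_le (turn_angle g) a.
Proof.
  intros H. apply Lub_Rbar_correct. intros z [T [HT ->]]. rewrite turn_integral by auto. now apply H.
Qed.

(** The bound [a] carries the strictness: partial turns that are merely below [b] may still have
    supremum [b]. *)
Lemma turn_lt_iff (b : R) : Rbar_lt (turn_angle g) b <-> exists a, a < b /\ forall t, 0 <= t -> th t - th 0 <= a.
Proof.
  split.
  - intros H. assert (X := turn_ge). destruct (turn_angle g) as [a| |]; try easy.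
    + exists a. split; [exact H|exact X].
    + elim (X 0 (Rle_refl 0)).
  - intros [a [Ha H]]. apply (Rbar_le_lt_trans _ a); [apply turn_le, H|exact Ha].
Qed.

End TurnAngle.

Theorem theorem3p19 (m : R -> R) (q : pt) (gq : curve) :
  von_Mangoldt m ->
  q <> (0, 0) ->
  geodesic m gq -> gq 0 = q -> rvel gq 0 (e_theta m q) ->
  (Rbar_lt (Finite (PI / 2)) (kappa_hat m q) <-> Rbar_lt (turn_angle gq) (Finite PI)) /\
  (kappa_hat m q = Finite (PI / 2) <-> turn_angle gq = Finite PI).
Proof.
  intros Hv Hq Hgeo H0 Hvel. assert (Hm := von_Mangoldt_model m Hv). apply rad_pos in Hq.
  assert (Hc := m_pos m Hm _ Hq). destruct (polar_exists q) as [th0 Eq].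
  destruct (parallel_geodesic m Hm gq q th0 Hgeo H0 Hq Eq Hvel) as [r [rho [th [G [Er0 [Erho0 [Eth0 Hg]]]]]]].
  assert (Hlt := turn_lt_iff m gq _ r rho th Hm Hc G Hg). assert (Hge := turn_ge m gq _ r rho th Hm Hc G Hg).
  assert (Hle := turn_le m gq _ r rho th Hm Hc G Hg). rewrite Eth0 in Hlt, Hge, Hle.
  assert (Hin : forall s x c, (forall T, seg m s 0 T) -> s 0 = q -> init m s x c -> Rbar_le (acos x) (kappa_hat m q)).
  { intros s x c Hs E Hi. apply Lub_Rbar_correct. apply (ray_angles m q Hm Hq). now exists s, x, c. }
  assert (Hsup : forall b : R, Rbar_lt b (kappa_hat m q) ->
    exists s x c, (forall T, seg m s 0 T) /\ s 0 = q /\ init m s x c /\ -1 <= x <= 1 /\ b < acos x).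
  { intros b Hb. apply NNPP. intros Hn. apply (Rbar_lt_not_le _ _ Hb). apply Lub_Rbar_correct.
    intros a Ha. apply (ray_angles m q Hm Hq) in Ha. destruct Ha as [s [x [c [Hs [E [Hi ->]]]]]].
    simpl. apply Rnot_lt_le. intros Hlt'. apply Hn. exists s, x, c. repeat (split; [now auto|]).
    split; auto. apply (init_abs m Hm s x c); auto. now rewrite E. }
  assert (Habs : forall s x c, s 0 = q -> init m s x c -> -1 <= x <= 1).
  { intros s x c E. apply init_abs; auto. now rewrite E. }
  assert (H1 : Rbar_lt (Finite (PI / 2)) (kappa_hat m q) <-> Rbar_lt (turn_angle gq) (Finite PI)).
  { rewrite Hlt. split.
    - intros H. destruct (Hsup _ H) as [s [x [c [Hs [E [Hi [Hx Ha]]]]]]]. apply acos_gt_PI2 in Ha; auto.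
      now apply (obtuse_ray m Hv q th0 Hq Eq r rho th G Er0 Erho0 Eth0 s x c).
    - intros [al0 [Hal0 Hb]].
      destruct (escape_ray m Hv q th0 Hq Eq r rho th G Er0 Erho0 Eth0 al0 Hb Hal0) as [s [x [c [Hs [E [Hi Hx]]]]]].
      apply (Rbar_lt_le_trans _ (acos x)); [|now apply (Hin s x c)]. simpl. apply acos_gt_PI2; auto.
      now apply (Habs s x c). }
  split; auto. split; intros H.
  - rewrite H in H1, Hsup.
    (* Rays with angles between PI / 2 - 1 / (j + 1) and PI / 2 have cosines within 1 / (j + 1) of
       0. Their limit is a ray at a right angle, so the value of the supremum is attained. *)
    assert (Hsmall : forall j : nat, exists s x c, (forall T, seg m s 0 T) /\ s 0 = q /\ init m s x c /\
      Rabs (x - 0) <= 1 / INR (S j)).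
    { intros j. assert (Hj : 0 < / INR (S j)) by (apply Rinv_0_lt_compat, lt_0_INR; lia).
      destruct (Hsup (PI / 2 - / INR (S j))) as [s [x [c [Hs [E [Hi [Hx Ha]]]]]]]; [cbn [Rbar_lt]; lra|].
      exists s, x, c. repeat (split; [now auto|]). assert (X := Hin s x c Hs E Hi). rewrite H in X. simpl in X.
      assert (Y := cos_lip (acos x) (PI / 2)). rewrite cos_PI2, cos_acos in Y by auto.
      rewrite (Rabs_left1 (acos x - PI / 2)) in Y by lra. lra. }
    destruct (choice _ Hsmall) as [s Hs]. destruct (choice2 _ Hs) as [x [c Hx]]. destruct ex_ultra as [U HU].
    destruct (limit_ray m Hm U HU s INR x c q 0 Hq) as [g [Hgs [E [c0 Hi]]]]; try (intros j; apply Hx).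
    { intros T. destruct (nfloor_ex (Rmax 0 T)) as [N HN]; [apply Rmax_l|].
      refine (ultra_imp _ HU _ _ _ (ultra_ge _ HU (S N))). intros j Hj.
      apply le_INR in Hj. rewrite S_INR in Hj. generalize (Rmax_r 0 T). lra. }
    { apply (ulim_inv_n U HU _ _ 1). intros j. apply Hx. }
    apply Rbar_le_antisym.
    + apply Hle. intros t Ht. left. now apply (right_angle_ray m Hv q th0 Hq Eq r rho th G Er0 Erho0 Eth0 g c0).
    + apply Rbar_not_lt_le. intros X. apply H1 in X. simpl in X. lra.
  - assert (Hno : ~ Rbar_lt (PI / 2) (kappa_hat m q)).
    { intros X. apply H1 in X. rewrite H in X. simpl in X. lra. }
    apply Rbar_le_antisym; [now apply Rbar_not_lt_le|].
    (* The angle increases strictly, so every partial turn stays below the total PI; this is the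
       hypothesis of [tight_seg]. *)
    assert (HPI : forall t, 0 <= t -> th t - th0 < PI).
    { intros t Ht. assert (X := par_mono m Hv _ r rho th Hq G t (t + 1) ltac:(lra)).
      assert (Y := Hge (t + 1) ltac:(lra)). rewrite H in Y. simpl in Y. lra. }
    rewrite <- acos_0. apply (Hin gq 0 (m (rad q))); auto.
    + now apply (tight_seg m Hv q th0 Hq Eq r rho th G Er0 Erho0 Eth0).
    + exists 1, r, rho, th. split; [lra|split; [auto|split; [auto|]]]. intros t Ht. apply Hg. lra.
Qed.
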